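(* Let $q$ be the Hastings–McLeod solution of the Painlevé II equation and let $R(x)=\int_x^\infty q(s)^2\,ds$. Then for every $c<0$, $$\int_c^\infty R(y)\,dy + \int_{-\infty}^c \left(R(y)-\frac14y^2+\frac1{8y}\right)dy = - \frac1{24}\log 2 -\zeta'(-1) + \frac1{12}|c|^3 + \frac18\log|c|$$ and $$\int_c^\infty q(y)\,dy + \int_{-\infty}^c \left(q(y)-\sqrt{\frac{|y|}2}\, \right) dy= \frac12 \log 2 +\frac{\sqrt{2}}{3}|c|^{3/2},$$ where $\zeta$ is the Riemann zeta function.
   Context: The Hastings–McLeod solution $q:\mathbb{R}\to\mathbb{R}$ is the unique global real solution of the Painlevé II equation $q''=2q^3+xq$ satisfying $q(x)\sim \mathrm{Ai}(x)$ as $x\to+\infty$, where $\mathrm{Ai}$ is the Airy function. (It is known that $q(x)=\sqrt{-x/2}\,\left(1+\frac{1}{8x^3}+O(|x|^{-6})\right)$ and $R(x)=\frac{x^2}{4}\left(1-\frac{1}{2x^3}+O(|x|^{-6})\right)$ as $x\to-\infty$, so the integrals over $(-\infty,c)$ converge.) *)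

(* Defs.v *)
From Stdlib Require Import Reals.
From Coquelicot Require Import Coquelicot.
Open Scope R_scope.

(* The integral converges only conditionally; [RInt_gen] is the limit of the
   proper integrals over [0, T] as T tends to +infinity. *)
Definition Airy_Ai (x : R) : R :=
  / PI * RInt_gen (fun t => cos (t ^ 3 / 3 + x * t))
                  (at_point 0) (Rbar_locally p_infty).

(* [Derive] is total, so differentiability of [q] itself must be required
   separately from that of [Derive q]. *)
Definition is_Painleve_II (q : R -> R) : Prop :=
  forall x : R,
    ex_derive q x /\ is_derive (Derive q) x (2 * q x ^ 3 + x * q x).

Definition is_Hastings_McLeod (q : R -> R) : Prop :=
  is_Painleve_II q /\
  @is_equiv R R_AbsRing R_NormedModule (Rbar_locally p_infty) q Airy_Ai.

Definition HM_R (q : R -> R) (x : R) : R :=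
  RInt_gen (fun s => q s ^ 2) (at_point x) (Rbar_locally p_infty).

(* n^(-s) = exp (- s log n), meaningful for n >= 1. *)
Definition nat_Cpow_opp (n : nat) (s : C) : C :=
  (Rpower (INR n) (- Re s) * cos (Im s * ln (INR n)),
   - (Rpower (INR n) (- Re s) * sin (Im s * ln (INR n)))).

(* The analytic continuation to C \ {1} of the Dirichlet series.  This fixes
   [zeta] everywhere except for its irrelevant value at the pole 1. *)
Definition is_Riemann_zeta (zeta : C -> C) : Prop :=
  (forall s : C, s <> RtoC 1 ->
     @ex_derive C_AbsRing C_NormedModule zeta s) /\
  (forall s : C, 1 < Re s ->
     @is_series C_AbsRing C_NormedModule
       (fun n => nat_Cpow_opp (S n) s) (zeta s)).

(* Main.v *)
(** The coefficients [x_k = dp k t] of the orthogonal polynomials on the unit circle for the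
    symbol [exp (t (z + 1/z))] solve discrete Painleve II.  With [t = m^3] and
    [k = 2 m^3 + s m], [m x_k] tends to [q s]: for large [s] because [x_k] is close to a Bessel
    coefficient and hence to [Ai], and then for all [s] by stability of the recurrence.

    Two exact identities, obtained by differentiating in [t], are [sum_j atanh x_(2j+1) = t] and,
    for the logarithm of the Toeplitz determinant,
    [n ln I_0(2t) - t^2 + sum_(k<=n) (n-k) ln (1 - x_k^2) = sum_(k>n) (k-n) ln (1 - x_k^2)].
    The parts [k > n] are Riemann sums for the integrals of [q] and of [R] over [(s, oo)].
    The parts [k <= n] are evaluated by Euler-Maclaurin from the expansion of [x_k] around
    [sqrt (1 - k/(2t))], and [sum_k k ln k] brings in [zeta'(-1)].  The unknown constants of
    [ln I_0] and of Stirling's formula only enter through a term linear in [n], which must vanish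
    because the right-hand side stays bounded.

    The value [zeta'(-1)] is identified with the constant of [sum_k k ln k] by Euler-Maclaurin
    summation of the Dirichlet series; the error term vanishes for [Re s = 2], and Goursat's
    theorem with a peaked kernel carries this over to [Re s = -1]. *)

Require Import Defs.
From Stdlib Require Import Arith ZArith Reals Lra Lia Psatz.
From Coquelicot Require Import Coquelicot.
Open Scope R_scope.

(** All estimates come from order: positive solutions of the discrete equation obey a comparison
    principle, so explicit sub- and supersolutions enclose [x_k]. With [h = 1/(2t)] and
    [p = 1 - k h] the expansion of [x_k] runs in powers of [h^2/p^3]. It is therefore valid up to
    [k = 2t - s m] with an error depending on [s] but not on [m], and [m] can tend to infinity
    first, [s] afterwards.

    The obstacle is the transition region. Far to the right only the ratio of [m x_k] to [q] is
    known to be close to 1; nothing is known about differences in [k], which a second order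
    recurrence also needs. A discrete mean value argument on a window of length 1 supplies one index
    with a small increment. From there the equation is followed leftwards, the direction in which
    the decaying solution [q] grows and the competing linear solution dies out. Left of a fixed
    point a crude Gronwall bound suffices.

    The scale [m] runs through natural numbers [M], so that explicit indices such as [2 M^3 - 8 M]
    are integers. *)

Ltac pos := lazymatch goal with
 | |- 0 < / _ => apply Rinv_0_lt_compat; pos
 | |- 0 < _ / _ => apply Rdiv_lt_0_compat; pos
 | |- 0 < _ ^ _ => apply pow_lt; pos
 | |- 0 < exp _ => apply exp_pos
 | |- 0 < _ * _ => first [lra | assumption | apply Rmult_lt_0_compat; pos]
 | |- 0 <= _ ^ 2 => apply pow2_ge_0
 | |- 0 <= _ ^ _ => apply pow_le; pos
 | |- 0 <= / _ => left; pos
 | |- 0 <= exp _ => left; pos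
 | |- 0 <= _ / _ => first [lra | assumption | apply Rdiv_le_0_compat; pos]
 | |- 0 <= _ * _ => first [lra | assumption | apply Rmult_le_pos; pos]
 | |- 0 <= Rabs _ => apply Rabs_pos
 | |- 0 <= INR _ => apply pos_INR
 | |- 0 <= Cmod _ => apply Cmod_ge_0
 | |- 0 < ?c => first [lra | assumption | is_var c; unfold c; pos]
 | |- 0 <= ?c => first [lra | assumption | is_var c; unfold c; pos]
 end.

Lemma div_le a b c : 0 < c -> a <= b * c -> a / c <= b.
Proof. intros Hc H. now apply Rle_div_l. Qed.

(** The eta-expanded left side is the shape in which [auto_derive] leaves the derivative of an
    abstract function, so rewriting with this form matches it. *)
Lemma Derive_eta (f : R -> R) (x l : R) : is_derive f x l -> Derive (fun y : R => f y) x = l.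
Proof. apply is_derive_unique. Qed.

Lemma exp_mono a b : a <= b -> exp a <= exp b.
Proof. intros [H|H]; [left; now apply exp_increasing|rewrite H; lra]. Qed.

Notation derive_plus := (is_derive_plus (K := R_AbsRing) (V := R_NormedModule)).
Notation derive_minus := (is_derive_minus (K := R_AbsRing) (V := R_NormedModule)).

Lemma Rinv_le_1 x : 1 <= x -> / x <= 1.
Proof. intros H. rewrite <- Rinv_1. apply Rinv_le_contravar; lra. Qed.

Lemma div_lt a b c : 0 < c -> a < b * c -> a / c < b.
Proof. intros Hc H. now apply Rlt_div_l. Qed.

Ltac mul_l := apply Rmult_le_compat_l; [pos |].
Ltac mul_r := apply Rmult_le_compat_r; [pos |].
Ltac abs_lra := repeat match goal with H : Rabs _ <= _ |- _ => apply Rabs_le_between in H end;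
 apply Rabs_le_between; lra.

(** * Mean value inequalities and initial conditions at 0 *)

Lemma is_derive_continuity_pt (f : R -> R) (x l : R) :
 is_derive f x l -> continuity_pt f x.
Proof.
 intros H. apply derivable_continuous_pt. exists l. now apply is_derive_Reals.
Qed.

Lemma mean_value (f df : R -> R) (a b : R) :
 a < b -> (forall x, a <= x <= b -> is_derive f x (df x)) ->
 exists c, a < c < b /\ f b - f a = df c * (b - a).
Proof.
 intros Hab H.
 destruct (MVT_cor2 f df a b Hab) as [c [H1 H2]].
 - intros c Hc. apply is_derive_Reals. now apply H.
 - exists c; split; assumption.
Qed.

Lemma deriv_le (f g df dg : R -> R) (a b : R) :
 a <= b ->
 (forall x, a <= x <= b -> is_derive f x (df x)) ->
 (forall x, a <= x <= b -> is_derive g x (dg x)) ->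
 (forall x, a <= x <= b -> df x <= dg x) ->
 f b - f a <= g b - g a.
Proof.
 intros Hab Hf Hg Hle. destruct (Req_dec a b) as [->|Hne]; [lra|].
 destruct (mean_value (fun x => g x - f x) (fun x => dg x - df x) a b) as [c [Hc E]].
 - lra.
 - intros x Hx. apply derive_minus; auto.
 - assert (0 <= dg c - df c) by (specialize (Hle c); lra).
  nra.
Qed.

(** Stands for the initial condition [g 0 = 0]. The functions at hand are controlled only for
    [t > 0], some of them involving division by [t], so the condition is a linear bound on a
    punctured right neighbourhood. *)
Definition small_at_0 (g : R -> R) : Prop :=
 exists C d, 0 < d /\ forall t, 0 < t < d -> Rabs (g t) <= C * t.

Lemma pos_of_deriv (g dg : R -> R) (T : R) :
 (forall t, 0 < t <= T -> is_derive g t (dg t)) ->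
 (forall t, 0 < t <= T -> 0 <= dg t) ->
 small_at_0 g -> 0 < T -> 0 <= g T.
Proof.
 intros Hd Hp [C [d [Hd0 HC]]] HT.
 apply Rnot_lt_le; intros Hneg.
 set (K := Rabs C + 1).
 assert (HK : 0 < K) by (unfold K; generalize (Rabs_pos C); lra).
 (* At this [s] the linear bound gives [|g s| <= - g T / 2], whereas monotonicity on [[s, T]] forces
    [g s <= g T < 0]. *)
 set (s := Rmin (Rmin (d / 2) (T / 2)) (- g T / (2 * K))).
 assert (Hs : 0 < s).
 { unfold s. repeat apply Rmin_glb_lt; try lra. pos. }
 assert (s <= d / 2 /\ s <= T / 2 /\ s <= - g T / (2 * K)) as [H1 [H2 H3]].
 { unfold s. split; [|split].
  - eapply Rle_trans; [apply Rmin_l|apply Rmin_l].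
  - eapply Rle_trans; [apply Rmin_l|apply Rmin_r].
  - apply Rmin_r. }
 assert (Hm : (fun _ : R => 0) T - (fun _ : R => 0) s <= g T - g s).
 { apply (deriv_le (fun _ => 0) g (fun _ => 0) dg s T); [lra| | |].
  - intros; auto_derive; auto.
  - intros; apply Hd; lra.
  - intros; apply Hp; lra. }
 cbn beta in Hm.
 assert (Hgs : Rabs (g s) <= C * s) by (apply HC; lra).
 assert (Rabs (g s) <= K * s).
 { apply Rle_trans with (1 := Hgs). unfold K. generalize (Rle_abs C). nra. }
 assert (K * s <= - g T / 2).
 { replace (- g T / 2) with (K * (- g T / (2 * K))) by (field; lra).
  mul_l; lra. }
 assert (- g s <= Rabs (g s)) by (rewrite <- Rabs_Ropp; apply Rle_abs). lra.
Qed.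

Lemma pos_strict_of_deriv (g dg : R -> R) (T : R) :
 (forall t, 0 < t <= T -> is_derive g t (dg t)) ->
 (forall t, 0 < t <= T -> 0 < dg t) ->
 small_at_0 g -> 0 < T -> 0 < g T.
Proof.
 intros Hd Hp Hs HT.
 assert (0 <= g (T / 2)).
 { apply (pos_of_deriv g dg); auto; try lra; intros; [apply Hd; lra|].
  left; apply Hp; lra. }
 destruct (mean_value g dg (T / 2) T) as [c [Hc E]]; [lra|intros; apply Hd; lra|].
 assert (0 < dg c) by (apply Hp; lra). nra.
Qed.

(** * Riccati equations and Bessel functions *)

(* [w = 1 - f^2] satisfies [w' = - 4 f y w + 2 k f^2 / t], so an integrating factor keeps [w] positive. *)
Lemma riccati_bounds (k : R) (y f : R -> R) :
 0 < k ->
 (forall t, 0 < t -> 0 < y t <= 1) ->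
 (forall t, 0 < t -> continuous y t) ->
 (forall t, 0 < t -> is_derive f t (2 * (1 - f t ^ 2) * y t - k * f t / t)) ->
 small_at_0 f ->
 forall t, 0 < t -> Rabs (f t) < 1.
Proof.
 intros Hk Hy Cy Hf [C [d [Hd HC]]] t Ht.
 set (K := Rabs C + 1).
 assert (HK : 0 < K) by (unfold K; generalize (Rabs_pos C); lra).
 (* At this [s] the bound near 0 yields [|f s| <= 1/2], so [1 - f^2] is positive there; the
    integrating factor carries the sign on to [t]. *)
 set (s := Rmin (Rmin (d / 2) (t / 2)) (1 / (2 * K))).
 assert (Hs : 0 < s).
 { unfold s. repeat apply Rmin_glb_lt; try lra. pos. }
 assert (s <= d / 2 /\ s <= t / 2 /\ s <= 1 / (2 * K)) as [H1 [H2 H3]].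
 { unfold s. split; [|split].
  - eapply Rle_trans; [apply Rmin_l|apply Rmin_l].
  - eapply Rle_trans; [apply Rmin_l|apply Rmin_r].
  - apply Rmin_r. }
 assert (Hfs : Rabs (f s) <= 1 / 2).
 { apply Rle_trans with (C * s); [apply HC; lra|].
  apply Rle_trans with (K * s).
  - mul_r. unfold K; generalize (Rle_abs C); lra.
  - replace (1 / 2) with (K * (1 / (2 * K))) by (field; lra).
   mul_l; lra. }
 assert (Cf : forall u, 0 < u -> continuous f u).
 { intros u Hu. apply (ex_derive_continuous (V := R_NormedModule)). eexists. now apply Hf. }
 set (I := (fun u => RInt (fun v => 4 * f v * y v) s u) : R -> R).
 assert (Cint : forall u, 0 < u -> continuous (fun v => 4 * f v * y v) u).
 { intros u Hu. apply (continuous_mult (K := R_AbsRing)); [|auto].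
  apply (continuous_mult (K := R_AbsRing)); [apply continuous_const|auto]. }
 assert (HI : forall u, s <= u -> is_derive I u (4 * f u * y u)).
 { intros u Hu. unfold I. apply (is_derive_RInt (V := R_NormedModule) (fun v => 4 * f v * y v) _ s).
  - exists (mkposreal (s / 2) ltac:(lra)). intros v Hv.
   apply (RInt_correct (V := R_CompleteNormedModule)).
   apply (ex_RInt_continuous (V := R_CompleteNormedModule)).
   intros z Hz. apply Cint.
   change (Rabs (v - u) < s / 2) in Hv. apply Rabs_def2 in Hv.
   revert Hz; apply Rmin_case; lra.
  - apply Cint; lra. }
 set (g := fun u => (1 - f u ^ 2) * exp (I u)).
 set (dg := fun u => 2 * k * f u ^ 2 / u * exp (I u)).
 assert (Hg : forall u, s <= u -> is_derive g u (dg u)).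
 { intros u Hu. unfold g, dg.
  assert (E1 := Hf u ltac:(lra)). assert (E2 := HI u Hu).
  auto_derive.
  - split; [eexists; exact E1|]. split; [eexists; exact E2|auto].
  - rewrite (Derive_eta _ _ _ E1).
   rewrite (Derive_eta _ _ _ E2).
   field. lra. }
 destruct (mean_value g dg s t) as [c [Hc E]]; [lra|intros; apply Hg; lra|].
 assert (0 <= dg c).
 { unfold dg. apply Rmult_le_pos; [|pos].
  apply Rmult_le_pos; [|pos].
  generalize (pow2_ge_0 (f c)); nra. }
 assert (0 < g s).
 { unfold g. apply Rmult_lt_0_compat; [|apply exp_pos].
  assert (f s ^ 2 <= 1 / 4); [|lra].
  rewrite <- (pow2_abs (f s)). generalize (Rabs_pos (f s)); nra. }
 assert (Hgt : 0 < g t) by nra.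
 assert (0 < 1 - f t ^ 2).
 { unfold g in Hgt. apply (Rmult_lt_reg_r (exp (I t))); [apply exp_pos|lra]. }
 assert (Hx : 0 < 1 - Rabs (f t) ^ 2) by (rewrite pow2_abs; lra).
 generalize (Rabs_pos (f t)); nra.
Qed.

(** Once [|f| < 1] is known, the derivative [2 t^k (1 - f^2) y] of [t^k f] is positive, and [t^k f]
    starts from 0. *)
Lemma riccati_pos (k : nat) (y f : R -> R) :
 (1 <= k)%nat ->
 (forall t, 0 < t -> 0 < y t <= 1) ->
 (forall t, 0 < t -> continuous y t) ->
 (forall t, 0 < t -> is_derive f t (2 * (1 - f t ^ 2) * y t - INR k * f t / t)) ->
 small_at_0 f ->
 forall t, 0 < t -> 0 < f t < 1.
Proof.
 intros Hk Hy Cy Hf Hs.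
 assert (HB : forall t, 0 < t -> Rabs (f t) < 1).
 { apply (riccati_bounds (INR k) y f); auto. apply lt_0_INR; lia. }
 intros t Ht. split; [|apply Rle_lt_trans with (1 := Rle_abs _); auto].
 assert (0 < t ^ k * f t).
 { apply (pos_strict_of_deriv (fun u => u ^ k * f u)
       (fun u => 2 * u ^ k * (1 - f u ^ 2) * y u)); auto.
  - intros u Hu. assert (E1 := Hf u ltac:(lra)).
   destruct k as [|k]; [lia|].
   auto_derive; [eexists; exact E1|].
   rewrite (Derive_eta _ _ _ E1).
   change (match k with 0%nat => 1 | S _ => INR k + 1 end) with (INR (S k)). simpl pow. field. lra.
  - intros u Hu. assert (B := HB u ltac:(lra)). assert (Y := Hy u ltac:(lra)).
   apply Rabs_def2 in B.
   assert (0 < 1 - f u ^ 2) by nra.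
   pos.
  - exists 1, 1. split; [lra|]. intros u Hu. rewrite Rabs_mult.
   assert (B := HB u ltac:(lra)).
   assert (Rabs (u ^ k) <= u).
   { rewrite Rabs_pos_eq; [|left; pos].
    destruct k as [|k]; [lia|]. simpl.
    assert (u ^ k <= 1); [|assert (0 < u ^ k) by pos; nra].
    rewrite <- (pow1 k). apply pow_incr; lra. }
   generalize (Rabs_pos (f u)) (Rabs_pos (u ^ k)); nra. }
 assert (0 < t ^ k) by pos.
 apply (Rmult_lt_reg_l (t ^ k)); lra.
Qed.

(* [I_0(2 t) = sum t^(2m) / m!^2]; as a function of [u = t^2] it solves [u A'' + A' = A]. *)
Definition bes_coef (n : nat) : R := / INR (fact n) ^ 2.
Definition besA : R -> R := PSeries bes_coef.
Definition besB : R -> R := PSeries (PS_derive bes_coef).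
Definition besC : R -> R := PSeries (PS_derive (PS_derive bes_coef)).

Lemma bes_coef_pos n : 0 < bes_coef n.
Proof. apply Rinv_0_lt_compat, pow_lt, INR_fact_lt_0. Qed.

Lemma bes_coef_S n : INR (S n) ^ 2 * bes_coef (S n) = bes_coef n.
Proof.
 unfold bes_coef. rewrite fact_simpl, mult_INR. field. split.
 - apply INR_fact_neq_0.
 - apply not_0_INR; lia.
Qed.

Lemma bes_radius : CV_radius bes_coef = p_infty.
Proof.
 apply CV_radius_infinite_DAlembert.
 - intros n. apply Rgt_not_eq, bes_coef_pos.
 - apply (is_lim_seq_le_le (fun _ => 0) _ (fun n => / INR (S n))).
  + intros n. split; [apply Rabs_pos|].
   rewrite Rabs_pos_eq.
   2:{ left; apply Rdiv_lt_0_compat; apply bes_coef_pos. }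
   rewrite <- (bes_coef_S n).
   assert (H := bes_coef_pos (S n)).
   assert (1 <= INR (S n)) by (rewrite S_INR; generalize (pos_INR n); lra).
   replace (bes_coef (S n) / (INR (S n) ^ 2 * bes_coef (S n)))
    with (/ INR (S n) * / INR (S n)) by (field; lra).
   assert (0 < / INR (S n)) by pos.
   assert (/ INR (S n) <= 1) by (apply Rinv_le_1; lra).
   nra.
  + apply is_lim_seq_const.
  + apply (is_lim_seq_incr_1 (fun n => / INR n)).
   replace (Finite 0) with (Rbar_inv p_infty) by reflexivity.
   apply is_lim_seq_inv; [apply is_lim_seq_INR|discriminate].
Qed.

Lemma bes_lt u : Rbar_lt (Rabs u) (CV_radius bes_coef).
Proof. now rewrite bes_radius. Qed.

Lemma bes_lt' u : Rbar_lt (Rabs u) (CV_radius (PS_derive bes_coef)).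
Proof. rewrite CV_radius_derive. apply bes_lt. Qed.

Lemma bes_lt'' u : Rbar_lt (Rabs u) (CV_radius (PS_derive (PS_derive bes_coef))).
Proof. rewrite CV_radius_derive. apply bes_lt'. Qed.

Lemma besA_derive u : is_derive besA u (besB u).
Proof. apply is_derive_PSeries, bes_lt. Qed.

Lemma besB_derive u : is_derive besB u (besC u).
Proof. apply is_derive_PSeries, bes_lt'. Qed.

Lemma bes_ode u : u * besC u + besB u = besA u.
Proof.
 unfold besC. rewrite <- PSeries_incr_1. unfold besB. rewrite <- PSeries_plus.
 - apply PSeries_ext. intros n. unfold PS_plus, PS_incr_1, PS_derive.
  destruct n as [|n].
  + unfold bes_coef. simpl. change plus with Rplus. change zero with 0. field.
  + change plus with Rplus. rewrite <- (bes_coef_S (S n)).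
   rewrite (S_INR (S n)). ring.
 - apply ex_pseries_incr_1, CV_disk_correct, CV_disk_inside, bes_lt''.
 - apply CV_disk_correct, CV_disk_inside, bes_lt'.
Qed.

Lemma PSeries_pos_coef (a : nat -> R) u :
 (forall n, 0 <= a n) -> 0 <= u -> ex_pseries a u -> a O <= PSeries a u.
Proof.
 intros Ha Hu Hex. apply (ex_pseries_R a u) in Hex.
 unfold PSeries. rewrite Series_incr_1; [|exact Hex].
 simpl. rewrite Rmult_1_r.
 assert (0 <= Series (fun k : nat => a (S k) * (u * u ^ k))); [|lra].
 rewrite <- (Rmult_0_l (Series (fun k => a (S k) * (u * u ^ k)))) at 1.
 rewrite <- Series_scal_l. apply Series_le.
 - intros n. rewrite Rmult_0_l. split; [lra|]. apply Rmult_le_pos; auto.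
  apply Rmult_le_pos; auto. now apply pow_le.
 - now apply (ex_series_incr_1 (fun k => a k * u ^ k)).
Qed.

Lemma besA_ge1 u : 0 <= u -> 1 <= besA u.
Proof.
 intros Hu. replace 1 with (bes_coef 0) by (unfold bes_coef; simpl; field).
 apply PSeries_pos_coef; auto.
 - intros; left; apply bes_coef_pos.
 - apply CV_disk_correct, CV_disk_inside, bes_lt.
Qed.

Definition besI0 (t : R) : R := besA (t ^ 2).
(** The quotient [I_1(2t) / I_0(2t)], because [2 I_1(2t)] is the derivative of [I_0(2t)] in [t]. It
    is the first nontrivial coefficient [x_1]. *)
Definition bes_ratio (t : R) : R := t * besB (t ^ 2) / besA (t ^ 2).

Lemma besI0_ge1 t : 1 <= besI0 t.
Proof. apply besA_ge1, pow2_ge_0. Qed.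

Lemma besI0_derive t : is_derive besI0 t (2 * bes_ratio t * besI0 t).
Proof.
 unfold besI0, bes_ratio. assert (E := besA_derive (t ^ 2)).
 assert (H := besI0_ge1 t). unfold besI0 in H.
 auto_derive; [eexists; exact E|].
 replace (Derive (fun x : R => besA x) (t * (t * 1))) with (besB (t ^ 2))
  by (symmetry; exact (is_derive_unique _ _ _ E)).
 simpl in *. field. lra.
Qed.

(** A consequence of the second order equation [bes_ode]. The factors [1] and [INR 1] are kept so
    that the statement is literally [dp_flow 0], with [dp 0] equal to 1. *)
Lemma bes_ratio_derive t : 0 < t ->
 is_derive bes_ratio t (2 * (1 - bes_ratio t ^ 2) * 1 - INR 1 * bes_ratio t / t).
Proof.
 intros Ht. unfold bes_ratio. assert (E := besA_derive (t ^ 2)).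
 assert (E2 := besB_derive (t ^ 2)). assert (O := bes_ode (t ^ 2)).
 assert (H := besI0_ge1 t). unfold besI0 in H.
 auto_derive.
 - repeat split; auto; [eexists; exact E2|eexists; exact E|simpl in H; lra].
 - replace (Derive (fun x : R => besA x) (t * (t * 1))) with (besB (t ^ 2))
   by (symmetry; exact (is_derive_unique _ _ _ E)).
  replace (Derive (fun x : R => besB x) (t * (t * 1)))
   with ((besA (t ^ 2) - besB (t ^ 2)) / t ^ 2).
  2:{ transitivity (besC (t ^ 2)); [|symmetry; exact (is_derive_unique _ _ _ E2)].
    rewrite <- O. field. lra. }
  simpl in *. field. lra.
Qed.

Lemma bes_ratio_small : small_at_0 bes_ratio.
Proof.
 assert (C : continuity_pt (fun t => besB (t ^ 2)) 0).
 { assert (E := besB_derive (0 ^ 2)).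
  apply (is_derive_continuity_pt _ _ (0 * besC (0 ^ 2))).
  apply (is_derive_comp besB (fun t => t ^ 2)); [exact E|].
  auto_derive; [auto|]. ring. }
 destruct (C 1 ltac:(lra)) as [d [Hd HC]].
 exists (Rabs (besB (0 ^ 2)) + 1), d. split; [lra|]. intros t Ht.
 assert (Rabs (besB (t ^ 2) - besB (0 ^ 2)) < 1).
 { apply HC. split; [split; [exact I|lra]|].
  simpl. unfold Rdist. rewrite Rminus_0_r, Rabs_pos_eq; lra. }
 assert (H1 := besI0_ge1 t). unfold besI0 in H1.
 unfold bes_ratio, Rdiv. rewrite !Rabs_mult, (Rabs_pos_eq t) by lra.
 assert (Rabs (/ besA (t ^ 2)) <= 1).
 { rewrite Rabs_pos_eq by pos.
  apply Rinv_le_1; lra. }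
 assert (Rabs (besB (t ^ 2)) <= Rabs (besB (0 ^ 2)) + 1).
 { replace (besB (t ^ 2)) with ((besB (t ^ 2) - besB (0 ^ 2)) + besB (0 ^ 2)) by ring.
  eapply Rle_trans; [apply Rabs_triang|]. lra. }
 generalize (Rabs_pos (besB (t ^ 2))) (Rabs_pos (/ besA (t ^ 2))); intros.
 apply Rle_trans with (t * Rabs (besB (t ^ 2)) * 1); [|nra].
 mul_l; nra.
Qed.

(** * Discrete Painleve II *)

(** Carries two consecutive terms because the recurrence has order two. In the successor case
    [INR k] refers to the whole argument [S k'], which is the index of the middle term [b]. *)
Fixpoint dp_pair (k : nat) (t : R) : R * R :=
 match k with
 | O => (1, bes_ratio t)
 | S k' => let (a, b) := dp_pair k' t in
      (b, INR k * b / (t * (1 - b ^ 2)) - a)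
 end.

(* The solution of discrete Painleve II attached to the symbol [exp (t (z + 1/z))]. *)
Definition dp (k : nat) (t : R) : R := fst (dp_pair k t).

Lemma dp_0 t : dp 0 t = 1.
Proof. reflexivity. Qed.

Lemma dp_1 t : dp 1 t = bes_ratio t.
Proof. reflexivity. Qed.

Lemma dp_SS k t :
 dp (S (S k)) t = INR (S k) * dp (S k) t / (t * (1 - dp (S k) t ^ 2)) - dp k t.
Proof.
 assert (E : forall j, dp_pair (S j) t =
  (snd (dp_pair j t), INR (S j) * snd (dp_pair j t) / (t * (1 - snd (dp_pair j t) ^ 2))
    - fst (dp_pair j t))).
 { intros j. change (dp_pair (S j) t) with
   (let (a, b) := dp_pair j t in (b, INR (S j) * b / (t * (1 - b ^ 2)) - a)).
  destruct (dp_pair j t); reflexivity. }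
 unfold dp. rewrite (E (S k)), (E k). cbn [fst snd]. reflexivity.
Qed.

(** The leading Taylor term at 0 with its relative error. Both sides are needed: the recurrence for
    the next coefficient subtracts two quantities of order [t^k], and only their common leading term
    makes the difference small. *)
Definition dp_bounds (k : nat) : Prop := forall t, 0 < t ->
 dp k t <= t ^ k / INR (fact k) /\ t ^ k / INR (fact k) * (1 - INR k * t ^ 2) <= dp k t.

(** The flow in [t] with the upper neighbour eliminated through the recurrence. In this form it is a
    Riccati equation for [x_(k+1)] driven by [x_k] alone, as [riccati_pos] requires. *)
Definition dp_flow (k : nat) : Prop := forall t, 0 < t ->
 is_derive (dp (S k)) t (2 * (1 - dp (S k) t ^ 2) * dp k t - INR (S k) * dp (S k) t / t).

(** Differentiates the recurrence that defines [x_(k+2)]. This needs the derivative of [x_k] in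
    terms of its upper neighbour, which is the lower flow rewritten by the recurrence, or 0 when
    [k = 0]; hence the disjunction. *)
Lemma dp_flow_step k :
 dp_flow k -> (forall t, 0 < t -> 0 < dp (S k) t < 1) ->
 (k = O \/ exists j, k = S j /\ dp_flow j /\ forall t, 0 < t -> 0 < dp k t < 1) ->
 dp_flow (S k).
Proof.
 intros H1 B1 Hk t Ht.
 assert (Dk : is_derive (dp k) t (INR k * dp k t / t - 2 * (1 - dp k t ^ 2) * dp (S k) t)).
 { destruct Hk as [->|[j [-> [Hj Bj]]]].
  - apply (is_derive_ext (fun _ => 1)); [reflexivity|].
   replace (INR 0 * dp 0 t / t - 2 * (1 - dp 0 t ^ 2) * dp 1 t) with 0.
   + auto_derive; auto.
   + rewrite dp_0. simpl. field. lra.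
  - assert (D := Hj t Ht). assert (b := Bj t Ht).
   replace (INR (S j) * dp (S j) t / t - 2 * (1 - dp (S j) t ^ 2) * dp (S (S j)) t)
    with (2 * (1 - dp (S j) t ^ 2) * dp j t - INR (S j) * dp (S j) t / t); [exact D|].
   rewrite (dp_SS j). assert (dp (S j) t ^ 2 <> 1) by nra. field. split; [lra|nra]. }
 assert (D1 := H1 t Ht). assert (b1 := B1 t Ht).
 apply (is_derive_ext (fun t => INR (S k) * dp (S k) t / (t * (1 - dp (S k) t ^ 2)) - dp k t));
  [intros u; symmetry; apply dp_SS|].
 assert (Hn : 1 - dp (S k) t ^ 2 <> 0) by nra.
 auto_derive.
 - repeat split; auto; try (eexists; eassumption).
  apply Rmult_integral_contrapositive_currified; [lra|]. simpl in Hn. exact Hn.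
 - rewrite (Derive_eta _ _ _ D1).
  rewrite (Derive_eta _ _ _ Dk).
  change (match k with 0%nat => 1 | S _ => INR k + 1 end) with (INR (S k)).
  rewrite (dp_SS k). rewrite !S_INR.
  set (X := dp (S k) t) in *. set (Y := dp k t) in *. set (n := INR k).
  simpl in Hn |- *. field. split; [lra|nra].
Qed.

Lemma sq_pow_derive (k : nat) (u : R) :
 is_derive (fun u => u ^ S k * u ^ S k) u (2 * INR (S k) * (u ^ k * u ^ S k)).
Proof.
 auto_derive; auto.
 change (match k with 0%nat => 1 | S _ => INR k + 1 end) with (INR (S k)). simpl. ring.
Qed.

Lemma sq_pow_derive2 (k : nat) (u : R) :
 is_derive (fun u => u ^ S k * u ^ S k * u ^ 2) u
  (2 * (INR (S k) + 1) * (u ^ k * u ^ S k) * u ^ 2).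
Proof.
 auto_derive; auto.
 change (match k with 0%nat => 1 | S _ => INR k + 1 end) with (INR (S k)). simpl. ring.
Qed.

Lemma pow_small (n : nat) (u : R) : 0 < u < 1 -> 0 <= u ^ S n <= u.
Proof.
 intros Hu. assert (0 <= u ^ n <= 1).
 { split; [pos|]. rewrite <- (pow1 n). apply pow_incr; lra. }
 simpl. nra.
Qed.

(** Integrates [(t^(k+1) x_(k+1))' = 2 t^(k+1) (1 - x_(k+1)^2) x_k] between the bounds for [x_k]:
    the upper estimate uses [1 - x^2 <= 1], the lower one uses [x_(k+1) <= t], read off from the
    upper estimate. *)
Lemma dp_bounds_step k :
 (forall t, 0 < t -> 0 < dp k t <= 1) -> dp_bounds k ->
 (forall t, 0 < t -> 0 < dp (S k) t < 1) -> dp_flow k -> dp_bounds (S k).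
Proof.
 intros Pk Bk P1 F1.
 assert (Fp : 0 < INR (fact k)) by apply INR_fact_lt_0.
 assert (Fp1 : 0 < INR (fact (S k))) by apply INR_fact_lt_0.
 assert (Hf : INR (fact (S k)) = INR (S k) * INR (fact k)) by (rewrite fact_simpl, mult_INR; ring).
 assert (Sk : 1 <= INR (S k)) by (rewrite S_INR; generalize (pos_INR k); lra).
 assert (Sk' : INR (S k) = INR k + 1) by apply S_INR.
 assert (Dg : forall t, 0 < t ->
  is_derive (fun u => u ^ S k * dp (S k) u) t (2 * t ^ S k * (1 - dp (S k) t ^ 2) * dp k t)).
 { intros t Ht. assert (D := F1 t Ht).
  auto_derive; [eexists; exact D|].
  rewrite (Derive_eta _ _ _ D).
  change (match k with 0%nat => 1 | S _ => INR k + 1 end) with (INR (S k)).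
  simpl pow. field. lra. }
 set (c := / INR (fact (S k))). assert (Hc : 0 < c) by pos.
 assert (Hck : c * INR (S k) = / INR (fact k)) by (unfold c; rewrite Hf; field; lra).
 assert (Up : forall t, 0 < t -> dp (S k) t <= t ^ S k * c).
 { intros t Ht.
  assert (0 <= c * (t ^ S k * t ^ S k) - t ^ S k * dp (S k) t).
  { apply (pos_of_deriv (fun u => c * (u ^ S k * u ^ S k) - u ^ S k * dp (S k) u)
    (fun u => c * (2 * INR (S k) * (u ^ k * u ^ S k)) -
         2 * u ^ S k * (1 - dp (S k) u ^ 2) * dp k u)); auto.
   - intros u Hu. apply derive_minus.
    + apply is_derive_scal, sq_pow_derive.
    + apply Dg; lra.
   - intros u Hu. assert (A := Pk u ltac:(lra)). assert (A1 := P1 u ltac:(lra)).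
    destruct (Bk u ltac:(lra)) as [A2 _].
    assert (0 < u ^ S k) by pos.
    assert (0 <= 1 - dp (S k) u ^ 2 <= 1) by nra.
    assert ((1 - dp (S k) u ^ 2) * dp k u <= u ^ k * / INR (fact k)).
    { apply Rle_trans with (1 * dp k u); [mul_r; lra|lra]. }
    replace (c * (2 * INR (S k) * (u ^ k * u ^ S k)))
     with (2 * u ^ S k * (u ^ k * (c * INR (S k)))) by ring.
    rewrite Hck. nra.
   - exists (c + 1), 1. split; [lra|]. intros u Hu.
    assert (A := P1 u ltac:(lra)). assert (A1 := pow_small k u Hu).
    assert (0 <= u ^ S k * u ^ S k <= u) by nra.
    apply Rabs_le. nra. }
  assert (0 < t ^ S k) by pos.
  apply (Rmult_le_reg_l (t ^ S k)); [lra|]. lra. }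
 intros t Ht. split; [now apply Up|].
 (* For [(k+1) t^2 >= 1] the claimed lower bound is not positive, so only small [t] requires an
    argument. *)
 destruct (Rle_dec 1 (INR (S k) * t ^ 2)) as [Hbig|Hsmall].
 { apply Rle_trans with 0; [|left; now apply P1].
  assert (0 <= t ^ S k / INR (fact (S k))).
  { pos. }
  nra. }
 apply Rnot_le_lt in Hsmall.
 assert (0 <= t ^ S k * dp (S k) t - c * (t ^ S k * t ^ S k)
      + c * INR (S k) * (t ^ S k * t ^ S k * t ^ 2)).
 { apply (pos_of_deriv (fun u => u ^ S k * dp (S k) u - c * (u ^ S k * u ^ S k)
      + c * INR (S k) * (u ^ S k * u ^ S k * u ^ 2))
    (fun u => 2 * u ^ S k * (1 - dp (S k) u ^ 2) * dp k u
         - c * (2 * INR (S k) * (u ^ k * u ^ S k))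
         + c * INR (S k) * (2 * (INR (S k) + 1) * (u ^ k * u ^ S k) * u ^ 2))); auto.
  - intros u Hu. apply derive_plus.
   1:apply derive_minus.
   + apply Dg; lra.
   + apply is_derive_scal, sq_pow_derive.
   + apply is_derive_scal, sq_pow_derive2.
  - intros u Hu. assert (A := Pk u ltac:(lra)). assert (A1 := P1 u ltac:(lra)).
   destruct (Bk u ltac:(lra)) as [_ A2].
   assert (Hut : 0 <= u ^ 2 <= t ^ 2) by (split; [pos|apply pow_incr; lra]).
   assert (Hsm : INR (S k) * u ^ 2 < 1).
   { apply Rle_lt_trans with (2 := Hsmall). mul_l; lra. }
   assert (Hu2 : u ^ 2 < 1) by nra.
   assert (A3 : dp (S k) u <= u).
   { apply Rle_trans with (1 := Up u ltac:(lra)).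
    assert (u < 1) by (apply Rnot_le_lt; intros Hx; nra). assert (P := pow_small k u ltac:(lra)).
    assert (c <= 1); [|nra]. unfold c. rewrite <- Rinv_1. apply Rinv_le_contravar; [lra|].
    apply (le_INR 1). assert (Z := lt_O_fact (S k)). lia. }
   assert (Hd : 1 - u ^ 2 <= 1 - dp (S k) u ^ 2) by nra.
   assert (Hku : 0 <= 1 - INR k * u ^ 2) by (rewrite Sk' in Hsm; lra).
   set (F := / INR (fact k)) in *.
   assert (Q : u ^ k * F * (1 - (INR k + 1) * u ^ 2) <= (1 - dp (S k) u ^ 2) * dp k u).
   { apply Rle_trans with ((1 - u ^ 2) * (u ^ k * F * (1 - INR k * u ^ 2))).
    - replace ((1 - u ^ 2) * (u ^ k * F * (1 - INR k * u ^ 2)))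
      with (u ^ k * F * ((1 - u ^ 2) * (1 - INR k * u ^ 2))) by ring.
     apply Rmult_le_compat_l; [pos|].
     assert (0 <= INR k * (u ^ 2 * u ^ 2)); [|lra].
     pos.
    - apply Rmult_le_compat; try lra; [|exact A2].
     pos. }
   assert (Pu1 : 0 < u ^ S k) by pos.
   replace (c * (2 * INR (S k) * (u ^ k * u ^ S k)))
    with (2 * u ^ S k * (u ^ k * (c * INR (S k)))) by ring.
   replace (c * INR (S k) * (2 * (INR (S k) + 1) * (u ^ k * u ^ S k) * u ^ 2))
    with (2 * u ^ S k * (u ^ k * (c * INR (S k)) * ((INR (S k) + 1) * u ^ 2))) by ring.
   rewrite Hck. fold F.
   assert (0 <= u ^ k * F * u ^ 2).
   { pos. }
   rewrite Sk'. nra.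
  - exists (1 + c + c * INR (S k)), 1. split; [lra|]. intros u Hu.
   assert (A := P1 u ltac:(lra)). assert (A1 := pow_small k u Hu).
   assert (0 <= c * INR (S k)) by nra.
   assert (0 <= u ^ S k * u ^ S k <= u) by nra.
   assert (0 <= u ^ S k * u ^ S k * u ^ 2 <= u) by nra.
   apply Rabs_le. nra. }
 assert (0 < t ^ S k) by pos.
 apply (Rmult_le_reg_l (t ^ S k)); [lra|].
 unfold Rdiv. fold c. lra.
Qed.

(** The two terms of the recurrence both equal [t^k / k!] up to a relative error of order [t^2], so
    their difference is of order [t]. The radius [d] keeps [(k+1) t <= 1/2]. *)
Lemma dp_small_step k :
 (forall t, 0 < t -> 0 < dp k t <= 1) ->
 (forall t, 0 < t -> 0 < dp (S k) t < 1) ->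
 dp_bounds k -> dp_bounds (S k) -> small_at_0 (dp (S (S k))).
Proof.
 intros P0 P1 B0 B1.
 assert (Hk := pos_INR k). assert (Sk' : INR (S k) = INR k + 1) by apply S_INR.
 set (d := / (2 * (INR k + 1))).
 assert (Hd : 0 < d) by pos.
 assert (Hd2 : d <= / 2) by (apply Rinv_le_contravar; lra).
 exists (INR k + 2), d. split; [auto|]. intros t Ht.
 destruct (B0 t ltac:(lra)) as [U0 L0]. destruct (B1 t ltac:(lra)) as [U1 L1].
 assert (A0 := P0 t ltac:(lra)). assert (A1 := P1 t ltac:(lra)).
 set (F := / INR (fact k)). assert (Fk : 0 < INR (fact k)) by apply INR_fact_lt_0.
 assert (HF1 : F <= 1).
 { unfold F. rewrite <- Rinv_1. apply Rinv_le_contravar; [lra|].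
  apply (le_INR 1). assert (Z := lt_O_fact k). lia. }
 assert (Hc : / INR (fact (S k)) = F / (INR k + 1)).
 { unfold F. rewrite fact_simpl, mult_INR, Sk'. field. lra. }
 assert (Ptk : 0 < t ^ k <= 1).
 { split; [pos|]. rewrite <- (pow1 k). apply pow_incr; lra. }
 unfold Rdiv in U0, L0, U1, L1. rewrite Hc in U1, L1. fold F in U0, L0. rewrite Sk' in L1.
 simpl pow in U1, L1. rewrite dp_SS, Sk'.
 set (x := dp (S k) t) in *. set (y := dp k t) in *. set (T := t ^ k) in *.
 set (G := T * F). assert (HG : 0 < G <= 1) by (unfold G; nra).
 assert (Hxt : (INR k + 1) * x <= t * G).
 { apply Rle_trans with ((INR k + 1) * (t * T * (F / (INR k + 1)))).
  - mul_l; lra.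
  - right. unfold G. field. lra. }
 assert (Hxt' : t * G * (1 - (INR k + 1) * t ^ 2) <= (INR k + 1) * x).
 { apply Rle_trans with ((INR k + 1) * (t * T * (F / (INR k + 1)) * (1 - (INR k + 1) * (t * (t * 1))))).
  - right. unfold G. field. lra.
  - mul_l; lra. }
 assert (x <= t) by nra.
 assert (Ht2 : t ^ 2 <= t / 2) by nra.
 assert (D : 0 < 1 - x ^ 2 <= 1) by (split; [nra|generalize (pow2_ge_0 x); lra]).
 set (w := (INR k + 1) * x / (t * (1 - x ^ 2))).
 assert (W1 : w <= G * (1 + 2 * t ^ 2)).
 { unfold w. apply (Rmult_le_reg_r (t * (1 - x ^ 2))); [pos|].
  replace ((INR k + 1) * x / (t * (1 - x ^ 2)) * (t * (1 - x ^ 2))) with ((INR k + 1) * x)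
   by (field; split; lra).
  apply Rle_trans with (1 := Hxt).
  replace (G * (1 + 2 * t ^ 2) * (t * (1 - x ^ 2))) with (t * G * ((1 + 2 * t ^ 2) * (1 - x ^ 2))) by ring.
  rewrite <- (Rmult_1_r (t * G)) at 1. mul_l. nra. }
 assert (W2 : G * (1 - (INR k + 1) * t ^ 2) <= w).
 { unfold w. apply (Rmult_le_reg_r (t * (1 - x ^ 2))); [pos|].
  replace ((INR k + 1) * x / (t * (1 - x ^ 2)) * (t * (1 - x ^ 2))) with ((INR k + 1) * x)
   by (field; split; lra).
  apply Rle_trans with (2 := Hxt').
  assert (Hkt : (INR k + 1) * t ^ 2 <= 1).
  { assert ((INR k + 1) * t <= / 2).
   { apply Rle_trans with ((INR k + 1) * d); [nra|]. right. unfold d. field. lra. }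
   nra. }
  replace (G * (1 - (INR k + 1) * t ^ 2) * (t * (1 - x ^ 2)))
   with (t * G * (1 - (INR k + 1) * t ^ 2) * (1 - x ^ 2)) by ring.
  rewrite <- (Rmult_1_r (t * G * (1 - (INR k + 1) * t ^ 2))) at 2.
  apply Rmult_le_compat_l; [|lra]. pos. }
 fold G in U0, L0.
 assert (G * t ^ 2 <= t) by nra.
 assert (0 <= G * t ^ 2) by pos.
 assert ((INR k + 2) * (G * t ^ 2) <= (INR k + 2) * t) by (mul_l; lra).
 apply Rabs_le. split; lra.
Qed.

(** One simultaneous induction, since the properties feed each other: the flow divides by [1 - x^2]
    and needs the range; the range of the next term needs its flow and its smallness at 0; the
    smallness needs the Taylor bounds of the two previous terms. *)
Lemma dp_all k : forall j, (j <= k)%nat ->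
 dp_flow j /\ (forall t, 0 < t -> 0 < dp (S j) t < 1) /\ dp_bounds j /\ dp_bounds (S j).
Proof.
 induction k as [|k IH]; intros j Hj.
 - assert (j = 0)%nat by lia. subst j.
  assert (F : dp_flow 0) by (intros t Ht; now apply bes_ratio_derive).
  assert (P : forall t, 0 < t -> 0 < dp 1 t < 1).
  { apply (riccati_pos 1 (fun _ => 1)); auto.
   - intros; lra.
   - intros; apply continuous_const.
   - apply bes_ratio_small. }
  assert (B : dp_bounds 0).
  { intros t Ht. rewrite dp_0. simpl. split; [lra|]. lra. }
  split; [exact F|]. split; [exact P|]. split; [exact B|].
  apply (dp_bounds_step 0); auto. intros; rewrite dp_0; lra.
 - destruct (Nat.eq_dec j (S k)) as [->|Hne]; [|apply IH; lia].
  destruct (IH k (Nat.le_refl k)) as (F & P & B & B1).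
  assert (P0 : forall t, 0 < t -> 0 < dp k t <= 1).
  { intros t Ht. destruct k as [|k]; [rewrite dp_0; lra|].
   destruct (IH k ltac:(lia)) as (_ & P0 & _). specialize (P0 t Ht). lra. }
  assert (F1 : dp_flow (S k)).
  { apply dp_flow_step; auto. destruct k as [|k]; [left; auto|right].
   exists k. destruct (IH k ltac:(lia)) as (F0 & P0' & _). auto. }
  assert (P1 : forall t, 0 < t -> 0 < dp (S (S k)) t < 1).
  { apply (riccati_pos (S (S k)) (dp (S k))).
   - lia.
   - intros t Ht. specialize (P t Ht). lra.
   - intros t Ht. apply (ex_derive_continuous (V := R_NormedModule)). eexists. now apply F.
   - intros t Ht. now apply F1.
   - now apply dp_small_step. }
  split; [exact F1|]. split; [exact P1|]. split; [exact B1|].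
  apply dp_bounds_step; auto. intros t Ht. specialize (P t Ht); lra.
Qed.

Lemma dp_S_range k t : 0 < t -> 0 < dp (S k) t < 1.
Proof. intros Ht. now apply (dp_all k k (Nat.le_refl k)). Qed.

Lemma dp_range k t : 0 < t -> 0 < dp k t <= 1.
Proof.
 intros Ht. destruct k; [rewrite dp_0; lra|]. generalize (dp_S_range k t Ht); lra.
Qed.

Lemma dp_upper k t : 0 < t -> dp k t <= t ^ k / INR (fact k).
Proof. intros Ht. now apply (dp_all k k (Nat.le_refl k)). Qed.

Lemma dp_lower k t : 0 < t -> t ^ k / INR (fact k) * (1 - INR k * t ^ 2) <= dp k t.
Proof. intros Ht. now apply (dp_all k k (Nat.le_refl k)). Qed.

Lemma dp_eqn k t : 0 < t ->
 INR (S k) * dp (S k) t = t * (1 - dp (S k) t ^ 2) * (dp (S (S k)) t + dp k t).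
Proof.
 intros Ht. rewrite dp_SS. generalize (dp_S_range k t Ht); intros. field. assert (dp (S k) t ^ 2 <> 1) by nra. split; [lra|]. simpl in *. nra.
Qed.

Lemma dp_derive_down k t : 0 < t ->
 is_derive (dp (S k)) t (2 * (1 - dp (S k) t ^ 2) * dp k t - INR (S k) * dp (S k) t / t).
Proof. intros Ht. now apply (dp_all k k (Nat.le_refl k)). Qed.

Lemma dp_derive k t : 0 < t ->
 is_derive (dp (S k)) t ((1 - dp (S k) t ^ 2) * (dp k t - dp (S (S k)) t)).
Proof.
 intros Ht. assert (D := dp_derive_down k t Ht).
 replace ((1 - dp (S k) t ^ 2) * (dp k t - dp (S (S k)) t))
  with (2 * (1 - dp (S k) t ^ 2) * dp k t - INR (S k) * dp (S k) t / t); [exact D|].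
 rewrite (dp_eqn k t Ht). field. lra.
Qed.

Lemma dp_lim0 t : 0 < t -> is_lim_seq (fun k => dp k t) 0.
Proof.
 intros Ht. apply (is_lim_seq_le_le (fun _ => 0) _ (fun k => t ^ k / INR (fact k))).
 - intros k. split; [left; now apply dp_range|now apply dp_upper].
 - apply is_lim_seq_const.
 - apply is_lim_seq_Reals. apply cv_speed_pow_fact.
Qed.

(** * Summation formulas *)

Fixpoint psum (f : nat -> R) (n : nat) : R :=
 match n with O => 0 | S n => psum f n + f n end.

Lemma psum_ext f g n : (forall k, (k < n)%nat -> f k = g k) -> psum f n = psum g n.
Proof.
 induction n; intros H; simpl; [auto|]. rewrite IHn, H; auto.
Qed.

Lemma psum_plus f g n : psum (fun k => f k + g k) n = psum f n + psum g n.
Proof. induction n; simpl; lra. Qed.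

Lemma psum_scal c f n : psum (fun k => c * f k) n = c * psum f n.
Proof. induction n; simpl; lra. Qed.

Lemma psum_minus f g n : psum f n - psum g n = psum (fun k => f k - g k) n.
Proof. induction n; cbn [psum]; [ring|]. rewrite <- IHn. ring. Qed.

Lemma psum_split f n m : psum f (n + m) = psum f n + psum (fun i => f (n + i)%nat) m.
Proof.
 induction m; simpl; [rewrite Nat.add_0_r; lra|].
 rewrite Nat.add_succ_r. simpl. lra.
Qed.

Lemma psum_le f g n : (forall k, (k < n)%nat -> f k <= g k) -> psum f n <= psum g n.
Proof.
 induction n; intros H; simpl; [lra|].
 assert (f n <= g n) by (apply H; lia). assert (psum f n <= psum g n) by (apply IHn; intros; apply H; lia). lra.
Qed.

Lemma psum_Rabs f n : Rabs (psum f n) <= psum (fun k => Rabs (f k)) n.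
Proof.
 induction n; simpl; [rewrite Rabs_R0; lra|].
 eapply Rle_trans; [apply Rabs_triang|]. lra.
Qed.

Lemma psum_telescope f n : psum (fun k => f k - f (S k)) n = f O - f n.
Proof. induction n; simpl; lra. Qed.

Lemma psum_const c n : psum (fun _ => c) n = INR n * c.
Proof. induction n; cbn [psum]; [simpl; lra|]. rewrite S_INR. lra. Qed.

Lemma psum_derive (F dF : nat -> R -> R) n x :
 (forall k, (k < n)%nat -> is_derive (F k) x (dF k x)) ->
 is_derive (fun t => psum (fun k => F k t) n) x (psum (fun k => dF k x) n).
Proof.
 induction n; intros H; simpl.
 - auto_derive; auto.
 - apply derive_plus.
  + apply IHn; intros; apply H; lia.
  + apply H; lia.
Qed.

Lemma small_at_0_plus f g : small_at_0 f -> small_at_0 g -> small_at_0 (fun t => f t + g t).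
Proof.
 intros [C [d [Hd H]]] [C' [d' [Hd' H']]]. exists (C + C'), (Rmin d d').
 split; [now apply Rmin_glb_lt|]. intros t [Ht1 Ht2].
 assert (t < d) by (apply Rlt_le_trans with (1 := Ht2), Rmin_l).
 assert (t < d') by (apply Rlt_le_trans with (1 := Ht2), Rmin_r).
 eapply Rle_trans; [apply Rabs_triang|].
 assert (A := H t ltac:(lra)). assert (A' := H' t ltac:(lra)). lra.
Qed.

Lemma small_at_0_scal c f : small_at_0 f -> small_at_0 (fun t => c * f t).
Proof.
 intros [C [d [Hd H]]]. exists (Rabs c * C), d. split; [auto|]. intros t Ht.
 rewrite Rabs_mult, Rmult_assoc. mul_l; auto.
Qed.

Lemma small_at_0_psum (F : nat -> R -> R) n :
 (forall k, (k < n)%nat -> small_at_0 (F k)) -> small_at_0 (fun t => psum (fun k => F k t) n).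
Proof.
 induction n; intros H; simpl.
 - exists 0, 1. split; [lra|]. intros; rewrite Rabs_R0; lra.
 - apply small_at_0_plus; [apply IHn; intros; apply H; lia|apply H; lia].
Qed.

Lemma small_at_0_ext f g : (forall t, 0 < t -> f t = g t) -> small_at_0 f -> small_at_0 g.
Proof.
 intros E [C [d [Hd H]]]. exists C, d. split; auto. intros t Ht. rewrite <- E by lra. auto.
Qed.

Lemma small_at_0_id : small_at_0 (fun t => t).
Proof. exists 1, 1. split; [lra|]. intros; rewrite Rabs_pos_eq; lra. Qed.

Lemma small_at_0_sq : small_at_0 (fun t => t ^ 2).
Proof.
 exists 1, 1. split; [lra|]. intros; rewrite Rabs_pos_eq; [nra|pos].
Qed.

Lemma small_increment (f df : R -> R) (B T : R) :
 small_at_0 f -> 0 < T ->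
 (forall t, 0 < t <= T -> is_derive f t (df t) /\ 0 <= df t <= B) ->
 0 <= f T <= B * T.
Proof.
 intros Hs HT H. split.
 - apply (pos_of_deriv f df T); auto; intros; now apply H.
 - assert (0 <= B * T - f T); [|lra].
  apply (pos_of_deriv (fun t => B * t - f t) (fun t => B - df t) T); auto.
  + intros t Ht. apply derive_minus.
   * auto_derive; auto. ring.
   * now apply H.
  + intros t Ht. destruct (H t Ht); lra.
  + apply (small_at_0_ext (fun t => B * t + (-1) * f t)); [intros; ring|].
   apply small_at_0_plus; apply small_at_0_scal; auto. apply small_at_0_id.
Qed.

Lemma dp_le_id k t : 0 < t -> t <= 1 -> dp (S k) t <= t.
Proof.
 intros Ht Ht1. apply Rle_trans with (1 := dp_upper (S k) t Ht).
 assert (1 <= INR (fact (S k))) by (apply (le_INR 1); assert (Z := lt_O_fact (S k)); lia).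
 apply (Rmult_le_reg_r (INR (fact (S k)))); [lra|].
 unfold Rdiv. rewrite Rmult_assoc, Rinv_l, Rmult_1_r by lra.
 assert (0 < t ^ k <= 1).
 { split; [pos|]. rewrite <- (pow1 k). apply pow_incr; lra. }
 simpl pow. nra.
Qed.

Definition atanh (x : R) : R := (ln (1 + x) - ln (1 - x)) / 2.

Lemma atanh_derive x : -1 < x < 1 -> is_derive atanh x (/ (1 - x ^ 2)).
Proof.
 intros Hx. unfold atanh. auto_derive; [lra|]. simpl. field. repeat split; nra.
Qed.

Lemma ln_1m_bound x : 0 <= x <= / 2 -> 0 <= - ln (1 - x) <= 2 * x.
Proof.
 intros Hx. rewrite <- ln_Rinv by lra.
 assert (E : / (1 - x) = 1 + x / (1 - x)) by (field; lra).
 assert (0 <= x / (1 - x) <= 2 * x).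
 { split; [apply Rmult_le_pos; [lra|pos]|].
  apply (Rmult_le_reg_r (1 - x)); [lra|]. unfold Rdiv.
  rewrite Rmult_assoc, Rinv_l by lra. nra. }
 rewrite E. split.
 - rewrite <- ln_1. apply ln_le; lra.
 - apply Rle_trans with (x / (1 - x)); [|lra].
  apply Rle_trans with (ln (exp (x / (1 - x)))); [apply ln_le; [lra|]|rewrite ln_exp; lra].
  apply exp_ineq1_le.
Qed.

Lemma ln_1p_bound x : 0 <= x -> 0 <= ln (1 + x) <= x.
Proof.
 intros Hx. split; [rewrite <- ln_1; apply ln_le; lra|].
 rewrite <- (ln_exp x) at 2. apply ln_le; [lra|].
 apply exp_ineq1_le.
Qed.

Lemma dp_pow_half k t : 0 < t -> t < / 2 -> 0 < dp (S k) t <= t.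
Proof. intros. split; [now apply dp_S_range|]. apply dp_le_id; lra. Qed.

Definition atanh_sum (J : nat) (t : R) : R := psum (fun j => atanh (dp (S (2 * j)) t)) J.

(** By [dp_derive] the derivative of [atanh x_(2j+1)] is [x_(2j) - x_(2j+2)]. The sum over odd
    indices telescopes to [1 - x_(2J)], so [t - atanh_sum J t] has the small derivative [x_(2J)]. *)
Lemma atanh_sum_bound J T : 0 < T ->
 0 <= T - atanh_sum J T <= T ^ (2 * J) / INR (fact (2 * J)) * T.
Proof.
 intros HT.
 apply (small_increment (fun t => t - atanh_sum J t) (fun t => dp (2 * J) t)); auto.
 - apply (small_at_0_ext (fun t => t + (-1) * atanh_sum J t)); [intros; ring|].
  apply small_at_0_plus; [apply small_at_0_id|]. apply small_at_0_scal.
  apply (small_at_0_psum (fun j t => atanh (dp (S (2 * j)) t))). intros j _.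
  exists 2, (/ 2). split; [lra|]. intros t Ht.
  assert (B := dp_pow_half (2 * j) t ltac:(lra) ltac:(lra)).
  unfold atanh. assert (B1 := ln_1p_bound (dp (S (2 * j)) t) ltac:(lra)).
  assert (B2 := ln_1m_bound (dp (S (2 * j)) t) ltac:(lra)).
  rewrite Rabs_pos_eq; lra.
 - intros t Ht. split.
  + replace (dp (2 * J) t) with (1 - psum (fun j => dp (2 * j) t - dp (2 * S j) t) J).
   2:{ rewrite (psum_telescope (fun j => dp (2 * j) t) J). rewrite Nat.mul_0_r, dp_0. ring. }
   apply derive_minus.
   * apply (is_derive_id (K := R_AbsRing)).
   * apply (psum_derive (fun j t => atanh (dp (S (2 * j)) t)) (fun j t => dp (2 * j) t - dp (2 * S j) t)).
    intros j _. assert (D := dp_derive (2 * j) t ltac:(lra)).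
    assert (Rg := dp_S_range (2 * j) t ltac:(lra)).
    assert (D2 := atanh_derive (dp (S (2 * j)) t) ltac:(lra)).
    assert (D3 := is_derive_comp (K := R_AbsRing) (V := R_NormedModule) atanh (dp (S (2 * j))) t _ _ D2 D).
    replace (2 * S j)%nat with (S (S (2 * j))) by lia.
    replace (dp (2 * j) t - dp (S (S (2 * j))) t) with
     (scal ((1 - dp (S (2 * j)) t ^ 2) * (dp (2 * j) t - dp (S (S (2 * j))) t))
       (/ (1 - dp (S (2 * j)) t ^ 2))); [exact D3|].
    unfold scal; simpl scal. unfold mult; cbn -[dp pow Nat.mul].
    set (X := dp (S (2 * j)) t) in *. assert (0 < 1 - X ^ 2) by nra. field. lra.
  + split; [left; apply dp_range; lra|].
   apply Rle_trans with (1 := dp_upper _ t ltac:(lra)).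
   apply Rmult_le_compat_r; [left; apply Rinv_0_lt_compat, INR_fact_lt_0|].
   apply pow_incr; lra.
Qed.

Lemma atanh_sum_lim t : 0 < t -> is_lim_seq (fun J => atanh_sum J t) t.
Proof.
 intros Ht. apply (is_lim_seq_le_le (fun J => t - t ^ (2 * J) / INR (fact (2 * J)) * t) _ (fun _ => t)).
 - intros J. generalize (atanh_sum_bound J t Ht); lra.
 - assert (L : is_lim_seq (fun n => t ^ n / INR (fact n)) 0)
   by (apply is_lim_seq_Reals, cv_speed_pow_fact).
  assert (L2 : is_lim_seq (fun J => t ^ (2 * J) / INR (fact (2 * J))) 0).
  { apply (is_lim_seq_subseq (fun n => t ^ n / INR (fact n)) _ (fun J => 2 * J)%nat); auto.
   apply eventually_subseq. intros; lia. }
  replace t with (t - 0 * t) at 1 by ring.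
  apply (is_lim_seq_minus' (fun _ => t)); [apply is_lim_seq_const|].
  apply (is_lim_seq_mult' _ (fun _ => t)); [exact L2|apply is_lim_seq_const].
 - apply is_lim_seq_const.
Qed.

(** The index is shifted: sums over [j < n] involve [x_1, ..., x_n] and avoid [x_0 = 1], where the
    logarithm is singular. *)
Definition dp_log (j : nat) (t : R) : R := ln (1 - dp (S j) t ^ 2).

(** With [y_j = x_j x_(j+1)] the derivative is [-2 (y_j - y_(j+1))]: plain sums telescope, and sums
    with weight [j+1] reduce to a sum of the [y_j] by parts. *)
Lemma dp_log_derive j t : 0 < t ->
 is_derive (dp_log j) t (-2 * (dp j t * dp (S j) t - dp (S j) t * dp (S (S j)) t)).
Proof.
 intros Ht. unfold dp_log. assert (D := dp_derive j t Ht). assert (Rg := dp_S_range j t Ht).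
 auto_derive.
 - repeat split; [eexists; exact D|nra].
 - rewrite (Derive_eta _ _ _ D).
  set (X := dp (S j) t) in *. assert (0 < 1 - X * (X * 1)) by nra. simpl. field. lra.
Qed.

Lemma dp_log_small j : small_at_0 (dp_log j).
Proof.
 exists 2, (/ 2). split; [lra|]. intros t Ht.
 assert (B := dp_pow_half j t ltac:(lra) ltac:(lra)). unfold dp_log.
 assert (dp (S j) t ^ 2 <= t) by nra. assert (B2 := pow2_ge_0 (dp (S j) t)).
 assert (B3 := ln_1m_bound (dp (S j) t ^ 2) ltac:(lra)).
 rewrite <- Rabs_Ropp, Rabs_pos_eq; lra.
Qed.

(** A first integral of the recurrence, whose induction step is the recurrence itself. It puts the
    derivative of the weighted logarithmic sum in closed form, and later acts as a discrete energy
    in [energy_bound]. *)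
Lemma dp_pair_sum K t : 0 < t ->
 psum (fun j => dp j t * dp (S j) t) K - INR K * (dp K t * dp (S K) t)
 = t * ((1 - dp K t ^ 2) * (1 - dp (S K) t ^ 2)).
Proof.
 intros Ht. induction K as [|K IH].
 - rewrite dp_0. simpl. ring.
 - assert (E := dp_eqn K t Ht). cbn [psum].
  replace (psum (fun j => dp j t * dp (S j) t) K) with
   (t * ((1 - dp K t ^ 2) * (1 - dp (S K) t ^ 2)) + INR K * (dp K t * dp (S K) t)) by lra.
  rewrite S_INR in *.
  replace (INR K * (dp K t * dp (S K) t)) with
   (((INR K + 1) * dp (S K) t) * dp K t - dp K t * dp (S K) t) by ring.
  replace ((INR K + 1) * (dp (S K) t * dp (S (S K)) t)) with
   (((INR K + 1) * dp (S K) t) * dp (S (S K)) t) by ring.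
  rewrite E. ring.
Qed.

Lemma psum_by_parts (y : nat -> R) K :
 psum (fun j => INR (S j) * (y j - y (S j))) K = psum y K - INR K * y K.
Proof. induction K; cbn [psum]; [simpl; ring|]. rewrite IHK, !S_INR. ring. Qed.

(** By parts and [dp_pair_sum], the derivative is [2t - 2t (1 - x_K^2) (1 - x_(K+1)^2)], which is
    small for large [K]. In the limit this is the strong Szego theorem
    [sum_j j ln (1 - x_j^2) = - t^2]. *)
Lemma log_sum0_bound K T : 0 < T ->
 0 <= T ^ 2 + psum (fun j => INR (S j) * dp_log j T) K
  <= 2 * T * ((T ^ K / INR (fact K)) ^ 2 + (T ^ S K / INR (fact (S K))) ^ 2) * T.
Proof.
 intros HT.
 apply (small_increment (fun t => t ^ 2 + psum (fun j => INR (S j) * dp_log j t) K)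
  (fun t => 2 * t + (-2) * (t * ((1 - dp K t ^ 2) * (1 - dp (S K) t ^ 2))))); auto.
 - apply small_at_0_plus; [apply small_at_0_sq|].
  apply (small_at_0_psum (fun j t => INR (S j) * dp_log j t)). intros.
  apply small_at_0_scal, dp_log_small.
 - intros t Ht. split.
  + apply derive_plus.
   { auto_derive; auto. ring. }
   rewrite <- dp_pair_sum by lra.
   rewrite <- (psum_by_parts (fun j => dp j t * dp (S j) t)).
   rewrite <- psum_scal.
   apply (psum_derive (fun j t => INR (S j) * dp_log j t)
     (fun j t => -2 * (INR (S j) * (dp j t * dp (S j) t - dp (S j) t * dp (S (S j)) t)))).
   intros j _.
   replace (-2 * (INR (S j) * (dp j t * dp (S j) t - dp (S j) t * dp (S (S j)) t)))
    with (INR (S j) * (-2 * (dp j t * dp (S j) t - dp (S j) t * dp (S (S j)) t))) by ring.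
   apply is_derive_scal, dp_log_derive; lra.
  + assert (forall k, 0 <= dp k t ^ 2 <= (T ^ k / INR (fact k)) ^ 2).
   { intros k. split; [pos|]. apply pow_incr.
    split; [left; apply dp_range; lra|].
    apply Rle_trans with (1 := dp_upper _ t ltac:(lra)).
    apply Rmult_le_compat_r; [left; apply Rinv_0_lt_compat, INR_fact_lt_0|].
    apply pow_incr; lra. }
   assert (H1 := H K). assert (H2 := H (S K)).
   assert (R1 := dp_range K t ltac:(lra)). assert (R2 := dp_range (S K) t ltac:(lra)).
   assert (dp K t ^ 2 <= 1 /\ dp (S K) t ^ 2 <= 1) by (split; nra).
   set (a := dp K t ^ 2) in *. set (b := dp (S K) t ^ 2) in *.
   set (A := (T ^ K / INR (fact K)) ^ 2) in *. set (B := (T ^ S K / INR (fact (S K))) ^ 2) in *.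
   replace (2 * t + (-2) * (t * ((1 - a) * (1 - b)))) with (2 * t * (a + b - a * b)) by ring.
   assert (0 <= a * b) by pos.
   assert (0 <= a + b - a * b) by nra.
   split; [pos|].
   apply Rmult_le_compat; lra.
Qed.

Lemma dp_factor_lim (T : R) : is_lim_seq (fun K => T ^ K / INR (fact K)) 0.
Proof. apply is_lim_seq_Reals, cv_speed_pow_fact. Qed.

Lemma log_sum0_lim t : 0 < t ->
 is_lim_seq (fun K => psum (fun j => INR (S j) * dp_log j t) K) (- t ^ 2).
Proof.
 intros Ht.
 apply (is_lim_seq_le_le (fun _ => - t ^ 2) _ (fun K =>
  2 * t * ((t ^ K / INR (fact K)) ^ 2 + (t ^ S K / INR (fact (S K))) ^ 2) * t - t ^ 2)).
 - intros K. generalize (log_sum0_bound K t Ht); lra.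
 - apply is_lim_seq_const.
 - assert (L := dp_factor_lim t). assert (L2 := L). apply is_lim_seq_incr_1 in L2.
  assert (S0 : forall u : nat -> R, is_lim_seq u 0 -> is_lim_seq (fun n => u n ^ 2) 0).
  { intros u Hu. replace 0 with (0 * 0) by ring.
   apply (is_lim_seq_ext (fun n => u n * u n)); [intros; ring|].
   now apply is_lim_seq_mult'. }
  replace (- t ^ 2) with (2 * t * (0 + 0) * t - t ^ 2) by ring.
  apply (is_lim_seq_minus' _ (fun _ => t ^ 2)); [|apply is_lim_seq_const].
  apply (is_lim_seq_mult' _ (fun _ => t)); [|apply is_lim_seq_const].
  apply (is_lim_seq_mult' (fun _ => 2 * t)); [apply is_lim_seq_const|].
  apply is_lim_seq_plus'; apply S0; auto.
Qed.

Lemma besI0_0 : besI0 0 = 1.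
Proof.
 unfold besI0, besA, PSeries. replace (0 ^ 2) with 0 by ring.
 rewrite Series_incr_1.
 - rewrite (Series_ext _ (fun n => 0 * 0)).
  + rewrite Series_scal_l. unfold bes_coef. simpl. field.
  + intros n. simpl. ring.
 - apply (ex_pseries_R bes_coef 0), CV_disk_correct, CV_disk_inside, bes_lt.
Qed.

Lemma ln_besI0_derive t : is_derive (fun t => ln (besI0 t)) t (2 * bes_ratio t).
Proof.
 assert (D := besI0_derive t). assert (H := besI0_ge1 t).
 auto_derive.
 - split; [eexists; exact D|split; [lra|auto]].
 - rewrite (Derive_eta _ _ _ D).
  field. lra.
Qed.

Lemma ln_besI0_small : small_at_0 (fun t => ln (besI0 t)).
Proof.
 exists 2, 1. split; [lra|]. intros t Ht.
 assert (0 <= ln (besI0 t) - ln (besI0 0) <= 2 * t).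
 2:{ rewrite besI0_0, ln_1 in H. rewrite Rabs_pos_eq; lra. }
 destruct (mean_value (fun t => ln (besI0 t)) (fun t => 2 * bes_ratio t) 0 t) as [c [Hc E]];
  [lra|intros; apply ln_besI0_derive|].
 rewrite E. assert (Rg := dp_S_range 0 c ltac:(lra)). rewrite dp_1 in Rg. nra.
Qed.

(** The derivative of [ln I_0(2t)] is [2 x_0 x_1], exactly the first term of the telescoping sum;
    only [2 x_K x_(K+1)] remains. *)
Lemma log_sum_bound K T : 0 < T ->
 0 <= ln (besI0 T) + psum (fun j => dp_log j T) K <= 2 * (T ^ K / INR (fact K)) * T.
Proof.
 intros HT.
 apply (small_increment (fun t => ln (besI0 t) + psum (fun j => dp_log j t) K)
  (fun t => 2 * (dp K t * dp (S K) t))); auto.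
 - apply small_at_0_plus; [apply ln_besI0_small|].
  apply (small_at_0_psum dp_log). intros; apply dp_log_small.
 - intros t Ht. split.
  + replace (2 * (dp K t * dp (S K) t)) with
    (2 * bes_ratio t + psum (fun j => -2 * (dp j t * dp (S j) t - dp (S j) t * dp (S (S j)) t)) K).
   * apply derive_plus; [apply ln_besI0_derive|].
    apply (psum_derive dp_log
     (fun j t => -2 * (dp j t * dp (S j) t - dp (S j) t * dp (S (S j)) t))).
    intros; apply dp_log_derive; lra.
   * rewrite psum_scal, (psum_telescope (fun j => dp j t * dp (S j) t)).
    change (dp 0 t) with 1. change (bes_ratio t) with (dp 1 t). ring.
  + assert (R1 := dp_range K t ltac:(lra)). assert (R2 := dp_S_range K t ltac:(lra)).
   split; [nra|].
   assert (dp K t <= T ^ K / INR (fact K)).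
   { apply Rle_trans with (1 := dp_upper _ t ltac:(lra)).
    apply Rmult_le_compat_r; [left; apply Rinv_0_lt_compat, INR_fact_lt_0|].
    apply pow_incr; lra. }
   nra.
Qed.

Lemma log_sum_lim t : 0 < t -> is_lim_seq (fun K => psum (fun j => dp_log j t) K) (- ln (besI0 t)).
Proof.
 intros Ht.
 apply (is_lim_seq_le_le (fun _ => - ln (besI0 t)) _
  (fun K => 2 * (t ^ K / INR (fact K)) * t - ln (besI0 t))).
 - intros K. generalize (log_sum_bound K t Ht); lra.
 - apply is_lim_seq_const.
 - replace (- ln (besI0 t)) with (2 * 0 * t - ln (besI0 t)) by ring.
  apply (is_lim_seq_minus' _ (fun _ => ln (besI0 t))); [|apply is_lim_seq_const].
  apply (is_lim_seq_mult' _ (fun _ => t)); [|apply is_lim_seq_const].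
  apply (is_lim_seq_mult' (fun _ => 2)); [apply is_lim_seq_const|apply dp_factor_lim].
Qed.

(* Both sides are [log D_n - t^2] for the Toeplitz determinant [D_n] of [exp (t (z + 1/z))]:
  the tail form uses [D_n -> exp (t^2)], the other one [D_0 = 1] and [D_1 = I_0(2 t)]. *)
Lemma log_tail_lim n t : 0 < t ->
 is_lim_seq (fun K => psum (fun i => INR (S i) * dp_log (n + i) t) K)
  (INR n * ln (besI0 t) - t ^ 2 + psum (fun j => (INR n - INR (S j)) * dp_log j t) n).
Proof.
 intros Ht.
 apply (is_lim_seq_ext (fun K => psum (fun j => INR (S j) * dp_log j t) (K + n)
   - INR n * psum (fun j => dp_log j t) (K + n)
   + psum (fun j => (INR n - INR (S j)) * dp_log j t) n)).
 - intros K. rewrite (Nat.add_comm K n), <- psum_scal.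
  replace (psum (fun j : nat => INR (S j) * dp_log j t) (n + K) -
   psum (fun k : nat => INR n * dp_log k t) (n + K)) with
   (psum (fun j => (INR (S j) - INR n) * dp_log j t) (n + K)).
  + rewrite psum_split.
   rewrite (psum_ext (fun i => (INR (S (n + i)) - INR n) * dp_log (n + i) t)
         (fun i => INR (S i) * dp_log (n + i) t)).
   2:{ intros. rewrite !S_INR, plus_INR. ring. }
   assert (psum (fun j => (INR (S j) - INR n) * dp_log j t) n
    = - psum (fun j => (INR n - INR (S j)) * dp_log j t) n); [|lra].
   rewrite (psum_ext (fun j => (INR (S j) - INR n) * dp_log j t)
            (fun j => (-1) * ((INR n - INR (S j)) * dp_log j t))).
   * rewrite psum_scal. ring.
   * intros; ring.
  + rewrite (psum_ext (fun j => (INR (S j) - INR n) * dp_log j t)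
    (fun j => INR (S j) * dp_log j t + (-1) * (INR n * dp_log j t))) by (intros; ring).
   rewrite psum_plus, psum_scal. ring.
 - replace (INR n * ln (besI0 t) - t ^ 2) with (- t ^ 2 - INR n * (- ln (besI0 t))) by ring.
  apply is_lim_seq_plus'; [|apply is_lim_seq_const].
  apply is_lim_seq_minus'.
  + apply (is_lim_seq_incr_n (fun K => psum (fun j => INR (S j) * dp_log j t) K) n).
   now apply log_sum0_lim.
  + apply (is_lim_seq_mult' (fun _ => INR n)); [apply is_lim_seq_const|].
   apply (is_lim_seq_incr_n (fun K => psum (fun j => dp_log j t) K) n).
   now apply log_sum_lim.
Qed.

(** * Comparison principle and crude bounds for the coefficients *)

Section Comparison.

Variable t : R.
Hypothesis Ht : 0 < t.

(* Since [k / (t (1 - x^2))] increases with [x], a sub- and a supersolution can be compared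
  at the point where their ratio is largest. *)
Lemma dp_comparison (u v : nat -> R) (i0 i1 : nat) :
 (i0 <= i1)%nat ->
 (forall k, (i0 <= k <= i1)%nat -> 0 < u k) ->
 (forall k, (i0 < k < i1)%nat -> u k < v k ->
   v k < 1 /\
   u (S k) + u (pred k) <= INR k * u k / (t * (1 - u k ^ 2)) /\
   INR k * v k / (t * (1 - v k ^ 2)) <= v (S k) + v (pred k)) ->
 v i0 <= u i0 -> v i1 <= u i1 ->
 forall k, (i0 <= k <= i1)%nat -> v k <= u k.
Proof.
 intros Hi Pu Hc H0 H1.
 assert (Hmax : exists m, (i0 <= m <= i1)%nat /\
   forall k, (i0 <= k <= i1)%nat -> v k / u k <= v m / u m).
 { assert (Hm : forall d, (i0 + d <= i1)%nat -> exists m, (i0 <= m <= i0 + d)%nat /\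
   forall k, (i0 <= k <= i0 + d)%nat -> v k / u k <= v m / u m).
  { induction d as [|d IH]; intros Hd.
   - exists i0. split; [lia|]. intros k Hk. replace k with i0 by lia. lra.
   - destruct (IH ltac:(lia)) as [m [Hm1 Hm2]].
    destruct (Rle_dec (v (i0 + S d)%nat / u (i0 + S d)%nat) (v m / u m)) as [Hle|Hgt].
    + exists m. split; [lia|]. intros k Hk.
     destruct (Nat.eq_dec k (i0 + S d)) as [->|]; [auto|apply Hm2; lia].
    + exists (i0 + S d)%nat. split; [lia|]. intros k Hk.
     destruct (Nat.eq_dec k (i0 + S d)) as [->|]; [lra|].
     apply Rle_trans with (v m / u m); [apply Hm2; lia|lra]. }
  destruct (Hm (i1 - i0)%nat ltac:(lia)) as [m [A B]].
  exists m. split; [lia|]. intros k Hk. apply B; lia. }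
 destruct Hmax as [m [Hm Hmx]].
 assert (Hle1 : v m / u m <= 1).
 (* If the largest ratio [l] exceeded 1, then [l u] would touch [v] at an interior index and
    dominate it at both neighbours. The two difference inequalities then order the coefficients at
    [u m < v m] the wrong way. *)
 { apply Rnot_lt_le; intros Hgt.
  assert (Pm := Pu m Hm).
  set (l := v m / u m) in *.
  assert (Ev : v m = l * u m) by (unfold l; field; lra).
  assert (Hlt : u m < v m) by (rewrite Ev; nra).
  assert (m <> i0) by (intros ->; lra). assert (m <> i1) by (intros ->; lra).
  destruct (Hc m ltac:(lia) Hlt) as (Hv1 & Hsup & Hsub).
  assert (Hn : forall k, (i0 <= k <= i1)%nat -> v k <= l * u k).
  { intros k Hk. assert (Pk := Pu k Hk). assert (A := Hmx k Hk).
   replace (v k) with (v k / u k * u k) by (field; lra).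
   mul_r; lra. }
  assert (A1 := Hn (S m) ltac:(lia)). assert (A2 := Hn (pred m) ltac:(lia)).
  assert (Hkm : 0 < INR m) by (apply lt_0_INR; lia).
  assert (Hbig : INR m * v m / (t * (1 - v m ^ 2)) <= l * (INR m * u m / (t * (1 - u m ^ 2)))).
  { apply Rle_trans with (1 := Hsub).
   apply Rle_trans with (l * (u (S m) + u (pred m))); [lra|].
   mul_l; lra. }
  assert (Dv : 0 < 1 - v m ^ 2) by nra. assert (Du : 1 - v m ^ 2 < 1 - u m ^ 2) by nra.
  clear Hsup Hsub A1 A2 Hmx Hn.
  assert (Hstr : l * (INR m * u m / (t * (1 - u m ^ 2))) < INR m * (l * u m) / (t * (1 - v m ^ 2))); [|rewrite <- Ev in Hstr; lra].
  replace (l * (INR m * u m / (t * (1 - u m ^ 2)))) with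
   (INR m * (l * u m) * / (t * (1 - u m ^ 2))) by (field; lra).
  apply Rmult_lt_compat_l.
  - rewrite <- Ev. pos.
  - apply Rinv_lt_contravar; [|apply Rmult_lt_compat_l; lra].
   pos. }
 intros k Hk. assert (Pk := Pu k Hk). assert (A := Hmx k Hk).
 replace (v k) with (v k / u k * u k) by (field; lra).
 apply Rle_trans with (1 * u k); [mul_r; lra|lra].
Qed.

Lemma dp_eqn' k : (0 < k)%nat ->
 INR k * dp k t / (t * (1 - dp k t ^ 2)) = dp (S k) t + dp (pred k) t.
Proof.
 intros Hk. destruct k as [|k]; [lia|]. simpl pred.
 rewrite (dp_eqn k t Ht). assert (Rg := dp_S_range k t Ht). assert (0 < 1 - dp (S k) t ^ 2) by nra.
 field. lra.
Qed.

Lemma dp_le_super (u : nat -> R) (i0 i1 : nat) :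
 (i0 <= i1)%nat ->
 (forall k, (i0 <= k <= i1)%nat -> 0 < u k) ->
 (forall k, (i0 < k < i1)%nat -> u k < 1 ->
   u (S k) + u (pred k) <= INR k * u k / (t * (1 - u k ^ 2))) ->
 dp i0 t <= u i0 -> dp i1 t <= u i1 ->
 forall k, (i0 <= k <= i1)%nat -> dp k t <= u k.
Proof.
 intros Hi Pu Hs H0 H1. apply (dp_comparison u (fun k => dp k t) i0 i1); auto.
 intros k Hk Hlt. destruct k as [|k]; [lia|]. assert (Rg := dp_S_range k t Ht).
 split; [lra|]. split; [apply Hs; auto; lra|]. right. apply dp_eqn'. lia.
Qed.

Lemma dp_ge_sub (v : nat -> R) (i0 i1 : nat) :
 (i0 <= i1)%nat ->
 (forall k, (i0 < k < i1)%nat -> 0 < v k -> v k < 1 /\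
   INR k * v k / (t * (1 - v k ^ 2)) <= v (S k) + v (pred k)) ->
 v i0 <= dp i0 t -> v i1 <= dp i1 t ->
 forall k, (i0 <= k <= i1)%nat -> v k <= dp k t.
Proof.
 intros Hi Hs H0 H1. apply (dp_comparison (fun k => dp k t) v i0 i1); auto.
 - intros; now apply dp_range.
 - intros k Hk Hlt. assert (Rg := dp_range k t Ht). destruct (Hs k Hk ltac:(lra)) as [A B].
  split; [auto|]. split; [|auto]. right. symmetry. apply dp_eqn'. lia.
Qed.

(** The right boundary condition is needed only at arbitrarily large indices: each [k] is handled on
    a finite range ending at such a [K]. *)
Lemma dp_le_super_inf (u : nat -> R) (i0 : nat) :
 (forall k, (i0 <= k)%nat -> 0 < u k) ->
 (forall k, (i0 < k)%nat -> u k < 1 ->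
   u (S k) + u (pred k) <= INR k * u k / (t * (1 - u k ^ 2))) ->
 dp i0 t <= u i0 ->
 (forall N, exists K, (N <= K)%nat /\ dp K t <= u K) ->
 forall k, (i0 <= k)%nat -> dp k t <= u k.
Proof.
 intros Pu Hs H0 HK k Hk. destruct (HK k) as [K [HK1 HK2]].
 apply (dp_le_super u i0 K); auto; try lia; intros.
 - apply Pu; lia.
 - apply Hs; auto; lia.
Qed.

(** The shifted sequence solves the equation with a larger coefficient and is therefore a
    subsolution. A right end point where it lies below exists, since otherwise the sequence would
    increase from [k] on and could not tend to 0. *)
Lemma dp_decr k : dp (S k) t <= dp k t.
Proof.
 assert (HK : exists K, (k <= K)%nat /\ dp (S K) t <= dp K t).
 { destruct (Classical_Prop.classic (exists K, (k <= K)%nat /\ dp (S K) t <= dp K t)) as [H|H]; [auto|].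
  exfalso. assert (Hinc : forall d, dp k t <= dp (k + d)%nat t).
  { induction d; [rewrite Nat.add_0_r; lra|]. rewrite Nat.add_succ_r.
   apply Rle_trans with (1 := IHd). apply Rnot_lt_le. intros Hl. apply H.
   exists (k + d)%nat. split; [lia|lra]. }
  assert (L := dp_lim0 t Ht). apply is_lim_seq_Reals in L.
  destruct (L (dp k t) ltac:(now apply dp_range)) as [N HN].
  specialize (HN (k + N)%nat ltac:(lia)). specialize (Hinc N).
  unfold Rdist in HN. rewrite Rminus_0_r, Rabs_pos_eq in HN; [lra|left; now apply dp_range]. }
 destruct HK as [K [HK1 HK2]].
 apply (dp_comparison (fun j => dp j t) (fun j => dp (S j) t) 0 K); auto; try lia.
 - intros; now apply dp_range.
 - intros j Hj Hlt. assert (Rg := dp_S_range j t Ht).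
  split; [lra|]. split; [right; symmetry; apply dp_eqn'; lia|].
  destruct j as [|j]; [lia|]. simpl pred.
  assert (E := dp_eqn' (S (S j)) ltac:(lia)). simpl pred in E. rewrite <- E.
  assert (0 < 1 - dp (S (S j)) t ^ 2) by nra.
  apply Rmult_le_compat_r; [left; apply Rinv_0_lt_compat; pos|].
  mul_r. apply le_INR; lia.
 - rewrite dp_0. generalize (dp_S_range 0 t Ht); lra.
Qed.

Lemma dp_mono j k : (j <= k)%nat -> dp k t <= dp j t.
Proof.
 induction 1; [lra|]. apply Rle_trans with (2 := IHle). apply dp_decr.
Qed.

End Comparison.

(** The positive root [Y] of [Y (Y - p) = B/4], a smoothing of the positive part of [p]. Its square
    root replaces the approximation [sqrt p] of [x_k] across and beyond [p = 0]. *)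
Definition rough (B p : R) : R := (p + sqrt (p ^ 2 + B)) / 2.

Lemma rough_pos B p : 0 < B -> 0 < rough B p.
Proof.
 intros HB. unfold rough. assert (Rabs p < sqrt (p ^ 2 + B)).
 { rewrite <- sqrt_Rsqr_abs. apply sqrt_lt_1_alt. unfold Rsqr. nra. }
 assert (- p <= Rabs p) by (rewrite <- Rabs_Ropp; apply Rle_abs). lra.
Qed.

Lemma rough_eq B p : 0 < B -> rough B p * (rough B p - p) = B / 4.
Proof.
 intros HB. unfold rough. assert (E := sqrt_sqrt (p ^ 2 + B) ltac:(generalize (pow2_ge_0 p); lra)). nra.
Qed.

Lemma sum_le_of_sq a b c : 0 <= c -> (a + b) ^ 2 <= c ^ 2 -> a + b <= c.
Proof. intros Hc H. apply Rnot_lt_le; intros Hl. nra. Qed.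

(** The condition on [h] bounds the second difference of [sqrt (p^2 + B)] by [2 B], so the values of
    [rough] at [p + h] and [p - h] add up to at most [2Y + B]. As [B = 4 Y (Y - p)], the square
    roots add up to at most [2 sqrt Y (1 + Y - p)], and
    [(1 + Y - p) (1 - Y) = 1 - p - Y (Y - p)]. *)
Lemma rough_super B h p : 0 < h -> 0 < B -> h ^ 4 <= 4 * B ^ 3 ->
 0 <= 1 - p -> rough B p < 1 ->
 (sqrt (rough B (p + h)) + sqrt (rough B (p - h))) * (1 - rough B p) <= 2 * (1 - p) * sqrt (rough B p).
Proof.
 intros Hh HB Hc Hp H1.
 assert (P0 := rough_pos B p HB). assert (Pp := rough_pos B (p + h) HB). assert (Pm := rough_pos B (p - h) HB).
 set (Y := rough B p) in *.
 assert (E : Y * (Y - p) = B / 4) by (apply rough_eq; auto).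
 set (s := sqrt (p ^ 2 + B)).
 assert (Hs2 : s * s = p ^ 2 + B) by (apply sqrt_sqrt; generalize (pow2_ge_0 p); lra).
 assert (Hs0 : 0 < s) by (apply sqrt_lt_R0; generalize (pow2_ge_0 p); lra).
 assert (HsB : h ^ 2 <= 2 * B * s).
 {    assert (Hb : B <= s * s) by (generalize (pow2_ge_0 p); lra).
  apply Rsqr_incr_0_var; [|nra]. unfold Rsqr.
  replace (h ^ 2 * h ^ 2) with (h ^ 4) by ring.
  replace (2 * B * s * (2 * B * s)) with (4 * B ^ 2 * (s * s)) by ring.
  apply Rle_trans with (1 := Hc). replace (4 * B ^ 3) with (4 * B ^ 2 * B) by ring.
  apply Rmult_le_compat_l; [generalize (pow2_ge_0 B); lra|lra]. }
 assert (Hsum : rough B (p + h) + rough B (p - h) <= 2 * Y + B).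
 { unfold Y, rough. fold s.
  set (a := sqrt ((p + h) ^ 2 + B)). set (b := sqrt ((p - h) ^ 2 + B)).
  assert (Ha : a * a = (p + h) ^ 2 + B) by (apply sqrt_sqrt; generalize (pow2_ge_0 (p + h)); lra).
  assert (Hb : b * b = (p - h) ^ 2 + B) by (apply sqrt_sqrt; generalize (pow2_ge_0 (p - h)); lra).
  assert (a + b <= 2 * s + 2 * B); [|lra].
  apply sum_le_of_sq; [lra|].
  assert ((a + b) ^ 2 <= 2 * (a * a + b * b)) by (generalize (pow2_ge_0 (a - b)); lra).
  apply Rle_trans with (1 := H). rewrite Ha, Hb.
  nra. }
 assert (Hu : sqrt (rough B (p + h)) + sqrt (rough B (p - h)) <= 2 * sqrt Y * (1 + (Y - p))).
 { set (a := sqrt (rough B (p + h))). set (b := sqrt (rough B (p - h))).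
  assert (Ha : a * a = rough B (p + h)) by (apply sqrt_sqrt; lra).
  assert (Hb : b * b = rough B (p - h)) by (apply sqrt_sqrt; lra).
  assert (HY : sqrt Y * sqrt Y = Y) by (apply sqrt_sqrt; lra).
  assert (0 <= sqrt Y) by apply sqrt_pos.
  apply sum_le_of_sq; [pos|].
  assert ((a + b) ^ 2 <= 2 * (a * a + b * b)) by (generalize (pow2_ge_0 (a - b)); lra).
  apply Rle_trans with (1 := H0). rewrite Ha, Hb.
  replace ((2 * sqrt Y * (1 + (Y - p))) ^ 2) with (4 * (sqrt Y * sqrt Y) * (1 + (Y - p)) ^ 2) by ring.
  rewrite HY. nra. }
 apply Rle_trans with (2 * sqrt Y * (1 + (Y - p)) * (1 - Y)).
 - mul_r; lra.
 - replace (2 * (1 - p) * sqrt Y) with (2 * sqrt Y * (1 - p)) by ring.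
  rewrite Rmult_assoc. apply Rmult_le_compat_l; [generalize (sqrt_pos Y); lra|]. nra.
Qed.

Section RoughBounds.

Variables t h : R.
Hypothesis Ht : 0 < t.
Hypothesis Hh : h = / (2 * t).

Lemma step_pos : 0 < h.
Proof. rewrite Hh. pos. Qed.

Lemma coef_eq (k x : R) : x ^ 2 <> 1 -> k * x / (t * (1 - x ^ 2)) = 2 * (k * h) * x / (1 - x ^ 2).
Proof. intros Hx. rewrite Hh. field. simpl in *. split; lra. Qed.

Lemma dp_lim0_eps eps N : 0 < eps -> exists K, (N <= K)%nat /\ dp K t <= eps.
Proof.
 intros He. assert (L := dp_lim0 t Ht). apply is_lim_seq_Reals in L.
 destruct (L eps He) as [K HK]. exists (N + K)%nat. split; [lia|].
 specialize (HK (N + K)%nat ltac:(lia)). unfold Rdist in HK.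
 rewrite Rminus_0_r in HK. apply Rabs_def2 in HK. lra.
Qed.

Lemma dp_eqn_le k : INR (S k) * dp (S k) t <= 2 * t * dp k t.
Proof.
 rewrite (dp_eqn k t Ht). assert (D1 := dp_decr t Ht k). assert (D2 := dp_decr t Ht (S k)).
 assert (R0 := dp_range k t Ht). assert (R2 := dp_S_range (S k) t Ht).
 replace (t * (1 - dp (S k) t ^ 2) * (dp (S (S k)) t + dp k t))
  with (t * ((1 - dp (S k) t ^ 2) * (dp (S (S k)) t + dp k t))) by ring.
 replace (2 * t * dp k t) with (t * (1 * (dp k t + dp k t))) by ring.
 mul_l. apply Rmult_le_compat; try lra; nra.
Qed.

Lemma dp_rough_upper B : 0 < B -> h ^ 4 <= 4 * B ^ 3 ->
 forall k, dp k t <= sqrt (rough B (1 - INR k * h)).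
Proof.
 intros HB Hc k. assert (h0 := step_pos).
 apply (dp_le_super_inf t Ht (fun k => sqrt (rough B (1 - INR k * h))) 0); try lia.
 - intros. apply sqrt_lt_R0, rough_pos; auto.
 - intros j Hj H1. destruct j as [|j]; [lia|]. simpl pred.
  set (p := 1 - INR (S j) * h).
  replace (1 - INR (S (S j)) * h) with (p - h) by (unfold p; rewrite !S_INR; ring).
  replace (1 - INR j * h) with (p + h) by (unfold p; rewrite S_INR; ring).
  assert (P := rough_pos B p HB). fold p in H1.
  assert (E : sqrt (rough B p) ^ 2 = rough B p) by (apply pow2_sqrt; lra).
  assert (Y1 : rough B p < 1) by (rewrite <- E; generalize (sqrt_pos (rough B p)); nra).
  rewrite coef_eq by (rewrite E; lra). rewrite E.
  apply (Rmult_le_reg_r (1 - rough B p)); [lra|].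
  replace (2 * (INR (S j) * h) * sqrt (rough B p) / (1 - rough B p) * (1 - rough B p))
   with (2 * (1 - p) * sqrt (rough B p)) by (unfold p at 1; field; lra).
  rewrite (Rplus_comm (sqrt (rough B (p - h)))).
  apply rough_super; auto. unfold p. assert (0 <= INR (S j) * h); [|lra].
  pos.
 - rewrite dp_0. apply Rle_trans with (sqrt 1); [rewrite sqrt_1; lra|].
  apply sqrt_le_1_alt. unfold rough. replace (1 - INR 0 * h) with 1 by (simpl; ring).
  assert (sqrt 1 <= sqrt (1 ^ 2 + B)) by (apply sqrt_le_1_alt; lra).
  rewrite sqrt_1 in H. lra.
 (* At infinity the barrier decays only like a power: its square is [B / (4 (Y - p))] with
    [Y - p <= K C]. It suffices that [K x_K^2] is small, and [dp_eqn_le] bounds [K x_K] by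
    [2 t x_(K-1)], which tends to 0. *)
 - intros N. set (C := 1 + h + sqrt B). assert (HC : 1 <= C) by (unfold C; generalize (sqrt_pos B); lra).
  destruct (dp_lim0_eps (B / (8 * t * C)) (S N)) as [K [HK1 HK2]].
  { apply Rdiv_lt_0_compat; [auto|]. pos. }
  exists (S K). split; [lia|].
  set (p := 1 - INR (S K) * h). assert (P := rough_pos B p HB). assert (E := rough_eq B p HB).
  assert (HSK : 1 <= INR (S K)) by (apply (le_INR 1); lia).
  assert (R1 := dp_S_range K t Ht).
  apply Rsqr_incr_0_var; [|apply sqrt_pos]. rewrite Rsqr_sqrt by lra. unfold Rsqr.
  assert (H1 := dp_eqn_le K).
  assert (HY : rough B p - p <= INR (S K) * C).
  { unfold rough. assert (sqrt (p ^ 2 + B) <= Rabs p + sqrt B).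
   { rewrite <- (sqrt_pow2 (Rabs p + sqrt B)) by (generalize (Rabs_pos p) (sqrt_pos B); lra).
    apply sqrt_le_1_alt. assert (sqrt B * sqrt B = B) by (apply sqrt_sqrt; lra).
    rewrite <- (pow2_abs p). generalize (Rabs_pos p) (sqrt_pos B). nra. }
   assert (Rabs p <= 1 + INR (S K) * h).
   { unfold p. assert (0 <= INR (S K) * h) by pos.
    apply Rabs_le; lra. }
   assert (- p <= Rabs p) by (rewrite <- Rabs_Ropp; apply Rle_abs).
   unfold C. generalize (sqrt_pos B); intros.
   assert (sqrt B <= INR (S K) * sqrt B) by nra.
   replace (INR (S K) * (1 + h + sqrt B)) with (INR (S K) + INR (S K) * h + INR (S K) * sqrt B) by ring.
   lra. }
  assert (H2 : INR (S K) * C * (dp (S K) t * dp (S K) t) <= B / 4).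
  { apply Rle_trans with (C * (2 * t * dp K t)).
   - replace (INR (S K) * C * (dp (S K) t * dp (S K) t)) with
     (C * ((INR (S K) * dp (S K) t) * dp (S K) t)) by ring.
    mul_l. apply Rle_trans with (2 := H1).
    rewrite <- (Rmult_1_r (INR (S K) * dp (S K) t)) at 2.
    apply Rmult_le_compat_l; [pos|lra].
   - apply Rle_trans with (C * (2 * t * (B / (8 * t * C)))).
    + mul_l. mul_l; lra.
    + right. field. lra. }
  assert (0 < rough B p - p) by nra.
  apply (Rmult_le_reg_l (rough B p - p)); [lra|].
  replace ((rough B p - p) * rough B p) with (B / 4) by lra.
  apply Rle_trans with (2 := H2). mul_r; nra.
Qed.

Lemma cos_ge x : 1 - x ^ 2 / 2 <= cos x.
Proof.
 replace x with (2 * (x / 2)) at 2 by field. rewrite cos_2a_sin.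
 assert (sin (x / 2) * sin (x / 2) <= (x / 2) * (x / 2)); [|nra].
 assert (Hs : forall y, 0 <= y -> sin y * sin y <= y * y).
 { intros y [Hy|<-]; [|rewrite sin_0; lra].
  assert (H1 := sin_lt_x y Hy).
  assert (H2 : - y <= sin y).
  { destruct (Rle_dec y PI) as [Hp|Hp]; [generalize (sin_ge_0 y ltac:(lra) Hp); lra|].
   generalize (SIN_bound y) PI2_3_2 PI_RGT_0; unfold PI2; intros. lra. }
  nra. }
 destruct (Rle_dec 0 x) as [H|H]; [apply Hs; lra|].
 replace (sin (x / 2) * sin (x / 2)) with (sin (- (x / 2)) * sin (- (x / 2))) by (rewrite sin_neg; ring).
 replace (x / 2 * (x / 2)) with (- (x / 2) * - (x / 2)) by ring. apply Hs; lra.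
Qed.

(** The subsolution is one arch of a sine of height [c], centred at [k] and of half-width [l]. It is
    an eigenvector of the neighbour sum with eigenvalue [2 cos th], and [PI <= 4] gives
    [cos th >= 1 - 2/l^2]. *)
Lemma dp_bump (k l : nat) (c : R) : (2 <= l)%nat -> (l <= k)%nat -> 0 < c < 1 ->
 (INR k + INR l) * h <= (1 - 2 / INR l ^ 2) * (1 - c ^ 2) -> c <= dp k t.
Proof.
 intros Hl Hk Hc Hcond. assert (h0 := step_pos).
 assert (Il : 2 <= INR l) by (apply (le_INR 2); auto).
 set (th := PI / (2 * INR l)). assert (PIp := PI_RGT_0).
 assert (Hcos : 1 - 2 / INR l ^ 2 <= cos th).
 { apply Rle_trans with (2 := cos_ge th). unfold th. assert (P4 := PI_4).
  replace ((PI / (2 * INR l)) ^ 2 / 2) with (PI ^ 2 / 8 * / INR l ^ 2) by (field; lra).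
  assert (0 < / INR l ^ 2) by pos.
  assert (PI ^ 2 <= 16) by nra. unfold Rdiv. nra. }
 set (v := fun i : nat => c * sin (th * (INR i - INR (k - l)))).
 assert (Hv : v k = c).
 { unfold v. replace (INR k - INR (k - l)) with (INR l) by (rewrite minus_INR; auto; ring).
  replace (th * INR l) with (PI / 2) by (unfold th; field; lra). rewrite sin_PI2. ring. }
 rewrite <- Hv.
 apply (dp_ge_sub t Ht v (k - l) (k + l)); try lia.
 - intros i Hi Hpos.
  assert (Hs1 := SIN_bound (th * (INR i - INR (k - l)))).
  assert (Hvc : v i <= c) by (unfold v; nra).
  split; [lra|]. rewrite coef_eq by nra.
  destruct i as [|i]; [lia|]. simpl pred.
  replace (v (S (S i)) + v i) with (2 * cos th * v (S i)).
  2:{ unfold v. set (a := th * (INR (S i) - INR (k - l))).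
    replace (th * (INR (S (S i)) - INR (k - l))) with (a + th) by (unfold a; rewrite !S_INR; ring).
    replace (th * (INR i - INR (k - l))) with (a - th) by (unfold a; rewrite S_INR; ring).
    rewrite sin_plus, sin_minus. ring. }
  assert (0 < 1 - c ^ 2) by nra.
  assert (1 - c ^ 2 <= 1 - v (S i) ^ 2) by nra.
  assert (INR (S i) * h <= cos th * (1 - c ^ 2)).
  { apply Rle_trans with ((INR k + INR l) * h).
   - mul_r. rewrite <- plus_INR. apply le_INR; lia.
   - apply Rle_trans with (1 := Hcond). mul_r; lra. }
  assert (0 <= INR (S i) * h) by pos.
  assert (0 <= cos th) by nra.
  apply (Rmult_le_reg_r (1 - v (S i) ^ 2)); [lra|].
  replace (2 * (INR (S i) * h) * v (S i) / (1 - v (S i) ^ 2) * (1 - v (S i) ^ 2))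
   with (2 * v (S i) * (INR (S i) * h)) by (field; lra).
  replace (2 * cos th * v (S i) * (1 - v (S i) ^ 2)) with (2 * v (S i) * (cos th * (1 - v (S i) ^ 2))) by ring.
  mul_l.
  apply Rle_trans with (cos th * (1 - c ^ 2)); [lra|]. mul_l; lra.
 - unfold v. replace (INR (k - l) - INR (k - l)) with 0 by ring. rewrite Rmult_0_r, sin_0, Rmult_0_r.
  left; now apply dp_range.
 - unfold v. replace (INR (k + l) - INR (k - l)) with (2 * INR l)
   by (rewrite plus_INR, minus_INR; auto; ring).
  replace (th * (2 * INR l)) with PI by (unfold th; field; lra).
  rewrite sin_PI, Rmult_0_r. left; now apply dp_range.
Qed.

(** A geometric sequence solves the linearised equation when [t (lam + 1/lam)] equals the index, and
    is a supersolution wherever the index is larger. At infinity it dominates because [dp_upper]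
    decays factorially. *)
Lemma dp_geom (j d : nat) (lam : R) : 0 < lam < 1 -> t * (lam + / lam) <= INR j ->
 dp (j + d) t <= dp j t * lam ^ d.
Proof.
 intros Hl Hj.
 assert (Pj := dp_range j t Ht).
 assert (H := dp_le_super_inf t Ht (fun i => dp j t * lam ^ (i - j)) j).
 cbv beta in H. replace d with (j + d - j)%nat at 2 by lia. apply H; try lia; clear H.
 - intros. pos.
 - intros k Hk Hu. set (u := dp j t * lam ^ (k - j)) in *.
  assert (Pu : 0 < u) by (pos).
  replace (dp j t * lam ^ (S k - j)) with (u * lam).
  2:{ unfold u. replace (S k - j)%nat with (S (k - j)) by lia. simpl. ring. }
  replace (dp j t * lam ^ (pred k - j)) with (u * / lam).
  2:{ unfold u. replace (k - j)%nat with (S (pred k - j)) by lia. simpl. field. lra. }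
  assert (t * (lam + / lam) <= INR k) by (apply Rle_trans with (1 := Hj), le_INR; lia).
  assert (0 < 1 - u ^ 2 <= 1) by (split; nra).
  apply (Rmult_le_reg_r (t * (1 - u ^ 2))); [pos|].
  replace (INR k * u / (t * (1 - u ^ 2)) * (t * (1 - u ^ 2))) with (u * INR k) by (field; lra).
  replace ((u * lam + u * / lam) * (t * (1 - u ^ 2))) with (u * (t * (lam + / lam) * (1 - u ^ 2))) by ring.
  mul_l.
  assert (0 < t * (lam + / lam)).
  { apply Rmult_lt_0_compat; [lra|]. assert (0 < / lam) by pos. lra. }
  nra.
 - rewrite Nat.sub_diag. simpl. lra.
 - intros N.
  assert (L := dp_factor_lim (t / lam)). apply is_lim_seq_Reals in L.
  destruct (L (dp j t) ltac:(lra)) as [K HK].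
  set (n := (N + K + j)%nat). exists n. split; [unfold n; lia|].
  specialize (HK n ltac:(unfold n; lia)). unfold Rdist in HK.
  rewrite Rminus_0_r in HK. apply Rabs_def2 in HK. destruct HK as [HK _].
  apply Rle_trans with (1 := dp_upper n t Ht).
  replace (t ^ n / INR (fact n)) with (lam ^ n * ((t / lam) ^ n / INR (fact n))).
  2:{ unfold Rdiv at 2. rewrite Rpow_mult_distr, pow_inv. field. split; [apply INR_fact_neq_0|apply pow_nonzero; lra]. }
  apply Rle_trans with (lam ^ n * dp j t); [mul_l; lra|].
  rewrite Rmult_comm. mul_l.
  replace n with ((n - j) + j)%nat at 1 by (unfold n; lia). rewrite pow_add.
  assert (lam ^ j <= 1) by (rewrite <- (pow1 j); apply pow_incr; lra).
  assert (0 < lam ^ (n - j)) by pos. nra.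
Qed.

(** The logarithm of [(t^(k+1)/(k+1)!) / x_(k+1)] vanishes at 0 and has derivative
    [2 (1 - x_(k+1)^2) x_(k+2) / x_(k+1)], which the recurrence bounds by [4 t / (k+2)]. Unlike
    [dp_lower], the result becomes sharp as [k] grows with [t] fixed. *)
Lemma dp_norm_lower k : t ^ S k / INR (fact (S k)) * exp (- (4 * t ^ 2 / INR (S (S k)))) <= dp (S k) t.
Proof.
 assert (Fp : 0 < INR (fact (S k))) by apply INR_fact_lt_0.
 assert (Sk : 0 < INR (S (S k))) by (apply lt_0_INR; lia).
 set (g := fun u => INR (S k) * ln u - ln (INR (fact (S k))) - ln (dp (S k) u)).
 set (dg := fun u => 2 * (1 - dp (S k) u ^ 2) * (dp (S (S k)) u / dp (S k) u)).
 assert (H : 0 <= g t <= 4 * t / INR (S (S k)) * t).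
 { apply (small_increment g dg); auto.
  - set (n := INR (S k)). assert (Hn : 1 <= n) by (apply (le_INR 1); lia).
   exists (2 * n), (/ (2 * n)). split; [pos|]. intros u Hu.
   assert (Hu1 : u * n <= / 2).
   { apply (Rmult_le_reg_r 2); [lra|]. replace (u * n * 2) with (u * (2 * n)) by ring.
    replace (/ 2 * 2) with (/ (2 * n) * (2 * n)) by (field; lra). mul_r; lra. }
   assert (U := dp_upper (S k) u ltac:(lra)). assert (L := dp_lower (S k) u ltac:(lra)).
   fold n in L. assert (Rg := dp_S_range k u ltac:(lra)).
   set (G := u ^ S k / INR (fact (S k))) in *.
   assert (HG : 0 < G) by (pos).
   assert (Eg : g u = ln G - ln (dp (S k) u)).
   { unfold g, G. rewrite ln_div; [|pos|auto]. rewrite ln_pow by lra. reflexivity. }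
   rewrite Eg. assert (Hnu : 0 <= n * u ^ 2 <= / 2) by (generalize (pow2_ge_0 u); nra).
   assert (ln (dp (S k) u) <= ln G) by (apply ln_le; lra).
   assert (ln (G * (1 - n * u ^ 2)) <= ln (dp (S k) u)) by (apply ln_le; nra).
   rewrite ln_mult in H0 by lra. assert (B := ln_1m_bound (n * u ^ 2) Hnu).
   rewrite Rabs_pos_eq; [|lra]. nra.
  - intros u Hu. assert (D := dp_derive_down k u ltac:(lra)).
   assert (Rg := dp_S_range k u ltac:(lra)). assert (Rg2 := dp_S_range (S k) u ltac:(lra)).
   split.
   + unfold g, dg. auto_derive.
    * repeat split; try lra. eexists; exact D.
    * rewrite (Derive_eta _ _ _ D).
     change (match k with 0%nat => 1 | S _ => INR k + 1 end) with (INR (S k)).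
     assert (E : dp k u = INR (S k) * dp (S k) u / (u * (1 - dp (S k) u ^ 2)) - dp (S (S k)) u)
      by (rewrite (dp_SS k); ring).
     rewrite E. assert (0 < 1 - dp (S k) u ^ 2) by nra. simpl in *. field. lra.
   + assert (B : dp (S (S k)) u / dp (S k) u <= 2 * t / INR (S (S k))).
    { apply (Rmult_le_reg_r (dp (S k) u * INR (S (S k)))); [pos|].
     replace (dp (S (S k)) u / dp (S k) u * (dp (S k) u * INR (S (S k))))
      with (INR (S (S k)) * dp (S (S k)) u) by (field; lra).
     replace (2 * t / INR (S (S k)) * (dp (S k) u * INR (S (S k))))
      with (2 * t * dp (S k) u) by (field; lra).
     assert (E := dp_eqn (S k) u ltac:(lra)). rewrite E.
     assert (D3 := dp_decr u ltac:(lra) (S k)). assert (D4 := dp_decr u ltac:(lra) (S (S k))).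
     assert (Rg3 := dp_S_range (S (S k)) u ltac:(lra)).
     apply Rle_trans with (u * (1 * (dp (S k) u + dp (S k) u))); [|nra].
     rewrite Rmult_assoc. mul_l. apply Rmult_le_compat; try lra; nra. }
    assert (0 < dp (S (S k)) u / dp (S k) u) by pos.
    assert (0 < 1 - dp (S k) u ^ 2 <= 1) by (split; nra).
    unfold dg. split; [pos|].
    replace (4 * t / INR (S (S k))) with (2 * 1 * (2 * t / INR (S (S k)))) by (field; lra).
    apply Rmult_le_compat; lra. }
 assert (Rg := dp_S_range k t Ht).
 set (G := t ^ S k / INR (fact (S k))).
 assert (HG : 0 < G) by (pos).
 assert (Eg : g t = ln G - ln (dp (S k) t)).
 { unfold g, G. rewrite ln_div; [|pos|auto]. rewrite ln_pow by lra. reflexivity. }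
 rewrite <- (exp_ln (dp (S k) t)) by lra. rewrite <- (exp_ln G) by lra. rewrite <- exp_plus.
 apply exp_mono; lra.
Qed.

End RoughBounds.

(** * Refined two-sided barriers *)

Lemma second_diff_bound (g g1 g2 : R -> R) (p h B : R) : 0 <= h ->
 (forall x, p - h <= x <= p + h -> is_derive g x (g1 x)) ->
 (forall x, p - h <= x <= p + h -> is_derive g1 x (g2 x)) ->
 (forall x, p - h <= x <= p + h -> Rabs (g2 x) <= B) ->
 Rabs (g (p + h) + g (p - h) - 2 * g p) <= B * h ^ 2.
Proof.
 intros Hh D1 D2 HB.
 set (F := fun s => g (p + s) + g (p - s)).
 assert (HF : forall s, 0 <= s <= h -> is_derive F s (g1 (p + s) - g1 (p - s))).
 { intros s Hs. assert (A1 := D1 (p + s) ltac:(lra)). assert (A2 := D1 (p - s) ltac:(lra)).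
  unfold F. auto_derive.
  - repeat split; eexists; eassumption.
  - rewrite (Derive_eta _ _ _ A1).
   replace (Derive (fun x => g x) (p + - s)) with (g1 (p - s)) by (symmetry; exact (is_derive_unique _ _ _ A2)).
   ring. }
 assert (Hd : forall s, 0 <= s <= h -> Rabs (g1 (p + s) - g1 (p - s)) <= 2 * B * s).
 { intros s Hs. destruct (Req_dec s 0) as [->|Hs0].
  - replace (p + 0) with p by ring. replace (p - 0) with p by ring. rewrite Rminus_diag, Rabs_R0. lra.
  - destruct (mean_value g1 g2 (p - s) (p + s)) as [c [Hc E]]; [lra|intros; apply D2; lra|].
   rewrite E, Rabs_mult, (Rabs_pos_eq (p + s - (p - s))) by lra.
   assert (b := HB c ltac:(lra)). nra. }
 assert (HS : forall s : R, is_derive (fun s => B * s ^ 2) s (2 * B * s)) by (intros; auto_derive; auto; ring).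
 assert (HS' : forall s : R, is_derive (fun s => - (B * s ^ 2)) s (- (2 * B * s))) by (intros; auto_derive; auto; ring).
 assert (U := deriv_le F (fun s => B * s ^ 2) _ (fun s => 2 * B * s) 0 h Hh HF (fun s _ => HS s)).
 assert (L := deriv_le (fun s => - (B * s ^ 2)) F (fun s => - (2 * B * s)) _ 0 h Hh (fun s _ => HS' s) HF).
 assert (E0 : F 0 = 2 * g p) by (unfold F; replace (p + 0) with p by ring; replace (p - 0) with p by ring; ring).
 assert (F h - F 0 <= B * h ^ 2 - B * 0 ^ 2).
 { apply U. intros s Hs. assert (A := Hd s Hs). apply Rabs_le_between in A. lra. }
 assert (- (B * h ^ 2) - - (B * 0 ^ 2) <= F h - F 0).
 { apply L. intros s Hs. assert (A := Hd s Hs). apply Rabs_le_between in A. lra. }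
 rewrite E0 in *. change (g (p + h) + g (p - h)) with (F h). apply Rabs_le. lra.
Qed.

(** The power [x^(1/2 - n)]. The family is closed under differentiation up to factors and contains
    the correction terms of the barrier. *)
Definition Gp (n : nat) (x : R) : R := sqrt x / x ^ n.

Lemma Gp_derive n x : (1 <= n)%nat -> 0 < x -> is_derive (Gp n) x ((1 / 2 - INR n) * Gp (S n) x).
Proof.
 intros Hn Hx. unfold Gp. auto_derive.
 - repeat split; [lra|apply pow_nonzero; lra].
 - assert (Hs : 0 < sqrt x) by (apply sqrt_lt_R0; lra).
  assert (E : x = sqrt x * sqrt x) by (symmetry; apply sqrt_sqrt; lra).
  destruct n as [|n]; [lia|].
  change (match n with 0%nat => 1 | S _ => INR n + 1 end) with (INR (S n)).
   simpl pow. simpl pred. assert (0 < x ^ n) by pos.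
   set (P := x ^ n) in *. set (N := INR (S n)). set (y := sqrt x) in *.
   rewrite E. field. lra.
Qed.

Lemma Gp_diff (n : nat) (p h : R) : (1 <= n)%nat -> 0 < p -> 0 <= h <= p / 2 ->
 Rabs (Gp n (p + h) + Gp n (p - h) - 2 * Gp n p)
  <= (INR n ^ 2 * 2 ^ (n + 3)) * Gp (n + 2) p * h ^ 2.
Proof.
 intros Hn Hp Hh.
 assert (In : 1 <= INR n) by (apply (le_INR 1); auto).
 apply (second_diff_bound (Gp n) (fun x => (1 / 2 - INR n) * Gp (S n) x)
   (fun x => (1 / 2 - INR n) * ((1 / 2 - INR (S n)) * Gp (S (S n)) x))); [lra| | |].
 - intros x Hx. apply Gp_derive; [lia|lra].
 - intros x Hx. apply is_derive_scal, Gp_derive; [lia|lra].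
 - intros x Hx. rewrite S_INR.
  assert (G0 : 0 <= Gp (S (S n)) x).
  { unfold Gp. apply Rmult_le_pos; [apply sqrt_pos|pos]. }
  assert (HG : Gp (S (S n)) x <= 2 ^ (n + 3) * Gp (n + 2) p).
  { unfold Gp. replace (S (S n)) with (n + 2)%nat by lia.
   replace (2 ^ (n + 3) * (sqrt p / p ^ (n + 2))) with (2 * sqrt p * / (p / 2) ^ (n + 2)).
   - apply Rmult_le_compat; [apply sqrt_pos|pos| |].
    + rewrite <- (sqrt_pow2 2) by lra. rewrite <- sqrt_mult by lra. apply sqrt_le_1_alt. lra.
    + apply Rinv_le_contravar; [pos|]. apply pow_incr; lra.
   - unfold Rdiv. rewrite Rpow_mult_distr, pow_inv.
    replace (n + 3)%nat with (S (n + 2)) by lia. change (2 ^ S (n + 2)) with (2 * 2 ^ (n + 2)).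
    field. split; apply pow_nonzero; lra. }
  replace ((1 / 2 - INR n) * ((1 / 2 - (INR n + 1)) * Gp (S (S n)) x))
   with ((INR n ^ 2 - 1 / 4) * Gp (S (S n)) x) by field.
  assert (0 <= INR n ^ 2 - 1 / 4) by nra.
  rewrite Rabs_pos_eq by pos.
  rewrite Rmult_assoc. apply Rmult_le_compat; lra.
Qed.

(** For [sqrt p] itself the leading second difference [- h^2 p^(-3/2) / 4] must be kept, because the
    first correction of the barrier has to cancel it; a mere bound as in [Gp_diff] would not do. The
    proof squares the sum of the two roots. *)
Lemma sqrt_diff (p h : R) : 0 < p -> 0 <= h <= p / 2 ->
 - (h ^ 4 / p ^ 4) * sqrt p / 4 <= sqrt (p + h) + sqrt (p - h) - 2 * sqrt p + h ^ 2 / p ^ 2 * sqrt p / 4 <= 0.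
Proof.
 intros Hp Hh. set (y := sqrt p). assert (Hy : 0 < y) by (apply sqrt_lt_R0; lra).
 set (v := h / p). assert (Hv : 0 <= v <= / 2).
 { unfold v. split; [apply Rmult_le_pos; [lra|pos]|].
  apply div_le; lra. }
 replace (h ^ 4 / p ^ 4) with (v ^ 4) by (unfold v; field; lra).
 replace (h ^ 2 / p ^ 2) with (v ^ 2) by (unfold v; field; lra).
 assert (E1 : sqrt (p + h) = y * sqrt (1 + v)).
 { unfold y. rewrite <- sqrt_mult by lra. f_equal. unfold v. field. lra. }
 assert (E2 : sqrt (p - h) = y * sqrt (1 - v)).
 { unfold y. rewrite <- sqrt_mult by lra. f_equal. unfold v. field. lra. }
 rewrite E1, E2. set (a := sqrt (1 + v)). set (b := sqrt (1 - v)).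
 assert (Ha : a * a = 1 + v) by (apply sqrt_sqrt; lra).
 assert (Hb : b * b = 1 - v) by (apply sqrt_sqrt; lra).
 assert (0 <= a) by apply sqrt_pos. assert (0 <= b) by apply sqrt_pos.
 assert (Hab : (a * b) * (a * b) = 1 - v ^ 2).
 { replace (a * b * (a * b)) with ((a * a) * (b * b)) by ring. rewrite Ha, Hb. ring. }
 assert (Hab0 : 0 <= a * b) by pos.
 assert (Hv2 : 0 <= v ^ 2 <= / 4) by (split; [pos|nra]).
 set (w := v ^ 2) in *. replace (v ^ 4) with (w ^ 2) by (unfold w; ring).
 assert (U1 : a * b <= 1 - w / 2) by (apply Rnot_lt_le; intros HH; nra).
 assert (L2 : 2 * (1 - w / 8 - w ^ 2 / 8) <= a + b).
 { apply Rnot_lt_le; intros HH.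
  assert ((a + b) * (a + b) < 2 * (1 - w / 8 - w ^ 2 / 8) * (2 * (1 - w / 8 - w ^ 2 / 8))) by nra.
  replace (2 * (1 - w / 8 - w ^ 2 / 8) * (2 * (1 - w / 8 - w ^ 2 / 8)))
   with (4 - w + w ^ 2 * (- 15 / 16 + w / 8 + w ^ 2 / 16)) in H1 by field.
  nra. }
 split; nra.
Qed.

(* [e] is the relative correction, [Q] the relative second difference of the barrier;
  the claim is that the residual of the discrete equation has the sign of [s]. *)
Lemma barrier_algebra (p z K s Q e : R) :
 0 < p <= 1 -> 0 < z <= / 20000 -> 30 <= K -> K * z ^ 2 <= / 100 ->
 s = 1 \/ s = -1 ->
 e = - ((1 - p) * z / 16) + s * K * z ^ 2 ->
 Rabs (Q + p * z / 4) <= p * (45 * z ^ 2 + K * z ^ 2) ->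
 0 <= s * ((2 * (1 + e) + Q) * (p * (2 * e + e ^ 2)) - Q * (1 - p)).
Proof.
 intros Hp Hz HK HKz Hs He HQ.
 set (q := Q + p * z / 4) in *. assert (EQ : Q = - (p * z / 4) + q) by (unfold q; ring).
 set (b := K * z ^ 2) in *.
 assert (Hz2 : 0 < z ^ 2) by pos.
 assert (Hb : 30 * z ^ 2 <= b) by (unfold b; mul_r; lra).
 assert (He1 : Rabs e <= z / 16 + b).
 { rewrite He. apply Rabs_le. replace (s * K * z ^ 2) with (s * b) by (unfold b; ring).
  assert (0 <= (1 - p) * z <= z) by (split; nra). destruct Hs as [-> | ->]; lra. }
 assert (HQ1 : Rabs Q <= z / 4 + (45 * z ^ 2 + b)).
 { rewrite EQ. eapply Rle_trans; [apply Rabs_triang|].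
  rewrite Rabs_Ropp, (Rabs_pos_eq (p * z / 4)) by nra.
  nra. }
 set (E := Rabs e) in *. set (QQ := Rabs Q) in *.
 assert (E0 : 0 <= E) by apply Rabs_pos.
 assert (Hz2' : z ^ 2 <= z / 20000) by nra.
 assert (HE2 : E * E <= z ^ 2 / 100 + b / 40).
 { apply Rle_trans with ((z / 16 + b) * (z / 16 + b)); [nra|].
  replace ((z / 16 + b) * (z / 16 + b)) with (z ^ 2 / 256 + b * (z / 8 + b)) by field.
  assert (b * (z / 8 + b) <= b * (/ 40)) by (mul_l; lra). lra. }
 assert (HEQ : E * QQ <= z ^ 2 / 32 + b / 40).
 { apply Rle_trans with ((z / 16 + b) * (z / 4 + (45 * z ^ 2 + b))); [nra|].
  replace ((z / 16 + b) * (z / 4 + (45 * z ^ 2 + b))) with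
   (z ^ 2 / 64 + z ^ 2 * (45 * z / 16) + b * (z / 4 + 45 * z ^ 2 + b + z / 16)) by field.
  assert (z ^ 2 * (45 * z / 16) <= z ^ 2 * (/ 64)) by (mul_l; lra).
  assert (b * (z / 4 + 45 * z ^ 2 + b + z / 16) <= b * (/ 40)) by (mul_l; lra). lra. }
 set (r := (1 - p) * (q / p)).
 assert (Hr : Rabs r <= 45 * z ^ 2 + b).
 { unfold r. rewrite Rabs_mult, (Rabs_pos_eq (1 - p)) by lra.
  assert (Rabs (q / p) <= 45 * z ^ 2 + b).
  { unfold Rdiv. rewrite Rabs_mult, (Rabs_pos_eq (/ p)) by pos.
   apply div_le; lra. }
  generalize (Rabs_pos (q / p)); nra. }
 replace ((2 * (1 + e) + Q) * (p * (2 * e + e ^ 2)) - Q * (1 - p)) with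
  (p * (4 * s * b + (6 * (e * e) + 2 * (e * e * e) + 2 * (e * Q) + e * e * Q - r))).
 2:{ assert (E1 : 4 * e * p = - ((1 - p) * (p * z / 4)) + 4 * s * b * p).
   { rewrite He. unfold b. field. }
   assert (E2 : r * p = (1 - p) * q) by (unfold r; field; lra).
   rewrite (Rmult_comm p).
   transitivity (4 * s * b * p + (6 * (e * e) + 2 * (e * e * e) + 2 * (e * Q) + e * e * Q) * p - r * p); [ring|].
   rewrite E2.
   transitivity (4 * e * p + (6 * (e * e) + 2 * (e * e * e) + 2 * (e * Q) + e * e * Q) * p - Q * (1 - p)); [|ring].
   rewrite E1, EQ. ring. }
 set (rest := 6 * (e * e) + 2 * (e * e * e) + 2 * (e * Q) + e * e * Q - r).
 assert (Hrest : Rabs rest <= 3 * b).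
 { assert (A1 : Rabs (e * e) = E * E) by apply Rabs_mult.
  assert (A2 : Rabs (e * Q) = E * QQ) by apply Rabs_mult.
  assert (A3 : Rabs (e * e * e) <= E * E / 50).
  { rewrite Rabs_mult, A1. fold E. nra. }
  assert (A4 : Rabs (e * e * Q) <= E * E / 50).
  { rewrite Rabs_mult, A1. fold QQ. nra. }
  apply Rabs_le_between in A3. apply Rabs_le_between in A4.
  apply Rabs_le_between in Hr.
  assert (B1 : - (E * E) <= e * e <= E * E) by (apply Rabs_le_between; lra).
  assert (B2 : - (E * QQ) <= e * Q <= E * QQ) by (apply Rabs_le_between; lra).
  unfold rest. apply Rabs_le. lra. }
 apply Rabs_le_between in Hrest.
 replace (s * (p * (4 * s * b + rest))) with (p * (4 * (s * s) * b + s * rest)) by ring.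
 apply Rmult_le_pos; [lra|]. destruct Hs as [-> | ->]; lra.
Qed.

(** The first two terms of the formal expansion of [x_k] in [z = h^2/p^3], with a term of the next
    order whose sign [s] makes it a supersolution ([s = 1]) or a subsolution ([s = -1]). The
    coefficient [- (1 - p)/16] balances the second difference [- p z / 4] of [sqrt p], relative to
    [sqrt p]. *)
Definition barrier (h K s p : R) : R :=
 sqrt p * (1 - (1 - p) * h ^ 2 / (16 * p ^ 3) + s * K * h ^ 4 / p ^ 6).

Lemma barrier_Gp h K s p : 0 < p ->
 barrier h K s p = sqrt p - h ^ 2 / 16 * (Gp 3 p - Gp 2 p) + s * K * h ^ 4 * Gp 6 p.
Proof. intros Hp. unfold barrier, Gp. field. lra. Qed.

Lemma barrier_residual (h K s p : R) :
 0 < h -> 0 < p <= 1 -> h ^ 2 <= / 20000 * p ^ 3 -> 30 <= K ->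
 K * h ^ 4 <= / 100 * p ^ 6 -> s = 1 \/ s = -1 ->
 0 <= s * (2 * (1 - p) * barrier h K s p
      - (barrier h K s (p + h) + barrier h K s (p - h)) * (1 - barrier h K s p ^ 2)).
Proof.
 intros Hh Hp Hz HK HKz Hs.
 assert (Hhp : h <= p / 2).
 { apply Rnot_lt_le; intros HH. nra. }
 set (z := h ^ 2 / p ^ 3).
 assert (Hh2 : 0 < h ^ 2) by pos.
 assert (Ez : h ^ 2 = z * p ^ 3) by (unfold z; field; lra).
 assert (z0 : 0 < z) by pos.
 assert (z1 : z <= / 20000) by (apply (Rmult_le_reg_r (p ^ 3)); lra).
 assert (Eh4 : h ^ 4 = z ^ 2 * p ^ 6) by (replace (h ^ 4) with (h ^ 2 * h ^ 2) by ring; rewrite Ez; ring).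
 assert (z2 : K * z ^ 2 <= / 100).
 { rewrite Eh4 in HKz. apply (Rmult_le_reg_r (p ^ 6)); [pos|lra]. }
 set (y := sqrt p). assert (Hy : 0 < y) by (apply sqrt_lt_R0; lra).
 assert (Ey : y * y = p) by (apply sqrt_sqrt; lra).
 set (e := - ((1 - p) * z / 16) + s * K * z ^ 2).
 set (f := barrier h K s p).
 assert (Ef : f = y * (1 + e)).
 { unfold f, barrier, e, z. fold y. field. lra. }
 set (P := barrier h K s (p + h) + barrier h K s (p - h)).
 set (Q := (P - 2 * f) / y).
 assert (EP : P = y * (2 * (1 + e) + Q)) by (unfold Q; rewrite Ef; field; lra).
 (* The constant 45 collects [(576 + 128)/16 = 44] from [Gp 3] and [Gp 2] and at most [1/4] from
    [sqrt]. The term with [K] absorbs the factor [18432 z], which is below 1 because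
    [z <= 1/20000]. *)
 assert (HQ : Rabs (Q + p * z / 4) <= p * (45 * z ^ 2 + K * z ^ 2)).
 { assert (S0 := sqrt_diff p h ltac:(lra) ltac:(lra)). fold y in S0.
  assert (S3 := Gp_diff 3 p h ltac:(lia) ltac:(lra) ltac:(lra)).
  assert (S2 := Gp_diff 2 p h ltac:(lia) ltac:(lra) ltac:(lra)).
  assert (S6 := Gp_diff 6 p h ltac:(lia) ltac:(lra) ltac:(lra)).
  set (d3 := Gp 3 (p + h) + Gp 3 (p - h) - 2 * Gp 3 p) in *.
  set (d2 := Gp 2 (p + h) + Gp 2 (p - h) - 2 * Gp 2 p) in *.
  set (d6 := Gp 6 (p + h) + Gp 6 (p - h) - 2 * Gp 6 p) in *.
  set (d0 := sqrt (p + h) + sqrt (p - h) - 2 * y + h ^ 2 / p ^ 2 * y / 4) in *.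
  assert (B3 : Rabs d3 <= y * (576 * (z / p ^ 2))).
  { apply Rle_trans with (1 := S3). right. unfold Gp. fold y. simpl (3 + 2)%nat. simpl (3 + 3)%nat.
   replace (INR 3) with 3 by (simpl; ring). unfold z. field. lra. }
  assert (B2 : Rabs d2 <= y * (128 * (z / p))).
  { apply Rle_trans with (1 := S2). right. unfold Gp. fold y. simpl (2 + 2)%nat. simpl (2 + 3)%nat.
   replace (INR 2) with 2 by (simpl; ring). unfold z. field. lra. }
  assert (B6 : Rabs d6 <= y * (18432 * (z / p ^ 5))).
  { apply Rle_trans with (1 := S6). right. unfold Gp. fold y. simpl (6 + 2)%nat. simpl (6 + 3)%nat.
   replace (INR 6) with 6 by (simpl; ring). unfold z. field. lra. }
  assert (B0 : Rabs d0 <= y * (p ^ 2 * z ^ 2 / 4)).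
  { replace (y * (p ^ 2 * z ^ 2 / 4)) with (h ^ 4 / p ^ 4 * y / 4) by (unfold z; field; lra).
   apply Rabs_le. lra. }
  assert (EQ : Q + p * z / 4 = (d0 - h ^ 2 / 16 * (d3 - d2) + s * K * h ^ 4 * d6) / y).
  { unfold Q, P, f. rewrite !barrier_Gp by lra. fold y. unfold d0, d3, d2, d6, z. field. lra. }
  rewrite EQ. unfold Rdiv. rewrite Rabs_mult, (Rabs_pos_eq (/ y)) by pos.
  apply div_le; [pos|].
  assert (C3 : Rabs (h ^ 2 / 16 * (d3 - d2)) <= y * (p * (44 * z ^ 2))).
  { rewrite Rabs_mult, (Rabs_pos_eq (h ^ 2 / 16)) by lra.
   assert (Rabs (d3 - d2) <= y * (704 * (z / p ^ 2))).
   { unfold Rminus. eapply Rle_trans; [apply Rabs_triang|]. rewrite Rabs_Ropp.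
    assert (z / p <= z / p ^ 2).
    { unfold Rdiv. mul_l. apply Rinv_le_contravar; nra. }
    nra. }
   apply Rle_trans with (h ^ 2 / 16 * (y * (704 * (z / p ^ 2)))).
   - mul_l; lra.
   - right. rewrite Ez. field. lra. }
  assert (C6 : Rabs (s * K * h ^ 4 * d6) <= y * (p * (K * z ^ 2))).
  { rewrite Rabs_mult.
   replace (Rabs (s * K * h ^ 4)) with (K * h ^ 4).
   2:{ assert (0 <= K * h ^ 4) by pos.
     destruct Hs as [-> | ->]; [rewrite Rabs_pos_eq|rewrite Rabs_left1]; lra. }
   apply Rle_trans with (K * h ^ 4 * (y * (18432 * (z / p ^ 5)))).
   - apply Rmult_le_compat_l; [|auto]. pos.
   - rewrite Eh4. replace (K * (z ^ 2 * p ^ 6) * (y * (18432 * (z / p ^ 5))))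
     with (y * (p * (K * z ^ 2)) * (18432 * z)) by (field; lra).
    rewrite <- (Rmult_1_r (y * (p * (K * z ^ 2)))) at 2.
    apply Rmult_le_compat_l; [|lra].
    apply Rmult_le_pos; [lra|]. apply Rmult_le_pos; [lra|]. pos. }
  set (X3 := h ^ 2 / 16 * (d3 - d2)) in *. set (X6 := s * K * h ^ 4 * d6) in *.
  assert (T1 := Rabs_triang (d0 - X3) X6). assert (T2 := Rabs_triang d0 (- X3)).
  rewrite Rabs_Ropp in T2. change (d0 + - X3) with (d0 - X3) in T2.
  assert (p ^ 2 * z ^ 2 <= p * z ^ 2).
  { mul_r; nra. }
  assert (Hpz : 0 <= y * (p * z ^ 2)).
  { apply Rmult_le_pos; [lra|]. pos. }
  assert (y * (p ^ 2 * z ^ 2 / 4) <= y * (p * z ^ 2) / 4).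
  { replace (y * (p * z ^ 2) / 4) with (y * (p * z ^ 2 / 4)) by field.
   mul_l; lra. }
  replace (p * (45 * z ^ 2 + K * z ^ 2) * y) with (45 * (y * (p * z ^ 2)) + y * (p * (K * z ^ 2))) by ring.
  replace (y * (p * (44 * z ^ 2))) with (44 * (y * (p * z ^ 2))) in C3 by ring.
  match goal with |- _ <= ?r => change (Rabs (d0 - X3 + X6) <= r) end. lra. }
 assert (A := barrier_algebra p z K s Q e Hp ltac:(lra) HK z2 Hs eq_refl HQ).
 replace (s * (2 * (1 - p) * f - P * (1 - f ^ 2))) with
  (y * (s * ((2 * (1 + e) + Q) * (p * (2 * e + e ^ 2)) - Q * (1 - p)))).
 - pos.
 - rewrite Ef, EP. replace ((y * (1 + e)) ^ 2) with (p * (1 + e) ^ 2) by (rewrite <- Ey; ring). ring.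
Qed.

Lemma last_index (P : nat -> Prop) (N : nat) : P O -> ~ P N ->
 exists n, P n /\ ~ P (S n).
Proof.
 intros H0 HN. induction N as [|N IH]; [contradiction|].
 destruct (Classical_Prop.classic (P N)) as [H|H]; [exists N; auto|auto].
Qed.

(** The barriers are valid only while [h^2] is small against [p^3]. They are compared on [[0, n]],
    where [n] is the last admissible index. At [n] the cruder [dp_rough_upper] and [dp_bump] already
    place [x_n] between them; at 0 both enclose [x_0 = 1]. *)
Lemma dp_refined : exists z0 K h0, 0 < z0 /\ 0 < K /\ 0 < h0 /\
 forall t h, 0 < t -> h = / (2 * t) -> h <= h0 -> forall k,
 let p := 1 - INR k * h in 0 < p -> h ^ 2 <= z0 * p ^ 3 ->
 Rabs (dp k t - sqrt p * (1 - (1 - p) * h ^ 2 / (16 * p ^ 3))) <= sqrt p * (K * h ^ 4 / p ^ 6).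
Proof.
 (* Chosen so that at the last index [K z^2] lies between [1/400] and [1/100]: above the relative
    errors [1/10000] and [1/500] of the crude bounds, and within the range permitted by
    [barrier_residual]. *)
 set (z1 := / 10 ^ 10). set (K := 10 ^ 18).
 assert (Ez1 : z1 = / 10 ^ 10) by reflexivity. assert (EK : K = 10 ^ 18) by reflexivity.
 assert (Hz1 : 0 < z1) by pos.
 exists (z1 / 2), K, (/ 10 ^ 6). split; [lra|]. split; [lra|]. split; [pos|].
 intros t h Ht Eh Hh0 k p Hp Hz.
 assert (Hh : 0 < h) by (apply (step_pos t h Ht Eh)).
 (* [n] is the last index in the region where the barriers are valid *)
 set (Good := fun n : nat => 0 < 1 - INR n * h /\ h ^ 2 <= z1 * (1 - INR n * h) ^ 3).
 destruct (last_index Good (Z.to_nat (up (/ h)))) as [n [[Hn1 Hn2] Hn3]].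
 { unfold Good. replace (1 - INR 0 * h) with 1 by (simpl; ring). split; [lra|].
  apply Rle_trans with (/ 10 ^ 6 * / 10 ^ 6); [nra|]. rewrite Ez1. lra. }
 { intros [H _]. destruct (archimed (/ h)) as [U _].
  assert (0 < / h) by pos.
  assert (0 <= up (/ h))%Z by (apply le_IZR; simpl; lra).
  rewrite INR_IZR_INZ, Z2Nat.id in H by auto.
  assert (1 < IZR (up (/ h)) * h); [|lra].
  apply (Rmult_lt_compat_r h) in U; [|lra]. rewrite Rinv_l in U; lra. }
 set (pn := 1 - INR n * h) in *.
 assert (Hpn1 : pn <= 1) by (unfold pn; generalize (pos_INR n); nra).
 assert (Hhp : h <= pn / 100000).
 { apply Rnot_lt_le; intros HH.
  rewrite Ez1 in Hn2. nra. }
 (* Since the next index is no longer good and [p] moves by at most a factor 0.99, [h^2/p^3] has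
    almost reached [z1]. Thus the correction term of the barrier is not negligible at [n]. *)
 assert (Hn4 : z1 / 2 * pn ^ 3 < h ^ 2).
 { apply Rnot_le_lt; intros HH. apply Hn3. unfold Good. rewrite S_INR.
  replace (1 - (INR n + 1) * h) with (pn - h) by (unfold pn; ring).
  split; [lra|]. apply Rle_trans with (1 := HH).
  assert ((99 / 100 * pn) ^ 3 <= (pn - h) ^ 3) by (apply pow_incr; lra).
  apply Rle_trans with (z1 * (99 / 100 * pn) ^ 3).
  - replace ((99 / 100 * pn) ^ 3) with (970299 / 1000000 * pn ^ 3) by field. nra.
  - mul_l; lra. }
 assert (Hpn3 : pn <= / 2).
 { apply Rnot_lt_le; intros HH. assert ((/ 2) ^ 3 <= pn ^ 3) by (apply pow_incr; lra).
  assert (h ^ 2 <= / 10 ^ 6 * / 10 ^ 6) by nra. rewrite Ez1 in Hn4. lra. }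
 assert (Hkn : (k <= n)%nat).
 { destruct (le_lt_dec k n) as [H|H]; [auto|exfalso].
  assert (p <= pn).
  { unfold p, pn. assert (INR n <= INR k) by (apply le_INR; lia). nra. }
  assert (p ^ 3 <= pn ^ 3) by (apply pow_incr; lra). nra. }
 set (zn := h ^ 2 / pn ^ 3).
 assert (Hpn3' : 0 < pn ^ 3) by pos.
 assert (Ezn : h ^ 2 = zn * pn ^ 3) by (unfold zn; field; lra).
 assert (Hzn : z1 / 2 <= zn <= z1) by (split; apply (Rmult_le_reg_r (pn ^ 3)); lra).
 assert (HKzn : / 400 <= K * zn ^ 2 <= / 100).
 { rewrite EK. split.
  - apply Rle_trans with (10 ^ 18 * (z1 / 2) ^ 2); [rewrite Ez1; lra|].
   mul_l. apply pow_incr; lra.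
  - apply Rle_trans with (10 ^ 18 * z1 ^ 2); [|rewrite Ez1; lra].
   mul_l. apply pow_incr; lra. }
 assert (Epn : sqrt pn * sqrt pn = pn) by (apply sqrt_sqrt; lra).
 assert (Hspn : 0 < sqrt pn) by (apply sqrt_lt_R0; lra).
 assert (Hup : dp n t <= sqrt pn * (1 + / 10000)).
 (* With [B = c p^2] the requirement [h^4 <= 4 B^3] becomes [z^2 <= 4 c^3], and [rough] exceeds [p]
    only by a relative error of order [c]. *)
 { set (c := / 10 ^ 4). assert (Ec : c = / 10 ^ 4) by reflexivity.
  set (B := c * pn ^ 2). assert (HB : 0 < B) by (apply Rmult_lt_0_compat; [rewrite Ec; pos|pos]).
  apply Rle_trans with (sqrt (rough B pn)).
  - apply dp_rough_upper; auto. replace (h ^ 4) with (h ^ 2 * h ^ 2) by ring. rewrite Ezn.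
   unfold B. replace (zn * pn ^ 3 * (zn * pn ^ 3)) with (zn ^ 2 * (pn ^ 3) ^ 2) by ring.
   replace (4 * (c * pn ^ 2) ^ 3) with (4 * c ^ 3 * (pn ^ 3) ^ 2) by ring.
   mul_r.
   apply Rle_trans with (z1 ^ 2); [apply pow_incr; lra|]. rewrite Ez1, Ec. lra.
  - rewrite <- (sqrt_pow2 (1 + / 10000)) by lra. rewrite <- sqrt_mult by lra.
   apply sqrt_le_1_alt. unfold rough.
   assert (sqrt (pn ^ 2 + B) <= pn * (1 + / 10000)); [|lra].
   rewrite <- (sqrt_pow2 (pn * (1 + / 10000))) by nra. apply sqrt_le_1_alt.
   unfold B. rewrite Ec. nra. }
 assert (Hlow : sqrt pn * (1 - / 500) <= dp n t).
 (* The arch has half-width about [eta p / h]. Widening the index range costs [eta p], the defect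
    [2/l^2] of the eigenvalue at most another [eta p]; hence the height [sqrt (p (1 - 2 eta))]. *)
 { set (eta := / 1000). assert (Eeta : eta = / 1000) by reflexivity.
  set (x := eta * pn / h).
  assert (Hx : 100 <= x).
  { unfold x. apply (Rmult_le_reg_r h); [lra|]. unfold Rdiv. rewrite Rmult_assoc, Rinv_l by lra. rewrite Eeta. lra. }
  set (l := Z.to_nat (up x - 1)).
  destruct (archimed x) as [U1 U2].
  assert (Hl : x - 1 < INR l <= x).
  { assert (0 <= up x - 1)%Z by (apply le_IZR; rewrite minus_IZR; simpl; lra).
   unfold l. rewrite INR_IZR_INZ, Z2Nat.id, minus_IZR by auto. lra. }
  assert (Hlh : INR l * h <= eta * pn).
  { apply Rle_trans with (x * h); [mul_r; lra|]. unfold x. right. field. lra. }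
  assert (Hnh : INR n * h = 1 - pn) by (unfold pn; ring).
  set (c2 := pn * (1 - 2 * eta)).
  assert (Hc2 : 0 < c2 < 1) by (unfold c2; rewrite Eeta; lra).
  apply Rle_trans with (sqrt c2).
  - unfold c2. rewrite sqrt_mult by (rewrite ?Eeta; lra).
   mul_l.
   rewrite <- (sqrt_pow2 (1 - / 500)) by lra. apply sqrt_le_1_alt. rewrite Eeta. lra.
  - apply (dp_bump t h Ht Eh n l).
   + apply INR_le. simpl. lra.
   + apply INR_le. apply (Rmult_le_reg_r h); [lra|]. rewrite Hnh. rewrite Eeta in *. lra.
   + split; [apply sqrt_lt_R0; lra|]. rewrite <- sqrt_1. apply sqrt_lt_1_alt. lra.
   + rewrite pow2_sqrt by lra. rewrite Rmult_plus_distr_r, Hnh.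
    assert (D : 2 / INR l ^ 2 <= eta * pn).
    { apply Rle_trans with (2 / (x / 2) ^ 2).
     - unfold Rdiv. mul_l. apply Rinv_le_contravar; [pos|].
      apply pow_incr; lra.
     - unfold x. replace (2 / (eta * pn / h / 2) ^ 2) with (8 / eta ^ 2 * (h ^ 2 / pn ^ 2))
       by (field; rewrite Eeta; repeat split; lra).
      rewrite Ezn. replace (zn * pn ^ 3 / pn ^ 2) with (zn * pn) by (field; lra).
      rewrite Eeta. rewrite Ez1 in Hzn. nra. }
    unfold c2.
    rewrite Eeta in *. nra. }
 assert (Hreg : forall j, (j <= n)%nat -> let q := 1 - INR j * h in
  pn <= q <= 1 /\ h ^ 2 <= z1 * q ^ 3 /\ K * h ^ 4 <= / 100 * q ^ 6).
 { intros j Hj q. assert (Hq : pn <= q <= 1).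
  { unfold q, pn. assert (INR j <= INR n) by (apply le_INR; auto). generalize (pos_INR j). nra. }
  assert (pn ^ 3 <= q ^ 3) by (apply pow_incr; lra).
  split; [auto|]. split; [nra|]. replace (h ^ 4) with (h ^ 2 * h ^ 2) by ring. rewrite Ezn.
  replace (K * (zn * pn ^ 3 * (zn * pn ^ 3))) with (K * zn ^ 2 * (pn ^ 6)) by ring.
  assert (pn ^ 6 <= q ^ 6) by (apply pow_incr; lra).
  apply Rle_trans with (/ 100 * pn ^ 6); [mul_r; lra|lra]. }
 assert (Hcorr : forall q, pn <= q <= 1 -> 0 <= (1 - q) * h ^ 2 / (16 * q ^ 3) <= / 1000).
 { intros q Hq.
  assert (pn ^ 3 <= q ^ 3) by (apply pow_incr; lra).
  split.
  - apply Rmult_le_pos; [pos|pos].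
  - apply (Rmult_le_reg_r (16 * q ^ 3)); [lra|].
   replace ((1 - q) * h ^ 2 / (16 * q ^ 3) * (16 * q ^ 3)) with ((1 - q) * h ^ 2) by (field; lra).
   rewrite Ez1 in *. nra. }
 assert (HK6 : forall q, pn <= q <= 1 -> K * h ^ 4 <= / 100 * q ^ 6 -> 0 < K * h ^ 4 / q ^ 6 <= / 100).
 { intros q Hq HH. assert (0 < q ^ 6) by pos. split.
  - apply Rdiv_lt_0_compat; [|auto]. pos.
  - apply div_le; [pos|]. lra. }
 assert (Hpow : h ^ 2 * h ^ 2 = h ^ 4) by ring.
 assert (HKn : K * h ^ 4 / pn ^ 6 = K * zn ^ 2) by (rewrite <- Hpow, Ezn; field; lra).
 assert (UP : dp k t <= barrier h K 1 p).
 { apply (dp_le_super t Ht (fun j => barrier h K 1 (1 - INR j * h)) 0 n); try lia.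
  - intros j Hj. destruct (Hreg j ltac:(lia)) as (R1 & R2 & R3).
   unfold barrier. apply Rmult_lt_0_compat; [apply sqrt_lt_R0; lra|].
   assert (A := Hcorr _ R1). assert (A2 := HK6 _ R1 R3).
   replace (1 * K * h ^ 4 / (1 - INR j * h) ^ 6) with (K * h ^ 4 / (1 - INR j * h) ^ 6) by (unfold Rdiv; ring). lra.
  - intros j Hj H1. destruct j as [|j]; [lia|]. simpl pred.
   destruct (Hreg (S j) ltac:(lia)) as (R1 & R2 & R3).
   set (q := 1 - INR (S j) * h) in *.
   replace (1 - INR (S (S j)) * h) with (q - h) by (unfold q; rewrite !S_INR; ring).
   replace (1 - INR j * h) with (q + h) by (unfold q; rewrite S_INR; ring).
   assert (A := barrier_residual h K 1 q Hh ltac:(lra) ltac:(rewrite Ez1 in R2; assert (0 < q ^ 3) by pos; nra)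
    ltac:(lra) R3 ltac:(auto)).
   set (f := barrier h K 1 q) in *.
   assert (Hf0 : 0 < f).
   { unfold f, barrier. apply Rmult_lt_0_compat; [apply sqrt_lt_R0; lra|].
    assert (A0 := Hcorr _ R1). assert (A2 := HK6 _ R1 R3).
    replace (1 * K * h ^ 4 / q ^ 6) with (K * h ^ 4 / q ^ 6) by (unfold Rdiv; ring). lra. }
   assert (Hf1 : 0 < 1 - f ^ 2) by nra.
   rewrite (coef_eq t h Ht Eh) by lra.
   apply (Rmult_le_reg_r (1 - f ^ 2)); [lra|].
   replace (2 * (INR (S j) * h) * f / (1 - f ^ 2) * (1 - f ^ 2)) with (2 * (1 - q) * f)
    by (unfold q; field; lra).
   lra.
  - rewrite dp_0. unfold barrier. replace (1 - INR 0 * h) with 1 by (simpl; ring). rewrite sqrt_1.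
   replace (1 * (1 - (1 - 1) * h ^ 2 / (16 * 1 ^ 3) + 1 * K * h ^ 4 / 1 ^ 6)) with (1 + K * h ^ 4) by field.
   nra.
  - apply Rle_trans with (1 := Hup). unfold barrier. fold pn. mul_l.
   replace (1 * K * h ^ 4 / pn ^ 6) with (K * zn ^ 2) by (rewrite <- HKn; unfold Rdiv; ring).
   replace ((1 - pn) * h ^ 2 / (16 * pn ^ 3)) with ((1 - pn) * zn / 16) by (unfold zn; field; lra).
   rewrite Ez1 in Hzn. nra. }
 assert (LOW : barrier h K (-1) p <= dp k t).
 { apply (dp_ge_sub t Ht (fun j => barrier h K (-1) (1 - INR j * h)) 0 n); try lia.
  - intros j Hj H0. destruct j as [|j]; [lia|]. simpl pred.
   destruct (Hreg (S j) ltac:(lia)) as (R1 & R2 & R3).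
   assert (Hq1 : 1 - INR (S j) * h < 1) by (assert (0 < INR (S j)) by (apply lt_0_INR; lia); nra).
   set (q := 1 - INR (S j) * h) in *.
   replace (1 - INR (S (S j)) * h) with (q - h) by (unfold q; rewrite !S_INR; ring).
   replace (1 - INR j * h) with (q + h) by (unfold q; rewrite S_INR; ring).
   assert (A := barrier_residual h K (-1) q Hh ltac:(lra) ltac:(rewrite Ez1 in R2; assert (0 < q ^ 3) by pos; nra)
    ltac:(lra) R3 ltac:(auto)).
   set (f := barrier h K (-1) q) in *.
   assert (Hf1 : f < 1).
   { unfold f, barrier. assert (sqrt q < 1) by (rewrite <- sqrt_1; apply sqrt_lt_1_alt; lra).
    assert (A0 := Hcorr _ R1). assert (A2 := HK6 _ R1 R3).
    replace (-1 * K * h ^ 4 / q ^ 6) with (- (K * h ^ 4 / q ^ 6)) by (unfold Rdiv; ring). nra. }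
   split; [auto|].
   assert (Hf2 : 0 < 1 - f ^ 2) by nra.
   rewrite (coef_eq t h Ht Eh) by lra.
   apply (Rmult_le_reg_r (1 - f ^ 2)); [lra|].
   replace (2 * (INR (S j) * h) * f / (1 - f ^ 2) * (1 - f ^ 2)) with (2 * (1 - q) * f)
    by (unfold q; field; lra).
   lra.
  - rewrite dp_0. unfold barrier. replace (1 - INR 0 * h) with 1 by (simpl; ring). rewrite sqrt_1.
   replace (1 * (1 - (1 - 1) * h ^ 2 / (16 * 1 ^ 3) + -1 * K * h ^ 4 / 1 ^ 6)) with (1 - K * h ^ 4) by field.
   nra.
  - apply Rle_trans with (2 := Hlow). unfold barrier. fold pn. mul_l.
   replace (-1 * K * h ^ 4 / pn ^ 6) with (- (K * zn ^ 2)) by (rewrite <- HKn; unfold Rdiv; ring).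
   assert (A := Hcorr pn ltac:(lra)). lra. }
 unfold barrier in UP, LOW.
 replace (1 * K * h ^ 4 / p ^ 6) with (K * h ^ 4 / p ^ 6) in UP by (unfold Rdiv; ring).
 replace (-1 * K * h ^ 4 / p ^ 6) with (- (K * h ^ 4 / p ^ 6)) in LOW by (unfold Rdiv; ring).
 apply Rabs_le. lra.
Qed.

(** * Bessel coefficients and the Airy function *)

Lemma sin_ge_cubic y : 0 <= y -> y - y ^ 3 / 6 <= sin y.
Proof.
 intros Hy.
 assert (H := deriv_le (fun y => y - y ^ 3 / 6) sin (fun y => 1 - y ^ 2 / 2) cos 0 y Hy).
 rewrite sin_0 in H. replace (0 - 0 ^ 3 / 6) with 0 in H by field.
 enough (y - y ^ 3 / 6 - 0 <= sin y - 0) by lra. apply H.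
 - intros; auto_derive; auto. field.
 - intros; apply is_derive_Reals, derivable_pt_lim_sin.
 - intros; apply cos_ge.
Qed.

Lemma cos_le_quartic y : 0 <= y -> cos y <= 1 - y ^ 2 / 2 + y ^ 4 / 24.
Proof.
 intros Hy.
 assert (H := deriv_le cos (fun y => 1 - y ^ 2 / 2 + y ^ 4 / 24) (fun y => - sin y) (fun y => - (y - y ^ 3 / 6)) 0 y Hy).
 rewrite cos_0 in H.
 enough (cos y - 1 <= 1 - y ^ 2 / 2 + y ^ 4 / 24 - (1 - 0 ^ 2 / 2 + 0 ^ 4 / 24)) by lra. apply H.
 - intros; apply is_derive_Reals, derivable_pt_lim_cos.
 - intros; auto_derive; auto. field.
 - intros x Hx. generalize (sin_ge_cubic x); intros. lra.
Qed.

Lemma sin_le_quintic y : 0 <= y -> sin y <= y - y ^ 3 / 6 + y ^ 5 / 120.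
Proof.
 intros Hy.
 assert (H := deriv_le sin (fun y => y - y ^ 3 / 6 + y ^ 5 / 120) cos (fun y => 1 - y ^ 2 / 2 + y ^ 4 / 24) 0 y Hy).
 rewrite sin_0 in H.
 enough (sin y - 0 <= y - y ^ 3 / 6 + y ^ 5 / 120 - (0 - 0 ^ 3 / 6 + 0 ^ 5 / 120)) by lra. apply H.
 - intros; apply is_derive_Reals, derivable_pt_lim_sin.
 - intros; auto_derive; auto. field.
 - intros; apply cos_le_quartic; lra.
Qed.

(* van der Corput: integrate [cos psi = (sin psi)' / psi'] by parts. *)
Lemma van_der_corput (psi d e : R -> R) (a b : R) : a <= b ->
 (forall x, a <= x <= b -> is_derive psi x (d x)) ->
 (forall x, a <= x <= b -> is_derive d x (e x)) ->
 (forall x, a <= x <= b -> 0 < d x /\ 0 <= e x) ->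
 Rabs (RInt (fun x => cos (psi x)) a b) <= 2 / d a.
Proof.
 intros Hab Dpsi Dd Hpos.
 destruct (Req_dec a b) as [<-|Hne].
 { rewrite RInt_point. change zero with 0. rewrite Rabs_R0.
  destruct (Hpos a ltac:(lra)). apply Rmult_le_pos; [lra|pos]. }
 set (c := fun x => cos (psi x)).
 assert (Cc : forall x, a <= x <= b -> continuous c x).
 { intros x Hx. unfold c. apply continuous_comp; [|apply continuous_cos].
  apply (ex_derive_continuous (V := R_NormedModule)). eexists. now apply Dpsi. }
 (* the primitive is only needed on [a, b]; extend [c] by constants to keep it continuous *)
 set (cl := fun x => c (Rmax a (Rmin b x))).
 assert (Ccl : forall x, continuous cl x).
 { intros x. unfold cl. apply (continuous_comp (fun x => Rmax a (Rmin b x)) c).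
  - apply continuity_pt_filterlim.
   apply continuity_pt_ext with (fun x => (a + (b + x - Rabs (b - x)) / 2 + Rabs (a - (b + x - Rabs (b - x)) / 2)) / 2).
   { intros u. unfold Rmax, Rmin. destruct (Rle_dec b u); destruct (Rle_dec a _); unfold Rabs;
    repeat destruct (Rcase_abs _); lra. }
   reg; apply Rcontinuity_abs || apply Rderivable_continuous_abs || auto.
  - apply Cc. unfold Rmax, Rmin. destruct (Rle_dec b x); destruct (Rle_dec a _); lra. }
 assert (Ecl : forall x, a <= x <= b -> cl x = c x).
 { intros x Hx. unfold cl. f_equal. rewrite Rmin_right by lra. apply Rmax_right; lra. }
 set (I := (fun x => RInt cl a x) : R -> R).
 assert (DI : forall x, is_derive I x (cl x)).
 { intros x. unfold I. apply (is_derive_RInt (V := R_NormedModule) cl _ a).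
  - exists (mkposreal 1 Rlt_0_1). intros y _.
   apply (RInt_correct (V := R_CompleteNormedModule)).
   apply (ex_RInt_continuous (V := R_CompleteNormedModule)). auto.
  - auto. }
 change (RInt (fun x => cos (psi x)) a b) with (RInt c a b). replace (RInt c a b) with (I b).
 2:{ apply RInt_ext. intros x Hx. rewrite Rmin_left, Rmax_right in Hx by lra. apply Ecl; lra. }
 set (G := fun x => I x - sin (psi x) / d x).
 assert (DG : forall x, a <= x <= b -> is_derive G x (sin (psi x) * e x / d x ^ 2)).
 { intros x Hx. assert (A1 := DI x). assert (A2 := Dpsi x Hx). assert (A3 := Dd x Hx).
  destruct (Hpos x Hx). unfold G. auto_derive.
  - repeat split; try (eexists; eassumption). lra.
  - rewrite (Derive_eta _ _ _ A1).
   rewrite (Derive_eta _ _ _ A2).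
   rewrite (Derive_eta _ _ _ A3).
   rewrite Ecl by lra. unfold c. field. lra. }
 assert (DH : forall x, a <= x <= b -> is_derive (fun x => - / d x) x (e x / d x ^ 2)).
 { intros x Hx. assert (A3 := Dd x Hx). destruct (Hpos x Hx). auto_derive.
  - repeat split; try (eexists; eassumption). lra.
  - rewrite (Derive_eta _ _ _ A3).
   field. lra. }
 assert (DH' : forall x, a <= x <= b -> is_derive (fun x => / d x) x (- (e x / d x ^ 2))).
 { intros x Hx. assert (A3 := Dd x Hx). destruct (Hpos x Hx). auto_derive.
  - repeat split; try (eexists; eassumption). lra.
  - rewrite (Derive_eta _ _ _ A3).
   field. lra. }
 assert (Hw : forall x, a <= x <= b -> 0 <= e x / d x ^ 2).
 { intros x Hx. destruct (Hpos x Hx). apply Rmult_le_pos; [lra|pos]. }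
 assert (U : G b - G a <= - / d b - - / d a).
 { apply (deriv_le G (fun x => - / d x) _ _ a b Hab DG DH). intros x Hx.
  assert (W := Hw x Hx). generalize (SIN_bound (psi x)); intros.
  unfold Rdiv in *. rewrite Rmult_assoc. nra. }
 assert (L : / d b - / d a <= G b - G a).
 { apply (deriv_le (fun x => / d x) G _ _ a b Hab DH' DG). intros x Hx.
  assert (W := Hw x Hx). generalize (SIN_bound (psi x)); intros.
  unfold Rdiv in *. rewrite Rmult_assoc. nra. }
 assert (Ia : I a = 0) by (unfold I; rewrite RInt_point; reflexivity).
 unfold G in U, L. rewrite Ia in U, L.
 destruct (Hpos a ltac:(lra)) as [da _]. destruct (Hpos b ltac:(lra)) as [db _].
 assert (ib : 0 < / d b) by pos.
 assert (Sa : - / d a <= sin (psi a) / d a <= / d a) by (generalize (SIN_bound (psi a)); unfold Rdiv; intros; nra).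
 assert (Sb : - / d b <= sin (psi b) / d b <= / d b) by (generalize (SIN_bound (psi b)); unfold Rdiv; intros; nra).
 unfold Rdiv at 1. apply Rabs_le. lra.
Qed.

Lemma continuous_cos_comp (f : R -> R) x : ex_derive f x -> continuous (fun x => cos (f x)) x.
Proof.
 intros H. apply continuous_comp; [|apply continuous_cos].
 now apply (ex_derive_continuous (V := R_NormedModule)).
Qed.

Lemma ex_RInt_cos (f : R -> R) a b : (forall x, ex_derive f x) -> ex_RInt (fun x => cos (f x)) a b.
Proof.
 intros H. apply (ex_RInt_continuous (V := R_CompleteNormedModule)).
 intros; now apply continuous_cos_comp.
Qed.

Definition airy_phase (s x : R) : R := x ^ 3 / 3 + s * x.

Lemma airy_phase_ex s x : ex_derive (airy_phase s) x.
Proof. unfold airy_phase. auto_derive. auto. Qed.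

Lemma airy_tail s a b : 0 <= s -> 0 < a <= b ->
 Rabs (RInt (fun x => cos (airy_phase s x)) a b) <= 2 / a ^ 2.
Proof.
 intros Hs Hab. eapply Rle_trans.
 - apply (van_der_corput (airy_phase s) (fun x => x ^ 2 + s) (fun x => 2 * x)); [lra| | |].
  + intros. unfold airy_phase. auto_derive; auto. field.
  + intros. auto_derive; auto. ring.
  + intros. split; nra.
 - cbv beta. mul_l. apply Rinv_le_contravar; [pos|lra].
Qed.

(** Beyond convergence, this gives the truncation error [2/a^2] uniformly in [s >= 0], which makes
    the comparison with Bessel's integral uniform in [s] as well. *)
Lemma airy_conv s : 0 <= s -> exists l,
 is_RInt_gen (fun x => cos (airy_phase s x)) (at_point 0) (Rbar_locally p_infty) l /\
 forall a, 0 < a -> Rabs (RInt (fun x => cos (airy_phase s x)) 0 a - l) <= 2 / a ^ 2.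
Proof.
 intros Hs. set (f := fun x => cos (airy_phase s x)).
 assert (Ex : forall a b, ex_RInt f a b) by (intros; apply ex_RInt_cos; intros; apply airy_phase_ex).
 assert (Hdiff : forall a b, 0 < a <= b -> Rabs (RInt f 0 b - RInt f 0 a) <= 2 / a ^ 2).
 { intros a b Hab. rewrite <- (RInt_Chasles f 0 a b) by auto.
  replace (plus (RInt f 0 a) (RInt f a b) - RInt f 0 a) with (RInt f a b)
   by (change plus with Rplus; set (u := (RInt f a b : R)); set (v := (RInt f 0 a : R)); change (u = v + u - v); ring).
  now apply airy_tail. }
 assert (HC : exists l, is_lim_seq (fun n => RInt f 0 (INR n)) (Finite l)).
 { apply ex_lim_seq_cauchy_corr. intros eps.
  destruct (archimed_cor1 (eps / 2) ltac:(destruct eps; simpl; lra)) as [N [HN1 HN2]].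
  exists N. assert (Hmain : forall n m, (N <= n <= m)%nat -> Rabs (RInt f 0 (INR m) - RInt f 0 (INR n)) < eps).
  { intros n m [H1 H2]. assert (1 <= INR N) by (apply (le_INR 1); lia).
   apply le_INR in H1. apply le_INR in H2.
   apply Rle_lt_trans with (1 := Hdiff (INR n) (INR m) ltac:(lra)).
   apply Rle_lt_trans with (2 * / INR N); [|lra].
   mul_l. apply Rinv_le_contravar; [lra|]. nra. }
  intros n m Hn Hm. destruct (le_lt_dec n m).
  - rewrite Rabs_minus_sym. apply Hmain; lia.
  - apply Hmain; lia. }
 destruct HC as [l Hl]. exists l.
 assert (HB : forall a, 0 < a -> Rabs (RInt f 0 a - l) <= 2 / a ^ 2).
 { intros a Ha. apply Rnot_lt_le; intros HH.
  apply is_lim_seq_Reals in Hl.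
  destruct (Hl (Rabs (RInt f 0 a - l) - 2 / a ^ 2) ltac:(lra)) as [N HN].
  destruct (INR_unbounded a) as [M HM].
  specialize (HN (N + M)%nat ltac:(lia)). unfold Rdist in HN.
  assert (A : a <= INR (N + M)) by (rewrite plus_INR; generalize (pos_INR N); lra).
  assert (B := Hdiff a _ (conj Ha A)).
  assert (T := Rabs_triang (RInt f 0 a - RInt f 0 (INR (N + M))) (RInt f 0 (INR (N + M)) - l)).
  replace (RInt f 0 a - RInt f 0 (INR (N + M)) + (RInt f 0 (INR (N + M)) - l)) with (RInt f 0 a - l) in T by ring.
  rewrite Rabs_minus_sym in B. lra. }
 split; [|exact HB].
 apply (filterlimi_lim_ext_loc (fun ab => RInt f (fst ab) (snd ab))).
 { exists (fun x => x = 0) (fun _ => True).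
  - reflexivity.
  - exists 0; auto.
  - intros x y _ _. apply (RInt_correct (V := R_CompleteNormedModule)). apply Ex. }
 intros P [eps HP].
 exists (fun x => x = 0) (fun y => 1 < y /\ 2 / eps < y).
 - reflexivity.
 - exists (Rmax 1 (2 / eps)). intros y Hy. split.
  + apply Rle_lt_trans with (2 := Hy), Rmax_l.
  + apply Rle_lt_trans with (2 := Hy), Rmax_r.
 - intros x y -> [Hy1 Hy2]. apply HP. simpl.
  change (Rabs (RInt f 0 y - l) < eps).
  apply Rle_lt_trans with (1 := HB y ltac:(lra)).
  destruct eps as [e He]; simpl in *.
  apply div_lt; [pos|].
  apply (Rmult_lt_compat_r e) in Hy2; [|lra].
  unfold Rdiv in Hy2. rewrite Rmult_assoc, Rinv_l in Hy2 by lra. nra.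
Qed.

Lemma Airy_Ai_approx s a : 0 <= s -> 0 < a ->
 Rabs (RInt (fun x => cos (airy_phase s x)) 0 a - PI * Airy_Ai s) <= 2 / a ^ 2.
Proof.
 intros Hs Ha. destruct (airy_conv s Hs) as [l [H1 H2]].
 assert (E : PI * Airy_Ai s = l).
 { unfold Airy_Ai. change (fun t => cos (t ^ 3 / 3 + s * t)) with (fun x => cos (airy_phase s x)).
  rewrite (is_RInt_gen_unique _ _ H1). assert (PP := PI_RGT_0). field. lra. }
 rewrite E. now apply H2.
Qed.

(** Bessel's integral for [J_k(2t)]. *)
Definition besJ (k : nat) (t : R) : R := RInt (fun th => cos (INR k * th - 2 * t * sin th)) 0 PI / PI.

(** After the substitution [th = x/m] the phase is [s x + 2 m^3 (x/m - sin (x/m))], which tends to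
    the Airy phase. On [[0, T]] the phases are compared by Taylor bounds; on [[T, PI m]] the phase
    derivative increases and is at least [T^2/2], so [van_der_corput] applies. *)
Lemma besJ_airy : forall eps, 0 < eps -> exists m0, 0 < m0 /\ forall m k, m0 <= m -> 2 * m ^ 3 <= INR k ->
 Rabs (m * besJ k (m ^ 3) - Airy_Ai ((INR k - 2 * m ^ 3) / m)) <= eps.
Proof.
 intros eps Heps. assert (PI3 : 1 < PI) by (generalize PI2_3_2; unfold PI2; lra).
 (* The tails contribute [4/T^2] and [2/T^2], together at most [eps/2]. The middle part is at most
    [T^6/m], which the choice of the threshold for [m] also brings below [eps/2]. *)
 set (T := 1 + 12 / eps).
 assert (HT : 1 < T) by (unfold T; assert (0 < 12 / eps) by pos; lra).
 assert (HT2 : 12 / T ^ 2 <= eps).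
 { apply (Rmult_le_reg_r (T ^ 2)); [pos|]. unfold Rdiv.
  rewrite Rmult_assoc, Rinv_l by (apply pow_nonzero; lra).
  assert (12 <= eps * T).
  { unfold T. replace (eps * (1 + 12 / eps)) with (eps + 12) by (field; lra). lra. }
  nra. }
 exists (T + 2 * (T ^ 6 / eps)). split.
 { assert (0 < T ^ 6 / eps) by pos. lra. }
 intros m k Hm Hk.
 assert (T6e : 0 < T ^ 6 / eps) by pos.
 assert (Hm1 : 2 * (T ^ 6 / eps) <= m) by lra.
 set (s := (INR k - 2 * m ^ 3) / m).
 assert (Hs : 0 <= s) by (apply Rmult_le_pos; [lra|pos]).
 set (psi := fun x => s * x + 2 * m ^ 3 * (x / m - sin (x / m))).
 assert (Dpsi : forall x, is_derive psi x (s + 2 * m ^ 2 * (1 - cos (x / m)))).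
 { intros x. unfold psi. auto_derive; auto. unfold Rdiv. field. lra. }
 assert (Dd : forall x, is_derive (fun x => s + 2 * m ^ 2 * (1 - cos (x / m))) x (2 * m * sin (x / m))).
 { intros x. auto_derive; auto. unfold Rdiv. field. lra. }
 assert (Exp : forall a b, ex_RInt (fun x => cos (psi x)) a b).
 { intros; apply ex_RInt_cos; intros; eexists; apply Dpsi. }
 assert (Exa : forall a b, ex_RInt (fun x => cos (airy_phase s x)) a b).
 { intros; apply ex_RInt_cos; intros; apply airy_phase_ex. }
 assert (EJ : PI * (m * besJ k (m ^ 3)) = RInt (fun x => cos (psi x)) 0 (PI * m)).
 { unfold besJ. replace (PI * (m * (RInt (fun th => cos (INR k * th - 2 * m ^ 3 * sin th)) 0 PI / PI)))
   with (m * RInt (fun th => cos (INR k * th - 2 * m ^ 3 * sin th)) 0 PI) by (field; lra).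
  assert (C := RInt_comp_lin (fun th => cos (INR k * th - 2 * m ^ 3 * sin th)) (/ m) 0 0 (PI * m)).
  replace (/ m * 0 + 0) with 0 in C by ring. replace (/ m * (PI * m) + 0) with PI in C by (field; lra).
  rewrite <- C.
  - rewrite <- (RInt_scal (V := R_CompleteNormedModule)).
   + apply RInt_ext. intros x _. unfold scal; simpl. unfold mult; simpl.
    rewrite <- Rmult_assoc, Rinv_r, Rmult_1_l by lra. f_equal.
    unfold psi, s. rewrite Rplus_0_r. unfold Rdiv. rewrite (Rmult_comm (/ m) x). field. lra.
   + apply (ex_RInt_scal (V := R_NormedModule)). apply (ex_RInt_cos (fun x => INR k * (/ m * x + 0) - 2 * m ^ 3 * sin (/ m * x + 0))).
    intros; auto_derive; auto.
  - apply (ex_RInt_cos (fun x => INR k * x - 2 * m ^ 3 * sin x)). intros; auto_derive; auto. }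
 assert (HTm : T <= PI * m) by nra.
 assert (Htail : Rabs (RInt (fun x => cos (psi x)) T (PI * m)) <= 4 / T ^ 2).
 { assert (HdT : T ^ 2 / 2 <= 2 * m ^ 2 * (1 - cos (T / m))).
  { set (y := T / m). assert (Hy : 0 < y <= 1).
   { unfold y. split; [pos|]. apply div_le; lra. }
   assert (C := cos_le_quartic y ltac:(lra)).
   assert (y ^ 4 <= y ^ 2).
   { replace (y ^ 4) with (y ^ 2 * y ^ 2) by ring. assert (0 <= y ^ 2 <= 1) by (split; nra). nra. }
   assert (y ^ 2 / 4 <= 1 - cos y) by (assert (0 < y ^ 2) by pos; lra).
   replace (T ^ 2 / 2) with (2 * m ^ 2 * (y ^ 2 / 4)) by (unfold y; field; lra).
   mul_l; lra. }
  eapply Rle_trans.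
  - apply (van_der_corput psi (fun x => s + 2 * m ^ 2 * (1 - cos (x / m))) (fun x => 2 * m * sin (x / m))); auto.
   intros x Hx. assert (Hxm : T / m <= x / m <= PI).
   { split; apply (Rmult_le_reg_r m); try lra; unfold Rdiv; rewrite !Rmult_assoc, !Rinv_l; lra. }
   assert (0 < T / m) by pos.
   split.
   + assert (cos (x / m) <= cos (T / m)) by (apply cos_decr_1; lra). nra.
   + apply Rmult_le_pos; [lra|]. apply sin_ge_0; lra.
  - cbv beta. replace (4 / T ^ 2) with (2 * / (T ^ 2 / 2)) by (field; lra).
   mul_l. apply Rinv_le_contravar; [|lra].
   assert (0 < T ^ 2) by pos. lra. }
 assert (Hmid : Rabs (RInt (fun x => cos (psi x)) 0 T - RInt (fun x => cos (airy_phase s x)) 0 T) <= eps / 2).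
 { rewrite <- (RInt_minus (V := R_CompleteNormedModule)) by auto.
  apply Rle_trans with (RInt (fun _ => T ^ 5 / m) 0 T).
  - apply (norm_RInt_le (V := R_NormedModule) (fun x => minus (cos (psi x)) (cos (airy_phase s x))) (fun _ => T ^ 5 / m) 0 T); [lra| | |].
   + intros x Hx. change (Rabs (cos (psi x) - cos (airy_phase s x)) <= T ^ 5 / m).
    assert (Hlip : forall u v, Rabs (cos u - cos v) <= Rabs (u - v)).
    { intros u v. rewrite <- (Rmult_1_l (Rabs (u - v))).
     apply (bounded_variation cos (fun x => - sin x) 1 v u). intros w _. split.
     - apply is_derive_Reals, derivable_pt_lim_cos.
     - rewrite Rabs_Ropp. apply Rabs_le, SIN_bound. }
    apply Rle_trans with (1 := Hlip _ _).
    set (y := x / m). assert (Hy : 0 <= y) by (apply Rmult_le_pos; [lra|pos]).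
    assert (A1 := sin_ge_cubic y Hy). assert (A2 := sin_le_quintic y Hy).
    replace (psi x - airy_phase s x) with (2 * m ^ 3 * ((y - sin y) - y ^ 3 / 6))
     by (unfold psi, airy_phase; fold y; replace x with (y * m) by (unfold y; field; lra); field).
    rewrite Rabs_mult, (Rabs_pos_eq (2 * m ^ 3)) by (assert (0 < m ^ 3) by pos; lra).
    apply Rle_trans with (2 * m ^ 3 * (y ^ 5 / 120)).
    * apply Rmult_le_compat_l; [assert (0 < m ^ 3) by pos; lra|].
     apply Rabs_le; lra.
    * unfold y. replace (2 * m ^ 3 * ((x / m) ^ 5 / 120)) with (x ^ 5 / (60 * m) * / m) by (field; lra).
     assert (0 <= x ^ 5 <= T ^ 5) by (split; [pos|apply pow_incr; lra]).
     mul_r.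
     apply div_le; [pos|]. nra.
   + apply (RInt_correct (V := R_CompleteNormedModule)). apply (ex_RInt_minus (V := R_NormedModule)); auto.
   + apply (RInt_correct (V := R_CompleteNormedModule)). apply ex_RInt_const.
  - rewrite RInt_const. change ((T - 0) * (T ^ 5 / m) <= eps / 2).
   rewrite Rminus_0_r. apply (Rmult_le_reg_r m); [lra|].
   replace (T * (T ^ 5 / m) * m) with (T ^ 6) by (field; lra).
   apply (Rmult_le_compat_l eps) in Hm1; [|lra].
   replace (eps * (2 * (T ^ 6 / eps))) with (2 * T ^ 6) in Hm1 by (field; lra). lra. }
 assert (Ha := Airy_Ai_approx s T Hs ltac:(lra)).
 apply (Rmult_le_reg_l PI); [lra|].
 rewrite <- (Rabs_pos_eq PI) at 1 by lra. rewrite <- Rabs_mult.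
 replace (PI * (m * besJ k (m ^ 3) - Airy_Ai s)) with
  (RInt (fun x => cos (psi x)) T (PI * m)
   + ((RInt (fun x => cos (psi x)) 0 T - RInt (fun x => cos (airy_phase s x)) 0 T)
   + (RInt (fun x => cos (airy_phase s x)) 0 T - PI * Airy_Ai s))).
 - eapply Rle_trans; [apply Rabs_triang|].
  eapply Rle_trans; [apply Rplus_le_compat_l, Rabs_triang|].
  assert (eps <= PI * eps) by nra. lra.
 - rewrite Rmult_minus_distr_l, EJ. rewrite <- (RInt_Chasles (fun x => cos (psi x)) 0 T (PI * m)) by auto.
  change plus with Rplus. ring.
Qed.

Lemma besJ_ex_RInt (a c : R) u v : ex_RInt (fun th => cos (a * th - c * sin th)) u v.
Proof. apply (ex_RInt_cos (fun th => a * th - c * sin th)). intros; auto_derive; auto. Qed.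

Lemma sin_INR_PI k : sin (INR k * PI) = 0.
Proof.
 induction k; [rewrite Rmult_0_l; apply sin_0|].
 rewrite S_INR, Rmult_plus_distr_r, Rmult_1_l, neg_sin, IHk. ring.
Qed.

(** Integrates the derivative of [sin (n th - 2 t sin th)] over [[0, PI]]; the boundary terms vanish
    because [n] is an integer. *)
Lemma besJ_eqn k t : INR (S k) * besJ (S k) t = t * (besJ (S (S k)) t + besJ k t).
Proof.
 assert (PP := PI_RGT_0). unfold besJ. set (n := INR (S k)).
 set (psi := fun th => n * th - 2 * t * sin th).
 assert (D : is_RInt (fun th => (n - 2 * t * cos th) * cos (psi th)) 0 PI (minus (sin (psi PI)) (sin (psi 0)))).
 { apply (is_RInt_derive (V := R_CompleteNormedModule) (fun th => sin (psi th))).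
  - intros x _. unfold psi. auto_derive; auto. match goal with |- ?a = ?b => change (@eq R a b) end. unfold Rminus; ring.
  - intros x _. apply (ex_derive_continuous (V := R_NormedModule)). unfold psi. auto_derive. auto. }
 replace (minus (sin (psi PI)) (sin (psi 0))) with 0 in D.
 2:{ unfold psi. rewrite sin_PI, sin_0. replace (n * PI - 2 * t * 0) with (n * PI) by ring.
   replace (n * 0 - 2 * t * 0) with 0 by ring. unfold n. rewrite sin_INR_PI, sin_0.
   change (0 = 0 - 0). ring. }
 apply (is_RInt_unique (V := R_CompleteNormedModule)) in D.
 assert (E : RInt (fun th => (n - 2 * t * cos th) * cos (psi th)) 0 PI =
  n * RInt (fun th => cos (psi th)) 0 PI -
  t * (RInt (fun th => cos (INR (S (S k)) * th - 2 * t * sin th)) 0 PI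
     + RInt (fun th => cos (INR k * th - 2 * t * sin th)) 0 PI)).
 { apply (is_RInt_unique (V := R_CompleteNormedModule)).
  apply (is_RInt_ext (V := R_NormedModule) (fun th => minus (scal n (cos (psi th)))
    (scal t (plus (cos (INR (S (S k)) * th - 2 * t * sin th)) (cos (INR k * th - 2 * t * sin th)))))).
  - intros th _. change (n * cos (psi th) - t * (cos (INR (S (S k)) * th - 2 * t * sin th)
    + cos (INR k * th - 2 * t * sin th)) = (n - 2 * t * cos th) * cos (psi th)).
   replace (INR (S (S k)) * th - 2 * t * sin th) with (psi th + th) by (unfold psi, n; rewrite !S_INR; ring).
   replace (INR k * th - 2 * t * sin th) with (psi th - th) by (unfold psi, n; rewrite !S_INR; ring).
   rewrite cos_plus, cos_minus. ring.
  - apply (is_RInt_minus (V := R_NormedModule)).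
   + apply (is_RInt_scal (V := R_NormedModule)). apply (RInt_correct (V := R_CompleteNormedModule)), besJ_ex_RInt.
   + apply (is_RInt_scal (V := R_NormedModule)), (is_RInt_plus (V := R_NormedModule));
    apply (RInt_correct (V := R_CompleteNormedModule)), besJ_ex_RInt. }
 rewrite D in E. change (fun th => cos (n * th - 2 * t * sin th)) with (fun th => cos (psi th)).
 apply (Rmult_eq_reg_r PI); [|lra].
 replace (n * (RInt (fun th => cos (psi th)) 0 PI / PI) * PI) with (n * RInt (fun th => cos (psi th)) 0 PI) by (field; lra).
 match goal with |- _ = ?r => replace r with (t * (RInt (fun th => cos (INR (S (S k)) * th - 2 * t * sin th)) 0 PI
     + RInt (fun th => cos (INR k * th - 2 * t * sin th)) 0 PI)) by (field; lra) end.
 lra.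
Qed.

Lemma continuity_2d_mult_sin (f : R -> R -> R) x y :
 continuity_2d_pt f x y -> continuity_2d_pt (fun u v => 2 * sin v * f u v) x y.
Proof.
 intros H. apply continuity_2d_pt_mult; [|exact H].
 apply continuity_2d_pt_mult; [apply continuity_2d_pt_const|].
 apply (continuity_1d_2d_pt_comp sin (fun _ v => v)); [apply continuity_sin|apply continuity_2d_pt_id2].
Qed.

Lemma besJ_derive k t : is_derive (besJ (S k)) t (besJ k t - besJ (S (S k)) t).
Proof.
 assert (PP := PI_RGT_0).
 set (f := fun u th => cos (INR (S k) * th - 2 * u * sin th)).
 set (df := fun u th => 2 * sin th * sin (INR (S k) * th - 2 * u * sin th)).
 assert (Df : forall u th, is_derive (fun u => f u th) u (df u th)).
 { assert (Dg : forall a u th, is_derive (fun u => cos (a * th - 2 * u * sin th)) u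
    (2 * sin th * sin (a * th - 2 * u * sin th))).
  { intros a u th. auto_derive; auto. unfold Rminus; ring. }
  intros u th. apply Dg. }
 assert (D : is_derive (fun u => RInt (fun th => f u th) 0 PI) t (RInt (fun th => Derive (fun u => f u th) t) 0 PI)).
 { apply is_derive_RInt_param.
  - exists (mkposreal 1 Rlt_0_1). intros u _ th _. eexists. apply Df.
  - intros th _. apply continuity_2d_pt_ext with df.
   { intros u v. symmetry. apply is_derive_unique, Df. }
   unfold df. apply continuity_2d_mult_sin.
   apply (continuity_1d_2d_pt_comp sin (fun u v => INR (S k) * v - 2 * u * sin v)); [apply continuity_sin|].
   apply continuity_2d_pt_minus.
   + apply continuity_2d_pt_mult; [apply continuity_2d_pt_const|apply continuity_2d_pt_id2].
   + apply continuity_2d_pt_mult.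
    * apply continuity_2d_pt_mult; [apply continuity_2d_pt_const|apply continuity_2d_pt_id1].
    * apply (continuity_1d_2d_pt_comp sin (fun _ v => v)); [apply continuity_sin|apply continuity_2d_pt_id2].
  - exists (mkposreal 1 Rlt_0_1). intros u _. apply besJ_ex_RInt. }
 assert (E : RInt (fun th => Derive (fun u => f u th) t) 0 PI / PI = besJ k t - besJ (S (S k)) t).
 { unfold besJ.
  transitivity ((RInt (fun th => cos (INR k * th - 2 * t * sin th)) 0 PI
   - RInt (fun th => cos (INR (S (S k)) * th - 2 * t * sin th)) 0 PI) / PI); [|field; lra].
  f_equal. rewrite <- (RInt_minus (V := R_CompleteNormedModule)) by apply besJ_ex_RInt.
  apply RInt_ext. intros th _. transitivity (df t th); [apply is_derive_unique, Df|].
  change (df t th = cos (INR k * th - 2 * t * sin th) - cos (INR (S (S k)) * th - 2 * t * sin th)). unfold df.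
  set (psi := INR (S k) * th - 2 * t * sin th).
  replace (INR (S (S k)) * th - 2 * t * sin th) with (psi + th) by (unfold psi; rewrite !S_INR; ring).
  replace (INR k * th - 2 * t * sin th) with (psi - th) by (unfold psi; rewrite !S_INR; ring).
  rewrite cos_plus, cos_minus. ring. }
 rewrite <- E. unfold besJ, Rdiv.
 apply (is_derive_ext (fun u => / PI * RInt (fun th => f u th) 0 PI)).
 { intros u. apply Rmult_comm. }
 rewrite Rmult_comm. now apply is_derive_scal.
Qed.

Lemma besJ_derive_down k t : 0 < t ->
 is_derive (fun u => u ^ S k * besJ (S k) u) t (2 * t ^ S k * besJ k t).
Proof.
 intros Ht. assert (D := besJ_derive k t). assert (E := besJ_eqn k t).
 auto_derive; [eexists; exact D|].
 rewrite (Derive_eta _ _ _ D).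
 change (match k with 0%nat => 1 | S _ => INR k + 1 end) with (INR (S k)). simpl pow. simpl pred.
 replace (1 * (INR (S k) * t ^ k) * besJ (S k) t) with (t ^ k * (INR (S k) * besJ (S k) t)) by ring.
 rewrite E. ring.
Qed.

Lemma besJ_Rabs_le1 k t : Rabs (besJ k t) <= 1.
Proof.
 assert (PP := PI_RGT_0). unfold besJ, Rdiv. rewrite Rabs_mult, (Rabs_pos_eq (/ PI)) by pos.
 apply (Rmult_le_reg_r PI); [lra|]. rewrite Rmult_assoc, Rinv_l, Rmult_1_r, Rmult_1_l by lra.
 apply Rle_trans with (RInt (fun _ => 1) 0 PI).
 - apply (norm_RInt_le (V := R_NormedModule) (fun th => cos (INR k * th - 2 * t * sin th)) (fun _ => 1) 0 PI); [lra| | |].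
  + intros. apply Rabs_le, COS_bound.
  + apply (RInt_correct (V := R_CompleteNormedModule)), besJ_ex_RInt.
  + apply (RInt_correct (V := R_CompleteNormedModule)), ex_RInt_const.
 - rewrite RInt_const. change ((PI - 0) * 1 <= PI). lra.
Qed.

Lemma besJ0_ge t : 0 < t -> 1 - 2 * t ^ 2 <= besJ 0 t.
Proof.
 intros Ht. assert (PP := PI_RGT_0). unfold besJ, Rdiv.
 apply (Rmult_le_reg_r PI); [lra|]. rewrite Rmult_assoc, Rinv_l, Rmult_1_r by lra.
 apply Rle_trans with (RInt (fun _ => 1 - 2 * t ^ 2) 0 PI).
 - rewrite RInt_const. right. change ((1 - 2 * t ^ 2) * PI = (PI - 0) * (1 - 2 * t ^ 2)). ring.
 - apply RInt_le; [lra|apply ex_RInt_const|apply besJ_ex_RInt|].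
  intros x _. eapply Rle_trans; [|apply cos_ge].
  assert (S := SIN_bound x). assert (sin x ^ 2 <= 1) by nra. simpl INR.
  replace ((0 * x - 2 * t * sin x) ^ 2 / 2) with (2 * t ^ 2 * sin x ^ 2) by field.
  nra.
Qed.

(** Integrates [(t^(k+1) J_(k+1))' = 2 t^(k+1) J_k] inductively, as for the coefficients [x_k]. For
    fixed [t] the relative error is of order [t^2/k]. *)
Lemma besJ_bounds k t : 0 < t ->
 t ^ k / INR (fact k) - 2 * (t ^ k * t ^ 2) / INR (fact (S k)) <= besJ k t <= t ^ k / INR (fact k).
Proof.
 revert t. induction k as [|k IH]; intros t Ht.
 - simpl fact. replace (t ^ 0 / INR 1) with 1 by (simpl; field).
  replace (2 * (t ^ 0 * t ^ 2) / INR 1) with (2 * t ^ 2) by (simpl; field).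
  split; [now apply besJ0_ge|]. generalize (besJ_Rabs_le1 0 t); intros H. apply Rabs_le_between in H; lra.
 - assert (F0 : 0 < INR (fact k)) by apply INR_fact_lt_0.
  assert (F1 : INR (fact (S k)) = INR (S k) * INR (fact k)) by (rewrite fact_simpl, mult_INR; ring).
  assert (F2 : INR (fact (S (S k))) = (INR (S k) + 1) * INR (fact (S k)))
   by (rewrite (fact_simpl (S k)), mult_INR, (S_INR (S k)); ring).
  assert (Sk : 0 < INR (S k)) by (apply lt_0_INR; lia).
  set (n := INR (S k)) in *. set (c := / INR (fact k)).
  assert (P1 : forall u, 0 < u < 1 -> 0 <= u ^ S k <= u) by (intros; now apply pow_small).
  assert (Sm : forall C1 C2, small_at_0 (fun u => u ^ S k * besJ (S k) u + C1 * (u ^ S k * u ^ S k) + C2 * (u ^ S k * u ^ S k * u ^ 2))).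
  { intros C1 C2. exists (1 + Rabs C1 + Rabs C2), 1. split; [lra|]. intros u Hu.
   assert (A := P1 u Hu). assert (B := besJ_Rabs_le1 (S k) u).
   assert (0 <= u ^ S k * u ^ S k <= u) by nra. assert (0 <= u ^ S k * u ^ S k * u ^ 2 <= u) by nra.
   eapply Rle_trans; [apply Rabs_triang|]. eapply Rle_trans; [apply Rplus_le_compat_r, Rabs_triang|].
   rewrite !(Rabs_mult C1), !(Rabs_mult C2), Rabs_mult.
   rewrite (Rabs_pos_eq (u ^ S k)), (Rabs_pos_eq (u ^ S k * u ^ S k)), (Rabs_pos_eq (u ^ S k * u ^ S k * u ^ 2)) by lra.
   generalize (Rabs_pos C1) (Rabs_pos C2) (Rabs_pos (besJ (S k) u)); intros. nra. }
  assert (Pt : 0 < t ^ S k) by pos.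
  split.
  + assert (0 <= t ^ S k * besJ (S k) t + (- (c / n)) * (t ^ S k * t ^ S k) + (2 * c / (n * (n + 1))) * (t ^ S k * t ^ S k * t ^ 2)).
   { apply (pos_of_deriv (fun t => t ^ S k * besJ (S k) t + (- (c / n)) * (t ^ S k * t ^ S k) + (2 * c / (n * (n + 1))) * (t ^ S k * t ^ S k * t ^ 2))
     (fun u => 2 * u ^ S k * besJ k u + (- (c / n)) * (2 * n * (u ^ k * u ^ S k))
      + (2 * c / (n * (n + 1))) * (2 * (n + 1) * (u ^ k * u ^ S k) * u ^ 2)) t); auto.
    - intros u Hu. repeat apply derive_plus.
     + apply besJ_derive_down; lra.
     + apply is_derive_scal, sq_pow_derive.
     + apply is_derive_scal, sq_pow_derive2.
    - intros u Hu. destruct (IH u ltac:(lra)) as [L _]. assert (0 < u ^ S k) by pos.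
     replace (- (c / n) * (2 * n * (u ^ k * u ^ S k))) with (2 * u ^ S k * (- (u ^ k * c))) by (field; lra).
     replace (2 * c / (n * (n + 1)) * (2 * (n + 1) * (u ^ k * u ^ S k) * u ^ 2))
      with (2 * u ^ S k * (2 * (u ^ k * u ^ 2) * (c / n))) by (field; lra).
     rewrite F1 in L. replace (2 * (u ^ k * u ^ 2) / (n * INR (fact k))) with (2 * (u ^ k * u ^ 2) * (c / n)) in L
      by (unfold c; field; lra).
     unfold Rdiv at 1 in L. fold c in L. nra. }
   apply (Rmult_le_reg_l (t ^ S k)); [lra|]. rewrite F2, F1.
   replace (t ^ S k * (t ^ S k / (n * INR (fact k)) - 2 * (t ^ S k * t ^ 2) / ((n + 1) * (n * INR (fact k)))))
    with ((c / n) * (t ^ S k * t ^ S k) - (2 * c / (n * (n + 1))) * (t ^ S k * t ^ S k * t ^ 2)) by (unfold c; field; lra).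
   lra.
  + assert (0 <= - (t ^ S k * besJ (S k) t + (- (c / n)) * (t ^ S k * t ^ S k) + 0 * (t ^ S k * t ^ S k * t ^ 2))).
   { apply (pos_of_deriv (fun u => - (u ^ S k * besJ (S k) u + (- (c / n)) * (u ^ S k * u ^ S k) + 0 * (u ^ S k * u ^ S k * u ^ 2)))
     (fun u => - (2 * u ^ S k * besJ k u + (- (c / n)) * (2 * n * (u ^ k * u ^ S k))
      + 0 * (2 * (n + 1) * (u ^ k * u ^ S k) * u ^ 2))) t); auto.
    - intros u Hu. apply (is_derive_opp (K := R_AbsRing) (V := R_NormedModule)).
     repeat apply derive_plus.
     + apply besJ_derive_down; lra.
     + apply is_derive_scal, sq_pow_derive.
     + apply is_derive_scal, sq_pow_derive2.
    - intros u Hu. destruct (IH u ltac:(lra)) as [_ U]. assert (0 < u ^ S k) by pos.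
     replace (- (c / n) * (2 * n * (u ^ k * u ^ S k))) with (2 * u ^ S k * (- (u ^ k * c))) by (field; lra).
     unfold Rdiv in U. fold c in U. nra.
    - destruct (Sm (- (c / n)) 0) as [C [d [Hd HC]]]. exists C, d. split; auto.
     intros u Hu. rewrite Rabs_Ropp. auto. }
   apply (Rmult_le_reg_l (t ^ S k)); [lra|]. rewrite F1.
   replace (t ^ S k * (t ^ S k / (n * INR (fact k)))) with ((c / n) * (t ^ S k * t ^ S k)) by (unfold c; field; lra).
   lra.
Qed.

(** * The nonlinear recurrence compared with the Bessel recurrence *)

Lemma finite_max (f : nat -> R) (a K : nat) : (a <= K)%nat ->
 exists m, (a <= m <= K)%nat /\ forall i, (a <= i <= K)%nat -> f i <= f m.
Proof.
 intros HaK. induction HaK as [|K HaK IH].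
 - exists a. split; [lia|]. intros i Hi. replace i with a by lia. lra.
 - destruct IH as [m [Hm1 Hm2]]. destruct (Rle_dec (f (S K)) (f m)) as [Hle|Hgt].
  + exists m. split; [lia|]. intros i Hi.
   destruct (Nat.eq_dec i (S K)) as [->|]; [auto|apply Hm2; lia].
  + exists (S K). split; [lia|]. intros i Hi.
   destruct (Nat.eq_dec i (S K)) as [->|]; [lra|].
   apply Rle_trans with (f m); [apply Hm2; lia|lra].
Qed.

(** The discrete Wronskian of the coefficients with [J_j(2t)]. The two recurrences differ only by
    the factor [1 - x_j^2], so it changes by cubically small terms. *)
Definition casoratian (t : R) (j : nat) : R := dp j t * besJ (S j) t - dp (S j) t * besJ j t.

Lemma casoratian_step t j : 0 < t ->
 casoratian t j = casoratian t (S j) + (dp (S (S j)) t + dp j t) * dp (S j) t ^ 2 * besJ (S j) t.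
Proof.
 intros Ht. unfold casoratian. assert (E1 := dp_eqn j t Ht). assert (E2 := besJ_eqn j t).
 set (x := dp (S j) t) in *. set (y := besJ (S j) t) in *.
 apply (Rmult_eq_reg_l t); [|lra].
 assert (t * (x * (besJ (S (S j)) t + besJ j t)) = t * ((1 - x ^ 2) * (dp (S (S j)) t + dp j t) * y)); [|nra].
 replace (t * (x * (besJ (S (S j)) t + besJ j t))) with (x * (t * (besJ (S (S j)) t + besJ j t))) by ring.
 rewrite <- E2. replace (x * (INR (S j) * y)) with ((INR (S j) * x) * y) by ring. rewrite E1. ring.
Qed.

Lemma ratio_step t j : 0 < t ->
 besJ (S j) t / dp (S j) t - besJ j t / dp j t = casoratian t j / (dp j t * dp (S j) t).
Proof.
 intros Ht. unfold casoratian. assert (R0 := dp_range j t Ht). assert (R1 := dp_range (S j) t Ht).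
 field. lra.
Qed.

(** Sums [casoratian_step] from [K] downwards. Geometric decay makes the squares [x_j^2] summable,
    and an assumed bound [T] on the ratio linearises the contribution of [besJ]. *)
Lemma casoratian_bound (t lam T : R) (a K : nat) : 0 < t -> 0 < lam < 1 ->
 (forall d, dp (a + d) t <= dp a t * lam ^ d) ->
 (forall i, (a <= i <= K)%nat -> Rabs (besJ i t) <= T * dp i t) -> 0 <= T ->
 forall e d, (d + e = K - a)%nat -> (a <= K)%nat ->
 Rabs (casoratian t (a + d)) <= Rabs (casoratian t K) +
  T * (2 * (dp (a + d) t * dp (S (a + d)) t) * dp a t ^ 2 * (lam ^ 2) ^ S d / (1 - lam ^ 2)).
Proof.
 intros Ht Hl Hg HT HT0. assert (Hq : 0 < 1 - lam ^ 2) by nra.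
 assert (Pl : forall n, 0 < (lam ^ 2) ^ n) by (intros; apply pow_lt; nra).
 induction e as [|e IH]; intros d Hd HaK.
 - replace (a + d)%nat with K by lia. rewrite <- (Rplus_0_r (Rabs (casoratian t K))) at 1.
  apply Rplus_le_compat_l. assert (R0 := dp_range K t Ht). assert (R1 := dp_range (S K) t Ht).
  apply Rmult_le_pos; [auto|]. apply Rmult_le_pos; [|pos].
  apply Rmult_le_pos; [|left; apply Pl]. pos.
 - assert (H := IH (S d) ltac:(lia) HaK). rewrite Nat.add_succ_r in H.
  set (j := (a + d)%nat) in *. rewrite (casoratian_step t j Ht).
  eapply Rle_trans; [apply Rabs_triang|].
  assert (R2 := dp_range (S (S j)) t Ht).
  assert (D0 := dp_decr t Ht j). assert (D1 := dp_decr t Ht (S j)).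
  assert (Hb := HT (S j) ltac:(unfold j; lia)).
  assert (Hg1 := Hg (S d)). rewrite Nat.add_succ_r in Hg1. fold j in Hg1.
  assert (Hsq : dp (S j) t ^ 2 <= dp a t ^ 2 * (lam ^ 2) ^ S d).
  { apply Rle_trans with ((dp a t * lam ^ S d) ^ 2); [apply pow_incr; lra|].
   right. rewrite Rpow_mult_distr, <- !pow_mult. do 2 f_equal. lia. }
  assert (Hw : Rabs ((dp (S (S j)) t + dp j t) * dp (S j) t ^ 2 * besJ (S j) t)
   <= T * (2 * (dp j t * dp (S j) t) * (dp a t ^ 2 * (lam ^ 2) ^ S d))).
  { rewrite Rabs_mult, Rabs_pos_eq.
   2:{ pos. }
   apply Rle_trans with ((2 * dp j t) * (dp a t ^ 2 * (lam ^ 2) ^ S d) * (T * dp (S j) t)).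
   - apply Rmult_le_compat; auto.
    + pos.
    + apply Rabs_pos.
    + apply Rmult_le_compat; try lra. pos.
   - right. ring. }
  assert (HC : T * (2 * (dp (S j) t * dp (S (S j)) t) * dp a t ^ 2 * (lam ^ 2) ^ S (S d) / (1 - lam ^ 2))
   <= T * (2 * (dp j t * dp (S j) t) * dp a t ^ 2 * (lam ^ 2) ^ S (S d) / (1 - lam ^ 2))).
  { mul_l. mul_r.
   apply Rmult_le_compat_r; [left; apply Pl|]. mul_r.
   mul_l. nra. }
  apply Rle_trans with (Rabs (casoratian t K) +
   (T * (2 * (dp j t * dp (S j) t) * dp a t ^ 2 * (lam ^ 2) ^ S (S d) / (1 - lam ^ 2))
    + T * (2 * (dp j t * dp (S j) t) * (dp a t ^ 2 * (lam ^ 2) ^ S d)))); [lra|].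
  right. f_equal. change ((lam ^ 2) ^ S (S d)) with (lam ^ 2 * (lam ^ 2) ^ S d). field. lra.
Qed.

(** A second summation: divided by [x_j x_(j+1)], the casoratian is the increment of the ratio. Its
    value at the far end is carried through every step, hence the term with [INR e]. *)
Lemma ratio_bound (t lam T : R) (a K : nat) : 0 < t -> 0 < lam < 1 ->
 (forall d, dp (a + d) t <= dp a t * lam ^ d) ->
 (forall i, (a <= i <= S K)%nat -> Rabs (besJ i t) <= T * dp i t) -> 0 <= T ->
 forall e d, (d + e = S K - a)%nat -> (a <= K)%nat ->
 Rabs (besJ (a + d) t / dp (a + d) t - besJ (S K) t / dp (S K) t) <=
  INR e * (Rabs (casoratian t (S K)) / (dp K t * dp (S K) t)) +
  T * (2 * dp a t ^ 2 * (lam ^ 2) ^ S d / (1 - lam ^ 2) ^ 2).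
Proof.
 intros Ht Hl Hg HT HT0. assert (Hq : 0 < 1 - lam ^ 2) by nra.
 assert (Pl : forall n, 0 < (lam ^ 2) ^ n) by (intros; apply pow_lt; nra).
 assert (RK := dp_range K t Ht). assert (RK1 := dp_range (S K) t Ht).
 set (dl := Rabs (casoratian t (S K)) / (dp K t * dp (S K) t)).
 induction e as [|e IH]; intros d Hd HaK.
 - replace (a + d)%nat with (S K) by lia. rewrite Rminus_diag, Rabs_R0. simpl INR. rewrite Rmult_0_l, Rplus_0_l.
  apply Rmult_le_pos; [auto|]. apply Rmult_le_pos; [|pos].
  apply Rmult_le_pos; [|left; apply Pl]. pos.
 - assert (H := IH (S d) ltac:(lia) HaK). rewrite Nat.add_succ_r in H.
  assert (HW := casoratian_bound t lam T a (S K) Ht Hl Hg ltac:(intros; apply HT; lia) HT0 (S e) d ltac:(lia) ltac:(lia)).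
  set (j := (a + d)%nat) in *.
  assert (Hs := ratio_step t j Ht).
  assert (R0 := dp_range j t Ht). assert (R1 := dp_range (S j) t Ht).
  assert (Pjj : 0 < dp j t * dp (S j) t) by pos.
  assert (Hstep : Rabs (besJ j t / dp j t - besJ (S j) t / dp (S j) t)
   <= dl + T * (2 * dp a t ^ 2 * (lam ^ 2) ^ S d / (1 - lam ^ 2))).
  { rewrite Rabs_minus_sym, Hs. unfold Rdiv at 1. rewrite Rabs_mult, (Rabs_pos_eq (/ _)) by pos.
   apply div_le; [pos|]. apply Rle_trans with (1 := HW).
   rewrite Rmult_plus_distr_r. apply Rplus_le_compat.
   - unfold dl. assert (Hm : dp K t * dp (S K) t <= dp j t * dp (S j) t).
    { apply Rmult_le_compat; try lra; apply dp_mono; auto; unfold j; lia. }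
    apply (Rmult_le_reg_r (dp K t * dp (S K) t)); [pos|].
    replace (Rabs (casoratian t (S K)) / (dp K t * dp (S K) t) * (dp j t * dp (S j) t) * (dp K t * dp (S K) t))
     with (Rabs (casoratian t (S K)) * (dp j t * dp (S j) t)) by (field; lra).
    mul_l; auto.
   - right. field. lra. }
  replace (besJ j t / dp j t - besJ (S K) t / dp (S K) t) with
   ((besJ j t / dp j t - besJ (S j) t / dp (S j) t) + (besJ (S j) t / dp (S j) t - besJ (S K) t / dp (S K) t)) by ring.
  eapply Rle_trans; [apply Rabs_triang|].
  rewrite S_INR.
  apply Rle_trans with (INR e * dl + dl + (T * (2 * dp a t ^ 2 * (lam ^ 2) ^ S d / (1 - lam ^ 2))
   + T * (2 * dp a t ^ 2 * (lam ^ 2) ^ S (S d) / (1 - lam ^ 2) ^ 2))); [lra|].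
  right. change ((lam ^ 2) ^ S (S d)) with (lam ^ 2 * (lam ^ 2) ^ S d). field. lra.
Qed.

(** The common normalisation at infinity: with [t] fixed both sequences are [t^k/k!] times
    [1 + O(t^2/k)]. *)
Lemma ratio_lim (t : R) : 0 < t -> forall eps, 0 < eps -> exists N, forall K, (N <= K)%nat ->
 Rabs (besJ (S K) t / dp (S K) t - 1) <= eps.
Proof.
 intros Ht eps He. set (t2 := t ^ 2). assert (Ht2 : 0 < t2) by pos.
 set (A := 8 * t2 + 8 * t2 / eps + 32 * t2 / eps).
 assert (A1 : 0 < 8 * t2 / eps) by pos.
 destruct (INR_unbounded A) as [N HN]. exists (S N). intros K HK.
 assert (HKA : A <= INR K) by (apply Rle_trans with (INR N); [lra|apply le_INR; lia]).
 assert (Hy : 4 * t2 / INR (S K) <= / 2).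
 { rewrite S_INR. apply (Rmult_le_reg_r (INR K + 1)); [unfold A in HKA; lra|].
  unfold Rdiv. rewrite Rmult_assoc, Rinv_l by (unfold A in HKA; lra). unfold A in HKA. lra. }
 assert (bnd : forall j, (K <= j)%nat ->
  let P := t ^ j / INR (fact j) in
  0 < P /\ P * / 2 <= dp j t <= P /\ P * (1 - 4 * t2 / INR (S j)) <= dp j t /\ P * (1 - 2 * t2 / INR (S j)) <= besJ j t <= P /\ 0 <= 4 * t2 / INR (S j) <= / 2).
 { intros j Hj P. assert (HP : 0 < P) by (apply Rdiv_lt_0_compat; [pos|apply INR_fact_lt_0]).
  assert (U := dp_upper j t Ht). fold P in U.
  destruct (besJ_bounds j t Ht) as [L2 U2]. fold P in U2.
  assert (HSj : INR (S K) <= INR (S j)) by (apply le_INR; lia).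
  assert (HSK : 0 < INR (S K)) by (apply lt_0_INR; lia).
  assert (Hyj : 0 <= 4 * t2 / INR (S j) <= / 2).
  { split; [apply Rmult_le_pos; [lra|pos]|].
   apply Rle_trans with (2 := Hy). mul_l. apply Rinv_le_contravar; lra. }
  assert (L : P * (1 - 4 * t2 / INR (S j)) <= dp j t).
  { destruct j as [|j]; [lia|]. assert (L := dp_norm_lower t Ht j). fold P in L.
   apply Rle_trans with (2 := L). mul_l.
   eapply Rle_trans; [|apply exp_ineq1_le]. fold t2. lra. }
  split; [auto|]. split; [split; [nra|auto]|]. split; [auto|]. split; [|auto].
  split; [|auto]. apply Rle_trans with (2 := L2). fold t2. right. unfold P.
  rewrite (fact_simpl j), mult_INR. field. split; [apply INR_fact_neq_0|lra]. }
 destruct (bnd (S K) ltac:(lia)) as (HP & B1 & B2 & B3 & B4). set (P := t ^ S K / INR (fact (S K))) in *.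
  set (y := 4 * t2 / INR (S (S K))) in *.
  replace (2 * t2 / INR (S (S K))) with (y / 2) in B3 by (unfold y; field; apply not_0_INR; lia).
  assert (Hy2 : 2 * y <= eps).
  { unfold y. apply (Rmult_le_reg_r (INR (S (S K)))); [apply lt_0_INR; lia|].
   replace (2 * (4 * t2 / INR (S (S K))) * INR (S (S K))) with (8 * t2) by (field; apply not_0_INR; lia).
   apply Rle_trans with (eps * (8 * t2 / eps)); [right; field; lra|].
   mul_l. rewrite !S_INR. unfold A in HKA. lra. }
  assert (Px : 0 < dp (S K) t) by lra.
  apply Rabs_le. split.
  + apply (Rmult_le_reg_r (dp (S K) t)); [auto|].
   replace ((besJ (S K) t / dp (S K) t - 1) * dp (S K) t) with (besJ (S K) t - dp (S K) t) by (field; lra). nra.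
  + apply (Rmult_le_reg_r (dp (S K) t)); [auto|].
   replace ((besJ (S K) t / dp (S K) t - 1) * dp (S K) t) with (besJ (S K) t - dp (S K) t) by (field; lra). nra.
Qed.

(** The casoratian at the far end will be multiplied by the number of steps. Closeness of two
    consecutive ratios bounds it by [2 e x_(K+1) x_(K+2)], and [(K+1) x_(K+2) <= 2 t x_K] absorbs
    the extra factor. *)
Lemma ratio_tail (t : R) : 0 < t -> forall eps, 0 < eps -> exists N, forall K, (N <= K)%nat ->
 Rabs (besJ (S K) t / dp (S K) t - 1) <= eps /\
 INR (S K) * (Rabs (casoratian t (S K)) / (dp K t * dp (S K) t)) <= eps.
Proof.
 intros Ht eps He. set (e := eps / (1 + 4 * t)).
 assert (He' : 0 < e) by pos.
 assert (Ee : e * (1 + 4 * t) = eps) by (unfold e; field; lra).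
 destruct (ratio_lim t Ht e He') as [N HN]. exists N. intros K HK.
 assert (H1 := HN K HK). assert (H2 := HN (S K) ltac:(lia)).
 split; [nra|].
 assert (R1 := dp_range (S K) t Ht). assert (R2 := dp_range (S (S K)) t Ht).
 assert (Hd : Rabs (besJ (S (S K)) t / dp (S (S K)) t - besJ (S K) t / dp (S K) t) <= 2 * e).
 { replace (besJ (S (S K)) t / dp (S (S K)) t - besJ (S K) t / dp (S K) t) with
   ((besJ (S (S K)) t / dp (S (S K)) t - 1) + - (besJ (S K) t / dp (S K) t - 1)) by ring.
  eapply Rle_trans; [apply Rabs_triang|]. rewrite Rabs_Ropp. lra. }
 rewrite (ratio_step t (S K) Ht) in Hd.
 assert (P2 : 0 < dp (S K) t * dp (S (S K)) t) by pos.
 unfold Rdiv in Hd at 1. rewrite Rabs_mult, (Rabs_pos_eq (/ _)) in Hd by pos.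
 set (W := Rabs (casoratian t (S K))) in *.
 assert (HW : W <= 2 * e * (dp (S K) t * dp (S (S K)) t)).
 { apply (Rmult_le_compat_r (dp (S K) t * dp (S (S K)) t)) in Hd; [|lra].
  rewrite Rmult_assoc, Rinv_l, Rmult_1_r in Hd by lra. exact Hd. }
 assert (E := dp_eqn_le t Ht (S K)). assert (D := dp_decr t Ht K).
 assert (I1 : INR (S K) * dp (S (S K)) t <= 2 * t * dp K t).
 { apply Rle_trans with (INR (S (S K)) * dp (S (S K)) t).
  - mul_r. apply le_INR; lia.
  - apply Rle_trans with (1 := E). mul_l; lra. }
 apply (Rmult_le_reg_r (dp K t * dp (S K) t)); [pos|].
 replace (INR (S K) * (W / (dp K t * dp (S K) t)) * (dp K t * dp (S K) t)) with (INR (S K) * W) by (field; lra).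
 apply Rle_trans with (INR (S K) * (2 * e * (dp (S K) t * dp (S (S K)) t))); [mul_l; lra|].
 apply Rle_trans with (2 * e * dp (S K) t * (2 * t * dp K t)).
 - replace (INR (S K) * (2 * e * (dp (S K) t * dp (S (S K)) t)))
   with (2 * e * dp (S K) t * (INR (S K) * dp (S (S K)) t)) by ring.
  apply Rmult_le_compat_l; [|auto]. pos.
 - rewrite <- Ee.
  replace (2 * e * dp (S K) t * (2 * t * dp K t)) with (e * (4 * t) * (dp K t * dp (S K) t)) by ring.
  mul_r. mul_l; lra.
Qed.

(** With [mu = sqrt M / (2m)] the index condition reads [k >= m^3 (2 + 4 mu^2)], while [lam + 1/lam]
    for [lam = 1 - mu] is at most [2 + 2 mu^2]. The rate is half of the true decay [sqrt M / m] per
    step. *)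
Lemma geom_decay (m M : R) (k d : nat) : 0 < m -> 0 < M <= m ^ 2 -> 2 * m ^ 3 + M * m <= INR k ->
 dp (k + d) (m ^ 3) <= dp k (m ^ 3) * (1 - sqrt M / (2 * m)) ^ d.
Proof.
 intros Hm HM Hk. assert (Ht : 0 < m ^ 3) by pos.
 assert (Hs : 0 < sqrt M) by (apply sqrt_lt_R0; lra). assert (Es : sqrt M * sqrt M = M) by (apply sqrt_sqrt; lra).
 assert (Hsm : sqrt M <= m) by (rewrite <- (sqrt_pow2 m) by lra; apply sqrt_le_1_alt; lra).
 set (mu := sqrt M / (2 * m)). assert (Hmu : 0 < mu <= / 2).
 { unfold mu. split; [pos|].
  apply div_le; lra. }
 apply dp_geom; auto; [lra|].
 assert (HM2 : M = 4 * m ^ 2 * mu ^ 2) by (unfold mu; rewrite <- Es at 1; field; lra).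
 apply Rle_trans with (2 := Hk).
 replace (2 * m ^ 3 + M * m) with (m ^ 3 * (2 + 4 * mu ^ 2)) by (rewrite HM2; ring).
 mul_l.
 apply (Rmult_le_reg_r (1 - mu)); [lra|].
 replace ((1 - mu + / (1 - mu)) * (1 - mu)) with ((1 - mu) ^ 2 + 1) by (field; lra).
 nra.
Qed.

(** The value [B = 1/(4 m^4)] is the smallest that [rough_super] admits for [h = 1/(2 m^3)]: the
    inequality is an equality. *)
Lemma cube_step (m : R) : 0 < m -> / (2 * m ^ 3) = / (2 * m ^ 3) /\ (/ (2 * m ^ 3)) ^ 4 <= 4 * (/ (4 * m ^ 4)) ^ 3.
Proof. intros Hm. split; [reflexivity|]. right. field. lra. Qed.

Lemma dp_scaled_rough (m : R) (k : nat) : 0 < m ->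
 dp k (m ^ 3) <= sqrt (rough (/ (4 * m ^ 4)) (1 - INR k * / (2 * m ^ 3))).
Proof.
 intros Hm. apply (dp_rough_upper (m ^ 3) (/ (2 * m ^ 3))); auto.
 - pos.
 - apply Rinv_0_lt_compat. assert (0 < m ^ 4) by pos. lra.
 - now apply cube_step.
Qed.

Lemma dp_scaled_right (m : R) (k : nat) : 0 < m -> 2 * m ^ 3 <= INR k -> m * dp k (m ^ 3) <= / 2.
Proof.
 intros Hm Hk. assert (H := dp_scaled_rough m k Hm). set (p := 1 - INR k * / (2 * m ^ 3)) in *.
 assert (P3 : 0 < m ^ 3) by pos.
 assert (Hp : p <= 0).
 { unfold p. assert (1 <= INR k * / (2 * m ^ 3)); [|lra].
  apply (Rmult_le_reg_r (2 * m ^ 3)); [lra|]. rewrite Rmult_assoc, Rinv_l; lra. }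
 assert (Hr : rough (/ (4 * m ^ 4)) p <= / (4 * m ^ 2)).
 { unfold rough. assert (sqrt (p ^ 2 + / (4 * m ^ 4)) <= - p + / (2 * m ^ 2)); [|replace (/ (4 * m ^ 2)) with (/ (2 * m ^ 2) / 2) by (field; lra); lra].
  assert (0 < / (2 * m ^ 2)) by pos.
  rewrite <- (sqrt_pow2 (- p + / (2 * m ^ 2))) by lra. apply sqrt_le_1_alt.
  replace (/ (4 * m ^ 4)) with ((/ (2 * m ^ 2)) ^ 2) by (field; lra). nra. }
 apply Rle_trans with (m * sqrt (/ (4 * m ^ 2))).
 - mul_l. apply Rle_trans with (1 := H). now apply sqrt_le_1_alt.
 - replace (/ (4 * m ^ 2)) with ((/ (2 * m)) ^ 2) by (field; lra).
  rewrite sqrt_pow2 by pos. right. field. lra.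
Qed.

(** Since [m x_k <= 1/2] and the decay rate is of order [sqrt M / m], the total relative effect [E]
    of the cubic term is at most [2/M]. The far end [K] then moves to infinity with [t] fixed. *)
Lemma besJ_dp_close (m M : R) (k : nat) : 0 < m -> 4 <= M <= m ^ 2 -> 2 * m ^ 3 + M * m <= INR k ->
 Rabs (besJ k (m ^ 3) - dp k (m ^ 3)) <= 4 / M * dp k (m ^ 3).
Proof.
 intros Hm HM Hk. set (t := m ^ 3) in *. assert (Ht : 0 < t) by pos.
 set (mu := sqrt M / (2 * m)).
 assert (Hs : 0 < sqrt M) by (apply sqrt_lt_R0; lra). assert (Es : sqrt M * sqrt M = M) by (apply sqrt_sqrt; lra).
 assert (Hsm : sqrt M <= m) by (rewrite <- (sqrt_pow2 m) by lra; apply sqrt_le_1_alt; lra).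
 assert (Hmu : 0 < mu <= / 2).
 { unfold mu. split; [pos|].
  apply div_le; lra. }
 set (lam := 1 - mu). assert (Hl : 0 < lam < 1) by (unfold lam; lra).
 assert (Hg : forall d, dp (k + d) t <= dp k t * lam ^ d).
 { intros d. apply geom_decay; auto. lra. }
 set (x := dp k t). assert (Rx := dp_range k t Ht). fold x in Rx.
 assert (Hmx : m * x <= / 2) by (apply dp_scaled_right; auto; fold t; nra).
 set (E := 2 * x ^ 2 * (lam ^ 2) ^ 1 / (1 - lam ^ 2) ^ 2).
 assert (HE : 0 <= E <= 2 / M).
 { assert (Hq : mu <= 1 - lam ^ 2) by (unfold lam; nra).
  unfold E. split.
  - apply Rmult_le_pos; [|pos]. pos.
  - apply Rle_trans with (2 * x ^ 2 * 1 / mu ^ 2).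
   + apply Rmult_le_compat; [pos|pos| |].
    * mul_l; lra.
    * apply Rinv_le_contravar; [pos|]. apply pow_incr; lra.
   + replace (2 * x ^ 2 * 1 / mu ^ 2) with (8 * (m * x) ^ 2 / M) by (unfold mu; rewrite <- Es at 1; field; lra).
    mul_r.
    assert (0 <= m * x) by nra. nra. }
 assert (HE2 : E <= / 2).
 { apply Rle_trans with (1 := proj2 HE). apply div_le; lra. }
 assert (Hmain : forall eps, 0 < eps -> eps <= 1 -> Rabs (besJ k t / x - 1) <= 2 * E + 4 * eps).
 { intros eps He He1. destruct (ratio_tail t Ht eps He) as [N HN].
  set (K := (N + k)%nat). destruct (HN K ltac:(unfold K; lia)) as [H1 H2].
  (* A bootstrap: with [T] the largest ratio, [ratio_bound] at the maximising index gives
     [T <= 1 + 2 eps + T E], and [E <= 1/2] yields [T <= 2 + 4 eps]. *)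
  destruct (finite_max (fun i => Rabs (besJ i t / dp i t)) k (S K)) as [i0 [Hi1 Hi2]]; [unfold K; lia|].
  set (T := Rabs (besJ i0 t / dp i0 t)) in *.
  assert (HT : forall i, (k <= i <= S K)%nat -> Rabs (besJ i t) <= T * dp i t).
  { intros i Hi. assert (A := Hi2 i Hi). cbv beta in A. fold T in A. assert (Ri := dp_range i t Ht).
   unfold Rdiv in A. rewrite Rabs_mult, (Rabs_pos_eq (/ _)) in A by pos.
   apply (Rmult_le_compat_r (dp i t)) in A; [|lra]. rewrite Rmult_assoc, Rinv_l, Rmult_1_r in A by lra. exact A. }
  assert (T0 : 0 <= T) by apply Rabs_pos.
  set (dl := Rabs (casoratian t (S K)) / (dp K t * dp (S K) t)) in *.
  assert (Hdl : 0 <= dl).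
  { assert (A := dp_range K t Ht). assert (B := dp_range (S K) t Ht).
   pos. }
  assert (Hb : forall d, (d <= S K - k)%nat -> Rabs (besJ (k + d) t / dp (k + d) t - besJ (S K) t / dp (S K) t) <= eps + T * E).
  { intros d Hd. assert (B := ratio_bound t lam T k K Ht Hl Hg HT T0 (S K - k - d) d ltac:(lia) ltac:(unfold K; lia)).
   fold dl in B. apply Rle_trans with (1 := B). apply Rplus_le_compat.
   - apply Rle_trans with (2 := H2). mul_r. apply le_INR; lia.
   - mul_l. unfold E. fold x.
    apply Rmult_le_compat_r; [left; apply Rinv_0_lt_compat, pow_lt; nra|].
    apply Rmult_le_compat_l; [generalize (pow2_ge_0 x); lra|].
    assert (0 <= lam ^ 2 <= 1) by (split; nra).
    assert (0 <= (lam ^ 2) ^ d <= 1).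
    { split; [pos|]. rewrite <- (pow1 d). apply pow_incr; lra. }
    simpl pow at 1. simpl pow at 3. simpl in *. nra. }
  assert (HK1 : Rabs (besJ (S K) t / dp (S K) t) <= 1 + eps).
  { replace (besJ (S K) t / dp (S K) t) with ((besJ (S K) t / dp (S K) t - 1) + 1) by ring.
   eapply Rle_trans; [apply Rabs_triang|]. rewrite (Rabs_pos_eq 1); lra. }
  assert (HT2 : T <= 2 + 4 * eps).
  { assert (B := Hb (i0 - k)%nat ltac:(lia)). replace (k + (i0 - k))%nat with i0 in B by lia.
   assert (T <= (eps + T * E) + (1 + eps)); [|nra]. unfold T at 1.
   replace (besJ i0 t / dp i0 t) with ((besJ i0 t / dp i0 t - besJ (S K) t / dp (S K) t) + besJ (S K) t / dp (S K) t) by ring.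
   eapply Rle_trans; [apply Rabs_triang|]. lra. }
  assert (B := Hb O ltac:(lia)). rewrite Nat.add_0_r in B. fold x in B.
  replace (besJ k t / x - 1) with ((besJ k t / x - besJ (S K) t / dp (S K) t) + (besJ (S K) t / dp (S K) t - 1)) by ring.
  eapply Rle_trans; [apply Rabs_triang|].
  assert (T * E <= (2 + 4 * eps) * E) by (mul_r; lra).
  assert (eps * E <= eps * / 2) by (mul_l; lra). lra. }
 assert (Hfin : Rabs (besJ k t / x - 1) <= 2 * E).
 { apply Rnot_lt_le; intros HH. set (g := Rabs (besJ k t / x - 1) - 2 * E) in *.
  assert (0 < g) by (unfold g; lra).
  assert (A := Hmain (Rmin 1 (g / 8)) ltac:(apply Rmin_glb_lt; lra) ltac:(apply Rmin_l)).
  assert (B := Rmin_r 1 (g / 8)). unfold g in *. lra. }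
 replace (besJ k t - x) with ((besJ k t / x - 1) * x) by (field; lra).
 rewrite Rabs_mult, (Rabs_pos_eq x) by lra. mul_r.
 apply Rle_trans with (1 := Hfin). unfold Rdiv in *. lra.
Qed.

(** The barrier [sqrt rough] in the scaled variable: with [B = 1/(4 m^4)] and [p = - s/(2 m^2)] the
    powers of [m] factor out, leaving a bound independent of [m]. *)
Definition Wf (s : R) : R := sqrt ((sqrt (s ^ 2 + 1) - s) / 4).

Definition scaled (m : R) (k : nat) : R := (INR k - 2 * m ^ 3) / m.

Lemma scaled_S m k : 0 < m -> scaled m (S k) = scaled m k + / m.
Proof. intros Hm. unfold scaled. rewrite S_INR. field. lra. Qed.

Lemma Wf_arg_pos s : 0 < sqrt (s ^ 2 + 1) - s.
Proof.
 assert (H := rough_pos 1 (- s) Rlt_0_1). unfold rough in H.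
 replace ((- s) ^ 2) with (s ^ 2) in H by ring. lra.
Qed.

Lemma dp_le_Wf m k : 0 < m -> m * dp k (m ^ 3) <= Wf (scaled m k).
Proof.
 intros Hm. assert (H := dp_scaled_rough m k Hm). set (s := scaled m k).
 assert (E : rough (/ (4 * m ^ 4)) (1 - INR k * / (2 * m ^ 3)) = ((sqrt (s ^ 2 + 1) - s) / 4) / m ^ 2).
 { unfold rough.
  replace (1 - INR k * / (2 * m ^ 3)) with (- s / (2 * m ^ 2)) by (unfold s, scaled; field; lra).
  replace ((- s / (2 * m ^ 2)) ^ 2 + / (4 * m ^ 4)) with ((s ^ 2 + 1) * (/ (2 * m ^ 2)) ^ 2) by (field; lra).
  assert (0 < / (2 * m ^ 2)) by (apply Rinv_0_lt_compat; assert (0 < m ^ 2) by pos; lra).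
  rewrite sqrt_mult_alt by (generalize (pow2_ge_0 s); lra). rewrite sqrt_pow2 by lra. field. lra. }
 rewrite E in H.
 rewrite sqrt_div_alt in H by pos. rewrite sqrt_pow2 in H by lra.
 fold (Wf s) in H.
 apply Rle_trans with (m * (Wf s / m)); [mul_l; lra|]. right. field. lra.
Qed.

Lemma Wf_nonneg s : 0 <= Wf s.
Proof. apply sqrt_pos. Qed.

Lemma Wf_sq s : Wf s ^ 2 = (sqrt (s ^ 2 + 1) - s) / 4.
Proof. apply pow2_sqrt. generalize (Wf_arg_pos s); lra. Qed.

Lemma Wf_left s L : 0 <= L -> - L <= s -> Wf s ^ 2 <= (2 * L + 1) / 4.
Proof.
 intros HL Hs. rewrite Wf_sq. assert (sqrt (s ^ 2 + 1) <= 2 * L + 1 + s); [|lra].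
 rewrite <- (sqrt_pow2 (2 * L + 1 + s)) by lra. apply sqrt_le_1_alt. nra.
Qed.

Lemma Wf_right s : 0 < s -> Wf s ^ 2 <= / (8 * s).
Proof.
 intros Hs. rewrite Wf_sq. assert (sqrt (s ^ 2 + 1) <= s + / (2 * s)).
 { assert (0 < / (2 * s)) by pos.
  rewrite <- (sqrt_pow2 (s + / (2 * s))) by lra. apply sqrt_le_1_alt.
  replace ((s + / (2 * s)) ^ 2) with (s ^ 2 + 1 + (/ (2 * s)) ^ 2) by (field; lra).
  generalize (pow2_ge_0 (/ (2 * s))). lra. }
 replace (/ (8 * s)) with (/ (2 * s) / 4) by (field; lra). lra.
Qed.

(** The difference of [dp_pair_sum] at [K] and at an index tending to infinity, using [(1 - a^2)(1 -
    b^2) = 1 - (a - b)^2 - 2ab + (ab)^2]. It controls the increment of the sequence by its size. *)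
Lemma energy_bound t K B : 0 < t ->
 (forall N, psum (fun i => dp (K + i) t * dp (S (K + i)) t) N <= B) ->
 t * (dp K t - dp (S K) t) ^ 2 <=
  (INR K - 2 * t) * (dp K t * dp (S K) t) + t * (dp K t * dp (S K) t) ^ 2 + B.
Proof.
 intros Ht HB. set (a := dp K t). set (b := dp (S K) t).
 assert (Hfin : forall eps, 0 < eps -> t - t * ((1 - a ^ 2) * (1 - b ^ 2)) - INR K * (a * b) <= B + t * eps).
 { intros eps He. destruct (dp_lim0_eps t Ht (Rmin 1 (eps / 2)) K) as [N [HN1 HN2]]; [apply Rmin_glb_lt; lra|].
  assert (S1 := dp_pair_sum K t Ht). assert (S2 := dp_pair_sum N t Ht). fold a b in S1.
  replace N with (K + (N - K))%nat in S2 at 1 by lia. rewrite psum_split in S2.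
  assert (H := HB (N - K)%nat). assert (R0 := dp_range N t Ht). assert (R1 := dp_range (S N) t Ht).
  assert (D := dp_decr t Ht N). assert (H2 := Rmin_r 1 (eps / 2)).
  set (c := dp N t) in *. set (d := dp (S N) t) in *.
  assert (1 - eps <= (1 - c ^ 2) * (1 - d ^ 2)).
  {
   nra. }
  assert (t * (1 - eps) <= t * ((1 - c ^ 2) * (1 - d ^ 2))) by (mul_l; lra).
  assert (0 <= INR N * (c * d)) by pos.
  lra. }
 assert (t - t * ((1 - a ^ 2) * (1 - b ^ 2)) - INR K * (a * b) <= B).
 { apply Rnot_lt_le; intros HH.
  assert (A := Hfin ((t - t * ((1 - a ^ 2) * (1 - b ^ 2)) - INR K * (a * b) - B) / (2 * t)) ltac:(pos)).
  replace (t * ((t - t * ((1 - a ^ 2) * (1 - b ^ 2)) - INR K * (a * b) - B) / (2 * t)))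
   with ((t - t * ((1 - a ^ 2) * (1 - b ^ 2)) - INR K * (a * b) - B) / 2) in A by (field; lra). lra. }
 nra.
Qed.

Lemma geom_sum_bound (q : R) N : 0 < q < 1 -> psum (fun i => q ^ i) N <= / (1 - q).
Proof.
 intros Hq. assert (E : (1 - q) * psum (fun i => q ^ i) N = 1 - q ^ N).
 { induction N; cbn [psum]; [simpl; ring|]. rewrite Rmult_plus_distr_l, IHN. simpl. ring. }
 apply (Rmult_le_reg_l (1 - q)); [lra|]. rewrite E, Rinv_r by lra.
 assert (0 < q ^ N) by pos. lra.
Qed.

Lemma psum_nonneg_mono f n m : (n <= m)%nat -> (forall k, 0 <= f k) -> psum f n <= psum f m.
Proof.
 intros H Hf. induction H; [lra|]. cbn [psum]. generalize (Hf m); lra.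
Qed.

Lemma index_above (m s : R) : 0 < m -> 0 <= s -> exists k, 2 * m ^ 3 + s * m <= INR k < 2 * m ^ 3 + s * m + 1.
Proof.
 intros Hm Hs. set (x := 2 * m ^ 3 + s * m). assert (0 < m ^ 3) by pos.
 assert (0 < x) by (unfold x; nra).
 destruct (nfloor_ex x ltac:(lra)) as [n Hn].
 destruct (Req_dec x (INR n)) as [E|E].
 - exists n. lra.
 - exists (S n). rewrite S_INR. lra.
Qed.

(* tail of [sum x_j x_(j+1)] from index [K]: at most [(6 - s_K) m] terms before the decay sets in *)
Lemma pair_tail_bound (m : R) (K : nat) (L : R) : 2 <= m -> 0 <= L -> - L <= scaled m K ->
 forall N, psum (fun i => dp (K + i) (m ^ 3) * dp (S (K + i)) (m ^ 3)) N <= (L + 8) * m * dp K (m ^ 3) ^ 2.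
Proof.
 intros Hm HL HK N. set (t := m ^ 3). assert (Ht : 0 < t) by pos.
 set (x := dp K t). assert (Rx := dp_range K t Ht). fold x in Rx.
 (* From scaled position 4 on, the decay ratio is [1 - sqrt 4 / (2m) = 1 - 1/m], whose geometric
    series sums to [m]. *)
 destruct (index_above m 4 ltac:(lra) ltac:(lra)) as [k1 Hk1]. fold t in Hk1.
 assert (HKs : 2 * t - L * m <= INR K).
 { unfold scaled in HK. apply (Rmult_le_compat_r m) in HK; [|lra]. unfold Rdiv in HK.
  rewrite Rmult_assoc, Rinv_l in HK by lra. fold t in HK. lra. }
 set (d := (k1 - K)%nat).
 assert (Hd : INR d <= (L + 4) * m + 1).
 { unfold d. destruct (le_lt_dec K k1).
  - rewrite minus_INR by lia. lra.
  - replace (k1 - K)%nat with O by lia. simpl. nra. }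
 assert (Hy : forall j, (K <= j)%nat -> 0 <= dp j t * dp (S j) t <= x * dp j t).
 { intros j Hj. assert (A := dp_range j t Ht). assert (B := dp_range (S j) t Ht).
  assert (C := dp_mono t Ht K (S j) ltac:(lia)). fold x in C. split; nra. }
 apply Rle_trans with (psum (fun i => dp (K + i) t * dp (S (K + i)) t) (d + N)).
 { apply psum_nonneg_mono; [lia|]. intros k. apply Hy; lia. }
 rewrite psum_split.
 assert (A1 : psum (fun i => dp (K + i) t * dp (S (K + i)) t) d <= INR d * x ^ 2).
 { rewrite <- psum_const. apply psum_le. intros k _. apply Rle_trans with (x * dp (K + k) t); [apply Hy; lia|].
  assert (C := dp_mono t Ht K (K + k) ltac:(lia)). fold x in C. nra. }
 assert (A2 : psum (fun i => dp (K + (d + i)) t * dp (S (K + (d + i))) t) N <= 2 * m * x ^ 2).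
 { assert (Hlam : 0 < 1 - sqrt 4 / (2 * m) < 1).
  { replace (sqrt 4) with 2 by (symmetry; replace 4 with (2 ^ 2) by ring; apply sqrt_pow2; lra).
   replace (2 / (2 * m)) with (/ m) by (field; lra).
   assert (0 < / m) by pos.
   assert (/ m <= / 2) by (apply Rinv_le_contravar; lra). lra. }
  apply Rle_trans with (psum (fun i => x ^ 2 * (1 - sqrt 4 / (2 * m)) ^ i) N).
  - apply psum_le. intros i _. apply Rle_trans with (x * dp (K + (d + i)) t); [apply Hy; lia|].
   replace (x ^ 2) with (x * x) by ring. rewrite Rmult_assoc. mul_l.
   assert (Hge : (K + (d + i) = (K + d) + i)%nat) by lia. rewrite Hge.
   assert (G := geom_decay m 4 (K + d) i ltac:(lra) ltac:(nra)).
   apply Rle_trans with (1 := G ltac:(fold t; apply Rle_trans with (INR k1); [lra|apply le_INR; unfold d; lia])).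
   mul_r. apply dp_mono; auto; lia.
  - rewrite psum_scal. assert (G := geom_sum_bound (1 - sqrt 4 / (2 * m)) N Hlam).
   replace (/ (1 - (1 - sqrt 4 / (2 * m)))) with m in G.
   + assert (0 <= x ^ 2 * m) by pos.
    apply Rle_trans with (x ^ 2 * m); [mul_l; exact G|lra].
   + replace (sqrt 4) with 2 by (symmetry; replace 4 with (2 ^ 2) by ring; apply sqrt_pow2; lra). field. lra. }
 apply Rle_trans with (((L + 4) * m + 1) * x ^ 2 + 2 * m * x ^ 2).
 - apply Rplus_le_compat; [|exact A2]. apply Rle_trans with (1 := A1). mul_r; lra.
 - fold x. nra.
Qed.

(** The discrete form of a bound on the logarithmic derivative. The three terms of [energy_bound]
    are at most [s0], [L + 2] and [L + 8] times [m x^2]; their sum is the constant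
    [s0 + 2 L + 10]. *)
Lemma dp_step_lower (m : R) (K : nat) (L s0 : R) : 2 <= m -> 0 <= L -> 0 <= s0 -> - L <= scaled m K <= s0 ->
 dp K (m ^ 3) * (1 - (s0 + 2 * L + 10) / m) <= dp (S K) (m ^ 3).
Proof.
 intros Hm HL Hs0 HK. set (t := m ^ 3). assert (Ht : 0 < t) by pos.
 assert (E := energy_bound t K _ Ht (pair_tail_bound m K L Hm HL (proj1 HK))). fold t in E.
 set (x := dp K t) in *. set (y := dp (S K) t) in *.
 assert (Rx := dp_range K t Ht). fold x in Rx. assert (Ry := dp_range (S K) t Ht). fold y in Ry.
 assert (D := dp_decr t Ht K). fold x y in D.
 assert (HKs : INR K - 2 * t <= s0 * m).
 { destruct HK as [_ HK]. unfold scaled in HK. apply (Rmult_le_compat_r m) in HK; [|lra]. unfold Rdiv in HK.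
  rewrite Rmult_assoc, Rinv_l, Rmult_1_r in HK by lra. exact HK. }
 assert (HW : (m * x) ^ 2 <= (2 * L + 1) / 4).
 { apply Rle_trans with (2 := Wf_left _ L HL (proj1 HK)). apply pow_incr. split; [nra|]. apply dp_le_Wf; lra. }
 set (C := s0 + 2 * L + 10). assert (HC : 10 <= C) by (unfold C; lra).
 assert (Hmain : t * (x - y) ^ 2 <= C * m * x ^ 2).
 { apply Rle_trans with (1 := E).
  assert (Hxy : 0 <= x * y <= x ^ 2) by (split; nra).
  assert (B1 : (INR K - 2 * t) * (x * y) <= s0 * m * x ^ 2).
  { apply Rle_trans with (s0 * m * (x * y)); [mul_r; lra|]. mul_l; lra. }
  assert (B2 : t * (x * y) ^ 2 <= (L + 2) * m * x ^ 2).
  { apply Rle_trans with (t * (x ^ 2 * x ^ 2)).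
   - mul_l. nra.
   - replace (t * (x ^ 2 * x ^ 2)) with ((m * x) ^ 2 * (m * x ^ 2)) by (unfold t; ring).
    rewrite (Rmult_assoc (L + 2)). apply Rmult_le_compat_r; [|lra].
    pos. }
  unfold C. nra. }
 assert (Hd : m * (x - y) <= C * x).
 { apply Rsqr_incr_0_var; [|nra]. unfold Rsqr.
  assert (m * (m ^ 2 * (x - y) ^ 2) <= m * (C * x ^ 2)) by (unfold t in Hmain; nra).
  apply Rmult_le_reg_l in H; [|lra].
  replace (m * (x - y) * (m * (x - y))) with (m ^ 2 * (x - y) ^ 2) by ring.
  apply Rle_trans with (1 := H). replace (C * x * (C * x)) with (C * (C * x ^ 2)) by ring. nra. }
 fold C. apply (Rmult_le_reg_l m); [lra|].
 replace (m * (x * (1 - C / m))) with (m * x - C * x) by (field; lra). lra.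
Qed.

(** At scaled position [-8] an arch gives [m x_k >= 1]. To the right each step loses at most the
    factor [1 - C/m], and about [(s0 + 8) m] steps lose a factor independent of [m]. *)
Lemma dp_scaled_lower (s0 : R) : 0 <= s0 -> exists c m0, 0 < c /\ forall M k, m0 <= INR M ->
 scaled (INR M) k <= s0 -> c <= INR M * dp k (INR M ^ 3).
Proof.
 intros Hs0. set (C := s0 + 2 * 8 + 10). assert (HC : 10 <= C) by (unfold C; lra).
 exists (exp (- (2 * C * (s0 + 9)))), (2 * C). split; [apply exp_pos|].
 intros M k HM Hk. set (m := INR M) in *.
 set (t := m ^ 3). assert (Ht : 0 < t) by pos.
 (* For half-width [M] and height [1/m], the condition of [dp_bump] compares [1 - 7/(2 m^2)] with
    [(1 - 2/m^2)(1 - 1/m^2)]. *)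
 set (k0 := (2 * M ^ 3 - 8 * M)%nat).
 assert (HMM : (20 <= M)%nat).
 { apply INR_le. fold m. simpl INR. lra. }
 assert (Hle : (9 * M <= 2 * M ^ 3)%nat) by (simpl; nia).
 assert (Hk0 : INR k0 = 2 * t - 8 * m).
 { unfold k0. rewrite minus_INR by lia. rewrite !mult_INR, pow_INR. fold m. unfold t. simpl INR. ring. }
 assert (Hbump : 1 <= m * dp k0 t).
 { assert (B := dp_bump t (/ (2 * t)) Ht eq_refl k0 M (/ m) ltac:(lia) ltac:(unfold k0; lia)).
  assert (im : 0 < / m) by pos.
  assert (/ m <= dp k0 t).
  { apply B.
   - split; [lra|]. rewrite <- Rinv_1. apply Rinv_lt_contravar; lra.
   - rewrite Hk0. fold m.
    assert (Em : / (2 * t) = (/ m) ^ 3 / 2) by (unfold t; field; lra). rewrite Em.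
    replace ((2 * t - 8 * m + m) * ((/ m) ^ 3 / 2)) with (1 - 7 / 2 * (/ m) ^ 2) by (unfold t; field; lra).
    replace (2 / m ^ 2) with (2 * (/ m) ^ 2) by (field; lra).
    nra. }
  apply (Rmult_le_compat_l m) in H; [|lra]. rewrite Rinv_r in H by lra. lra. }
 assert (HCm : 0 <= C / m <= / 2).
 { split; [apply Rmult_le_pos; [lra|pos]|].
  apply div_le; lra. }
 assert (Hexp : exp (- (2 * (C / m))) <= 1 - C / m).
 { set (y := C / m) in *. assert (A := exp_ineq1_le (2 * y)). rewrite exp_Ropp.
  apply (Rmult_le_reg_l (exp (2 * y))); [apply exp_pos|]. rewrite Rinv_r by (apply Rgt_not_eq, exp_pos). nra. }
 destruct (le_lt_dec k k0) as [Hkk|Hkk].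
 { apply Rle_trans with 1.
  - rewrite <- exp_0. assert (0 < 2 * C * (s0 + 9)) by nra. left. apply exp_increasing. lra.
  - apply Rle_trans with (1 := Hbump). mul_l. now apply dp_mono. }
 assert (Hind : forall d, scaled m (k0 + d) <= s0 + / m -> exp (- (2 * (C / m)) * INR d) <= m * dp (k0 + d) t).
 { induction d as [|d IH]; intros Hd.
  - rewrite Rmult_0_r, exp_0, Nat.add_0_r. exact Hbump.
  - rewrite Nat.add_succ_r, scaled_S in Hd by lra.
   assert (im : 0 < / m) by pos.
   assert (IH' := IH ltac:(lra)). rewrite Nat.add_succ_r, S_INR.
   assert (Hs : - 8 <= scaled m (k0 + d) <= s0).
   { split; [|lra]. unfold scaled. apply (Rmult_le_reg_r m); [lra|]. unfold Rdiv.
    rewrite Rmult_assoc, Rinv_l by lra. rewrite plus_INR, Hk0. unfold t. generalize (pos_INR d). lra. }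
   assert (St := dp_step_lower m (k0 + d) 8 s0 ltac:(lra) ltac:(lra) Hs0 Hs). fold C t in St.
   replace (- (2 * (C / m)) * (INR d + 1)) with (- (2 * (C / m)) * INR d + - (2 * (C / m))) by ring.
   rewrite exp_plus. apply Rle_trans with (m * dp (k0 + d) t * (1 - C / m)).
   + apply Rmult_le_compat; auto; pos.
   + rewrite Rmult_assoc. mul_l; lra. }
 assert (im : 0 < / m) by pos.
 assert (H := Hind (k - k0)%nat). replace (k0 + (k - k0))%nat with k in H by lia.
 apply Rle_trans with (2 := H ltac:(lra)).
 assert (Hd : INR (k - k0) <= (s0 + 8) * m).
 { rewrite minus_INR by lia. rewrite Hk0. unfold scaled in Hk. apply (Rmult_le_compat_r m) in Hk; [|lra].
  unfold Rdiv in Hk. rewrite Rmult_assoc, Rinv_l in Hk by lra. fold t in Hk. lra. }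
 assert (A : - (2 * C * (s0 + 9)) <= - (2 * (C / m)) * INR (k - k0)).
 { assert (2 * (C / m) * INR (k - k0) <= 2 * (C / m) * ((s0 + 8) * m)) by (mul_l; lra).
  replace (2 * (C / m) * ((s0 + 8) * m)) with (2 * C * (s0 + 8)) in H0 by (field; lra). nra. }
 apply exp_mono; lra.
Qed.

(** * Convergence to the Hastings-McLeod solution *)

Definition airy_like (q : R -> R) : Prop :=
 forall eps, 0 < eps -> exists X, forall x, X <= x -> Rabs (Airy_Ai x - q x) <= eps * Rabs (Airy_Ai x).

(** A chain of three approximations: [x_k] to the Bessel coefficient with relative error [4/s],
    Bessel to Airy with an absolute error, Airy to [q] by hypothesis. As [Ai] decays, the middle
    error has to be made relative. *)
Lemma dp_close_to_q (q : R -> R) : airy_like q -> forall eps, 0 < eps -> exists X, 1 <= X /\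
 forall s, X <= s -> exists M0 c, 0 < c /\ forall M k, M0 <= INR M -> s <= scaled (INR M) k <= s + 1 ->
  Rabs (INR M * dp k (INR M ^ 3) - q (scaled (INR M) k)) <= eps * q (scaled (INR M) k) /\
  c <= INR M * dp k (INR M ^ 3).
Proof.
 intros Hq eps He.
 set (e := Rmin (/ 20) (eps / 20)).
 assert (He0 : 0 < e) by (apply Rmin_glb_lt; lra).
 assert (He1 : e <= / 20) by apply Rmin_l. assert (He2 : e <= eps / 20) by apply Rmin_r.
 destruct (Hq e He0) as [X1 HX1].
 exists (Rmax (Rmax 4 X1) (8 / e)). split.
 { apply Rle_trans with 4; [lra|]. eapply Rle_trans; [apply Rmax_l|apply Rmax_l]. }
 intros s Hs.
 assert (Hs4 : 4 <= s) by (apply Rle_trans with (2 := Hs); eapply Rle_trans; [apply Rmax_l|apply Rmax_l]).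
 assert (HsX : X1 <= s) by (apply Rle_trans with (2 := Hs); eapply Rle_trans; [apply Rmax_r|apply Rmax_l]).
 assert (Hse : 8 / e <= s) by (apply Rle_trans with (2 := Hs), Rmax_r).
 assert (H4s : 4 / s <= e / 2).
 { apply div_le; [pos|].
  apply (Rmult_le_compat_l e) in Hse; [|lra]. replace (e * (8 / e)) with 8 in Hse by (field; lra). lra. }
 (* The lower bound [c] for [m x_k], uniform in [m], turns the absolute accuracy [c e / 2] of
    [besJ_airy] into a relative one. It depends on [s], so the threshold for [M] does too. *)
 destruct (dp_scaled_lower (s + 1) ltac:(lra)) as (c & m1 & Hc & Hlow).
 destruct (besJ_airy (e / 2 * c) ltac:(pos)) as (m2 & Hm2 & HJ).
 exists (Rmax (Rmax m1 m2) (s + 1)), c. split; [auto|].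
 intros M k HM Hk. set (m := INR M) in *.
 assert (Hm1 : m1 <= m) by (apply Rle_trans with (2 := HM); eapply Rle_trans; [apply Rmax_l|apply Rmax_l]).
 assert (Hm2' : m2 <= m) by (apply Rle_trans with (2 := HM); eapply Rle_trans; [apply Rmax_r|apply Rmax_l]).
 assert (Hms : s + 1 <= m) by (apply Rle_trans with (2 := HM), Rmax_r).
 assert (Hkm : 2 * m ^ 3 + s * m <= INR k).
 { destruct Hk as [Hk _]. unfold scaled in Hk. apply (Rmult_le_compat_r m) in Hk; [|lra].
  unfold Rdiv in Hk. rewrite Rmult_assoc, Rinv_l in Hk by lra. lra. }
 assert (A1 := Hlow M k Hm1 ltac:(fold m; lra)). fold m in A1.
 split; [|exact A1].
 assert (A2 := HJ m k Hm2' ltac:(nra)). fold (scaled m k) in A2.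
 assert (A3 := besJ_dp_close m s k ltac:(lra) ltac:(split; nra) Hkm).
 set (x := m * dp k (m ^ 3)) in *. set (sk := scaled m k) in *.
 assert (A4 : Rabs (m * besJ k (m ^ 3) - x) <= e / 2 * x).
 { unfold x. replace (m * besJ k (m ^ 3) - m * dp k (m ^ 3)) with (m * (besJ k (m ^ 3) - dp k (m ^ 3))) by ring.
  rewrite Rabs_mult, (Rabs_pos_eq m) by lra.
  replace (e / 2 * (m * dp k (m ^ 3))) with (m * (e / 2 * dp k (m ^ 3))) by ring.
  mul_l. apply Rle_trans with (1 := A3).
  apply Rmult_le_compat_r; [|lra]. left. apply dp_range. pos. }
 assert (A5 : Rabs (x - Airy_Ai sk) <= e * x).
 { replace (x - Airy_Ai sk) with (- (m * besJ k (m ^ 3) - x) + (m * besJ k (m ^ 3) - Airy_Ai sk)) by ring.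
  eapply Rle_trans; [apply Rabs_triang|]. rewrite Rabs_Ropp.
  assert (e / 2 * c <= e / 2 * x) by (mul_l; lra). lra. }
 assert (A6 := HX1 sk ltac:(lra)).
 apply Rabs_le_between in A5.
 assert (Ai0 : 0 < Airy_Ai sk) by nra. rewrite (Rabs_pos_eq (Airy_Ai sk)) in A6 by lra.
 apply Rabs_le_between in A6.
 assert (Aix : Airy_Ai sk <= 2 * x) by nra.
 assert (e * Airy_Ai sk <= e * (2 * x)) by (mul_l; lra).
 assert (Hqx : x / 2 <= q sk) by nra.
 assert (Rabs (x - q sk) <= 3 * e * x) by (apply Rabs_le; lra).
 apply Rle_trans with (1 := H0).
 apply Rle_trans with (3 * e * (2 * q sk)); [mul_l; lra|]. nra.
Qed.

Lemma grid_limit (f : R -> R) (s B : R) (M0 : R) : continuity_pt f s -> 0 <= s ->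
 (forall M k, M0 <= INR M -> s <= scaled (INR M) k <= s + 1 -> f (scaled (INR M) k) <= B) -> f s <= B.
Proof.
 intros Cf Hs H. apply Rnot_lt_le; intros HH.
 destruct (Cf (f s - B) ltac:(lra)) as [d [Hd HC]].
 destruct (INR_unbounded (1 + / d + Rabs M0)) as [M HM].
 assert (id : 0 < / d) by pos. assert (M00 := Rle_abs M0). assert (M01 := Rabs_pos M0).
 set (m := INR M) in *.
 destruct (index_above m s ltac:(lra) Hs) as [k Hk].
 assert (Hsk : s <= scaled m k < s + / m).
 { unfold scaled. split.
  - apply (Rmult_le_reg_r m); [lra|]. unfold Rdiv. rewrite Rmult_assoc, Rinv_l; lra.
  - apply div_lt; [pos|].
   rewrite Rmult_plus_distr_r, Rinv_l; lra. }
 assert (im : / m < d).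
 { rewrite <- (Rinv_inv d). apply Rinv_lt_contravar; [pos|lra]. }
 assert (im1 : / m <= 1) by (apply Rinv_le_1; lra).
 assert (A := H M k ltac:(fold m; lra) ltac:(fold m; lra)). fold m in A.
 destruct (Req_dec s (scaled m k)) as [E|E]; [rewrite <- E in A; lra|].
 assert (B' : Rabs (f (scaled m k) - f s) < f s - B).
 { apply HC. split; [split; [exact I|auto]|]. simpl. unfold Rdist. rewrite Rabs_pos_eq; lra. }
 apply Rabs_def2 in B'. lra.
Qed.

(** * Positivity and decay of the Painleve solution on the right *)

Section Right.

Variables q dq : R -> R.
Hypothesis Hq1 : forall x, is_derive q x (dq x).
Hypothesis Hq2 : forall x, is_derive dq x (2 * q x ^ 3 + x * q x).
Hypothesis HqA : airy_like q.

Lemma q_cont x : continuity_pt q x.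
Proof. eapply is_derive_continuity_pt, Hq1. Qed.

(** Both facts are inherited from the discrete sequence: positivity from the uniform lower bound for
    [m x_k], size from [Wf]. No independent information on the Airy function enters. *)
Lemma q_right_bounds : exists X, 1 <= X /\ forall s, X <= s -> 0 < q s /\ q s ^ 2 <= / s.
Proof.
 destruct (dp_close_to_q q HqA (/ 4) ltac:(lra)) as [X [HX H]]. exists X. split; [auto|]. intros s Hs.
 destruct (H s Hs) as (M0 & c & Hc & HM). split.
 - assert (- q s <= - (c / 2)); [|lra].
  apply (grid_limit (fun x => - q x) s _ M0); [|lra|].
  + apply continuity_pt_opp, q_cont.
  + intros M k HM1 Hk. destruct (HM M k HM1 Hk) as [A B]. apply Rabs_le_between in A. lra.
 - apply (grid_limit (fun x => q x ^ 2) s _ (Rmax 1 M0)); [|lra|].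
  + apply continuity_pt_ext with (fun x => q x * q x); [intros; ring|]. apply continuity_pt_mult; apply q_cont.
  + intros M k HM1 Hk. assert (M1 : 1 <= INR M) by (apply Rle_trans with (2 := HM1), Rmax_l).
   destruct (HM M k ltac:(apply Rle_trans with (2 := HM1), Rmax_r) Hk) as [A B].
   assert (W := dp_le_Wf (INR M) k ltac:(lra)). assert (W2 := Wf_right (scaled (INR M) k) ltac:(lra)).
   apply Rabs_le_between in A. set (sk := scaled (INR M) k) in *.
   apply Rle_trans with ((2 * Wf sk) ^ 2); [apply pow_incr; lra|].
   apply Rle_trans with (4 * / (8 * sk)); [nra|].
   replace (4 * / (8 * sk)) with (/ (2 * sk)) by (field; lra). apply Rinv_le_contravar; lra.
Qed.

(** Since [q'' - q = (2 q^2 + s - 1) q >= 0], the function [(q' + q) exp (- s)] increases. Were it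
    positive at one point, [q] would stay bounded away from 0 to the right, against [q^2 <= 1/s].
    Integrating [q' <= - q] gives the exponential bound. *)
Lemma q_decay : exists X, 1 <= X /\ (forall s, X <= s -> 0 < q s /\ q s ^ 2 <= / s /\ dq s <= - q s) /\
 forall s y, X <= s <= y -> q y <= q s * exp (- (y - s)).
Proof.
 destruct q_right_bounds as [X [HX H]]. exists X. split; [auto|].
 assert (Hg : forall s, X <= s -> dq s <= - q s).
 { intros s1 Hs1. apply Rnot_lt_le; intros HH.
  set (g := fun s => (dq s + q s) * exp (- s)).
  assert (Dg : forall s, is_derive g s ((2 * q s ^ 3 + s * q s - q s) * exp (- s))).
  { intros s. unfold g. assert (E1 := Hq1 s). assert (E2 := Hq2 s). auto_derive.
   - repeat split; eexists; eassumption.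
   - rewrite (Derive_eta _ _ _ E1).
    rewrite (Derive_eta _ _ _ E2).
    ring. }
  set (gam := dq s1 + q s1). assert (Hgam : 0 < gam) by (unfold gam; lra).
  assert (Hgg : forall s, s1 <= s -> gam <= dq s + q s).
  { intros s Hs. destruct (Req_dec s s1) as [->|Hne]; [unfold gam; lra|].
   destruct (mean_value g _ s1 s ltac:(lra) (fun x _ => Dg x)) as [z [Hz E]].
   assert (0 <= g s - g s1).
   { rewrite E. destruct (H z ltac:(lra)) as [P _]. apply Rmult_le_pos; [|lra].
    apply Rmult_le_pos; [|pos]. nra. }
   unfold g in H0. fold gam in H0.
   assert (exp (- s) <= exp (- s1)) by (left; apply exp_increasing; lra).
   assert (P := exp_pos (- s)). nra. }
  (* Far enough that [q s2 >= gam/2], while [1/s2 < gam^2/4]. *)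
  set (s2 := s1 + 1 + 16 / gam ^ 2). assert (0 < 16 / gam ^ 2) by pos.
  assert (Hf : gam * exp s2 - gam * exp s1 <= q s2 * exp s2 - q s1 * exp s1).
  { apply (deriv_le (fun s => gam * exp s) (fun s => q s * exp s) (fun s => gam * exp s) (fun s => (dq s + q s) * exp s) s1 s2).
   - unfold s2; lra.
   - intros; auto_derive; auto. ring.
   - intros x Hx. assert (E1 := Hq1 x). auto_derive.
    + eexists; exact E1.
    + rewrite (Derive_eta _ _ _ E1). ring.
   - intros x Hx. mul_r. apply Hgg; lra. }
  destruct (H s1 Hs1) as [P1 _]. destruct (H s2 ltac:(unfold s2; lra)) as [P2 P3].
  assert (Pe1 := exp_pos s1).
  assert (He : 2 * exp s1 <= exp s2).
  { replace s2 with (s1 + (1 + 16 / gam ^ 2)) by (unfold s2; ring). rewrite exp_plus.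
   assert (2 <= exp (1 + 16 / gam ^ 2)) by (eapply Rle_trans; [|apply exp_ineq1_le]; lra). nra. }
  assert (gam / 2 <= q s2).
  { apply (Rmult_le_reg_r (exp s2)); [lra|]. nra. }
  assert (Hg4 : gam ^ 2 / 4 <= q s2 ^ 2) by nra.
  assert (Hs2 : / s2 < gam ^ 2 / 4).
  { apply (Rmult_lt_reg_r s2); [unfold s2; lra|]. rewrite Rinv_l by (unfold s2; lra).
   assert (gam ^ 2 / 4 * (16 / gam ^ 2) = 4) by (field; lra).
   unfold s2. nra. }
  lra. }
 split.
 - intros s Hs. destruct (H s Hs). auto.
 - intros s y Hsy.
  assert (D : forall x, is_derive (fun x => q x * exp x) x ((dq x + q x) * exp x)).
  { intros x. assert (E1 := Hq1 x). auto_derive.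
   - eexists; exact E1.
   - rewrite (Derive_eta _ _ _ E1). ring. }
  assert (L : q y * exp y - q s * exp s <= 0 - 0).
  { apply (deriv_le (fun x => q x * exp x) (fun _ => 0) (fun x => (dq x + q x) * exp x) (fun _ => 0) s y); [lra|intros; apply D| |].
   - intros; auto_derive; auto.
   - intros x Hx. assert (A := Hg x ltac:(lra)). assert (P := exp_pos x). nra. }
  replace (- (y - s)) with (s + - y) by ring. rewrite exp_plus, exp_Ropp.
  assert (P := exp_pos y). apply (Rmult_le_reg_r (exp y)); [lra|].
  replace (q s * (exp s * / exp y) * exp y) with (q s * exp s) by (field; lra). lra.
Qed.

End Right.

(* A discrete substitute for the mean value theorem: if increments cannot jump across [-c, c],
  one of them lies in [-c, c]. *)
Lemma small_increment_exists (E : nat -> R) (n : nat) (eta c : R) :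
 0 < c -> Rabs (E O) <= eta -> Rabs (E n) <= eta -> 2 * eta < INR n * c ->
 (forall i, (S i < n)%nat -> E (S i) - E i > c -> E (S (S i)) - E (S i) >= - c) ->
 (forall i, (S i < n)%nat -> E (S i) - E i < - c -> E (S (S i)) - E (S i) <= c) ->
 exists i, (i < n)%nat /\ Rabs (E (S i) - E i) <= c.
Proof.
 intros Hc H0 Hn Hnc Hp Hm.
 destruct (Classical_Prop.classic (exists i, (i < n)%nat /\ Rabs (E (S i) - E i) <= c)) as [|Hno]; [auto|exfalso].
 assert (Hbig : forall i, (i < n)%nat -> c < E (S i) - E i \/ E (S i) - E i < - c).
 { intros i Hi. destruct (Rlt_dec c (E (S i) - E i)); [auto|]. destruct (Rlt_dec (E (S i) - E i) (- c)); [auto|].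
  exfalso. apply Hno. exists i. split; [auto|]. apply Rabs_le; lra. }
 apply Rabs_le_between in H0. apply Rabs_le_between in Hn.
 destruct n as [|n]; [simpl in Hnc; lra|].
 destruct (Hbig O ltac:(lia)) as [Hs|Hs].
 - assert (Hall : forall i, (i < S n)%nat -> c < E (S i) - E i).
  { induction i; intros Hi; [auto|]. assert (A := IHi ltac:(lia)).
   assert (B := Hp i Hi A). destruct (Hbig (S i) Hi); [auto|lra]. }
  assert (Hsum : forall i, (i <= S n)%nat -> INR i * c <= E i - E O).
  { induction i; intros Hi; [simpl; lra|]. rewrite S_INR. assert (A := IHi ltac:(lia)).
   assert (B := Hall i ltac:(lia)). lra. }
  assert (A := Hsum (S n) ltac:(lia)). lra.
 - assert (Hall : forall i, (i < S n)%nat -> E (S i) - E i < - c).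
  { induction i; intros Hi; [auto|]. assert (A := IHi ltac:(lia)).
   assert (B := Hm i Hi A). destruct (Hbig (S i) Hi); [lra|auto]. }
  assert (Hsum : forall i, (i <= S n)%nat -> INR i * c <= E O - E i).
  { induction i; intros Hi; [simpl; lra|]. rewrite S_INR. assert (A := IHi ltac:(lia)).
   assert (B := Hall i ltac:(lia)). lra. }
  assert (A := Hsum (S n) ltac:(lia)). lra.
Qed.

Lemma psum_shift (f : nat -> R) n : psum f (S n) = f O + psum (fun i => f (S i)) n.
Proof. change (S n) with (1 + n)%nat. rewrite psum_split. cbn [psum]. simpl Nat.add. lra. Qed.

(* [U] and [Y] are listed towards decreasing argument; [rho = Y/U - 1] satisfies an equation whose
  solution operator is a contraction because the sum of the [U_i^2] is small. *)
Lemma ratio_contraction (U Y : nat -> R) (D : nat) (m lam eta C umin : R) :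
 0 < m -> 0 < lam < 1 -> 1 <= m * (1 - lam ^ 2) -> 0 < eta -> 8 * eta <= / 2 -> 0 <= C -> 0 < umin ->
 (forall d, (d <= S D)%nat -> umin <= U d /\ U d ^ 2 <= / 64) ->
 (forall d, (d <= D)%nat -> U d <= lam * U (S d)) ->
 (forall d, (d < D)%nat -> Rabs (Y (S d) / U (S d) - 1) <= / 2 ->
   Rabs ((U (S d) * Y d - Y (S d) * U d) - (U (S (S d)) * Y (S d) - Y (S (S d)) * U (S d)))
    <= 8 / m ^ 2 * U (S d) ^ 4 * Rabs (Y (S d) / U (S d) - 1) + C / m ^ 3) ->
 Rabs (Y O / U O - 1) <= eta -> Rabs (Y 1%nat / U 1%nat - Y O / U O) <= 4 * eta / m ->
 (INR D + 1) ^ 2 * (C / m ^ 3) / umin ^ 2 <= eta ->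
 forall d, (d <= S D)%nat -> Rabs (Y d / U d - 1) <= 8 * eta.
Proof.
 intros Hm Hl Hml He He8 HC Hu HU HUl Hstep H0 H1 HCm.
 set (rho := fun d => Y d / U d - 1). set (V := fun d => U (S d) * Y d - Y (S d) * U d).
 assert (Pu : forall d, (d <= S D)%nat -> 0 < U d) by (intros d Hd; destruct (HU d Hd); lra).
 assert (Erho : forall d, (d <= D)%nat -> rho d - rho (S d) = V d / (U d * U (S d))).
 { intros d Hd. unfold rho, V. assert (A := Pu d ltac:(lia)). assert (B := Pu (S d) ltac:(lia)). field. lra. }
 assert (Hsq : forall n, (n <= S D)%nat -> psum (fun i => U i ^ 2) (S n) <= m * U n ^ 2).
 { induction n; intros Hn.
  - cbn [psum].
   assert (1 <= m) by (assert (0 <= m * lam ^ 2) by pos; lra).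
   assert (1 * U O ^ 2 <= m * U O ^ 2) by (mul_r; lra). lra.
  - assert (A := IHn ltac:(lia)). change (psum (fun i => U i ^ 2) (S (S n))) with
    (psum (fun i => U i ^ 2) (S n) + U (S n) ^ 2).
   assert (B := HUl n ltac:(lia)). assert (P := Pu n ltac:(lia)).
   assert (U n ^ 2 <= lam ^ 2 * U (S n) ^ 2).
   { replace (lam ^ 2 * U (S n) ^ 2) with ((lam * U (S n)) ^ 2) by ring. apply pow_incr; lra. }
   assert (m * U n ^ 2 <= m * (lam ^ 2 * U (S n) ^ 2)) by (mul_l; lra).
   assert (1 * U (S n) ^ 2 <= m * (1 - lam ^ 2) * U (S n) ^ 2) by (mul_r; lra). lra. }
 assert (Hlam : forall n, (n <= S D)%nat -> U O <= lam ^ n * U n).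
 { induction n; intros Hn; [simpl; lra|]. apply Rle_trans with (1 := IHn ltac:(lia)).
  simpl. rewrite (Rmult_comm lam), Rmult_assoc. mul_l. apply HUl; lia. }
 assert (Hmono : forall n, (n <= D)%nat -> U n <= U (S n)).
 { intros n Hn. assert (A := HUl n Hn). assert (B := Pu (S n) ltac:(lia)). nra. }
 assert (HV0 : Rabs (V O) <= U O * U 1%nat * (4 * eta / m)).
 { assert (A := Erho O ltac:(lia)). assert (P0 := Pu O ltac:(lia)). assert (P1 := Pu 1%nat ltac:(lia)).
  replace (V O) with (U O * U 1%nat * (rho O - rho 1%nat)) by (rewrite A; field; lra).
  rewrite Rabs_mult, (Rabs_pos_eq (U O * U 1%nat)) by nra.
  mul_l. unfold rho. rewrite Rabs_minus_sym.
  replace (Y 1%nat / U 1%nat - 1 - (Y O / U O - 1)) with (Y 1%nat / U 1%nat - Y O / U O) by ring. auto. }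
 assert (Hw : forall n, (n <= D)%nat ->
  Rabs (V n) <= U O * U 1%nat * (4 * eta / m) + 64 * eta / m ^ 2 * psum (fun i => U (S i) ^ 4) n + INR n * (C / m ^ 3) ->
  Rabs (rho n - rho (S n)) <= 4 * eta / m * (lam ^ 2) ^ n + 64 * eta / m * U n ^ 2 + INR n * (C / m ^ 3) / umin ^ 2).
 { intros n Hn HV. rewrite (Erho n Hn). assert (P0 := Pu n ltac:(lia)). assert (P1 := Pu (S n) ltac:(lia)).
  assert (PP : 0 < U n * U (S n)) by nra.
  unfold Rdiv at 1. rewrite Rabs_mult, (Rabs_pos_eq (/ (U n * U (S n)))) by pos.
  apply div_le; [pos|].
  apply Rle_trans with (1 := HV). rewrite !Rmult_plus_distr_r.
  assert (em : 0 < eta / m) by pos.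
  apply Rplus_le_compat; [apply Rplus_le_compat|].
  - assert (A := Hlam n ltac:(lia)). assert (B := Hlam (S n) ltac:(lia)).
   assert (U 1%nat <= lam ^ n * U (S n)).
   { clear - HUl Hl Hn Pu. induction n; [simpl; lra|]. apply Rle_trans with (1 := IHn ltac:(lia)).
    simpl pow. rewrite (Rmult_comm lam), Rmult_assoc. mul_l. apply HUl; lia. }
   assert (P00 := Pu O ltac:(lia)). assert (P01 := Pu 1%nat ltac:(lia)).
   rewrite <- pow_mult. replace (2 * n)%nat with (n + n)%nat by lia. rewrite pow_add.
   apply Rle_trans with ((lam ^ n * U n) * (lam ^ n * U (S n)) * (4 * eta / m)).
   + apply Rmult_le_compat_r; [unfold Rdiv in *; lra|]. apply Rmult_le_compat; lra.
   + right. ring.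
  - assert (A : psum (fun i => U (S i) ^ 4) n <= U n * U (S n) * (m * U n ^ 2)).
   { apply Rle_trans with (U n * U (S n) * psum (fun i => U i ^ 2) (S n)).
    - rewrite <- psum_scal. apply Rle_trans with (psum (fun i => U n * U (S n) * U (S i) ^ 2) n).
     + apply psum_le. intros i Hi. replace (U (S i) ^ 4) with (U (S i) * U (S i) * U (S i) ^ 2) by ring.
      mul_r.
      assert (Hmm : forall a b, (a <= b)%nat -> (b <= S D)%nat -> U a <= U b).
      { intros a b Hab. induction Hab; intros Hb; [lra|]. apply Rle_trans with (1 := IHHab ltac:(lia)). apply Hmono; lia. }
      assert (C1 := Hmm (S i) n ltac:(lia) ltac:(lia)). assert (C2 := Hmm (S i) (S n) ltac:(lia) ltac:(lia)).
      assert (C3 := Pu (S i) ltac:(lia)). apply Rmult_le_compat; lra.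
     + rewrite psum_shift.
      assert (0 <= U n * U (S n) * U O ^ 2) by pos. lra.
    - mul_l. apply Hsq; lia. }
   apply Rle_trans with (64 * eta / m ^ 2 * (U n * U (S n) * (m * U n ^ 2))).
   + apply Rmult_le_compat_l; [|auto]. apply Rmult_le_pos; [lra|pos].
   + right. field. lra.
  - destruct (HU n ltac:(lia)) as [B1 _]. destruct (HU (S n) ltac:(lia)) as [B2 _].
   apply (Rmult_le_reg_r (umin ^ 2)); [pos|].
   replace (INR n * (C / m ^ 3) / umin ^ 2 * (U n * U (S n)) * umin ^ 2)
    with (INR n * (C / m ^ 3) * (U n * U (S n))) by (field; lra).
   mul_l. nra. }
 (* Proved together because the bound on [V] yields the increment of [rho], and
    [|rho| <= 8 eta <= 1/2] is what permits the next step of [V]. The budget is [eta] for the start,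
    [4 eta] for the initial increment, and [eta] each for the nonlinearity and the residual. *)
 assert (Hmain : forall n, (n <= D)%nat ->
  Rabs (V n) <= U O * U 1%nat * (4 * eta / m) + 64 * eta / m ^ 2 * psum (fun i => U (S i) ^ 4) n + INR n * (C / m ^ 3)
  /\ Rabs (rho (S n)) <= eta + 4 * eta / m * psum (fun i => (lam ^ 2) ^ i) (S n)
     + 64 * eta / m * psum (fun i => U i ^ 2) (S n) + INR (S n) * (INR D * (C / m ^ 3) / umin ^ 2)
  /\ Rabs (rho (S n)) <= 8 * eta).
 { assert (em : 0 < eta / m) by pos.
  assert (Hfin : forall n, (n <= D)%nat ->
    eta + 4 * eta / m * psum (fun i => (lam ^ 2) ^ i) (S n)
     + 64 * eta / m * psum (fun i => U i ^ 2) (S n) + INR (S n) * (INR D * (C / m ^ 3) / umin ^ 2) <= 8 * eta).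
  { intros n Hn.
   assert (A1 : psum (fun i => (lam ^ 2) ^ i) (S n) <= m).
   { assert (Hq2 : 0 < lam ^ 2 < 1) by (split; nra).
    apply Rle_trans with (1 := geom_sum_bound (lam ^ 2) (S n) Hq2).
    apply (Rmult_le_reg_r (1 - lam ^ 2)); [lra|]. rewrite Rinv_l; lra. }
   assert (A2 := Hsq n ltac:(lia)). destruct (HU n ltac:(lia)) as [_ A3].
   assert (A4 : 4 * eta / m * psum (fun i => (lam ^ 2) ^ i) (S n) <= 4 * eta).
   { apply Rle_trans with (4 * eta / m * m); [|right; field; lra]. apply Rmult_le_compat_l; [unfold Rdiv in *; lra|auto]. }
   assert (A5 : 64 * eta / m * psum (fun i => U i ^ 2) (S n) <= eta).
   { apply Rle_trans with (64 * eta / m * (m * / 64)); [|right; field; lra].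
    apply Rmult_le_compat_l; [unfold Rdiv in *; lra|]. apply Rle_trans with (1 := A2). mul_l; lra. }
   assert (A6 : INR (S n) * (INR D * (C / m ^ 3) / umin ^ 2) <= eta).
   { apply Rle_trans with (2 := HCm). rewrite S_INR. apply le_INR in Hn. assert (B := pos_INR n).
    replace (INR D * (C / m ^ 3) / umin ^ 2) with (INR D * (C / m ^ 3 / umin ^ 2)) by (unfold Rdiv; ring).
    replace ((INR D + 1) ^ 2 * (C / m ^ 3) / umin ^ 2) with ((INR D + 1) * ((INR D + 1) * (C / m ^ 3 / umin ^ 2))) by (unfold Rdiv; ring).
    apply Rmult_le_compat; [lra| |lra|].
    - pos.
    - mul_r; lra. }
   lra. }
  induction n as [|n IH]; intros Hn.
  - assert (B0 : Rabs (V 0%nat) <= U O * U 1%nat * (4 * eta / m) + 64 * eta / m ^ 2 * psum (fun i => U (S i) ^ 4) 0 + INR 0 * (C / m ^ 3)).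
   { cbn [psum]. simpl INR. lra. }
   split; [exact B0|].
   assert (W := Hw O ltac:(lia) B0).
   assert (R1 : Rabs (rho 1%nat) <= eta + 4 * eta / m * psum (fun i => (lam ^ 2) ^ i) 1
     + 64 * eta / m * psum (fun i => U i ^ 2) 1 + INR 1 * (INR D * (C / m ^ 3) / umin ^ 2)).
   { cbn [psum]. simpl INR in *. simpl ((lam ^ 2) ^ 0) in *.
    replace (rho 1%nat) with (rho O - (rho O - rho 1%nat)) by ring.
    assert (T := Rabs_triang (rho O) (- (rho O - rho 1%nat))). rewrite Rabs_Ropp in T.
    unfold Rminus at 1. apply Rle_trans with (1 := T).
    assert (0 <= INR D * (C / m ^ 3) / umin ^ 2).
    { apply Rmult_le_pos; [pos|pos]. }
    change (Rabs (rho O) <= eta) in H0. unfold Rdiv in *. lra. }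
   split; [exact R1|]. apply Rle_trans with (1 := R1). apply Hfin; lia.
  - destruct (IH ltac:(lia)) as (IV & IR & I8).
   assert (Hs := Hstep n ltac:(lia)). change (Y (S n) / U (S n) - 1) with (rho (S n)) in Hs.
   assert (Hs' := Hs ltac:(lra)).
   change (U (S n) * Y n - Y (S n) * U n) with (V n) in Hs'.
   change (U (S (S n)) * Y (S n) - Y (S (S n)) * U (S n)) with (V (S n)) in Hs'.
   assert (U4 : 0 <= U (S n) ^ 4) by (replace (U (S n) ^ 4) with ((U (S n) ^ 2) ^ 2) by ring; pos).
   assert (m2 : 0 < / m ^ 2) by pos.
   assert (BV : Rabs (V (S n)) <= U O * U 1%nat * (4 * eta / m) + 64 * eta / m ^ 2 * psum (fun i => U (S i) ^ 4) (S n) + INR (S n) * (C / m ^ 3)).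
   { cbn [psum]. rewrite S_INR.
    replace (V (S n)) with (V n + - (V n - V (S n))) by ring.
    eapply Rle_trans; [apply Rabs_triang|]. rewrite Rabs_Ropp.
    assert (8 / m ^ 2 * U (S n) ^ 4 * Rabs (rho (S n)) <= 8 / m ^ 2 * U (S n) ^ 4 * (8 * eta)).
    { apply Rmult_le_compat_l; [|auto]. apply Rmult_le_pos; [unfold Rdiv; lra|auto]. }
    replace (8 / m ^ 2 * U (S n) ^ 4 * (8 * eta)) with (64 * eta / m ^ 2 * U (S n) ^ 4) in H by (unfold Rdiv; ring).
    lra. }
   split; [exact BV|].
   assert (W := Hw (S n) Hn BV).
   assert (R1 : Rabs (rho (S (S n))) <= eta + 4 * eta / m * psum (fun i => (lam ^ 2) ^ i) (S (S n))
     + 64 * eta / m * psum (fun i => U i ^ 2) (S (S n)) + INR (S (S n)) * (INR D * (C / m ^ 3) / umin ^ 2)).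
   { change (psum (fun i => (lam ^ 2) ^ i) (S (S n))) with (psum (fun i => (lam ^ 2) ^ i) (S n) + (lam ^ 2) ^ S n).
    change (psum (fun i => U i ^ 2) (S (S n))) with (psum (fun i => U i ^ 2) (S n) + U (S n) ^ 2).
    rewrite (S_INR (S n)).
    replace (rho (S (S n))) with (rho (S n) - (rho (S n) - rho (S (S n)))) by ring.
    assert (T := Rabs_triang (rho (S n)) (- (rho (S n) - rho (S (S n))))). rewrite Rabs_Ropp in T.
    unfold Rminus at 1. apply Rle_trans with (1 := T).
    assert (INR (S n) * (C / m ^ 3) / umin ^ 2 <= INR D * (C / m ^ 3) / umin ^ 2).
    { mul_r.
     mul_r. apply le_INR; lia. }
    lra. }
   split; [exact R1|]. apply Rle_trans with (1 := R1). apply Hfin; lia. }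
 intros d Hd. destruct d as [|d].
 - lra.
 - apply (Hmain d). lia.
Qed.

Lemma discrete_gronwall (a : nat -> R) (D : nat) (L c : R) : 0 <= L -> 0 <= c -> 0 <= a O ->
 (forall d, (d < D)%nat -> a (S d) <= (1 + L) * a d + c) ->
 forall d, (d <= D)%nat -> a d <= exp (L * INR d) * (a O + c * INR d).
Proof.
 intros HL Hc H0 Hs. induction d as [|d IH]; intros Hd.
 - simpl. rewrite !Rmult_0_r, exp_0. lra.
 - apply Rle_trans with (1 := Hs d Hd). assert (A := IH ltac:(lia)).
  replace (L * INR (S d)) with (L * INR d + L) by (rewrite S_INR; ring).
  replace (c * INR (S d)) with (c * INR d + c) by (rewrite S_INR; ring).
  rewrite exp_plus.
  assert (E := exp_ineq1_le L).
  assert (P1 : 1 <= exp (L * INR d)).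
  { rewrite <- exp_0. assert (0 <= L * INR d) by pos.
   apply exp_mono; lra. }
  set (e := exp (L * INR d)) in *. set (b := a O + c * INR d) in *.
  assert (Hb : 0 <= b) by (unfold b; assert (0 <= c * INR d) by pos; lra).
  replace (a O + (c * INR d + c)) with (b + c) by (unfold b; ring).
  apply Rle_trans with ((1 + L) * (e * b) + c); [apply Rplus_le_compat_r, Rmult_le_compat_l; lra|].
  assert ((1 + L) * (e * b) <= exp L * (e * b)) by (apply Rmult_le_compat_r; [pos|lra]).
  assert (1 * 1 <= e * exp L) by (apply Rmult_le_compat; lra).
  assert (1 * 1 * c <= e * exp L * c) by (mul_r; lra).
  replace (e * exp L * (b + c)) with (exp L * (e * b) + e * exp L * c) by ring. lra.
Qed.

Lemma compact_bound (f : R -> R) (a b : R) : (forall x, continuity_pt f x) ->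
 exists B, 0 < B /\ forall x, a <= x <= b -> Rabs (f x) <= B.
Proof.
 intros Cf. destruct (Rle_dec a b) as [Hab|Hab].
 2:{ exists 1. split; [lra|]. intros; lra. }
 destruct (continuity_ab_maj (fun x => Rabs (f x)) a b Hab) as [z [Hz _]].
 { intros c _. apply (continuity_pt_comp f Rabs); [apply Cf|apply Rcontinuity_abs]. }
 exists (Rabs (f z) + 1). split; [generalize (Rabs_pos (f z)); lra|].
 intros x Hx. specialize (Hz x Hx). cbv beta in Hz. lra.
Qed.

Lemma painleve_taylor (q dq : R -> R) (a b : R) :
 (forall x, is_derive q x (dq x)) -> (forall x, is_derive dq x (2 * q x ^ 3 + x * q x)) ->
 exists L, 0 < L /\ forall s d, a <= s <= b -> 0 < d <= 1 ->
  Rabs (q (s + d) + q (s - d) - 2 * q s - d ^ 2 * (2 * q s ^ 3 + s * q s)) <= L * d ^ 3.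
Proof.
 intros H1 H2.
 set (f3 := fun x => 6 * q x ^ 2 * dq x + q x + x * dq x).
 assert (Df : forall x, is_derive (fun x => 2 * q x ^ 3 + x * q x) x (f3 x)).
 { intros x. assert (E1 := H1 x). auto_derive; [repeat split; eexists; exact E1|].
  rewrite (Derive_eta _ _ _ E1).
  unfold f3. ring. }
 assert (Cq : forall x, continuity_pt q x) by (intros; eapply is_derive_continuity_pt; apply H1).
 assert (Cdq : forall x, continuity_pt dq x) by (intros; eapply is_derive_continuity_pt; apply H2).
 destruct (compact_bound f3 (a - 1) (b + 1)) as [L [HL HB]].
 { intros x. unfold f3.
  apply (continuity_pt_plus (fun x => 6 * q x ^ 2 * dq x + q x) (fun x => x * dq x)).
  - apply (continuity_pt_plus (fun x => 6 * q x ^ 2 * dq x) q); [|apply Cq].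
   apply (continuity_pt_mult (fun x => 6 * q x ^ 2) dq); [|apply Cdq].
   apply continuity_pt_ext with (fun x => 6 * (q x * q x)); [intros; ring|].
   apply (continuity_pt_scal (fun x => q x * q x)). apply continuity_pt_mult; apply Cq.
  - apply (continuity_pt_mult (fun x => x) dq); [apply continuity_pt_id|apply Cdq]. }
 exists L. split; [auto|]. intros s d Hs Hd.
 set (c := 2 * q s ^ 3 + s * q s).
 assert (A := second_diff_bound (fun x => q x - c * x ^ 2 / 2) (fun x => dq x - c * x)
   (fun x => (2 * q x ^ 3 + x * q x) - c) s d (L * d) ltac:(lra)).
 replace (q (s + d) + q (s - d) - 2 * q s - d ^ 2 * c) with
  (q (s + d) - c * (s + d) ^ 2 / 2 + (q (s - d) - c * (s - d) ^ 2 / 2) - 2 * (q s - c * s ^ 2 / 2)) by field.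
 replace (L * d ^ 3) with (L * d * d ^ 2) by ring. apply A.
 - intros x _. apply derive_minus; [apply H1|auto_derive; auto; field].
 - intros x _. apply derive_minus; [apply H2|auto_derive; auto; ring].
 - intros x Hx. apply Rle_trans with (L * Rabs (x - s)).
  + unfold c. apply (bounded_variation (fun x => 2 * q x ^ 3 + x * q x) f3 L s x).
   intros y Hy. split; [apply Df|]. apply HB.
   assert (Rabs (x - s) <= d) by (apply Rabs_le; lra).
   assert (Hy' : Rabs (y - s) <= d) by lra. apply Rabs_le_between in Hy'. lra.
  + mul_l. apply Rabs_le; lra.
Qed.

Definition Xs (m : R) (k : nat) : R := m * dp k (m ^ 3).

Lemma scaled_pred m k : 0 < m -> (0 < k)%nat -> scaled m (pred k) = scaled m k - / m.
Proof. intros Hm Hk. destruct k as [|k]; [lia|]. rewrite scaled_S by auto. simpl pred. ring. Qed.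

Lemma scaled_le m j k : 0 < m -> (j <= k)%nat -> scaled m j <= scaled m k.
Proof.
 intros Hm Hjk. unfold scaled. mul_r.
 apply le_INR in Hjk. lra.
Qed.

Lemma scaled_lt_inv m j k : 0 < m -> scaled m j <= scaled m k -> (j <= k)%nat.
Proof.
 intros Hm H. apply INR_le. unfold scaled in H. apply (Rmult_le_compat_r m) in H; [|lra].
 unfold Rdiv in H. rewrite !Rmult_assoc, !Rinv_l, !Rmult_1_r in H by lra. lra.
Qed.

Lemma scaled_add m k d : 0 < m -> scaled m (k + d) = scaled m k + INR d / m.
Proof. intros Hm. unfold scaled. rewrite plus_INR. field. lra. Qed.

(** * Convergence of the scaled coefficients *)

Section Convergence.

Variables q dq : R -> R.
Hypothesis Hq1 : forall x, is_derive q x (dq x).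
Hypothesis Hq2 : forall x, is_derive dq x (2 * q x ^ 3 + x * q x).
Hypothesis HqA : airy_like q.

(** With [k/t = 2 + s/m^2] and [x = X/m], expanding [1/(1 - x^2)] turns the recurrence into a
    difference scheme for Painleve II. The sampled [q] satisfies the same scheme by Taylor's
    formula, both up to order [m^(-3)]. *)
Lemma residuals (a b : R) : exists B C m0, 1 <= B /\ 0 < C /\ 1 <= m0 /\ forall m k, m0 <= m -> a <= scaled m k <= b ->
 (0 < k)%nat /\ 0 < Xs m k <= B /\ Rabs (q (scaled m k)) <= B /\ Rabs (scaled m k) <= B /\
 Rabs (Xs m (S k) + Xs m (pred k) - 2 * Xs m k - Xs m k * (scaled m k + 2 * Xs m k ^ 2) / m ^ 2) <= C / m ^ 3 /\
 Rabs (q (scaled m (S k)) + q (scaled m (pred k)) - 2 * q (scaled m k)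
   - q (scaled m k) * (scaled m k + 2 * q (scaled m k) ^ 2) / m ^ 2) <= C / m ^ 3.
Proof.
 destruct (painleve_taylor q dq a b Hq1 Hq2) as [L [HL HT]].
 destruct (compact_bound q a b) as [Bq [HBq HB]].
 { intros; eapply is_derive_continuity_pt; apply Hq1. }
 set (A := Rabs a + Rabs b).
 assert (HA : 0 <= Rabs a /\ 0 <= Rabs b) by (split; apply Rabs_pos).
 set (B := 1 + A + Bq).
 exists B, (L + 6 * B ^ 5), (2 * B). unfold B at 1. assert (B1 : 1 <= B) by (unfold B, A; lra).
 assert (B5 : 0 < B ^ 5) by pos.
 split; [unfold A; lra|]. split; [lra|]. split; [lra|].
 intros m k Hm Hk. set (s := scaled m k) in *. set (t := m ^ 3). assert (Ht : 0 < t) by pos.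
 assert (im : 0 < / m <= 1).
 { split; [pos|]. apply Rinv_le_1; lra. }
 assert (HsA : Rabs s <= A).
 { unfold A. apply Rabs_le. generalize (Rle_abs a) (Rle_abs b) (Rle_abs (- a)) (Rle_abs (- b)). rewrite !Rabs_Ropp. lra. }
 assert (HsB : Rabs s <= B) by (unfold B; lra).
 assert (Ek : INR k = 2 * t + s * m) by (unfold s, scaled, t; field; lra).
 assert (Hk0 : (0 < k)%nat).
 { apply INR_lt. simpl INR. rewrite Ek. apply Rabs_le_between in HsB. unfold t. nra. }
 assert (HX : 0 < Xs m k <= B).
 { unfold Xs. fold t. split; [apply Rmult_lt_0_compat; [lra|now apply dp_range]|].
  assert (W := dp_le_Wf m k ltac:(lra)). fold t s in W. apply Rle_trans with (1 := W).
  assert (W2 := Wf_left s A ltac:(unfold A; lra) ltac:(apply Rabs_le_between in HsA; lra)).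
  apply Rnot_lt_le; intros HH. unfold B in *. nra. }
 split; [auto|]. split; [auto|].
 split; [apply Rle_trans with (1 := HB s Hk); unfold B, A; lra|].
 split; [auto|]. split.
 - set (X := Xs m k) in *. set (x := dp k t).
  assert (Ex : X = m * x) by reflexivity.
  assert (Hx : 0 < x <= B / m).
  { split; [now apply dp_range|]. apply (Rmult_le_reg_l m); [lra|]. rewrite <- Ex.
   replace (m * (B / m)) with B by (field; lra). lra. }
  assert (Hx2 : 0 <= x ^ 2 <= / 4) by (split; [pos|nra]).
  assert (E := dp_eqn' t Ht k Hk0). fold x in E.
  assert (ES : Xs m (S k) + Xs m (pred k) = X * ((2 + s * (/ m) ^ 2) / (1 - x ^ 2))).
  { unfold Xs. fold t. rewrite <- Rmult_plus_distr_l, <- E, Ek, Ex. unfold t. field. lra. }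
  rewrite ES.
  replace (X * ((2 + s * (/ m) ^ 2) / (1 - x ^ 2)) - 2 * X - X * (s + 2 * X ^ 2) / m ^ 2)
   with (X * ((s * (/ m) ^ 2 + 2 * x ^ 2) * x ^ 2 / (1 - x ^ 2))).
  2:{ rewrite Ex. field. lra. }
  set (i2 := (/ m) ^ 2). assert (Hi2 : 0 < i2) by pos.
  assert (Hx3 : x ^ 2 <= B ^ 2 * i2).
  { unfold i2. replace (B ^ 2 * (/ m) ^ 2) with ((B / m) ^ 2) by (field; lra). apply pow_incr; lra. }
  rewrite Rabs_mult, (Rabs_pos_eq X) by lra. unfold Rdiv at 1.
  rewrite !Rabs_mult, (Rabs_pos_eq (x ^ 2)), (Rabs_pos_eq (/ (1 - x ^ 2))) by (try (left; apply Rinv_0_lt_compat); lra).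
  assert (I1 : / (1 - x ^ 2) <= 2).
  { rewrite <- (Rinv_inv 2). apply Rinv_le_contravar; lra. }
  assert (I0 : 0 < / (1 - x ^ 2)) by pos.
  assert (I2 : Rabs (s * i2 + 2 * x ^ 2) <= 3 * B ^ 2 * i2).
  { eapply Rle_trans; [apply Rabs_triang|]. rewrite Rabs_mult, (Rabs_pos_eq i2), (Rabs_pos_eq (2 * x ^ 2)) by lra.
   assert (Rabs s * i2 <= B * i2) by (mul_r; lra).
   assert (B * i2 <= B ^ 2 * i2) by (mul_r; nra). lra. }
  assert (P2 : 0 <= Rabs (s * i2 + 2 * x ^ 2)) by apply Rabs_pos.
  apply Rle_trans with (B * (3 * B ^ 2 * i2 * (B ^ 2 * i2) * 2)).
  + apply Rmult_le_compat; try lra.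
   * pos.
   * apply Rmult_le_compat; try lra; [pos|]. apply Rmult_le_compat; lra.
  + replace (B * (3 * B ^ 2 * i2 * (B ^ 2 * i2) * 2)) with (6 * B ^ 5 * (/ m * (/ m) ^ 3)) by (unfold i2; ring).
   unfold Rdiv, t. rewrite <- pow_inv.
   assert (/ m * (/ m) ^ 3 <= 1 * (/ m) ^ 3) by (mul_r; lra).
   apply Rle_trans with (6 * B ^ 5 * (1 * (/ m) ^ 3)); [mul_l; lra|]. nra.
 - rewrite scaled_S, scaled_pred by (auto; lra). fold s.
  assert (T := HT s (/ m) Hk im).
  replace (q s * (s + 2 * q s ^ 2) / m ^ 2) with ((/ m) ^ 2 * (2 * q s ^ 3 + s * q s)) by (field; lra).
  apply Rle_trans with (1 := T). unfold Rdiv, t. rewrite <- pow_inv.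
  apply Rmult_le_compat_r; [left; pos|lra].
Qed.

Lemma exists_index_near (m s : R) : 1 <= m -> 0 <= s -> exists k, s <= scaled m k < s + / m.
Proof.
 intros Hm Hs. destruct (index_above m s ltac:(lra) Hs) as [k Hk]. exists k. unfold scaled. split.
 - apply (Rmult_le_reg_r m); [lra|]. unfold Rdiv. rewrite Rmult_assoc, Rinv_l; lra.
 - apply div_lt; [pos|].
  rewrite Rmult_plus_distr_r, Rinv_l; lra.
Qed.

Lemma ratio_nonlinearity (u X : R) : 0 < u -> Rabs (X / u - 1) <= / 2 ->
 Rabs (2 * (u * X * (X ^ 2 - u ^ 2))) <= 8 * u ^ 4 * Rabs (X / u - 1).
Proof.
 intros Hu Hr. set (r := X / u) in *. assert (EX : X = r * u) by (unfold r; field; lra).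
 replace (2 * (u * X * (X ^ 2 - u ^ 2))) with (u ^ 4 * (2 * r * (r + 1)) * (r - 1)) by (rewrite EX; ring).
 assert (H4 : 0 < u ^ 4) by pos.
 apply Rabs_le_between in Hr.
 rewrite !Rabs_mult, (Rabs_pos_eq (u ^ 4)), (Rabs_pos_eq 2), (Rabs_pos_eq r), (Rabs_pos_eq (r + 1)) by lra.
 mul_r. rewrite (Rmult_comm 8). mul_l. nra.
Qed.

Lemma converge_right : exists X0, 64 <= X0 /\ (forall s, X0 <= s -> 0 < q s <= / 8) /\
 forall eta b, 0 < eta -> exists M0, forall M k, M0 <= INR M -> X0 <= scaled (INR M) k <= b ->
  Rabs (Xs (INR M) k - q (scaled (INR M) k)) <= eta.
Proof.
 destruct (q_decay q dq Hq1 Hq2 HqA) as (X & HX1 & HX2 & HX3).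
 set (X0 := Rmax X 64). assert (X0a : X <= X0) by apply Rmax_l. assert (X0b : 64 <= X0) by apply Rmax_r.
 assert (Hsmall : forall s, X0 <= s -> 0 < q s /\ q s ^ 2 <= / 64).
 { intros s Hs. destruct (HX2 s ltac:(lra)) as (P1 & P2 & _). split; [auto|].
  apply Rle_trans with (1 := P2). apply Rinv_le_contravar; lra. }
 exists X0. split; [auto|]. split.
 { intros s Hs. destruct (Hsmall s Hs). split; [auto|]. apply Rnot_lt_le; intros HH. nra. }
 intros eta0 b He0.
 set (eta := Rmin eta0 (/ 16)). assert (He : 0 < eta) by (apply Rmin_glb_lt; lra).
 assert (He1 : eta <= eta0) by apply Rmin_l. assert (He2 : eta <= / 16) by apply Rmin_r.
 destruct (dp_close_to_q q HqA eta He) as (Y & HY1 & HY2).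
 set (sg := Rmax (Rmax X0 b) Y).
 assert (Hsg : X0 <= sg /\ b <= sg /\ Y <= sg).
 { unfold sg. split; [eapply Rle_trans; [apply Rmax_l|apply Rmax_l]|].
  split; [eapply Rle_trans; [apply Rmax_r|apply Rmax_l]|apply Rmax_r]. }
 destruct (HY2 sg ltac:(lra)) as (M1 & c & Hc & Htop).
 destruct (residuals X0 (sg + 2)) as (B & C & m0 & HB & HC & Hm0 & Hres).
 set (umin := q (sg + 3)). assert (Hum : 0 < umin) by (apply Hsmall; lra).
 assert (Hqmono : forall s y, X0 <= s <= y -> q y <= q s).
 { intros s y Hsy. apply Rle_trans with (1 := HX3 s y ltac:(lra)).
  destruct (Hsmall s ltac:(lra)). rewrite <- (Rmult_1_r (q s)) at 2. mul_l.
  rewrite <- exp_0. destruct (Req_dec s y) as [->|]; [replace (- (y - y)) with 0 by ring; lra|].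
  left. apply exp_increasing; lra. }
 set (C2 := 2 * B * C). assert (HC2 : 0 < C2) by (unfold C2; nra).
 (* [C3] bounds the increment of the discrete Wronskian on the top window *)
 set (C3 := 1 + C2).
 exists (5 + Rabs M1 + m0 + C3 / (4 * eta * umin ^ 2) + (sg + 4) ^ 2 * C2 / (umin ^ 2 * eta)).
 intros M k HM Hk. set (m := INR M) in *.
 assert (Hu2 : 0 < umin ^ 2) by pos.
 assert (A1 : 0 <= C3 / (4 * eta * umin ^ 2)).
 { apply Rmult_le_pos; [unfold C3; lra|left; apply Rinv_0_lt_compat]. pos. }
 assert (A2 : 0 <= (sg + 4) ^ 2 * C2 / (umin ^ 2 * eta)).
 { apply Rmult_le_pos; [pos|left; apply Rinv_0_lt_compat; nra]. }
 assert (A3 := Rabs_pos M1). assert (A4 := Rle_abs M1).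
 assert (Hm5 : 5 < m) by lra. assert (HmM1 : M1 <= m) by lra. assert (Hmm0 : m0 <= m) by lra.
 assert (HmC3 : C3 <= 4 * eta * umin ^ 2 * m).
 { apply Rle_trans with (4 * eta * umin ^ 2 * (C3 / (4 * eta * umin ^ 2))); [right; field; lra|].
  apply Rmult_le_compat_l; [|lra]. pos. }
 assert (HmC2 : (sg + 4) ^ 2 * C2 <= umin ^ 2 * eta * m).
 { apply Rle_trans with (umin ^ 2 * eta * ((sg + 4) ^ 2 * C2 / (umin ^ 2 * eta))); [right; field; lra|].
  apply Rmult_le_compat_l; [|lra]. pos. }
 assert (im : 0 < / m < / 5) by (split; [pos|apply Rinv_lt_contravar; lra]).
 set (u := fun j => q (scaled m j)). set (x := fun j => Xs m j).
 set (V := fun j => u j * x (S j) - x j * u (S j)).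
 assert (Hu0 : forall j, X0 <= scaled m j <= sg + 3 -> umin <= u j /\ u j ^ 2 <= / 64).
 { intros j Hj. split; [apply Hqmono; lra|]. apply Hsmall; lra. }
 assert (HV : forall j, X0 <= scaled m j <= sg + 2 ->
   Rabs (V j - V (pred j) - 2 * (u j * x j * (x j ^ 2 - u j ^ 2)) / m ^ 2) <= C2 / m ^ 3).
 { intros j Hj. destruct (Hres m j Hmm0 Hj) as (R0 & R1 & R2 & R3 & R4 & R5).
  destruct j as [|j]; [lia|]. simpl pred in *. unfold V.
  set (e1 := Xs m (S (S j)) + Xs m j - 2 * Xs m (S j) - Xs m (S j) * (scaled m (S j) + 2 * Xs m (S j) ^ 2) / m ^ 2) in *.
  set (e2 := q (scaled m (S (S j))) + q (scaled m j) - 2 * q (scaled m (S j))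
   - q (scaled m (S j)) * (scaled m (S j) + 2 * q (scaled m (S j)) ^ 2) / m ^ 2) in *.
  replace (u (S j) * x (S (S j)) - x (S j) * u (S (S j)) - (u j * x (S j) - x j * u (S j)) -
   2 * (u (S j) * x (S j) * (x (S j) ^ 2 - u (S j) ^ 2)) / m ^ 2) with (u (S j) * e1 + - (x (S j) * e2)).
  2:{ unfold e1, e2, u, x. field. lra. }
  eapply Rle_trans; [apply Rabs_triang|]. rewrite Rabs_Ropp, !Rabs_mult.
  change (Rabs (u (S j)) <= B) in R2. change (0 < x (S j) <= B) in R1. rewrite (Rabs_pos_eq (x (S j))) by lra.
  replace (C2 / m ^ 3) with (B * (C / m ^ 3) + B * (C / m ^ 3)) by (unfold C2; field; lra).
  apply Rplus_le_compat; apply Rmult_le_compat; try apply Rabs_pos; lra. }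
 assert (Hdx : forall j, X0 <= scaled m j <= sg + 2 -> x (S j) / u (S j) - x j / u j = V j / (u j * u (S j))).
 { intros j Hj. destruct (Hu0 j ltac:(lra)). assert (E := scaled_S m j ltac:(lra)).
  destruct (Hu0 (S j) ltac:(lra)). unfold V. field. lra. }
 assert (Hrho : forall j, sg <= scaled m j <= sg + 1 -> Rabs (x j / u j - 1) <= eta).
 { intros j Hj. destruct (Htop M j HmM1 Hj) as [T1 _]. fold m in T1. change (Rabs (x j - u j) <= eta * u j) in T1.
  destruct (Hu0 j ltac:(lra)). replace (x j / u j - 1) with ((x j - u j) * / u j) by (field; lra).
  rewrite Rabs_mult, (Rabs_pos_eq (/ u j)) by pos.
  apply div_le; lra. }
 destruct (exists_index_near m sg ltac:(lra) ltac:(lra)) as [kt Hkt].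
 assert (HM2 : (2 <= M)%nat) by (apply INR_le; fold m; simpl; lra).
 assert (Hwin : forall i, (i <= M - 2)%nat -> sg <= scaled m (kt + i) <= sg + 1 - / m).
 { intros i Hi. rewrite scaled_add by lra. assert (0 <= INR i / m) by pos.
  assert (INR i / m <= 1 - 2 * / m).
  { apply div_le; [pos|].
   rewrite Rmult_minus_distr_r, (Rmult_assoc 2), Rinv_l by lra. apply le_INR in Hi. rewrite minus_INR in Hi by auto.
   fold m in Hi. simpl INR in Hi. lra. }
  lra. }
 assert (Hjump : forall j, sg <= scaled m j <= sg + 1 -> Rabs (V j - V (pred j)) <= C3 / m ^ 2).
 { intros j Hj. assert (A := HV j ltac:(lra)). assert (A' := Hrho j Hj). destruct (Hu0 j ltac:(lra)) as [B1 B2].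
  assert (N := ratio_nonlinearity (u j) (x j) ltac:(lra) ltac:(lra)).
  assert (N2 : Rabs (2 * (u j * x j * (x j ^ 2 - u j ^ 2))) <= 1).
  { apply Rle_trans with (1 := N). replace (u j ^ 4) with (u j ^ 2 * u j ^ 2) by ring.
   assert (0 <= u j ^ 2) by apply pow2_ge_0.
   assert (0 <= u j ^ 2 * u j ^ 2 <= / 64) by (split; nra). nra. }
  set (w := 2 * (u j * x j * (x j ^ 2 - u j ^ 2))) in *.
  replace (V j - V (pred j)) with ((V j - V (pred j) - w / m ^ 2) + w / m ^ 2) by ring.
  eapply Rle_trans; [apply Rabs_triang|].
  assert (im2 : 0 < / m ^ 2) by pos.
  assert (Rabs (w / m ^ 2) <= 1 / m ^ 2).
  { unfold Rdiv. rewrite Rabs_mult, (Rabs_pos_eq (/ m ^ 2)) by lra. mul_r; lra. }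
  assert (C2 / m ^ 3 <= C2 / m ^ 2).
  { unfold Rdiv. mul_l. apply Rinv_le_contravar; [pos|].
   replace (m ^ 3) with (m ^ 2 * m) by ring. nra. }
  unfold C3. unfold Rdiv in *. lra. }
 (* The increment is [V / (u u')] and [V] moves by at most [C3/m^2] per step. An increment beyond
    [4 eta / m] forces [|V| >= C3/m^2] for large [m], so the next one cannot have the opposite
    sign. *)
 destruct (small_increment_exists (fun i => x (kt + i)%nat / u (kt + i)%nat - 1) (M - 2) eta (4 * eta / m)) as [i [Hi1 Hi2]].
 - pos.
 - apply Hrho. generalize (Hwin O ltac:(lia)); lra.
 - apply Hrho. generalize (Hwin (M - 2)%nat ltac:(lia)); lra.
 - rewrite minus_INR by auto. fold m. simpl INR. apply (Rmult_lt_reg_r m); [lra|].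
  replace ((m - (1 + 1)) * (4 * eta / m) * m) with ((m - 2) * 4 * eta) by (field; lra). nra.
 - intros i Hi Hd. cbv beta in *. rewrite !Nat.add_succ_r in *. set (j := (kt + i)%nat) in *.
  assert (W0 := Hwin i ltac:(lia)). assert (W1 := Hwin (S i) ltac:(lia)). fold j in W0. rewrite Nat.add_succ_r in W1. fold j in W1.
  assert (E0 := Hdx j ltac:(lra)). assert (E1 := Hdx (S j) ltac:(lra)).
  destruct (Hu0 j ltac:(lra)) as [U0 _]. destruct (Hu0 (S j) ltac:(lra)) as [U1 _].
  assert (SS2 := scaled_S m (S j) ltac:(lra)). destruct (Hu0 (S (S j)) ltac:(lra)) as [U2 _].
  replace (x (S j) / u (S j) - 1 - (x j / u j - 1)) with (V j / (u j * u (S j))) in Hd by lra.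
  replace (x (S (S j)) / u (S (S j)) - 1 - (x (S j) / u (S j) - 1)) with (V (S j) / (u (S j) * u (S (S j)))) by lra.
  assert (J := Hjump (S j) ltac:(lra)). simpl pred in J. apply Rabs_le_between in J.
  assert (P1 : umin ^ 2 <= u j * u (S j)) by nra.
  assert (HVj : C3 / m ^ 2 <= V j).
  { apply Rle_trans with (u j * u (S j) * (4 * eta / m)).
   - apply Rle_trans with (umin ^ 2 * (4 * eta / m)).
    + apply (Rmult_le_reg_r (m ^ 2)); [pos|].
     replace (C3 / m ^ 2 * m ^ 2) with C3 by (field; lra).
     replace (umin ^ 2 * (4 * eta / m) * m ^ 2) with (4 * eta * umin ^ 2 * m) by (field; lra). lra.
    + apply Rmult_le_compat_r; [|auto]. pos.
   - replace (V j) with (u j * u (S j) * (V j / (u j * u (S j)))) by (field; lra).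
    mul_l; lra. }
  assert (0 <= V (S j) / (u (S j) * u (S (S j)))).
  { pos. }
  assert (0 < 4 * eta / m) by pos. lra.
 - intros i Hi Hd. cbv beta in *. rewrite !Nat.add_succ_r in *. set (j := (kt + i)%nat) in *.
  assert (W0 := Hwin i ltac:(lia)). assert (W1 := Hwin (S i) ltac:(lia)). fold j in W0. rewrite Nat.add_succ_r in W1. fold j in W1.
  assert (E0 := Hdx j ltac:(lra)). assert (E1 := Hdx (S j) ltac:(lra)).
  destruct (Hu0 j ltac:(lra)) as [U0 _]. destruct (Hu0 (S j) ltac:(lra)) as [U1 _].
  assert (SS2 := scaled_S m (S j) ltac:(lra)). destruct (Hu0 (S (S j)) ltac:(lra)) as [U2 _].
  replace (x (S j) / u (S j) - 1 - (x j / u j - 1)) with (V j / (u j * u (S j))) in Hd by lra.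
  replace (x (S (S j)) / u (S (S j)) - 1 - (x (S j) / u (S j) - 1)) with (V (S j) / (u (S j) * u (S (S j)))) by lra.
  assert (J := Hjump (S j) ltac:(lra)). simpl pred in J. apply Rabs_le_between in J.
  assert (P1 : umin ^ 2 <= u j * u (S j)) by nra.
  assert (HVj : V j <= - (C3 / m ^ 2)).
  { apply Rle_trans with (- (u j * u (S j) * (4 * eta / m))).
   - replace (V j) with (- (u j * u (S j) * - (V j / (u j * u (S j))))) by (field; lra).
    apply Ropp_le_contravar. mul_l; lra.
   - apply Ropp_le_contravar. apply Rle_trans with (umin ^ 2 * (4 * eta / m)).
    + apply (Rmult_le_reg_r (m ^ 2)); [pos|].
     replace (C3 / m ^ 2 * m ^ 2) with C3 by (field; lra).
     replace (umin ^ 2 * (4 * eta / m) * m ^ 2) with (4 * eta * umin ^ 2 * m) by (field; lra). lra.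
    + apply Rmult_le_compat_r; [|auto]. pos. }
  assert (0 <= - V (S j) / (u (S j) * u (S (S j)))).
  { pos. }
  assert (0 < 4 * eta / m) by pos. unfold Rdiv in *. lra.
 - set (k1 := (kt + i)%nat). cbv beta in Hi2. rewrite Nat.add_succ_r in Hi2. fold k1 in Hi2.
  assert (Hk1 := Hwin i ltac:(lia)). fold k1 in Hk1.
  assert (HSk1 := scaled_S m k1 ltac:(lra)).
  assert (Hkk1 : (k <= k1)%nat) by (apply (scaled_lt_inv m); lra).
  set (D := (k1 - k)%nat).
  assert (Hidx : forall d, (d <= S D)%nat -> X0 <= scaled m (S k1 - d) <= sg + 1).
  { intros d Hd. split.
   - apply Rle_trans with (scaled m k); [lra|]. apply scaled_le; [lra|]. unfold D in Hd. lia.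
   - apply Rle_trans with (scaled m (S k1)); [apply scaled_le; [lra|lia]|]. lra. }
  (* The argument [d] counts steps leftwards from [S k1]. The exponential decay of [q] supplies the
     growth ratio [lam = exp (- 1/m)] in that direction. *)
  assert (RC := ratio_contraction (fun d => u (S k1 - d)%nat) (fun d => x (S k1 - d)%nat) D m (exp (- / m)) eta C2 umin).
  cbv beta in RC.
  assert (Hlam : 0 < exp (- / m) < 1).
  { split; [apply exp_pos|]. rewrite <- exp_0. apply exp_increasing. lra. }
  assert (Hfin : Rabs (x (S k1 - S D)%nat / u (S k1 - S D)%nat - 1) <= 8 * eta).
  { apply RC; auto; try lra; clear RC.
   - assert (E2 : exp (- / m) ^ 2 = / exp (2 * / m)).
    { rewrite <- exp_Ropp. replace (exp (- / m) ^ 2) with (exp (- / m) * exp (- / m)) by ring.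
     rewrite <- exp_plus. f_equal. ring. }
    rewrite E2. assert (E3 := exp_ineq1_le (2 * / m)).
    assert (/ exp (2 * / m) <= / (1 + 2 * / m)) by (apply Rinv_le_contravar; lra).
    assert (/ (1 + 2 * / m) <= 1 - / m).
    { apply (Rmult_le_reg_r (1 + 2 * / m)); [lra|]. rewrite Rinv_l by lra. nra. }
    apply Rle_trans with (m * (/ m)); [right; field; lra|]. mul_l; lra.
   - intros d Hd. apply Hu0. generalize (Hidx d Hd); lra.
   - intros d Hd. assert (I1 := Hidx (S d) ltac:(lia)).
    replace (S k1 - d)%nat with (S (S k1 - S d)) by lia. unfold u. rewrite scaled_S by lra.
    rewrite Rmult_comm. assert (Dq := HX3 (scaled m (S k1 - S d)) (scaled m (S k1 - S d) + / m) ltac:(lra)).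
    replace (- (scaled m (S k1 - S d) + / m - scaled m (S k1 - S d))) with (- / m) in Dq by ring. exact Dq.
   - intros d Hd Hr. assert (I1 := Hidx (S d) ltac:(lia)). set (j := (S k1 - S d)%nat) in *.
    replace (S k1 - d)%nat with (S j) by (unfold j; lia). replace (S k1 - S (S d))%nat with (pred j) by (unfold j; lia).
    assert (A := HV j ltac:(lra)). destruct (Hu0 j ltac:(lra)) as [B1 B2].
    assert (N := ratio_nonlinearity (u j) (x j) ltac:(lra) Hr).
    set (w := 2 * (u j * x j * (x j ^ 2 - u j ^ 2))) in *.
    replace (u j * x (S j) - x j * u (S j) - (u (pred j) * x j - x (pred j) * u j)) with (V j - V (pred j)).
    2:{ unfold V. replace (S (pred j)) with j by lia. ring. }
    replace (V j - V (pred j)) with (w / m ^ 2 + (V j - V (pred j) - w / m ^ 2)) by ring.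
    eapply Rle_trans; [apply Rabs_triang|]. apply Rplus_le_compat; [|exact A].
    unfold Rdiv at 1. assert (im2 : 0 < / m ^ 2) by pos.
    rewrite Rabs_mult, (Rabs_pos_eq (/ m ^ 2)) by lra.
    replace (8 / m ^ 2 * u j ^ 4 * Rabs (x j / u j - 1)) with (8 * u j ^ 4 * Rabs (x j / u j - 1) * / m ^ 2) by (field; destruct (Hu0 j ltac:(lra)); lra).
    mul_r; lra.
   - rewrite Nat.sub_0_r. apply Hrho. lra.
   - rewrite Nat.sub_0_r. replace (S k1 - 1)%nat with k1 by lia.
    rewrite Rabs_minus_sym. replace (x (S k1) / u (S k1) - x k1 / u k1) with
     (x (S k1) / u (S k1) - 1 - (x k1 / u k1 - 1)) by ring. exact Hi2.
   - assert (HD : INR D + 1 <= (sg + 4) * m).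
    { unfold D. rewrite minus_INR by auto.
     assert (scaled m k1 * m - scaled m k * m = INR k1 - INR k) by (unfold scaled; field; lra).
     assert (scaled m k1 * m <= (sg + 1) * m) by (mul_r; lra).
     assert (0 <= scaled m k * m) by pos. lra. }
    apply (Rmult_le_reg_r (umin ^ 2 * m)); [pos|].
    replace ((INR D + 1) ^ 2 * (C2 / m ^ 3) / umin ^ 2 * (umin ^ 2 * m)) with ((INR D + 1) ^ 2 * (C2 / m ^ 2)) by (field; lra).
    apply Rle_trans with (((sg + 4) * m) ^ 2 * (C2 / m ^ 2)).
    + apply Rmult_le_compat_r; [apply Rmult_le_pos; [lra|pos]|].
     apply pow_incr. split; [generalize (pos_INR D); lra|auto].
    + replace (((sg + 4) * m) ^ 2 * (C2 / m ^ 2)) with ((sg + 4) ^ 2 * C2) by (field; lra). lra. }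
  replace (S k1 - S D)%nat with k in Hfin by (unfold D; lia).
  change (Rabs (x k - u k) <= eta0).
  destruct (Hu0 k ltac:(lra)) as [B1 B2].
  replace (x k - u k) with ((x k / u k - 1) * u k) by (field; lra).
  rewrite Rabs_mult, (Rabs_pos_eq (u k)) by lra.
  generalize (Rabs_pos (x k / u k - 1)); nra.
Qed.

End Convergence.

Lemma INR_div_bound (D : nat) (m L : R) : 0 < m -> INR D / m <= L -> INR D <= L * m.
Proof.
 intros Hm H. apply (Rmult_le_compat_r m) in H; [|lra]. unfold Rdiv in H. rewrite Rmult_assoc, Rinv_l in H; lra.
Qed.

Lemma cubic_lipschitz (s u X B : R) : 0 <= B -> Rabs s <= B -> Rabs u <= B -> Rabs X <= B ->
 Rabs (X * (s + 2 * X ^ 2) - u * (s + 2 * u ^ 2)) <= (B + 6 * B ^ 2) * Rabs (X - u).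
Proof.
 intros HB Hs Hu HX.
 replace (X * (s + 2 * X ^ 2) - u * (s + 2 * u ^ 2)) with ((s + 2 * (X * X + X * u + u * u)) * (X - u)) by ring.
 rewrite Rabs_mult. mul_r.
 assert (P : forall a b, Rabs a <= B -> Rabs b <= B -> Rabs (a * b) <= B ^ 2).
 { intros a b Ha Hb. rewrite Rabs_mult. replace (B ^ 2) with (B * B) by ring.
  apply Rmult_le_compat; auto; apply Rabs_pos. }
 assert (P1 := P X X HX HX). assert (P2 := P X u HX Hu). assert (P3 := P u u Hu Hu).
 apply Rabs_le_between in P1. apply Rabs_le_between in P2. apply Rabs_le_between in P3.
 apply Rabs_le_between in Hs. apply Rabs_le. lra.
Qed.

(** Right of [X0] this is [converge_right]. To the left the error satisfies a linear second order
    difference inequality over about [len m] steps with coefficients of order [1/m^2], so Gronwall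
    costs only the constant [G]. The initial increment again comes from [small_increment_exists]. *)
Lemma converge_all (q dq : R -> R) :
 (forall x, is_derive q x (dq x)) -> (forall x, is_derive dq x (2 * q x ^ 3 + x * q x)) -> airy_like q ->
 forall a b eps, 0 < eps -> exists M0, forall M k, M0 <= INR M -> a <= scaled (INR M) k <= b ->
  Rabs (Xs (INR M) k - q (scaled (INR M) k)) <= eps.
Proof.
 intros Hq1 Hq2 HqA a b eps Heps.
 destruct (converge_right q dq Hq1 Hq2 HqA) as (X0 & HX0 & Hqs & Hcv).
 destruct (Hcv eps b Heps) as (Mr & HMr).
 set (a' := Rmin a 0). assert (Ha' : a' <= a /\ a' <= 0) by (split; [apply Rmin_l|apply Rmin_r]).
 destruct (residuals q dq Hq1 Hq2 a' (X0 + 2)) as (B & C & m0 & HB & HC & Hm0 & Hres).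
 set (Lp := B + 6 * B ^ 2). assert (HLp : 1 <= Lp) by (unfold Lp; nra).
 set (len := X0 + 1 - a').
 set (G := exp ((2 * Lp + 1) * len)). assert (HG : 0 < G) by apply exp_pos.
 set (eta := eps / (10 * G)). assert (Heta : 0 < eta) by pos.
 destruct (Hcv eta (X0 + 1) Heta) as (M1 & HM1).
 set (C4 := Lp * eta + 2 * C). assert (HC4 : 0 < C4) by (unfold C4; nra).
 exists (5 + Rabs Mr + Rabs M1 + m0 + C4 / (4 * eta) + 8 * C * len * G / eps).
 intros M k HM Hk. set (m := INR M) in *.
 assert (A1 : 0 <= C4 / (4 * eta)) by (apply Rmult_le_pos; [lra|pos]).
 assert (A2 : 0 <= 8 * C * len * G / eps).
 { apply Rmult_le_pos; [pos|pos]. }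
 assert (R1 := Rabs_pos Mr). assert (R2 := Rle_abs Mr). assert (R3 := Rabs_pos M1). assert (R4 := Rle_abs M1).
 assert (Hmm0 : m0 <= m) by lra.
 destruct (Rle_dec X0 (scaled m k)) as [Hright|Hleft]; [apply HMr; [fold m; lra|fold m; lra]|].
 apply Rnot_le_lt in Hleft.
 assert (HmC4 : C4 <= 4 * eta * m).
 { apply Rle_trans with (4 * eta * (C4 / (4 * eta))); [right; field; lra|]. mul_l; lra. }
 assert (HmC : 8 * C * len * G <= eps * m).
 { apply Rle_trans with (eps * (8 * C * len * G / eps)); [right; field; lra|]. mul_l; lra. }
 set (E := fun j => Xs m j - q (scaled m j)).
 assert (Hstep : forall j, a' <= scaled m j <= X0 + 2 -> (0 < j)%nat /\
   Rabs (E (S j) + E (pred j) - 2 * E j) <= Lp / m ^ 2 * Rabs (E j) + 2 * C / m ^ 3).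
 { intros j Hj. destruct (Hres m j Hmm0 Hj) as (S0 & S1 & S2 & S3 & S4 & S5). split; [auto|].
  set (X := Xs m j) in *. set (u := q (scaled m j)) in *. set (s := scaled m j) in *.
  set (e1 := Xs m (S j) + Xs m (pred j) - 2 * X - X * (s + 2 * X ^ 2) / m ^ 2) in *.
  set (e2 := q (scaled m (S j)) + q (scaled m (pred j)) - 2 * u - u * (s + 2 * u ^ 2) / m ^ 2) in *.
  replace (E (S j) + E (pred j) - 2 * E j) with
   ((X * (s + 2 * X ^ 2) - u * (s + 2 * u ^ 2)) * / m ^ 2 + (e1 + - e2)).
  2:{ unfold E, e1, e2, X, u, s. field. lra. }
  eapply Rle_trans; [apply Rabs_triang|].
  assert (T := Rabs_triang e1 (- e2)). rewrite Rabs_Ropp in T.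
  assert (im2 : 0 < / m ^ 2) by pos.
  rewrite Rabs_mult, (Rabs_pos_eq (/ m ^ 2)) by lra.
  assert (CL := cubic_lipschitz s u X B ltac:(lra) S3 S2 ltac:(apply Rabs_le; lra)). fold Lp in CL.
  change (Rabs (E j)) with (Rabs (X - u)).
  apply (Rmult_le_compat_r (/ m ^ 2)) in CL; [|lra].
  replace (Lp / m ^ 2 * Rabs (X - u)) with (Lp * Rabs (X - u) * / m ^ 2) by (unfold Rdiv; ring).
  unfold Rdiv in *. lra. }
 assert (HEs : forall j, X0 <= scaled m j <= X0 + 1 -> Rabs (E j) <= eta).
 { intros j Hj. apply HM1; fold m; lra. }
 destruct (exists_index_near m X0 ltac:(lra) ltac:(lra)) as [kt Hkt].
 assert (HM2 : (2 <= M)%nat) by (apply INR_le; fold m; simpl; lra).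
 assert (Hwin : forall i, (i <= M - 2)%nat -> X0 <= scaled m (kt + i) <= X0 + 1 - / m).
 { intros i Hi. rewrite scaled_add by lra. assert (0 <= INR i / m) by pos.
  assert (INR i / m <= 1 - 2 * / m).
  { apply div_le; [pos|].
   rewrite Rmult_minus_distr_r, (Rmult_assoc 2), Rinv_l by lra. apply le_INR in Hi. rewrite minus_INR in Hi by auto.
   fold m in Hi. simpl INR in Hi. lra. }
  lra. }
 assert (Hsmall2 : forall j, X0 <= scaled m j <= X0 + 1 -> Rabs (E (S j) + E (pred j) - 2 * E j) <= 4 * eta / m).
 { intros j Hj. destruct (Hstep j ltac:(lra)) as [_ HS]. assert (HE := HEs j Hj).
  apply Rle_trans with (1 := HS).
  apply Rle_trans with (C4 / m ^ 2).
  - unfold C4. assert (Lp / m ^ 2 * Rabs (E j) <= Lp / m ^ 2 * eta).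
   { apply Rmult_le_compat_l; [pos|auto]. }
   assert (2 * C / m ^ 3 <= 2 * C / m ^ 2).
   { unfold Rdiv. mul_l. apply Rinv_le_contravar; [pos|].
    replace (m ^ 3) with (m ^ 2 * m) by ring.
    apply Rle_trans with (m ^ 2 * 1); [lra|mul_l; lra]. }
   unfold Rdiv in *. lra.
  - apply (Rmult_le_reg_r (m ^ 2)); [pos|].
   replace (C4 / m ^ 2 * m ^ 2) with C4 by (field; lra).
   replace (4 * eta / m * m ^ 2) with (4 * eta * m) by (field; lra). auto. }
 destruct (small_increment_exists (fun i => E (kt + i)%nat) (M - 2) eta (4 * eta / m)) as [i [Hi1 Hi2]].
 - pos.
 - apply HEs. generalize (Hwin O ltac:(lia)); lra.
 - apply HEs. generalize (Hwin (M - 2)%nat ltac:(lia)); lra.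
 - rewrite minus_INR by auto. fold m. simpl INR. apply (Rmult_lt_reg_r m); [lra|].
  replace ((m - (1 + 1)) * (4 * eta / m) * m) with ((m - 2) * 4 * eta) by (field; lra).
  assert (2 * eta * m < (m - 2) * 4 * eta); [|lra].
  assert (0 < eta * (m - 4)) by pos. lra.
 - intros i Hi Hd. cbv beta in *. rewrite !Nat.add_succ_r in *. set (j := (kt + i)%nat) in *.
  assert (W1 := Hwin (S i) ltac:(lia)). rewrite Nat.add_succ_r in W1. fold j in W1.
  assert (J := Hsmall2 (S j) ltac:(lra)). simpl pred in J. apply Rabs_le_between in J.
  lra.
 - intros i Hi Hd. cbv beta in *. rewrite !Nat.add_succ_r in *. set (j := (kt + i)%nat) in *.
  assert (W1 := Hwin (S i) ltac:(lia)). rewrite Nat.add_succ_r in W1. fold j in W1.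
  assert (J := Hsmall2 (S j) ltac:(lra)). simpl pred in J. apply Rabs_le_between in J.
  lra.
 - set (k1 := (kt + i)%nat). cbv beta in Hi2. rewrite Nat.add_succ_r in Hi2. fold k1 in Hi2.
  assert (Hk1 := Hwin i ltac:(lia)). fold k1 in Hk1.
  assert (Hkk1 : (k <= k1)%nat) by (apply (scaled_lt_inv m); lra).
  set (D := (k1 - k)%nat).
  assert (HD : INR D / m <= len).
  { assert (Es : scaled m k1 = scaled m k + INR D / m).
   { rewrite <- scaled_add by lra. f_equal. unfold D. lia. }
   unfold len. lra. }
  (* A phase space norm: value plus difference quotient, as the step is [1/m]. Its growth factor per
     step is [1 + O(1/m)]. *)
  set (av := fun d => Rabs (E (k1 - d)%nat) + m * Rabs (E (S k1 - d)%nat - E (k1 - d)%nat)).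
  assert (Hav : forall d, (d < D)%nat -> av (S d) <= (1 + (2 * Lp + 1) / m) * av d + 4 * C / m ^ 2).
  { intros d Hd. unfold av. set (j := (k1 - d)%nat).
   replace (S k1 - S d)%nat with j by (unfold j; lia). replace (S k1 - d)%nat with (S j) by (unfold j, D in *; lia).
   replace (k1 - S d)%nat with (pred j) by (unfold j; lia).
   assert (Hj : a' <= scaled m j <= X0 + 2).
   { split.
    - apply Rle_trans with (scaled m k); [lra|]. apply scaled_le; [lra|unfold j, D in *; lia].
    - apply Rle_trans with (scaled m k1); [apply scaled_le; [lra|unfold j; lia]|lra]. }
   destruct (Hstep j Hj) as [_ HS].
   set (F := m * Rabs (E (S j) - E j)).
   assert (HF : m * Rabs (E j - E (pred j)) <= F + (Lp / m * Rabs (E j) + 2 * C / m ^ 2)).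
   { replace (E j - E (pred j)) with ((E (S j) - E j) + - (E (S j) + E (pred j) - 2 * E j)) by ring.
    apply Rle_trans with (m * (Rabs (E (S j) - E j) + Rabs (E (S j) + E (pred j) - 2 * E j))).
    - mul_l. eapply Rle_trans; [apply Rabs_triang|]. rewrite Rabs_Ropp. lra.
    - rewrite Rmult_plus_distr_l. fold F. apply Rplus_le_compat_l.
     replace (Lp / m * Rabs (E j) + 2 * C / m ^ 2) with (m * (Lp / m ^ 2 * Rabs (E j) + 2 * C / m ^ 3)) by (field; lra).
     mul_l; lra. }
   assert (HE' : Rabs (E (pred j)) <= Rabs (E j) + / m * (m * Rabs (E j - E (pred j)))).
   { rewrite <- Rmult_assoc, Rinv_l, Rmult_1_l by lra.
    replace (E (pred j)) with (E j + - (E j - E (pred j))) at 1 by ring.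
    eapply Rle_trans; [apply Rabs_triang|]. rewrite Rabs_Ropp. lra. }
   set (e := Rabs (E j)) in *.
   set (F' := m * Rabs (E j - E (pred j))) in *.
   assert (T1 : / m * F' <= / m * (F + (Lp / m * e + 2 * C / m ^ 2))) by (mul_l; lra).
   assert (Q1 : 0 <= Lp / m * e) by pos.
   assert (Q2 : 0 <= 2 * C / m ^ 2) by (apply Rmult_le_pos; [lra|pos]).
   assert (T2 : / m * (F + (Lp / m * e + 2 * C / m ^ 2)) <= / m * F + (Lp / m * e + 2 * C / m ^ 2)).
   { rewrite Rmult_plus_distr_l. apply Rplus_le_compat_l.
    rewrite <- (Rmult_1_l (Lp / m * e + 2 * C / m ^ 2)) at 2. mul_r; lra. }
   replace ((1 + (2 * Lp + 1) / m) * (e + F) + 4 * C / m ^ 2) with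
    (e + F + 2 * (Lp / m * e) + 2 * (Lp / m * F) + / m * e + / m * F + 2 * (2 * C / m ^ 2)) by (field; lra).
   assert (0 <= Lp / m * F) by pos.
   assert (0 <= / m * e) by pos. lra. }
  assert (Hav0 : av O <= 5 * eta).
  { unfold av. rewrite !Nat.sub_0_r. assert (A := HEs k1 ltac:(lra)).
   assert (m * Rabs (E (S k1) - E k1) <= m * (4 * eta / m)) by (mul_l; lra).
   replace (m * (4 * eta / m)) with (4 * eta) in H by (field; lra). lra. }
  assert (Hav00 : 0 <= av O).
  { unfold av. apply Rplus_le_le_0_compat; [apply Rabs_pos|]. pos. }
  assert (HGr := discrete_gronwall av D ((2 * Lp + 1) / m) (4 * C / m ^ 2)
   ltac:(pos) ltac:(apply Rmult_le_pos; [lra|pos]) Hav00 Hav D (Nat.le_refl D)).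
  assert (HEk : Rabs (E k) <= av D).
  { unfold av. replace (k1 - D)%nat with k by (unfold D; lia).
   assert (0 <= m * Rabs (E (S k1 - D)%nat - E k)) by pos. lra. }
  change (Rabs (E k) <= eps).
  apply Rle_trans with (1 := HEk). apply Rle_trans with (1 := HGr).
  assert (I1 : exp ((2 * Lp + 1) / m * INR D) <= G).
  { unfold G. assert (A : (2 * Lp + 1) / m * INR D <= (2 * Lp + 1) * len).
   { replace ((2 * Lp + 1) / m * INR D) with ((2 * Lp + 1) * (INR D / m)) by (field; lra).
    mul_l; lra. }
   apply exp_mono; lra. }
  assert (I2 : 4 * C / m ^ 2 * INR D <= 4 * C * len / m).
  { replace (4 * C / m ^ 2 * INR D) with (4 * C / m * (INR D / m)) by (field; lra).
   replace (4 * C * len / m) with (4 * C / m * len) by (field; lra).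
   apply Rmult_le_compat_l; [pos|lra]. }
  assert (I3 : 0 <= 4 * C / m ^ 2 * INR D).
  { apply Rmult_le_pos; [|apply pos_INR]. apply Rmult_le_pos; [lra|pos]. }
  apply Rle_trans with (G * (5 * eta + 4 * C * len / m)).
  + apply Rmult_le_compat; [pos|lra|lra|lra].
  + rewrite Rmult_plus_distr_l.
   assert (G * (5 * eta) = eps / 2) by (unfold eta; field; lra).
   assert (G * (4 * C * len / m) <= eps / 2).
   { apply (Rmult_le_reg_r (2 * m)); [lra|].
    replace (G * (4 * C * len / m) * (2 * m)) with (8 * C * len * G) by (field; lra). lra. }
   lra.
Qed.

(** * Sums to the right and integrals over half-lines *)

Lemma ex_RInt_cont (f : R -> R) a b : (forall x, continuity_pt f x) -> ex_RInt f a b.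
Proof.
 intros Cf. apply (ex_RInt_continuous (V := R_CompleteNormedModule)). intros x _.
 apply continuity_pt_filterlim, Cf.
Qed.

Lemma exp_opp_lt (e : R) : 0 < e -> exists X, forall s, X <= s -> exp (- s) < e.
Proof.
 intros He. exists (1 - ln e). intros s Hs. rewrite <- (exp_ln e) at 1 by auto. apply exp_increasing. lra.
Qed.

Lemma is_RInt_gen_of_lim (f : R -> R) (a l : R) : (forall x, continuity_pt f x) ->
 (forall eps, 0 < eps -> exists X, forall b, X <= b -> Rabs (RInt f a b - l) <= eps) ->
 is_RInt_gen f (at_point a) (Rbar_locally p_infty) l.
Proof.
 intros Cf H.
 apply (filterlimi_lim_ext_loc (fun ab => RInt f (fst ab) (snd ab))).
 { exists (fun x => x = a) (fun _ => True); [reflexivity|exists 0; auto|].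
  intros x y _ _. apply (RInt_correct (V := R_CompleteNormedModule)). now apply ex_RInt_cont. }
 intros P [eps HP]. destruct (H (eps / 2)) as [X HX]; [destruct eps; simpl; lra|].
 exists (fun x => x = a) (fun y => X < y); [reflexivity|exists X; auto|].
 intros x y -> Hy. apply HP. change (Rabs (RInt f a y - l) < eps).
 apply Rle_lt_trans with (1 := HX y ltac:(lra)). destruct eps; simpl; lra.
Qed.

Lemma is_RInt_gen_minf_of_lim (f : R -> R) (c l : R) : (forall x, x <= c -> continuity_pt f x) ->
 (forall eps, 0 < eps -> exists X, forall b, b <= X -> b <= c -> Rabs (RInt f b c - l) <= eps) ->
 is_RInt_gen f (Rbar_locally m_infty) (at_point c) l.
Proof.
 intros Cf H.
 apply (filterlimi_lim_ext_loc (fun ab => RInt f (fst ab) (snd ab))).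
 { exists (fun x => x < c) (fun x => x = c); [exists c; auto|reflexivity|].
  intros x y Hx ->. apply (RInt_correct (V := R_CompleteNormedModule)). simpl.
  apply (ex_RInt_continuous (V := R_CompleteNormedModule)). intros z Hz.
  rewrite Rmax_right in Hz by lra. apply continuity_pt_filterlim, Cf; lra. }
 intros P [eps HP]. destruct (H (eps / 2)) as [X HX]; [destruct eps; simpl; lra|].
 exists (fun x => x < Rmin X c) (fun y => y = c); [exists (Rmin X c); auto|reflexivity|].
 intros x y Hx ->. assert (A := Rmin_l X c). assert (B := Rmin_r X c).
 apply HP. change (Rabs (RInt f x c - l) < eps).
 apply Rle_lt_trans with (1 := HX x ltac:(lra) ltac:(lra)). destruct eps; simpl; lra.
Qed.

(** The bound [C exp (- x)] is reproduced by integration, so the statement can be iterated: it is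
    applied to [q], to [q^2], and once more to the tail of [q^2]. *)
Lemma tail_integral (f : R -> R) (X C : R) : (forall x, continuity_pt f x) -> 0 <= C ->
 (forall s, X <= s -> Rabs (f s) <= C * exp (- s)) ->
 exists I : R -> R, (forall x, is_RInt_gen f (at_point x) (Rbar_locally p_infty) (I x)) /\
  (forall x, is_derive I x (- f x)) /\ (forall x, X <= x -> Rabs (I x) <= C * exp (- x)).
Proof.
 intros Cf HC Hf.
 assert (Ex : forall a b, ex_RInt f a b) by (intros; now apply ex_RInt_cont).
 assert (Hd : forall a b, X <= a <= b -> Rabs (RInt f a b) <= C * exp (- a) - C * exp (- b)).
 { intros a b Hab.
  apply (norm_RInt_le (V := R_NormedModule) f (fun s => C * exp (- s)) a b (RInt f a b) (C * exp (- a) - C * exp (- b))); [lra| | |].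
  - intros x Hx. apply Hf; lra.
  - apply (RInt_correct (V := R_CompleteNormedModule)), Ex.
  - replace (C * exp (- a) - C * exp (- b)) with (minus ((fun s => - C * exp (- s)) b) ((fun s => - C * exp (- s)) a)).
   + apply (is_RInt_derive (V := R_CompleteNormedModule) (fun s => - C * exp (- s)) (fun s => C * exp (- s))).
    * intros x _. auto_derive; auto. match goal with |- ?a = ?b => change (@eq R a b) end. ring.
    * intros x _. apply (ex_derive_continuous (V := R_NormedModule)). auto_derive. auto.
   + change ((- C * exp (- b)) - (- C * exp (- a)) = C * exp (- a) - C * exp (- b)). ring. }
 assert (HL : exists l, is_lim_seq (fun n => RInt f X (X + INR n)) (Finite l)).
 { apply ex_lim_seq_cauchy_corr. intros eps.
  destruct (exp_opp_lt (eps / (C + 1))) as [Y HY].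
  { apply Rdiv_lt_0_compat; [destruct eps; simpl; lra|lra]. }
  destruct (INR_unbounded (Rabs (Y - X))) as [N HN]. exists N.
  assert (Hmain : forall n m, (N <= n <= m)%nat -> Rabs (RInt f X (X + INR m) - RInt f X (X + INR n)) < eps).
  { intros n m [H1 H2]. apply le_INR in H1. apply le_INR in H2. assert (P := pos_INR N). assert (PY := Rle_abs (Y - X)).
   rewrite <- (RInt_Chasles f X (X + INR n) (X + INR m)) by auto.
   replace (plus (RInt f X (X + INR n)) (RInt f (X + INR n) (X + INR m)) - RInt f X (X + INR n)) with (RInt f (X + INR n) (X + INR m)).
   2:{ set (u := (RInt f (X + INR n) (X + INR m) : R)). set (v := (RInt f X (X + INR n) : R)). change (u = v + u - v). ring. }
   apply Rle_lt_trans with (1 := Hd (X + INR n) (X + INR m) ltac:(lra)).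
   assert (E1 := HY (X + INR n) ltac:(lra)). assert (E2 := exp_pos (- (X + INR m))). assert (E3 := exp_pos (- (X + INR n))).
   apply (Rmult_lt_compat_l (C + 1)) in E1; [|lra].
   replace ((C + 1) * (eps / (C + 1))) with (pos eps) in E1 by (field; lra). nra. }
  intros n m Hn Hm. destruct (le_lt_dec n m); [rewrite Rabs_minus_sym|]; apply Hmain; lia. }
 destruct HL as [l Hl].
 assert (HB : forall b, X <= b -> Rabs (RInt f X b - l) <= C * exp (- b)).
 { intros b Hb. apply Rnot_lt_le; intros HH. apply is_lim_seq_Reals in Hl.
  destruct (Hl (Rabs (RInt f X b - l) - C * exp (- b)) ltac:(lra)) as [N HN].
  destruct (INR_unbounded (b - X)) as [M HM].
  specialize (HN (N + M)%nat ltac:(lia)). unfold Rdist in HN.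
  set (y := X + INR (N + M)) in *.
  assert (Hy : b <= y) by (unfold y; rewrite plus_INR; generalize (pos_INR N); lra).
  assert (D := Hd b y (conj Hb Hy)).
  rewrite <- (RInt_Chasles f X b y) in HN by auto. change plus with Rplus in HN.
  assert (P := exp_pos (- y)).
  assert (T := Rabs_triang (RInt f X b + RInt f b y - l) (- RInt f b y)). rewrite Rabs_Ropp in T.
  replace (RInt f X b + RInt f b y - l + - RInt f b y) with (RInt f X b - l) in T by (simpl; ring). nra. }
 exists (fun x => l - RInt f X x).
 split; [|split].
 - intros x. apply is_RInt_gen_of_lim; auto. intros eps He.
  destruct (exp_opp_lt (eps / (C + 1))) as [Y HY]; [pos|].
  exists (Rmax X Y). intros b Hb. assert (B1 := Rmax_l X Y). assert (B2 := Rmax_r X Y).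
  assert (E := RInt_Chasles f X x b ltac:(auto) ltac:(auto)). change plus with Rplus in E.
  replace (RInt f x b - (l - RInt f X x)) with (RInt f X b - l) by (rewrite <- E; simpl; ring).
  apply Rle_trans with (1 := HB b ltac:(lra)). assert (E1 := HY b ltac:(lra)).
  apply (Rmult_lt_compat_l (C + 1)) in E1; [|lra].
  replace ((C + 1) * (eps / (C + 1))) with eps in E1 by (field; lra). nra.
 - intros x. replace (- f x) with (0 - f x) by ring.
  apply derive_minus; [auto_derive; auto|].
  apply (is_derive_RInt (V := R_NormedModule) f (fun x => RInt f X x) X).
  + exists (mkposreal 1 Rlt_0_1). intros y _. apply (RInt_correct (V := R_CompleteNormedModule)), Ex.
  + apply continuity_pt_filterlim, Cf.
 - intros x Hx. rewrite Rabs_minus_sym. auto.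
Qed.

Lemma ln_1m_quadratic y : 0 <= y <= / 2 -> - y - y ^ 2 <= ln (1 - y) <= - y.
Proof.
 intros Hy. split.
 - assert (H := deriv_le (fun x => - x - x ^ 2) (fun x => ln (1 - x)) (fun x => - 1 - 2 * x) (fun x => - / (1 - x)) 0 y ltac:(lra)).
  cbv beta in H. rewrite Rminus_0_r, ln_1 in H.
  enough (- y - y ^ 2 - (- 0 - 0 ^ 2) <= ln (1 - y) - 0) by lra. apply H.
  + intros; auto_derive; auto. ring.
  + intros; auto_derive; [lra|]. field. lra.
  + intros x Hx. apply Ropp_le_cancel. rewrite Ropp_involutive.
   apply (Rmult_le_reg_r (1 - x)); [lra|]. rewrite Rinv_l by lra. nra.
 - rewrite <- (ln_exp (- y)). apply ln_le; [lra|]. generalize (exp_ineq1_le (- y)); lra.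
Qed.

Lemma atanh_bounds y : 0 <= y <= / 2 -> y <= atanh y <= y + 2 * y ^ 2.
Proof.
 intros Hy. assert (E0 : atanh 0 = 0) by (unfold atanh; rewrite Rplus_0_r, Rminus_0_r, ln_1; field).
 assert (D : forall x, 0 <= x <= y -> is_derive atanh x (/ (1 - x ^ 2))) by (intros; apply atanh_derive; lra).
 assert (B : forall x, 0 <= x <= y -> 1 <= / (1 - x ^ 2) <= 1 + 2 * x).
 { intros x Hx. assert (0 <= x ^ 2 <= / 4) by (split; [pos|nra]). split.
  - rewrite <- Rinv_1 at 1. apply Rinv_le_contravar; lra.
  - apply (Rmult_le_reg_r (1 - x ^ 2)); [lra|]. rewrite Rinv_l by lra. nra. }
 split.
 - assert (H := deriv_le (fun x => x) atanh (fun _ => 1) _ 0 y ltac:(lra) ltac:(intros; auto_derive; auto) D). cbv beta in H.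
  enough (y - 0 <= atanh y - atanh 0) by lra. apply H. intros; now apply B.
 - assert (H := deriv_le atanh (fun x => x + 2 * x ^ 2) _ (fun x => 1 + 4 * x) 0 y ltac:(lra) D ltac:(intros; auto_derive; auto; ring)). cbv beta in H.
  enough (atanh y - atanh 0 <= y + 2 * y ^ 2 - (0 + 2 * 0 ^ 2)) by lra. apply H. intros x Hx. generalize (B x Hx); lra.
Qed.

Lemma weighted_geom_bound (q : R) N : 0 < q < 1 -> psum (fun d => INR (S d) * q ^ d) N <= / (1 - q) ^ 2.
Proof.
 intros Hq. assert (E : (1 - q) ^ 2 * psum (fun d => INR (S d) * q ^ d) N = 1 - (INR N + 1) * q ^ N + INR N * q ^ S N).
 { induction N; cbn [psum]; [simpl; ring|]. rewrite Rmult_plus_distr_l, IHN, !S_INR. simpl. ring. }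
 apply (Rmult_le_reg_l ((1 - q) ^ 2)); [pos|]. rewrite E, Rinv_r by (apply pow_nonzero; lra).
 assert (0 < q ^ N) by pos. simpl pow.
 assert (INR N * (q * q ^ N) <= INR N * q ^ N) by (mul_l; nra). lra.
Qed.

(** Double summation by parts, the discrete counterpart of integrating [s f''(s)]. It turns the
    weights of the logarithmic sum into boundary values of a second primitive. *)
Lemma psum_second_diff (P : nat -> R) N :
 psum (fun i => INR (S i) * (P (S (S i)) - 2 * P (S i) + P i)) N = P O - P N + INR N * (P (S N) - P N).
Proof. induction N; cbn [psum]; [simpl; ring|]. rewrite IHN, !S_INR. ring. Qed.

Lemma lipschitz_on (f df : R -> R) (a b B : R) :
 (forall x, a <= x <= b -> is_derive f x (df x) /\ Rabs (df x) <= B) ->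
 forall x y, a <= x <= b -> a <= y <= b -> Rabs (f x - f y) <= B * Rabs (x - y).
Proof.
 intros H.
 assert (Main : forall x y, a <= x -> x < y -> y <= b -> Rabs (f x - f y) <= B * Rabs (x - y)).
 { intros x y Hx Hxy Hy. destruct (mean_value f df x y Hxy) as [c [Hc E]]; [intros; apply H; lra|].
  rewrite (Rabs_minus_sym (f x)), (Rabs_minus_sym x), E, Rabs_mult.
  mul_r; apply H; lra. }
 intros x y Hx Hy. destruct (Rtotal_order x y) as [L|[->|L]]; [apply Main; lra| |].
 - unfold Rminus. rewrite !Rplus_opp_r, Rabs_R0. lra.
 - rewrite Rabs_minus_sym, (Rabs_minus_sym x). apply Main; lra.
Qed.

Section RightSums.

Variables q dq : R -> R.
Hypothesis Hq1 : forall x, is_derive q x (dq x).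
Hypothesis Hq2 : forall x, is_derive dq x (2 * q x ^ 3 + x * q x).
Hypothesis HqA : airy_like q.

Lemma q_continuous x : continuity_pt q x.
Proof. eapply is_derive_continuity_pt, Hq1. Qed.

Lemma q_sq_lipschitz a b : exists L, 0 < L /\ forall x y, a <= x <= b -> a <= y <= b ->
 Rabs (q x - q y) <= L * Rabs (x - y) /\ Rabs (q x ^ 2 - q y ^ 2) <= L * Rabs (x - y).
Proof.
 destruct (compact_bound q a b q_continuous) as [B [HB HB']].
 destruct (compact_bound dq a b) as [B2 [HB2 HB2']]; [intros; eapply is_derive_continuity_pt, Hq2|].
 exists (B2 + 2 * B * B2). split; [nra|]. intros x y Hx Hy.
 assert (HL : Rabs (q x - q y) <= B2 * Rabs (x - y)).
 { apply (lipschitz_on q dq a b); auto. }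
 assert (P := Rabs_pos (x - y)). split.
 - assert (0 <= 2 * B * B2 * Rabs (x - y)) by (apply Rmult_le_pos; nra). lra.
 - replace (q x ^ 2 - q y ^ 2) with ((q x + q y) * (q x - q y)) by ring. rewrite Rabs_mult.
  assert (Rabs (q x + q y) <= 2 * B).
  { eapply Rle_trans; [apply Rabs_triang|]. generalize (HB' x Hx) (HB' y Hy); lra. }
  apply Rle_trans with (2 * B * (B2 * Rabs (x - y))).
  + apply Rmult_le_compat; auto; apply Rabs_pos.
  + assert (0 <= B2 * Rabs (x - y)) by pos. lra.
Qed.

Lemma dp_small_right m k S : 0 < m -> 0 < S -> S <= scaled m k -> (m * dp k (m ^ 3)) ^ 2 <= / (8 * S).
Proof.
 intros Hm HS Hk. assert (Pk : 0 <= m * dp k (m ^ 3)).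
 { apply Rmult_le_pos; [lra|]. left. apply dp_range, pow_lt; lra. }
 apply Rle_trans with (Wf (scaled m k) ^ 2); [apply pow_incr; split; [auto|now apply dp_le_Wf]|].
 apply Rle_trans with (1 := Wf_right (scaled m k) ltac:(lra)). apply Rinv_le_contravar; lra.
Qed.

Lemma scaled_index m k s : 0 < m -> s <= scaled m k -> 2 * m ^ 3 + s * m <= INR k.
Proof.
 intros Hm H. unfold scaled in H. apply (Rmult_le_compat_r m) in H; [|lra].
 unfold Rdiv in H. rewrite Rmult_assoc, Rinv_l in H by lra. lra.
Qed.

(** The geometric ratio [1 - sqrt S / (2m)] makes the weighted sums of order [m^2], which
    [(m x_b)^2 <= 1/(8S)] compensates; the bound is uniform in [m] and in the number of terms. Here
    [S] is the real cut-off, hence [Datatypes.S] for the successor. *)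
Lemma log_tail_small (m S : R) (b N K : nat) : 1 <= m -> 4 <= S -> S <= m -> S <= scaled m b ->
 Rabs (psum (fun d => INR (1 + (N + d)) * dp_log (b + d) (m ^ 3)) K) <= (INR N / m * 2 / sqrt S + 4 / S) / (4 * S).
Proof.
 intros Hm HS HSm Hb. set (t := m ^ 3). assert (Ht : 0 < t) by pos.
 assert (Hsq : 2 <= sqrt S).
 { rewrite <- (sqrt_pow2 2) by lra. apply sqrt_le_1_alt. lra. }
 assert (Esq : sqrt S * sqrt S = S) by (apply sqrt_sqrt; lra).
 assert (HsS : sqrt S <= m) by nra.
 set (mu := sqrt S / (2 * m)). assert (Hmu : 0 < mu <= / 2).
 { unfold mu. split; [pos|].
  apply div_le; lra. }
 set (lam := 1 - mu). set (x := dp b t). assert (Rx := dp_range b t Ht). fold x in Rx.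
 assert (Hg : forall d, dp (b + d) t <= x * lam ^ d).
 { intros d. apply geom_decay; [lra|nra|]. now apply scaled_index; [lra|]. }
 assert (Hx2 := dp_small_right m b S ltac:(lra) ltac:(lra) Hb). fold t x in Hx2.
 assert (x_half : x <= / 2).
 { assert (H := dp_scaled_right m b ltac:(lra)). fold t x in H.
  assert (m * x <= / 2). { apply H. assert (A := scaled_index m b S ltac:(lra) Hb). fold t in A. nra. } nra. }
 assert (Hlog : forall d, Rabs (dp_log (b + d) t) <= 2 * x ^ 2 * lam ^ d).
 { intros d. unfold dp_log. set (y := dp (Datatypes.S (b + d)) t).
  assert (Ry := dp_range (Datatypes.S (b + d)) t Ht). fold y in Ry.
  assert (Hy : y <= x * lam ^ d).
  { apply Rle_trans with (2 := Hg d). apply dp_decr; auto. }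
  assert (Hld : 0 < lam ^ d <= 1).
  { assert (H1 := pow_incr lam 1 d ltac:(unfold lam; lra)). rewrite pow1 in H1.
   split; [apply pow_lt; unfold lam; lra|auto]. }
  assert (Hy2 : y ^ 2 <= x ^ 2 * lam ^ d).
  { apply Rle_trans with ((x * lam ^ d) ^ 2); [apply pow_incr; lra|].
   replace ((x * lam ^ d) ^ 2) with (x ^ 2 * lam ^ d * lam ^ d) by ring.
   nra. }
  assert (B := ln_1m_bound (y ^ 2) ltac:(split; [pos|nra])).
  rewrite <- Rabs_Ropp, Rabs_pos_eq; lra. }
 apply Rle_trans with (1 := psum_Rabs _ _).
 apply Rle_trans with (psum (fun d => 2 * x ^ 2 * (INR N * lam ^ d + INR (Datatypes.S d) * lam ^ d)) K).
 - apply psum_le. intros d _. rewrite Rabs_mult, (Rabs_pos_eq (INR (1 + (N + d)))) by apply pos_INR.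
  replace (INR (1 + (N + d))) with (INR N + INR (Datatypes.S d)) by (rewrite <- plus_INR; f_equal; lia).
  replace (2 * x ^ 2 * (INR N * lam ^ d + INR (Datatypes.S d) * lam ^ d)) with
   ((INR N + INR (Datatypes.S d)) * (2 * x ^ 2 * lam ^ d)) by ring.
  apply Rmult_le_compat_l; [apply Rplus_le_le_0_compat; apply pos_INR|auto].
 - rewrite psum_scal, psum_plus, psum_scal.
  assert (G1 := geom_sum_bound lam K ltac:(unfold lam; lra)).
  assert (G2 := weighted_geom_bound lam K ltac:(unfold lam; lra)).
  replace (1 - lam) with mu in * by (unfold lam; ring).
  apply Rle_trans with (2 * x ^ 2 * (INR N * / mu + / mu ^ 2)).
  + apply Rmult_le_compat_l; [generalize (pow2_ge_0 x); lra|].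
   apply Rplus_le_compat; [mul_l; exact G1|exact G2].
  + replace (2 * x ^ 2 * (INR N * / mu + / mu ^ 2)) with (2 * (m * x) ^ 2 * (INR N / m * 2 / sqrt S + 4 / S)).
   * replace ((INR N / m * 2 / sqrt S + 4 / S) / (4 * S)) with (2 * / (8 * S) * (INR N / m * 2 / sqrt S + 4 / S)) by (field; lra).
    apply Rmult_le_compat_r; [|lra]. apply Rplus_le_le_0_compat.
    -- pos; pos.
    -- apply Rmult_le_pos; [lra|pos].
   * unfold mu. rewrite <- Esq at 2. field. lra.
Qed.

End RightSums.

Lemma lim_close (u : nat -> R) (l x e : R) N : is_lim_seq u l ->
 (forall K, Rabs (u (N + K)%nat - x) <= e) -> Rabs (l - x) <= e.
Proof.
 intros Hl H. apply Rnot_lt_le; intros HH. apply is_lim_seq_Reals in Hl.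
 destruct (Hl (Rabs (l - x) - e) ltac:(lra)) as [K HK]. specialize (HK (N + K)%nat ltac:(lia)).
 unfold Rdist in HK. specialize (H K). rewrite Rabs_minus_sym in HK.
 assert (T := Rabs_triang (l - u (N + K)%nat) (u (N + K)%nat - x)).
 replace (l - u (N + K)%nat + (u (N + K)%nat - x)) with (l - x) in T by ring. lra.
Qed.

Lemma exp_opp_quadratic s : 0 < s -> exp (- s) <= 4 / s ^ 2.
Proof.
 intros Hs. rewrite exp_Ropp. replace (4 / s ^ 2) with (/ (s ^ 2 / 4)) by (field; lra).
 apply Rinv_le_contravar; [nra|]. replace s with (s / 2 + s / 2) at 2 by field. rewrite exp_plus.
 assert (H := exp_ineq1_le (s / 2)). nra.
Qed.

(** One cut-off meets all demands: it lies right of the window, makes the exponential boundary terms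
    small even against the window length, and makes the bound [4 / sqrt s] for the discarded terms
    small. *)
Lemma cutoff (a x0 C0 eps : R) : 0 <= C0 -> 0 < eps -> exists s, 4 <= s /\ Rabs a + 3 <= s /\ x0 <= s /\
 C0 * exp (- s) * (2 * s + 1) <= eps / 4 /\ 4 / sqrt s <= eps / 4.
Proof.
 intros HC0 He. exists (Rabs a + 4 + Rabs x0 + (16 / eps) ^ 2 + 48 * C0 / eps).
 assert (P1 := pow2_ge_0 (16 / eps)). assert (P2 : 0 <= 48 * C0 / eps) by pos.
 assert (Pa := Rabs_pos a). assert (PX := Rabs_pos x0). assert (HX := Rle_abs x0).
 set (s := Rabs a + 4 + Rabs x0 + (16 / eps) ^ 2 + 48 * C0 / eps).
 assert (Hs : 4 <= s /\ Rabs a + 3 <= s /\ x0 <= s /\ (16 / eps) ^ 2 <= s /\ 48 * C0 / eps <= s) by (unfold s; repeat split; lra).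
 clearbody s. destruct Hs as [Hs4 [Hsa [HsX [Hs1 Hs2]]]]. do 3 (split; [lra|]). split.
 - assert (E := exp_opp_quadratic s ltac:(lra)). apply Rle_trans with (C0 * (4 / s ^ 2) * (3 * s)).
  + apply Rmult_le_compat; [apply Rmult_le_pos; [lra|pos]|lra| |lra]. mul_l; lra.
  + replace (C0 * (4 / s ^ 2) * (3 * s)) with (48 * C0 / eps * (eps / 4) / s) by (field; lra).
   apply div_le; [pos|]. rewrite Rmult_comm. mul_l; lra.
 - assert (Hsq : 16 / eps <= sqrt s) by (rewrite <- (sqrt_pow2 (16 / eps)); [now apply sqrt_le_1_alt|left; pos]).
  assert (Psq : 0 < sqrt s) by (apply sqrt_lt_R0; lra). apply div_le; [pos|].
  apply (Rmult_le_compat_r (eps / 4)) in Hsq; [|lra]. replace (16 / eps * (eps / 4)) with 4 in Hsq by (field; lra). lra.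
Qed.

Lemma psum_Rabs_le (f : nat -> R) N e : (forall i, (i < N)%nat -> Rabs (f i) <= e) -> Rabs (psum f N) <= INR N * e.
Proof.
 intros H. apply Rle_trans with (1 := psum_Rabs _ _). rewrite <- psum_const. now apply psum_le.
Qed.

Lemma atanh_tail_small (m s : R) (b K : nat) : 1 <= m -> 4 <= s -> s <= m -> s <= scaled m b ->
 Rabs (psum (fun i => atanh (dp (S (b + 2 * i)) (m ^ 3))) K) <= 4 / sqrt s.
Proof.
 intros Hm Hs Hsm Hb. set (t := m ^ 3). assert (Ht : 0 < t) by pos.
 assert (Hsq : 2 <= sqrt s) by (rewrite <- (sqrt_pow2 2) by lra; apply sqrt_le_1_alt; lra).
 assert (Esq : sqrt s * sqrt s = s) by (apply sqrt_sqrt; lra).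
 assert (HsS : sqrt s <= m) by nra.
 set (mu := sqrt s / (2 * m)). assert (Hmu : 0 < mu <= / 2).
 { unfold mu. split; [pos|].
  apply div_le; lra. }
 set (lam := 1 - mu). set (x := dp b t). assert (Rx := dp_range b t Ht). fold x in Rx.
 assert (Hx2 := dp_small_right m b s ltac:(lra) ltac:(lra) Hb). fold t x in Hx2.
 assert (Hx1 : m * x <= / 2).
 { apply dp_scaled_right; [lra|]. assert (A := scaled_index m b s ltac:(lra) Hb). nra. }
 assert (x_half : x <= / 2) by nra.
 assert (Hterm : forall i, Rabs (atanh (dp (S (b + 2 * i)) t)) <= 2 * x * lam ^ i).
 { intros i. set (y := dp (S (b + 2 * i)) t). assert (Ry := dp_range (S (b + 2 * i)) t Ht). fold y in Ry.
  assert (Hl : forall n, 0 < lam ^ n <= 1).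
  { intros n. assert (H1 := pow_incr lam 1 n ltac:(unfold lam; lra)). rewrite pow1 in H1.
   split; [apply pow_lt; unfold lam; lra|auto]. }
  assert (Hy : y <= x * lam ^ i).
  { apply Rle_trans with (dp (b + i) t); [apply dp_mono; [auto|lia]|].
   apply geom_decay; [lra|nra|]. now apply scaled_index; [lra|]. }
  assert (HL := Hl i). assert (x * lam ^ i <= x * 1) by (mul_l; lra).
  assert (B := atanh_bounds y ltac:(lra)). rewrite Rabs_pos_eq by lra. nra. }
 apply Rle_trans with (1 := psum_Rabs _ _).
 apply Rle_trans with (psum (fun i => 2 * x * lam ^ i) K); [apply psum_le; intros; apply Hterm|].
 rewrite psum_scal. apply Rle_trans with (2 * x * / mu).
 - mul_l. replace mu with (1 - lam) by (unfold lam; ring). apply geom_sum_bound. unfold lam; lra.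
 - unfold mu. replace (2 * x * / (sqrt s / (2 * m))) with (4 * (m * x) / sqrt s) by (field; lra).
  mul_r; lra.
Qed.

(** The finite expression that [log_tail_lim] identifies with the infinite tail
    [sum_(k>n) (k - n) ln (1 - x_k^2)]. Its two readings are evaluated separately, as a tail on the
    right and as a finite sum on the left. *)
Definition log_tail (n : nat) (t : R) : R :=
 INR n * ln (besI0 t) - t ^ 2 + psum (fun j => (INR n - INR (S j)) * dp_log j t) n.

(** * Riemann sums on bounded windows and their exponentially small ends *)

Section Windows.

Variables q dq : R -> R.
Hypothesis Hq1 : forall x, is_derive q x (dq x).
Hypothesis Hq2 : forall x, is_derive dq x (2 * q x ^ 3 + x * q x).
Hypothesis HqA : airy_like q.

Lemma window_index (a s m : R) n : 1 <= m -> Rabs a + 3 <= s -> a <= scaled m n <= a + 1 ->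
 exists N, s <= scaled m (n + N) < s + / m /\ INR N <= 2 * s * m - 1.
Proof.
 intros Hm Hs Hn. assert (Ha := Rle_abs a). assert (Ha' := Rle_abs (- a)). rewrite Rabs_Ropp in Ha'.
 assert (Hi : / m <= 1) by (apply Rinv_le_1; lra).
 destruct (exists_index_near m s Hm ltac:(lra)) as [k Hk].
 assert (Hnk : (n <= k)%nat) by (apply scaled_lt_inv with m; lra).
 exists (k - n)%nat. replace (n + (k - n))%nat with k by lia. split; [auto|].
 assert (E := scaled_add m n (k - n) ltac:(lra)). replace (n + (k - n))%nat with k in E by lia.
 assert (H : INR (k - n) / m <= 2 * s - 1) by lra.
 apply (INR_div_bound (k - n) m) in H; nra.
Qed.

Lemma window_data (a s : R) : exists B L, 1 <= B /\ 0 < L /\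
 (forall x y, a <= x <= s -> a <= y <= s -> Rabs (q x - q y) <= L * Rabs (x - y) /\ Rabs (q x ^ 2 - q y ^ 2) <= L * Rabs (x - y)) /\
 forall eta, 0 < eta -> exists M0, forall M k, M0 <= INR M -> a <= scaled (INR M) k <= s ->
  Rabs (Xs (INR M) k) <= B /\ Rabs (Xs (INR M) k - q (scaled (INR M) k)) <= eta /\
  Rabs (Xs (INR M) k ^ 2 - q (scaled (INR M) k) ^ 2) <= 2 * B * eta.
Proof.
 destruct (compact_bound q a s) as [B [HB HB']]; [intros; eapply is_derive_continuity_pt, Hq1|].
 destruct (q_sq_lipschitz q dq Hq1 Hq2 a s) as [L [HL HL']].
 exists (B + 1), L. split; [lra|]. split; [auto|]. split; [auto|]. intros eta Heta.
 destruct (converge_all q dq Hq1 Hq2 HqA a s (Rmin eta 1)) as [M0 HM]; [apply Rmin_glb_lt; lra|].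
 exists M0. intros M k H1 H2. specialize (HM M k H1 H2). specialize (HB' _ H2).
 assert (A1 := Rmin_l eta 1). assert (A2 := Rmin_r eta 1).
 set (X := Xs (INR M) k) in *. set (u := q (scaled (INR M) k)) in *.
 assert (HX : Rabs X <= B + 1).
 { assert (T := Rabs_triang (X - u) u). replace (X - u + u) with X in T by ring. lra. }
 repeat split; [auto|lra|]. replace (X ^ 2 - u ^ 2) with ((X + u) * (X - u)) by ring.
 rewrite Rabs_mult. apply Rmult_le_compat; try apply Rabs_pos; [|lra].
 eapply Rle_trans; [apply Rabs_triang|lra].
Qed.

Variables Q1 Q2 : R -> R.
Hypothesis HQ1 : forall x, is_derive Q1 x (- q x ^ 2).
Hypothesis HQ2 : forall x, is_derive Q2 x (- Q1 x).
Variables X0 C0 : R.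
Hypothesis HC0 : 0 <= C0.
Hypothesis HQ1b : forall x, X0 <= x -> Rabs (Q1 x) <= C0 * exp (- x).
Hypothesis HQ2b : forall x, X0 <= x -> Rabs (Q2 x) <= C0 * exp (- x).

(** As [Q2'' = q^2], the term [q^2/m^2] is a second difference of [Q2] with step [1/m], up to order
    [m^(-3)]. *)
Lemma second_diff_Q2 (L x d : R) : 0 < d -> (forall y, x - d <= y <= x + d -> Rabs (q y ^ 2 - q x ^ 2) <= L * Rabs (y - x)) -> 0 < L ->
 Rabs (Q2 (x + d) + Q2 (x - d) - 2 * Q2 x - d ^ 2 * q x ^ 2) <= L * d ^ 3.
Proof.
 intros Hd HL PL.
 assert (H := second_diff_bound (fun y => Q2 y - (y - x) ^ 2 / 2 * q x ^ 2) (fun y => - Q1 y - (y - x) * q x ^ 2)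
  (fun y => q y ^ 2 - q x ^ 2) x d (L * d) ltac:(lra)). cbv beta in H.
 replace (L * d ^ 3) with (L * d * d ^ 2) by ring.
 replace (Q2 (x + d) + Q2 (x - d) - 2 * Q2 x - d ^ 2 * q x ^ 2) with
  (Q2 (x + d) - (x + d - x) ^ 2 / 2 * q x ^ 2 + (Q2 (x - d) - (x - d - x) ^ 2 / 2 * q x ^ 2) - 2 * (Q2 x - (x - x) ^ 2 / 2 * q x ^ 2)) by field.
 apply H.
 - intros y Hy. assert (D := HQ2 y). auto_derive; [eexists; exact D|].
  rewrite (Derive_eta _ _ _ D). field.
 - intros y Hy. assert (D := HQ1 y). auto_derive; [eexists; exact D|].
  rewrite (Derive_eta _ _ _ D). ring.
 - intros y Hy. apply Rle_trans with (1 := HL y Hy). mul_l. apply Rabs_le. lra.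
Qed.

(** Each term is [- X^2/m^2] up to [m^(-4)], hence minus a second difference of [Q2], and the
    weighted sum collapses to [- Q2] at the left end. The weights add up to order [m^2], so the
    error per term has to be a small multiple of [m^(-2)]. *)
Lemma log_tail_right (a eps : R) : 0 < eps -> exists M0, forall M n, M0 <= INR M -> a <= scaled (INR M) n <= a + 1 ->
 Rabs (log_tail n (INR M ^ 3) + Q2 (scaled (INR M) n)) <= eps.
Proof.
 intros He.
 destruct (cutoff a X0 C0 eps HC0 He) as [s [Hs4 [Hsa [HsX [Hexp Hsq]]]]]. assert (Pa := Rabs_pos a).
 destruct (window_data a (s + 2)) as [B [L [HB [HL [HLip HW]]]]].
 destruct (HW (eps / (4 * (4 * s ^ 2) * (2 * B)))) as [M0 HM0]; [pos|].
 set (eta := eps / (4 * (4 * s ^ 2) * (2 * B))) in *.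
 exists (Rabs M0 + s + 2 * B + (4 * (4 * s ^ 2) * (B ^ 4 + L)) / eps).
 intros M n HM Hn. set (m := INR M) in *.
 assert (PM := Rle_abs M0). assert (PM' := Rabs_pos M0).
 assert (PB : 1 <= B ^ 4) by (rewrite <- (pow1 4); apply pow_incr; lra).
 assert (P3 : 0 < 4 * (4 * s ^ 2) * (B ^ 4 + L)) by nra.
 assert (P4 : 0 < (4 * (4 * s ^ 2) * (B ^ 4 + L)) / eps) by pos.
 assert (Hm1 : 1 <= m) by lra. assert (Hi : / m <= 1) by (apply Rinv_le_1; lra).
 assert (Pi : 0 < / m) by pos.
 destruct (window_index a s m n Hm1 Hsa Hn) as [N [HN1 HN2]].
 assert (PN := pos_INR N).
 set (F := fun i => Q2 (scaled m (n + i))).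
 assert (Hrange : forall i, (i <= S N)%nat -> a <= scaled m (n + i) <= s + 2).
 { intros i Hi2. split; [apply Rle_trans with (1 := proj1 Hn); apply scaled_le; [lra|lia]|].
  apply Rle_trans with (scaled m (S (n + N))); [apply scaled_le; [lra|lia]|]. rewrite scaled_S by lra. lra. }
 assert (Hterm : forall i, (i < N)%nat -> Rabs (INR (S i) * dp_log (n + i) (m ^ 3) + INR (S i) * (F (S (S i)) - 2 * F (S i) + F i)) <=
  INR N * ((2 * B * eta + (B ^ 4 + L) / m) / m ^ 2)).
 { intros i Hi2. rewrite <- Rmult_plus_distr_l, Rabs_mult, (Rabs_pos_eq (INR (S i))) by apply pos_INR.
  apply Rmult_le_compat; [apply pos_INR|apply Rabs_pos|apply le_INR; lia|].
  destruct (HM0 M (n + S i)%nat ltac:(change (M0 <= m); lra) (Hrange (S i) ltac:(lia))) as [W1 [W2 W3]]. fold m in W1, W2, W3.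
  set (x := scaled m (n + S i)) in *. set (X := Xs m (n + S i)) in *.
  assert (E1 : F (S (S i)) = Q2 (x + / m)).
  { unfold F, x. rewrite <- scaled_S by lra. f_equal. f_equal. lia. }
  assert (E2 : F i = Q2 (x - / m)).
  { unfold F, x. rewrite <- scaled_pred by (lra || lia). f_equal. f_equal. lia. }
  assert (E3 : F (S i) = Q2 x) by reflexivity.
  assert (E4 : dp_log (n + i) (m ^ 3) = ln (1 - (X / m) ^ 2)).
  { unfold dp_log, X, Xs. replace (n + S i)%nat with (S (n + i)) by lia. f_equal. field. lra. }
  assert (HX2 : (X / m) ^ 2 = X ^ 2 * (/ m) ^ 2) by (unfold Rdiv; ring).
  assert (BX : X ^ 2 <= B ^ 2) by (rewrite <- (pow2_abs X); apply pow_incr; split; [apply Rabs_pos|auto]).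
  assert (Bm : B * / m <= / 2).
  { apply div_le; lra. }
  assert (Q0 := pow2_ge_0 X). assert (Q3 : 0 < (/ m) ^ 2) by pos.
  assert (BX' : (X / m) ^ 2 <= (B * / m) ^ 2) by (rewrite HX2, Rpow_mult_distr; mul_r; lra).
  assert (Bm2 : (B * / m) ^ 2 <= (/ 2) ^ 2) by (apply pow_incr; split; [apply Rmult_le_pos|]; lra).
  assert (small : 0 <= (X / m) ^ 2 <= / 2) by (split; [pos|lra]).
  assert (H1 := ln_1m_quadratic _ small).
  assert (H2 := second_diff_Q2 L x (/ m) Pi ltac:(intros y Hy; apply HLip; unfold x in *; [|apply Hrange; lia];
    rewrite <- scaled_S in Hy by lra; rewrite <- scaled_pred in Hy by (lra || lia); assert (R1 := Hrange i ltac:(lia)); assert (R2 := Hrange (S (S i)) ltac:(lia));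
    replace (pred (n + S i)) with (n + i)%nat in Hy by lia; replace (S (n + S i)) with (n + S (S i))%nat in Hy by lia; lra) HL).
  rewrite E1, E2, E3, E4.
  assert (H4 : ((X / m) ^ 2) ^ 2 <= B ^ 4 * / m ^ 3).
  { apply Rle_trans with (((B * / m) ^ 2) ^ 2); [apply pow_incr; lra|].
   replace (((B * / m) ^ 2) ^ 2) with (B ^ 4 * / m ^ 3 * / m) by (field; lra).
   rewrite <- (Rmult_1_r (B ^ 4 * / m ^ 3)) at 2. apply Rmult_le_compat_l; [|lra].
   apply Rmult_le_pos; [lra|]. left. pos. }
  replace ((2 * B * eta + (B ^ 4 + L) / m) / m ^ 2) with (B ^ 4 * / m ^ 3 + (2 * B * eta) * (/ m) ^ 2 + L * (/ m) ^ 3) by (field; lra).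
  assert (H5 : Rabs (X ^ 2 - q x ^ 2) * (/ m) ^ 2 <= 2 * B * eta * (/ m) ^ 2) by (mul_r; lra).
  rewrite <- (Rabs_pos_eq ((/ m) ^ 2)), <- Rabs_mult in H5 by lra.
  rewrite (Rabs_pos_eq ((/ m) ^ 2)) in H5 by lra.
  assert (H6 : (X ^ 2 - q x ^ 2) * (/ m) ^ 2 = (X / m) ^ 2 - (/ m) ^ 2 * q x ^ 2) by (rewrite HX2; ring).
  rewrite H6 in H5.
  apply Rabs_le_between in H2. abs_lra. }
 set (err := (2 * B * eta + (B ^ 4 + L) / m) / m ^ 2) in Hterm.
 assert (Herr : INR N * (INR N * err) <= eps / 2).
 { apply Rle_trans with (4 * s ^ 2 * m ^ 2 * err).
  - rewrite <- Rmult_assoc. apply Rmult_le_compat_r.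
   + unfold err. apply Rdiv_le_0_compat; [|pos].
    assert (0 < eta) by (unfold eta; apply Rdiv_lt_0_compat; nra).
    assert (0 < (B ^ 4 + L) / m) by pos. nra.
   + nra.
  - unfold err. replace (4 * s ^ 2 * m ^ 2 * ((2 * B * eta + (B ^ 4 + L) / m) / m ^ 2)) with
    (4 * s ^ 2 * (2 * B) * eta + 4 * (4 * s ^ 2) * (B ^ 4 + L) / eps * (eps / 4) / m) by (field; lra).
   replace (4 * s ^ 2 * (2 * B) * eta) with (eps / 4) by (unfold eta; field; lra).
   assert (4 * (4 * s ^ 2) * (B ^ 4 + L) / eps * (eps / 4) / m <= eps / 4); [|lra].
   apply div_le; [pos|].
   rewrite Rmult_comm. mul_l; lra. }
 assert (Hwin : Rabs (psum (fun i => INR (S i) * dp_log (n + i) (m ^ 3)) N + (F O - F N + INR N * (F (S N) - F N))) <= eps / 2).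
 { rewrite <- psum_second_diff, <- psum_plus. apply Rle_trans with (2 := Herr). apply psum_Rabs_le, Hterm. }
 assert (Hee : forall x, s <= x -> C0 * exp (- x) <= C0 * exp (- s)).
 { intros x Hx. mul_l. destruct Hx as [Hx| ->]; [left; apply exp_increasing|]; lra. }
 assert (HFN : Rabs (F N) <= C0 * exp (- s)) by (apply Rle_trans with (2 := Hee _ (proj1 HN1)), HQ2b; lra).
 assert (HFd : INR N * Rabs (F (S N) - F N) <= 2 * s * (C0 * exp (- s))).
 { assert (D : Rabs (F (S N) - F N) <= C0 * exp (- s) * / m).
  { unfold F. rewrite <- plus_n_Sm, scaled_S by lra. set (x := scaled m (n + N)) in *.
   destruct (mean_value Q2 (fun x => - Q1 x) x (x + / m) ltac:(lra) ltac:(intros; apply HQ2)) as [c [Hc Ec]].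
   rewrite Ec, Rabs_mult, Rabs_Ropp. replace (x + / m - x) with (/ m) by ring. rewrite (Rabs_pos_eq (/ m)) by lra.
   mul_r. apply Rle_trans with (2 := Hee c ltac:(lra)), HQ1b; lra. }
  assert (Pe : 0 <= C0 * exp (- s)) by (apply Rmult_le_pos; [lra|pos]).
  apply Rle_trans with ((2 * s * m) * (C0 * exp (- s) * / m)).
  - apply Rmult_le_compat; [auto|apply Rabs_pos|lra|auto].
  - right. field. lra. }
 assert (Htail : (INR N / m * 2 / sqrt s + 4 / s) / (4 * s) <= eps / 4).
 { assert (Psq : 2 <= sqrt s) by (rewrite <- (sqrt_pow2 2) by lra; apply sqrt_le_1_alt; lra).
  assert (Esq : sqrt s * sqrt s = s) by (apply sqrt_sqrt; lra).
  assert (HNm : INR N / m <= 2 * s).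
  { apply div_le; [pos|]. lra. }
  apply Rle_trans with (4 / sqrt s).
  - apply Rle_trans with ((2 * s * 2 / sqrt s + 4 / s) / (4 * s)).
   + mul_r. apply Rplus_le_compat_r.
    mul_r. lra.
   + set (w := sqrt s) in *. rewrite <- Esq.
    replace ((2 * (w * w) * 2 / w + 4 / (w * w)) / (4 * (w * w))) with (/ w * (1 + / (w * w * w))) by (field; lra).
    unfold Rdiv. rewrite (Rmult_comm 4). mul_l.
    assert (/ (w * w * w) <= 1); [|lra]. rewrite <- Rinv_1. apply Rinv_le_contravar; nra.
  - exact Hsq. }
 assert (Hlim := log_tail_lim n (m ^ 3) ltac:(pos)). fold (log_tail n (m ^ 3)) in Hlim.
 replace (log_tail n (m ^ 3) + Q2 (scaled m n)) with (log_tail n (m ^ 3) - - F O) by (unfold F; rewrite Nat.add_0_r; ring).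
 apply (lim_close _ _ _ _ N Hlim). intros K. rewrite psum_split.
 assert (T := log_tail_small m s (n + N) N K Hm1 ltac:(lra) ltac:(lra) ltac:(lra)).
 rewrite (psum_ext (fun i => INR (S (N + i)) * dp_log (n + (N + i)) (m ^ 3)) (fun d => INR (1 + (N + d)) * dp_log (n + N + d) (m ^ 3)) K)
  by (intros; rewrite Nat.add_assoc; reflexivity).
 assert (HFd' : Rabs (INR N * (F (S N) - F N)) <= 2 * s * (C0 * exp (- s))) by (rewrite Rabs_mult, (Rabs_pos_eq (INR N)) by auto; auto).
 abs_lra.
Qed.

(** The terms are [X/m] up to [m^(-2)] and only every second index occurs, so they form a Riemann
    sum of step [2/m] for half of the integral of [q]. *)
Lemma atanh_sum_right (P : R -> R) (a eps : R) : (forall x, is_derive P x (- q x)) ->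
 (forall x, X0 <= x -> Rabs (P x) <= C0 * exp (- x)) -> 0 < eps ->
 exists M0, forall M J, M0 <= INR M -> a <= scaled (INR M) (2 * J) <= a + 1 ->
 Rabs (INR M ^ 3 - atanh_sum J (INR M ^ 3) - P (scaled (INR M) (2 * J)) / 2) <= eps.
Proof.
 intros HP HPb He.
 destruct (cutoff a X0 C0 eps HC0 He) as [s [Hs4 [Hsa [HsX [Hexp Hsq]]]]].
 destruct (window_data a (s + 3)) as [B [L [HB [HL [HLip HW]]]]].
 destruct (HW (eps / (8 * s))) as [M0 HM0]; [pos|].
 set (eta := eps / (8 * s)) in *.
 assert (P3 : 0 < 8 * s * (2 * B ^ 2 + L) / eps) by (apply Rdiv_lt_0_compat; [|lra]; assert (0 <= B ^ 2) by apply pow2_ge_0; nra).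
 exists (Rabs M0 + s + 2 * B + 8 * s * (2 * B ^ 2 + L) / eps).
 intros M J HM Hn. set (m := INR M) in *. set (n := (2 * J)%nat) in *.
 assert (PM := Rle_abs M0). assert (PM' := Rabs_pos M0).
 assert (Hm1 : 1 <= m) by lra. assert (Hi : / m <= 1) by (apply Rinv_le_1; lra).
 destruct (window_index a s m n Hm1 Hsa Hn) as [N0 [HN1 HN2]].
 (* The window must contain an even number of indices to consist of whole pairs; the cut-off moves
    by at most two steps. *)
 assert (EN : exists N, (N0 <= 2 * N <= N0 + 2)%nat).
 { destruct (Nat.Even_or_Odd N0) as [[c ->]|[c ->]]; exists (S c); lia. }
 destruct EN as [N [HNa HNb]].
 assert (HN3 : INR N <= 2 * s * m).
 { apply le_INR in HNb. rewrite plus_INR, mult_INR in HNb. simpl in HNb. nra. }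
 assert (Hend : s <= scaled m (n + 2 * N) <= s + 3).
 { split; [apply Rle_trans with (1 := proj1 HN1); apply scaled_le; [lra|lia]|].
  apply Rle_trans with (scaled m (S (S (n + N0)))); [apply scaled_le; [lra|lia]|]. rewrite !scaled_S by lra. lra. }
 assert (Hrange : forall i, (i <= 2 * N)%nat -> a <= scaled m (n + i) <= s + 3).
 { intros i Hi2. split; [apply Rle_trans with (1 := proj1 Hn); apply scaled_le; [lra|lia]|].
  apply Rle_trans with (2 := proj2 Hend). apply scaled_le; [lra|lia]. }
 set (F := fun i => P (scaled m (n + 2 * i)) / 2).
 assert (Hterm : forall i, (i < N)%nat -> Rabs (atanh (dp (S (2 * (J + i))) (m ^ 3)) - (F i - F (S i))) <=
  (eta + (2 * B ^ 2 + L) / m) / m).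
 { intros i Hi2. replace (S (2 * (J + i)))%nat with (n + S (2 * i))%nat by (unfold n; lia).
  assert (Rg := Hrange (S (2 * i)) ltac:(lia)).
  destruct (HM0 M (n + S (2 * i))%nat ltac:(change (M0 <= m); lra) Rg) as [W1 [W2 _]]. fold m in W1, W2.
  set (x := scaled m (n + S (2 * i))) in *. set (X := Xs m (n + S (2 * i))) in *.
  assert (E1 : F (S i) = P (x + / m) / 2).
  { unfold F, x. rewrite <- scaled_S by lra. do 3 f_equal. lia. }
  assert (E2 : F i = P (x - / m) / 2).
  { unfold F, x. rewrite <- scaled_pred by (lra || lia). do 3 f_equal. lia. }
  assert (RA := Hrange (2 * i)%nat ltac:(lia)). assert (RB := Hrange (2 * S i)%nat ltac:(lia)).
  replace (n + 2 * i)%nat with (pred (n + S (2 * i))) in RA by lia. replace (n + 2 * S i)%nat with (S (n + S (2 * i))) in RB by lia.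
  rewrite scaled_S in RB by lra. rewrite scaled_pred in RA by (lra || lia). fold x in RA, RB.
  destruct (mean_value P (fun x => - q x) (x - / m) (x + / m) ltac:(lra) ltac:(intros; apply HP)) as [c [Hc Ec]].
  assert (EF : F i - F (S i) = q c * / m) by (rewrite E1, E2; lra).
  assert (Lc := proj1 (HLip c x ltac:(lra) Rg)).
  assert (Lc2 : L * Rabs (c - x) <= L * / m) by (mul_l; apply Rabs_le; lra).
  replace (dp (n + S (2 * i)) (m ^ 3)) with (X * / m) by (unfold X, Xs; field; lra).
  assert (PX0 : 0 <= X).
  { apply Rmult_le_pos; [lra|]. left. apply dp_range, pow_lt; lra. }
  rewrite (Rabs_pos_eq X) in W1 by auto.
  assert (Bm : B * / m <= / 2).
  { apply div_le; lra. }
  assert (XB : X * / m <= B * / m) by (mul_r; lra).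
  assert (X0m : 0 <= X * / m) by pos.
  assert (A := atanh_bounds (X * / m) ltac:(lra)).
  assert (A2 : (X * / m) ^ 2 <= (B * / m) ^ 2) by (apply pow_incr; lra).
  rewrite EF. replace ((eta + (2 * B ^ 2 + L) / m) / m) with (2 * (B * / m) ^ 2 + (eta * / m + L * / m * / m)) by (field; lra).
  assert (D1 : Rabs ((X - q x) * / m) <= eta * / m) by (rewrite Rabs_mult, (Rabs_pos_eq (/ m)) by lra; mul_r; lra).
  assert (D2 : Rabs ((q c - q x) * / m) <= L * / m * / m) by (rewrite Rabs_mult, (Rabs_pos_eq (/ m)) by lra; mul_r; lra).
  abs_lra. }
 assert (Hwin : Rabs (psum (fun i => atanh (dp (S (2 * (J + i))) (m ^ 3))) N - (F O - F N)) <= eps / 2).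
 { replace (psum (fun i => atanh (dp (S (2 * (J + i))) (m ^ 3))) N - (F O - F N)) with
   (psum (fun i => atanh (dp (S (2 * (J + i))) (m ^ 3)) - (F i - F (S i))) N).
  2:{ rewrite <- psum_telescope. rewrite <- (psum_ext (fun i => atanh (dp (S (2 * (J + i))) (m ^ 3)) + - 1 * (F i - F (S i)))) by (intros; ring).
    rewrite psum_plus, psum_scal. ring. }
  apply Rle_trans with (1 := psum_Rabs_le _ _ _ Hterm).
  assert (Peta : 0 < eta) by (unfold eta; pos).
  assert (PBL : 0 < 2 * B ^ 2 + L) by (assert (0 <= B ^ 2) by apply pow2_ge_0; lra).
  apply Rle_trans with (2 * s * m * ((eta + (2 * B ^ 2 + L) / m) / m)).
  - apply Rmult_le_compat_r; [|lra]. apply Rdiv_le_0_compat; [|lra].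
   assert (0 < (2 * B ^ 2 + L) / m) by pos. lra.
  - replace (2 * s * m * ((eta + (2 * B ^ 2 + L) / m) / m)) with (2 * s * eta + 8 * s * (2 * B ^ 2 + L) / eps * (eps / 4) / m) by (field; lra).
   replace (2 * s * eta) with (eps / 4) by (unfold eta; field; lra).
   assert (8 * s * (2 * B ^ 2 + L) / eps * (eps / 4) / m <= eps / 4); [|lra].
   apply div_le; [pos|].
   rewrite Rmult_comm. mul_l; lra. }
 assert (HFN : Rabs (F N) <= eps / 4).
 { unfold F. unfold Rdiv at 1. rewrite Rabs_mult, (Rabs_pos_eq (/ 2)) by lra.
  assert (H := HPb (scaled m (n + 2 * N)) ltac:(lra)).
  assert (C0 * exp (- scaled m (n + 2 * N)) <= C0 * exp (- s)) by (mul_l; apply exp_mono; lra).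
  assert (0 <= C0 * exp (- s) * s) by pos. lra. }
 assert (Hlim := atanh_sum_lim (m ^ 3) ltac:(pos)).
 replace (m ^ 3 - atanh_sum J (m ^ 3) - P (scaled m n) / 2) with (m ^ 3 - (atanh_sum J (m ^ 3) + F O)) by (unfold F; rewrite Nat.add_0_r; ring).
 apply (lim_close _ _ _ _ (J + N) Hlim). intros K. unfold atanh_sum. rewrite !psum_split.
 assert (T := atanh_tail_small m s (n + 2 * N) K Hm1 ltac:(lra) ltac:(lra) ltac:(lra)).
 rewrite (psum_ext (fun i => atanh (dp (S (2 * (J + N + i))) (m ^ 3))) (fun i => atanh (dp (S (n + 2 * N + 2 * i)) (m ^ 3))) K)
  by (intros; do 3 f_equal; unfold n; lia).
 abs_lra.
Qed.

End Windows.

(** * Sums to the left *)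

Lemma bounded_from_0 (f df : R -> R) (B : R) : f 0 = 0 ->
 (forall x, 0 <= x <= 1 -> is_derive f x (df x) /\ Rabs (df x) <= B) -> forall x, 0 <= x <= 1 -> Rabs (f x) <= B.
Proof.
 intros H0 H x Hx. assert (L := lipschitz_on f df 0 1 B H x 0 Hx ltac:(lra)).
 rewrite H0, !Rminus_0_r, (Rabs_pos_eq x) in L by lra. assert (A := proj2 (H 0 ltac:(lra))).
 generalize (Rabs_pos (df 0)); nra.
Qed.

(* The Peano kernel in differential form: the third derivative in [x] of
  [x (u 0 + u x) / 2 - (U x - U 0) - x^2 (u1 x - u1 0) / 12] is [- x^2 u4 x / 12]. *)
Lemma euler_maclaurin_unit (U u u1 u2 u3 u4 : R -> R) (B : R) :
 (forall x, 0 <= x <= 1 -> is_derive U x (u x) /\ is_derive u x (u1 x) /\ is_derive u1 x (u2 x) /\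
  is_derive u2 x (u3 x) /\ is_derive u3 x (u4 x) /\ Rabs (u4 x) <= B) ->
 Rabs ((u 0 + u 1) / 2 - (U 1 - U 0) - (u1 1 - u1 0) / 12) <= B.
Proof.
 intros H.
 assert (F2 : forall x, 0 <= x <= 1 -> Rabs (x * u2 x / 6 - (u1 x - u1 0) / 6 - x ^ 2 * u3 x / 12) <= B).
 { apply (bounded_from_0 _ (fun x => - x ^ 2 * u4 x / 12)); [field|].
  intros x Hx. destruct (H x Hx) as [D0 [D1 [D2 [D3 [D4 HB]]]]]. split.
  - auto_derive; [repeat split; eexists; eassumption|].
   rewrite (Derive_eta _ _ _ D2), (Derive_eta _ _ _ D3), (Derive_eta _ _ _ D4). field.
  - assert (P := Rabs_pos (u4 x)).
   replace (- x ^ 2 * u4 x / 12) with (- (x ^ 2 / 12) * u4 x) by field.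
   rewrite Rabs_mult, Rabs_Ropp, (Rabs_pos_eq (x ^ 2 / 12)) by nra.
   assert (x ^ 2 / 12 <= 1) by nra. nra. }
 assert (F1 : forall x, 0 <= x <= 1 -> Rabs ((u 0 + u x) / 2 + x * u1 x / 2 - u x - x * (u1 x - u1 0) / 6 - x ^ 2 * u2 x / 12) <= B).
 { apply (bounded_from_0 _ (fun x => x * u2 x / 6 - (u1 x - u1 0) / 6 - x ^ 2 * u3 x / 12)); [field|].
  intros x Hx. destruct (H x Hx) as [D0 [D1 [D2 [D3 [D4 HB]]]]]. split; [|auto].
  auto_derive; [repeat split; eexists; eassumption|].
  rewrite (Derive_eta _ _ _ D1), (Derive_eta _ _ _ D2), (Derive_eta _ _ _ D3). field. }
 assert (F0 := bounded_from_0 (fun x => x * (u 0 + u x) / 2 - (U x - U 0) - x ^ 2 * (u1 x - u1 0) / 12)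
  (fun x => (u 0 + u x) / 2 + x * u1 x / 2 - u x - x * (u1 x - u1 0) / 6 - x ^ 2 * u2 x / 12) B).
 cbv beta in F0. replace ((u 0 + u 1) / 2 - (U 1 - U 0) - (u1 1 - u1 0) / 12) with
  (1 * (u 0 + u 1) / 2 - (U 1 - U 0) - 1 ^ 2 * (u1 1 - u1 0) / 12) by field.
 apply F0; [field| |lra].
 intros x Hx. destruct (H x Hx) as [D0 [D1 [D2 [D3 [D4 HB]]]]]. split; [|auto].
 auto_derive; [repeat split; eexists; eassumption|].
 rewrite (Derive_eta _ _ _ D0), (Derive_eta _ _ _ D1), (Derive_eta _ _ _ D2). field.
Qed.

Lemma euler_maclaurin_step (U u u1 u2 u3 u4 : R -> R) (n B : R) :
 (forall x, n <= x <= n + 1 -> is_derive U x (u x) /\ is_derive u x (u1 x) /\ is_derive u1 x (u2 x) /\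
  is_derive u2 x (u3 x) /\ is_derive u3 x (u4 x) /\ Rabs (u4 x) <= B) ->
 Rabs ((u n + u (n + 1)) / 2 - (U (n + 1) - U n) - (u1 (n + 1) - u1 n) / 12) <= B.
Proof.
 intros H. assert (E := euler_maclaurin_unit (fun x => U (n + x)) (fun x => u (n + x)) (fun x => u1 (n + x))
  (fun x => u2 (n + x)) (fun x => u3 (n + x)) (fun x => u4 (n + x)) B). cbv beta in E. rewrite Rplus_0_r in E. apply E.
 intros x Hx. destruct (H (n + x) ltac:(lra)) as [D0 [D1 [D2 [D3 [D4 HB]]]]].
 assert (G : forall (f : R -> R) (l : R), is_derive f (n + x) l -> is_derive (fun x => f (n + x)) x l).
 { intros f l Df. rewrite <- (Rmult_1_l l).
  apply (is_derive_comp (K := R_AbsRing) (V := R_NormedModule) f (fun x => n + x) x l 1 Df). auto_derive; auto. }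
 exact (conj (G _ _ D0) (conj (G _ _ D1) (conj (G _ _ D2) (conj (G _ _ D3) (conj (G _ _ D4) HB))))).
Qed.

(** The constant is the supremum of all [f - w]. The index type carries no order, so the lemma
    serves sequences as well as a real variable. *)
Lemma squeezed_constant {T : Type} (P : T -> Prop) (f w : T -> R) (x0 : T) : P x0 ->
 (forall x y, P x -> P y -> f x - w x <= f y + w y) -> exists l, forall x, P x -> Rabs (f x - l) <= w x.
Proof.
 intros Hx0 H.
 destruct (completeness (fun r => exists x, P x /\ r = f x - w x)) as [l [U L]].
 - exists (f x0 + w x0). intros r [x [Hx ->]]. auto.
 - exists (f x0 - w x0), x0. auto.
 - exists l. intros x Hx. assert (A : f x - w x <= l) by (apply U; eauto).
  assert (B : l <= f x + w x) by (apply L; intros r [y [Hy ->]]; auto).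
  apply Rabs_le_between. lra.
Qed.

Lemma convergent_sequence (v w : nat -> R) : (forall k, 0 <= w k) ->
 (forall k, Rabs (v (S k) - v k) <= w k - w (S k)) -> exists l, forall k, Rabs (v k - l) <= w k.
Proof.
 intros Hw H. assert (M : forall d k, Rabs (v (k + d)%nat - v k) <= w k - w (k + d)%nat).
 { induction d; intros k; [rewrite Nat.add_0_r; unfold Rminus; rewrite !Rplus_opp_r, Rabs_R0; lra|].
  rewrite <- plus_n_Sm. specialize (IHd k). specialize (H (k + d)%nat).
  abs_lra. }
 destruct (squeezed_constant (fun _ => True) v w O I) as [l Hl]; [|exists l; auto].
 intros x y _ _. destruct (le_lt_dec x y) as [L|L].
 - assert (E := M (y - x)%nat x). replace (x + (y - x))%nat with y in E by lia.
  apply Rabs_le_between in E. generalize (Hw x) (Hw y); lra.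
 - assert (E := M (x - y)%nat y). replace (y + (x - y))%nat with x in E by lia.
  apply Rabs_le_between in E. generalize (Hw x) (Hw y); lra.
Qed.

(** The term [1/(12 n)] is included and the error is [O(1/n^2)] because the sum is later multiplied
    by [n]. *)
Lemma stirling : exists g0, forall n, (1 <= n)%nat ->
 Rabs (psum (fun k => ln (INR (S k))) n - (INR n * ln (INR n) - INR n + ln (INR n) / 2 + / (12 * INR n)) - g0) <= 12 / INR n ^ 2.
Proof.
 destruct (convergent_sequence (fun j => psum (fun k => ln (INR (S k))) (S j) - (INR (S j) * ln (INR (S j)) - INR (S j) + ln (INR (S j)) / 2 + / (12 * INR (S j))))
  (fun j => 12 / INR (S j) ^ 2)) as [g Hg].
 - intros k. apply Rdiv_le_0_compat; [lra|]. apply pow_lt, lt_0_INR; lia.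
 - intros k. cbn [psum]. rewrite (S_INR (S k)). set (n := INR (S k)). assert (Hn : 1 <= n) by (unfold n; rewrite S_INR; generalize (pos_INR k); lra).
  assert (H := euler_maclaurin_step (fun x => x * ln x - x) ln (fun x => / x) (fun x => - / x ^ 2) (fun x => 2 / x ^ 3) (fun x => - 6 / x ^ 4) n (6 / n ^ 4)).
  match type of H with _ -> Rabs ?a <= _ => match goal with |- Rabs ?b <= _ => replace b with a by (field; lra) end end.
  apply Rle_trans with (6 / n ^ 4).
  + apply H. intros x Hx. refine (conj _ (conj _ (conj _ (conj _ (conj _ _)))));
    try (auto_derive; [try lra; apply Rgt_not_eq, Rlt_gt; simpl in *; nra|field; lra]).
   replace (-6 / x ^ 4) with (- (6 * / x ^ 4)) by (field; lra). rewrite Rabs_Ropp, Rabs_pos_eq; [|pos].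
   mul_l. apply Rinv_le_contravar; [pos|apply pow_incr; lra].
  + replace (12 / n ^ 2 - 12 / (n + 1) ^ 2) with (6 / n ^ 4 * (2 * n ^ 2 * (2 * n + 1) / (n + 1) ^ 2)) by (field; lra).
   rewrite <- (Rmult_1_r (6 / n ^ 4)) at 1. apply Rmult_le_compat_l; [pos|].
   apply (Rmult_le_reg_r ((n + 1) ^ 2)); [apply pow_lt; lra|]. unfold Rdiv. rewrite Rmult_assoc, Rinv_l by (apply pow_nonzero; lra). nra.
 - exists g. intros [|j] Hj; [lia|]. apply Hg.
Qed.

(** The constant is that of Glaisher and Kinkelin: with [1/12] moved into the expansion, [gK] equals
    [ln A - 1/12], which is [- zeta'(-1)]. *)
Definition log_hyperfactorial_const (gK : R) : Prop := forall n, (1 <= n)%nat ->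
 Rabs (psum (fun k => INR (S k) * ln (INR (S k))) n -
  (INR n ^ 2 / 2 * ln (INR n) - INR n ^ 2 / 4 + INR n * ln (INR n) / 2 + (ln (INR n) + 1) / 12) - gK) <= 4 / INR n.

Lemma log_hyperfactorial : exists gK, log_hyperfactorial_const gK.
Proof.
 destruct (convergent_sequence (fun j => psum (fun k => INR (S k) * ln (INR (S k))) (S j) -
  (INR (S j) ^ 2 / 2 * ln (INR (S j)) - INR (S j) ^ 2 / 4 + INR (S j) * ln (INR (S j)) / 2 + (ln (INR (S j)) + 1) / 12))
  (fun j => 4 / INR (S j))) as [g Hg].
 - intros k. apply Rdiv_le_0_compat; [lra|]. apply lt_0_INR; lia.
 - intros k. cbn [psum]. rewrite (S_INR (S k)). set (n := INR (S k)). assert (Hn : 1 <= n) by (unfold n; rewrite S_INR; generalize (pos_INR k); lra).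
  assert (H := euler_maclaurin_step (fun x => x ^ 2 / 2 * ln x - x ^ 2 / 4) (fun x => x * ln x) (fun x => ln x + 1) (fun x => / x) (fun x => - / x ^ 2) (fun x => 2 / x ^ 3) n (2 / n ^ 3)).
  match type of H with _ -> Rabs ?a <= _ => match goal with |- Rabs ?b <= _ => replace b with a by (field; lra) end end.
  apply Rle_trans with (2 / n ^ 3).
  + apply H. intros x Hx. refine (conj _ (conj _ (conj _ (conj _ (conj _ _)))));
    try (auto_derive; [try lra; apply Rgt_not_eq, Rlt_gt; simpl in *; nra|field; lra]).
   rewrite Rabs_pos_eq; [|pos].
   mul_l. apply Rinv_le_contravar; [pos|apply pow_incr; lra].
  + replace (4 / n - 4 / (n + 1)) with (2 / n ^ 3 * (2 * n ^ 2 / (n + 1))) by (field; lra).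
   rewrite <- (Rmult_1_r (2 / n ^ 3)) at 1. apply Rmult_le_compat_l; [pos|].
   apply (Rmult_le_reg_r (n + 1)); [lra|]. unfold Rdiv. rewrite Rmult_assoc, Rinv_l by lra. nra.
 - exists g. intros [|j] Hj; [lia|]. apply Hg.
Qed.

(** The refined barrier at [k = 1], where [p = 1 - h]: up to order [h^3] the coefficient [x_1] is
    [sqrt (1 - h)]. *)
Lemma bes_ratio_expansion : exists A t0, 0 < A /\ 1 <= t0 /\ forall t, t0 <= t ->
 Rabs (2 * bes_ratio t - (2 - / (2 * t) - / (16 * t ^ 2))) <= A / t ^ 3.
Proof.
 destruct dp_refined as [z0 [K [h0 [Hz0 [HK [Hh0 H]]]]]].
 exists (2 + 64 * K), (1 + / h0 + 8 / z0).
 assert (P1 : 0 < / h0) by pos. assert (P2 : 0 < 8 / z0) by pos.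
 split; [lra|]. split; [lra|]. intros t Ht. set (h := / (2 * t)).
 assert (Hh : 0 < h) by pos.
 assert (Eh : h * t = / 2) by (unfold h; field; lra).
 assert (Hh1 : h <= / 2) by nra.
 assert (Hh2 : h <= h0).
 { apply (Rmult_le_reg_r t); [lra|]. rewrite Eh. assert (h0 * / h0 = 1) by (field; lra). nra. }
 assert (Hh3 : h <= z0 / 8).
 { apply (Rmult_le_reg_r t); [lra|]. rewrite Eh. assert (z0 / 8 * (8 / z0) = 1) by (field; lra). nra. }
 specialize (H t h ltac:(lra) eq_refl Hh2 1%nat). cbv zeta in H. rewrite Rmult_1_l in H. set (p := 1 - h) in *.
 assert (Hp : / 2 <= p <= 1) by (unfold p; lra).
 assert (Hp3 : / 8 <= p ^ 3) by (replace (/ 8) with ((/ 2) ^ 3) by field; apply pow_incr; lra).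
 assert (Hp6 : / 64 <= p ^ 6) by (replace (/ 64) with ((/ 2) ^ 6) by field; apply pow_incr; lra).
 specialize (H ltac:(lra) ltac:(nra)). rewrite dp_1 in H. replace (1 - p) with h in H by (unfold p; ring).
 set (w := sqrt p) in *. assert (Ew : w * w = p) by (apply sqrt_sqrt; lra).
 assert (Hw : 0 <= w) by apply sqrt_pos.
 assert (h3 : 0 < h ^ 3) by pos.
 assert (H1 : w * (K * h ^ 4 / p ^ 6) <= 32 * K * h ^ 3).
 { assert (K * h ^ 4 / p ^ 6 <= 64 * (K * h ^ 4)).
  { unfold Rdiv. rewrite Rmult_comm. apply Rmult_le_compat_r.
   - apply Rmult_le_pos; [lra|]. pos.
   - rewrite <- (Rinv_inv 64). apply Rinv_le_contravar; lra. }
  assert (K * h ^ 4 <= K * h ^ 3 / 2) by (replace (h ^ 4) with (h ^ 3 * h) by ring; assert (0 < K * h ^ 3) by nra; nra).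
  assert (0 <= K * h ^ 4 / p ^ 6) by (pos). nra. }
 assert (H2 : 0 <= h * h ^ 2 / (16 * p ^ 3) <= h ^ 3 / 2).
 { assert (/ (16 * p ^ 3) <= / 2) by (apply Rinv_le_contravar; lra).
  assert (0 < / (16 * p ^ 3)) by pos. unfold Rdiv. split; [nra|].
  replace (h * h ^ 2) with (h ^ 3) by ring. nra. }
 assert (H3 : Rabs (w - (1 - h / 2 - h ^ 2 / 8)) <= h ^ 3 / 2).
 { set (v := 1 - h / 2 - h ^ 2 / 8). assert (Hv : / 2 <= v) by (unfold v; nra).
  assert (E : (v - w) * (v + w) = h ^ 3 / 8 * (1 + h / 8)) by (unfold v; replace ((1 - h / 2 - h ^ 2 / 8 - w) * (1 - h / 2 - h ^ 2 / 8 + w)) with ((1 - h / 2 - h ^ 2 / 8) ^ 2 - w * w) by ring; rewrite Ew; unfold p; field).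
  assert (0 <= v - w) by (apply Rnot_lt_le; intros L; nra).
  rewrite Rabs_minus_sym, Rabs_pos_eq by auto. nra. }
 assert (Hgoal : Rabs (2 * bes_ratio t - (2 - h - h ^ 2 / 4)) <= 2 * (1 + 32 * K) * h ^ 3).
 { apply Rabs_le_between in H, H3. apply Rabs_le_between.
  assert (w * (h * h ^ 2 / (16 * p ^ 3)) <= h ^ 3 / 2) by nra. assert (0 <= w * (h * h ^ 2 / (16 * p ^ 3))) by nra. lra. }
 replace (/ (16 * t ^ 2)) with (h ^ 2 / 4) by (unfold h; field; lra).
 apply Rle_trans with (1 := Hgoal). replace ((2 + 64 * K) / t ^ 3) with ((2 + 64 * K) * (8 * h ^ 3)) by (unfold h; field; lra).
 assert (0 < K * h ^ 3) by nra. lra.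
Qed.

(** Integrates [bes_ratio_expansion] in [t]: the difference of both sides has a derivative of order
    [t^(-3)] and thus converges at rate [t^(-2)]. The limit [C0] is left unspecified. *)
Lemma ln_besI0_expansion : exists C0 A t0, 0 < A /\ 1 <= t0 /\ forall t, t0 <= t ->
 Rabs (ln (besI0 t) - (2 * t - ln t / 2 + / (16 * t)) - C0) <= A / t ^ 2.
Proof.
 destruct bes_ratio_expansion as [A [t0 [HA [Ht0 H]]]].
 set (f := fun t => ln (besI0 t) - (2 * t - ln t / 2 + / (16 * t))).
 set (df := fun t => 2 * bes_ratio t - (2 - / (2 * t) - / (16 * t ^ 2))).
 assert (Df : forall t, t0 <= t -> is_derive f t (df t)).
 { intros t Ht. unfold f, df.
  apply derive_minus; [apply ln_besI0_derive|].
  auto_derive; [lra|field; lra]. }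
 assert (Dw : forall t, t0 <= t -> is_derive (fun t => - (A / t ^ 2)) t (2 * (A / t ^ 3))).
 { intros t Ht. assert (0 < t * (t * 1)) by nra. auto_derive; [lra|field; lra]. }
 assert (PA : forall t, t0 <= t -> 0 < A / t ^ 3) by (intros; pos).
 assert (M : forall x y, t0 <= x <= y -> Rabs (f y - f x) <= A / x ^ 2 - A / y ^ 2).
 { intros x y Hxy.
  assert (U := deriv_le f (fun t => - (A / t ^ 2)) df (fun t => 2 * (A / t ^ 3)) x y ltac:(lra) ltac:(intros; apply Df; lra) ltac:(intros; apply Dw; lra)).
  assert (L := deriv_le (fun t => - f t) (fun t => - (A / t ^ 2)) (fun t => - df t) (fun t => 2 * (A / t ^ 3)) x y ltac:(lra)
   ltac:(intros; apply (is_derive_opp (K := R_AbsRing) (V := R_NormedModule)); apply Df; lra) ltac:(intros; apply Dw; lra)).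
  cbv beta in U, L.
  assert (B : forall t, x <= t <= y -> - (2 * (A / t ^ 3)) <= df t <= 2 * (A / t ^ 3)).
  { intros t Ht. assert (G := H t ltac:(lra)). fold (df t) in G. apply Rabs_le_between in G. generalize (PA t ltac:(lra)); lra. }
  apply Rabs_le_between. assert (U' := U ltac:(intros; apply B; lra)).
  assert (L' := L ltac:(intros t Ht; generalize (B t Ht); lra)). lra. }
 assert (Pw : forall x, t0 <= x -> 0 < A / x ^ 2) by (intros; pos).
 destruct (squeezed_constant (fun t => t0 <= t) f (fun t => A / t ^ 2) t0 (Rle_refl _)) as [l Hl].
 - intros x y Hx Hy. destruct (Rle_dec x y) as [L|L].
  + generalize (M x y ltac:(lra)); intros E. apply Rabs_le_between in E. generalize (Pw y Hy). lra.
  + generalize (M y x ltac:(lra)); intros E. apply Rabs_le_between in E. generalize (Pw x Hx). lra.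
 - exists l, A, t0. auto.
Qed.

Lemma ln_1p_quadratic d : Rabs d <= / 2 -> Rabs (ln (1 + d) - d) <= d ^ 2.
Proof.
 intros Hd. apply Rabs_le_between in Hd. apply Rabs_le_between. destruct (Rle_dec 0 d) as [L|L].
 - assert (A := ln_1p_bound d L).
  assert (B := deriv_le (fun x => x - x ^ 2) (fun x => ln (1 + x)) (fun x => 1 - 2 * x) (fun x => / (1 + x)) 0 d L).
  cbv beta in B. rewrite Rplus_0_r, ln_1 in B.
  enough (d - d ^ 2 - (0 - 0 ^ 2) <= ln (1 + d) - 0) by lra.
  apply B; [intros; auto_derive; auto; ring|intros; auto_derive; [lra|field; lra]|].
  intros x Hx. apply (Rmult_le_reg_r (1 + x)); [lra|]. rewrite Rinv_l by lra. nra.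
 - assert (A := ln_1m_quadratic (- d) ltac:(lra)). replace (1 - - d) with (1 + d) in A by ring.
  replace ((- d) ^ 2) with (d ^ 2) in A by ring. lra.
Qed.

Lemma atanh_lipschitz a b c : 0 < c -> 0 <= a -> 0 <= b -> a ^ 2 <= 1 - c -> b ^ 2 <= 1 - c ->
 Rabs (atanh a - atanh b) <= / c * Rabs (a - b).
Proof.
 intros Hc Ha Hb Ha2 Hb2.
 apply (lipschitz_on atanh (fun x => / (1 - x ^ 2)) 0 (Rmax a b)); [|split; [auto|apply Rmax_l]|split; [auto|apply Rmax_r]].
 intros x Hx. assert (Hx2 : x ^ 2 <= 1 - c).
 { apply Rle_trans with (Rmax a b ^ 2); [apply pow_incr; lra|]. unfold Rmax; destruct (Rle_dec a b); auto. }
 split; [apply atanh_derive; split; [lra|nra]|].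
 rewrite Rabs_pos_eq; [apply Rinv_le_contravar; lra|pos].
Qed.

Lemma atanh_sqrt p : 0 < p < 1 -> atanh (sqrt p) = ln (1 + sqrt p) - ln (1 - p) / 2.
Proof.
 intros Hp. assert (E : sqrt p * sqrt p = p) by (apply sqrt_sqrt; lra). assert (P := sqrt_lt_R0 p ltac:(lra)).
 assert (sqrt p < 1) by nra. unfold atanh. replace (1 - p) with ((1 - sqrt p) * (1 + sqrt p)) by (rewrite <- E at 3; ring).
 rewrite ln_mult by lra. field.
Qed.

(** For small [k] the coefficient is close to 1, where both functions are singular. Errors are
    therefore measured against [kap = 1 - p]: the proof writes [1 - x^2 = kap (1 + d)] with
    [|d| <= 1/2]. *)
Lemma dp_left : exists z1 h1 C, 0 < z1 /\ 0 < h1 /\ 0 < C /\ forall t h, 0 < t -> h = / (2 * t) -> h <= h1 ->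
 forall k, let p := 1 - INR (S k) * h in 0 < p -> h ^ 2 <= z1 * p ^ 3 ->
 Rabs (dp_log k t - (ln (1 - p) + h ^ 2 / (8 * p ^ 2))) <= C * h ^ 4 / (p ^ 5 * (1 - p)) /\
 Rabs (atanh (dp (S k) t) - (ln (1 + sqrt p) - ln (1 - p) / 2)) <= C * h ^ 2 / sqrt p ^ 5.
Proof.
 destruct dp_refined as [z0 [K [h0 [Hz0 [HK [Hh0 H]]]]]].
 set (K2 := 2 * K + (1 + K) ^ 2). assert (HK2 : 1 < K2) by (unfold K2; nra).
 set (c := / (4 * K2 + 4)). assert (Hc : 0 < c <= / 8).
 { unfold c. split; [pos|apply Rinv_le_contravar; lra]. }
 assert (Ec : c * K2 + c = / 4) by (unfold c; field; lra).
 exists (Rmin z0 (c / 4)), (Rmin h0 (c / 16)), (K2 + 1 + 2 * K2 ^ 2 + 1 + 8 * K).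
 assert (M1 := Rmin_l z0 (c / 4)). assert (M2 := Rmin_r z0 (c / 4)).
 assert (M3 := Rmin_l h0 (c / 16)). assert (M4 := Rmin_r h0 (c / 16)).
 split; [apply Rmin_glb_lt; lra|]. split; [apply Rmin_glb_lt; lra|].
 assert (HKK : 0 <= K2 ^ 2) by apply pow2_ge_0. split; [lra|].
 intros t h Ht Eh Hh k p Hp Hz.
 assert (h_pos : 0 < h) by (rewrite Eh; pos).
 assert (p3 : 0 < p ^ 3) by pos.
 assert (Hk1 : h <= 1 - p).
 { unfold p. rewrite S_INR. generalize (pos_INR k). nra. }
 set (kap := 1 - p) in *.
 assert (Hkap : 0 < kap <= 1) by (unfold kap in *; lra).
 specialize (H t h Ht Eh ltac:(lra) (S k)). cbv zeta in H. fold p kap in H.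
 specialize (H Hp ltac:(nra)).
 set (w := sqrt p) in *. assert (Ew : w * w = p) by (apply sqrt_sqrt; lra).
 assert (Hw : 0 < w) by (apply sqrt_lt_R0; auto). assert (Hw1 : w <= 1) by (unfold kap in *; nra).
 set (z := h ^ 2 / p ^ 3). assert (Pz : 0 < z) by (apply Rdiv_lt_0_compat; [apply pow_lt|]; auto).
 assert (Hz4 : z <= c / 4).
 { unfold z. apply (Rmult_le_reg_r (p ^ 3)); auto. unfold Rdiv at 1. rewrite Rmult_assoc, Rinv_l by lra. nra. }
 set (r := z / kap). assert (Er : r * kap = z) by (unfold r; field; lra).
 assert (Hr : 0 < r) by pos.
 (* Either [kap >= 1/2], or [p >= 1/2]; in the second case [z <= 8 h^2], while [kap >= h] because
    the index is at least 1. *)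
 assert (Hrc : r <= c).
 { destruct (Rle_dec (/ 2) kap) as [L|L]; [nra|].
  assert (Hp2 : / 2 <= p) by (unfold kap in *; lra).
  assert (/ 8 <= p ^ 3) by (replace (/ 8) with ((/ 2) ^ 3) by field; apply pow_incr; lra).
  assert (Hz8 : z <= 8 * h ^ 2).
  { assert (Ez : z * p ^ 3 = h ^ 2) by (unfold z; field; lra). nra. }
  nra. }
 set (y := dp (S k) t) in *. assert (Ry := dp_range (S k) t Ht). fold y in Ry.
 replace (kap * h ^ 2 / (16 * p ^ 3)) with (kap * z / 16) in H by (unfold z; field; lra).
 replace (K * h ^ 4 / p ^ 6) with (K * z ^ 2) in H by (unfold z; field; lra).
 set (th := y / w - (1 - kap * z / 16)). assert (Eth : y = w * (1 - kap * z / 16 + th)) by (unfold th; field; lra).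
 assert (Hth : Rabs th <= K * z ^ 2).
 { replace (y - w * (1 - kap * z / 16)) with (w * th) in H by (unfold th; field; lra).
  rewrite Rabs_mult, (Rabs_pos_eq w) in H by lra. now apply Rmult_le_reg_l in H. }
 assert (Hz1 : z <= 1) by lra. assert (Hz2 : 0 < z ^ 2 <= z) by (split; [pos|nra]).
 set (rho := 2 * th + (th - kap * z / 16) ^ 2).
 assert (Hrho : Rabs rho <= K2 * z ^ 2).
 { assert (Hs : Rabs (th - kap * z / 16) <= (1 + K) * z).
  { apply Rabs_le_between in Hth. apply Rabs_le_between. assert (0 < kap * z <= z) by nra.
   assert (K * z ^ 2 <= K * z) by (mul_l; lra). lra. }
  unfold rho. eapply Rle_trans; [apply Rabs_triang|]. rewrite Rabs_mult, (Rabs_pos_eq 2) by lra.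
  rewrite (Rabs_pos_eq ((th - kap * z / 16) ^ 2)) by apply pow2_ge_0.
  assert (Hs2 : (th - kap * z / 16) ^ 2 <= ((1 + K) * z) ^ 2).
  { rewrite <- (pow2_abs (th - kap * z / 16)). apply pow_incr. split; [apply Rabs_pos|auto]. }
  unfold K2. rewrite Rpow_mult_distr in Hs2. lra. }
 assert (Ey2 : y ^ 2 = p * (1 - kap * z / 8 + rho)) by (rewrite Eth, <- Ew; unfold rho; field).
 set (e := p * z * r). assert (He : 0 < e) by (unfold e; pos).
 assert (Hez : e <= r) by (unfold e; assert (p * z <= 1) by (unfold kap in *; nra); nra).
 set (d := p * z / 8 - p * rho / kap).
 assert (Ed : 1 - y ^ 2 = kap * (1 + d))
  by (rewrite Ey2; replace (kap * (1 + d)) with (kap + kap * p * z / 8 - p * rho) by (unfold d; field; lra); unfold kap; field).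
 assert (Hd1 : Rabs (p * rho / kap) <= K2 * e).
 { unfold Rdiv. rewrite !Rabs_mult, (Rabs_pos_eq p), (Rabs_pos_eq (/ kap)) by (try (left; apply Rinv_0_lt_compat); lra).
  replace (K2 * e) with (p * (K2 * z ^ 2) * / kap) by (unfold e, r; field; lra).
  mul_r. mul_l; lra. }
 assert (Hpz : 0 < p * z <= c / 4) by (unfold kap in *; nra).
 assert (HK2e : K2 * e <= c * K2) by (rewrite (Rmult_comm c); mul_l; lra).
 assert (Hd : Rabs d <= / 2).
 { unfold d. abs_lra. }
 split.
 - unfold dp_log. fold y. rewrite Ed. apply Rabs_le_between in Hd as Hd'.
  rewrite ln_mult by lra. replace (h ^ 2 / (8 * p ^ 2)) with (p * z / 8) by (unfold z; field; lra).
  replace ((K2 + 1 + 2 * K2 ^ 2 + 1 + 8 * K) * h ^ 4 / (p ^ 5 * kap)) with ((K2 + 1 + 2 * K2 ^ 2 + 1 + 8 * K) * e) by (unfold e, r, z; field; lra).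
  assert (Q := ln_1p_quadratic d Hd).
  assert (Hd2 : d ^ 2 <= e + 2 * K2 ^ 2 * e).
  { apply Rle_trans with (2 * (p * z / 8) ^ 2 + 2 * (p * rho / kap) ^ 2).
   - unfold d. assert (0 <= (p * z / 8 + p * rho / kap) ^ 2) by apply pow2_ge_0. lra.
   - assert (B1 : (p * rho / kap) ^ 2 <= (K2 * e) ^ 2).
    { rewrite <- (pow2_abs (p * rho / kap)). apply pow_incr. split; [apply Rabs_pos|auto]. }
    assert (B2 : (K2 * e) ^ 2 <= K2 ^ 2 * e).
    { rewrite Rpow_mult_distr. mul_l. nra. }
    assert (B3 : 2 * (p * z / 8) ^ 2 <= e).
    { assert (p * z * (p * z) <= p * z * r).
     { mul_l. rewrite <- Er. unfold kap in *. nra. }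
     unfold e. nra. }
    lra. }
  assert (Er2 : ln kap + ln (1 + d) - (ln kap + p * z / 8) = (ln (1 + d) - d) - p * rho / kap) by (unfold d; ring).
  rewrite Er2. assert (0 < K * e) by nra.
  abs_lra.
 - replace (ln (1 + w) - ln kap / 2) with (atanh w) by (apply atanh_sqrt; unfold kap in *; lra).
  apply Rabs_le_between in Hd.
  eapply Rle_trans; [apply (atanh_lipschitz y w (kap / 2)); [lra|lra|lra| |]|].
  + enough (kap * / 2 <= kap * (1 + d)) by lra. mul_l; lra.
  + replace (w ^ 2) with p by (rewrite <- Ew; ring). unfold kap in *; lra.
  + assert (Hyw : Rabs (y - w) <= w * (kap * z / 16 + K * z ^ 2)).
   { replace (y - w) with (w * (th - kap * z / 16)) by (rewrite Eth; ring). rewrite Rabs_mult, (Rabs_pos_eq w) by lra.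
    mul_l. apply Rabs_le_between in Hth. apply Rabs_le_between. assert (0 < kap * z) by pos. lra. }
   apply Rle_trans with (/ (kap / 2) * (w * (kap * z / 16 + K * z ^ 2))).
   * mul_l; auto.
   * replace (/ (kap / 2) * (w * (kap * z / 16 + K * z ^ 2))) with (w * z * (/ 8 + 2 * K * r)) by (unfold r; field; lra).
    replace ((K2 + 1 + 2 * K2 ^ 2 + 1 + 8 * K) * h ^ 2 / w ^ 5) with (w * z * (K2 + 1 + 2 * K2 ^ 2 + 1 + 8 * K)).
    -- apply Rmult_le_compat_l; [pos|]. assert (K * r <= K * 1) by (mul_l; lra). lra.
    -- unfold z. rewrite <- Ew. field. lra.
Qed.

(** * Riemann sums and Stirling sums over the left range *)

Lemma psum_telescope_le (f g : nat -> R) (c : R) n : (forall j, (j < n)%nat -> Rabs (f j) <= c * (g (S j) - g j)) ->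
 0 <= c * g O -> Rabs (psum f n) <= c * g n.
Proof.
 intros H H0. apply Rle_trans with (1 := psum_Rabs _ _). apply Rle_trans with (1 := psum_le _ _ _ H).
 rewrite psum_scal. rewrite (psum_ext _ (fun j => - g j - - g (S j))) by (intros; ring). rewrite psum_telescope. lra.
Qed.

Lemma inv_cube_step p h : 0 < h <= p -> h / p ^ 4 <= 3 * (/ p ^ 3 - / (p + h) ^ 3).
Proof.
 intros H. assert (0 < p ^ 3) by pos. assert (0 < (p + h) ^ 3) by pos.
 replace (3 * (/ p ^ 3 - / (p + h) ^ 3)) with (h / p ^ 4 * (3 * p * (3 * p ^ 2 + 3 * p * h + h ^ 2) / (p + h) ^ 3)) by (field; lra).
 rewrite <- (Rmult_1_r (h / p ^ 4)) at 1. apply Rmult_le_compat_l; [pos|].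
 apply (Rmult_le_reg_r ((p + h) ^ 3)); auto. unfold Rdiv. rewrite Rmult_assoc, Rinv_l by lra.
 nra.
Qed.

Lemma inv_step p h : 0 < h <= p -> h / p ^ 2 <= 2 * (/ p - / (p + h)).
Proof.
 intros H. replace (2 * (/ p - / (p + h))) with (h / p ^ 2 * (2 * p / (p + h))) by (field; lra).
 rewrite <- (Rmult_1_r (h / p ^ 2)) at 1. apply Rmult_le_compat_l; [pos|].
 apply (Rmult_le_reg_r (p + h)); [lra|]. unfold Rdiv. rewrite Rmult_assoc, Rinv_l by lra. lra.
Qed.

Lemma riemann_step (p x h : R) : 0 < p <= x -> 0 < h <= x ->
 Rabs (h * ((x - p) / x ^ 2) - ((ln (x + h) + p / (x + h)) - (ln x + p / x))) <= h * (2 * (/ x - / (x + h))).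
Proof.
 intros Hp Hh. apply Rle_trans with (h * (h / x ^ 2)); [|mul_l; now apply inv_step].
 destruct (mean_value (fun y => ln y + p / y) (fun y => (y - p) / y ^ 2) x (x + h) ltac:(lra)) as [c [Hc Ec]].
 { intros y Hy. auto_derive; [lra|field; lra]. }
 rewrite Ec. replace (x + h - x) with h by ring.
 replace (h * ((x - p) / x ^ 2) - (c - p) / c ^ 2 * h) with (h * ((x - p) / x ^ 2 - (c - p) / c ^ 2)) by ring.
 rewrite Rabs_mult, (Rabs_pos_eq h) by lra. mul_l.
 eapply Rle_trans; [apply (lipschitz_on (fun y => (y - p) / y ^ 2) (fun y => (2 * p - y) / y ^ 3) x (x + h) (/ x ^ 2)); [|lra|lra]|].
 - intros y Hy. assert (0 < y * (y * 1)) by nra. split; [auto_derive; [lra|field; lra]|].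
  unfold Rdiv. rewrite Rabs_mult, (Rabs_pos_eq (/ y ^ 3)) by pos.
  apply Rle_trans with (y * / y ^ 3).
  + mul_r. apply Rabs_le. lra.
  + replace (y * / y ^ 3) with (/ y ^ 2) by (field; lra). apply Rinv_le_contravar; [pos|apply pow_incr; lra].
 - unfold Rdiv. rewrite Rmult_comm. mul_r. apply Rabs_le. lra.
Qed.

(** The weights are of order [t], so leading terms must be summed exactly. Since [1 - p = k h], they
    are [ln (k h)] and lead to [sum ln k] and [sum k ln k]. The correction [h^2/(8 p^2)] is a
    Riemann sum producing [- ln p / 8]; the remainder is summed by [inv_cube_step]. *)
Lemma log_tail_expansion (gK : R) : log_hyperfactorial_const gK ->
 exists G z1 h1 C, 0 < z1 /\ 0 < h1 /\ 0 < C /\ forall t h n, 0 < t -> h = / (2 * t) -> h <= h1 ->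
 let v := INR n * h in let p := 1 - v in 0 < p <= / 2 -> h ^ 2 <= z1 * p ^ 3 ->
 Rabs (log_tail n t - (INR n * G + (v - / 4 + v ^ 2 * ln v / 2 - 3 / 4 * v ^ 2) / h ^ 2 + (ln h - ln v) / 12 - ln p / 8 - gK))
  <= C * (h + h ^ 2 / p ^ 3 + h / p).
Proof.
 intros HK. destruct stirling as [g0 Hg0]. destruct ln_besI0_expansion as [C0 [A [t0 [HA [Ht0 Hl]]]]].
 destruct dp_left as [z1 [h1 [C [Hz1 [Hh1 [HC HD]]]]]].
 (* The coefficient of [n]: the Stirling constant, the constant of [ln I_0], and [ln 2 / 2] from
    [- ln t / 2] with [t = 1/(2h)]. *)
 exists (g0 + C0 + ln 2 / 2), (Rmin z1 1), (Rmin h1 (/ (2 * t0))), (32 + 4 * A + 16 * C + 6 * C + 1).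
 split; [apply Rmin_glb_lt; lra|]. split; [apply Rmin_glb_lt; [lra|pos]|]. split; [lra|].
 intros t h n Ht Eh Hh v p Hp Hz.
 assert (M1 := Rmin_l z1 1). assert (M2 := Rmin_r z1 1). assert (M3 := Rmin_l h1 (/ (2 * t0))). assert (M4 := Rmin_r h1 (/ (2 * t0))).
 assert (h_pos : 0 < h) by (rewrite Eh; pos).
 assert (Et : t = / (2 * h)) by (rewrite Eh; field; lra).
 assert (Ht0t : t0 <= t).
 { apply Rnot_lt_le; intros L. assert (/ (2 * t0) < / (2 * t)) by (apply Rinv_lt_contravar; nra). lra. }
 set (N := INR n) in *. assert (Ev : v = 1 - p) by (unfold p; ring).
 assert (HN : 0 < N) by (unfold v in Ev; nra).
 assert (Hn1 : (1 <= n)%nat) by (destruct n; [unfold N in HN; simpl in HN; lra|lia]).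
 assert (HN1 : 1 <= N) by (apply (le_INR 1 n); auto).
 assert (HiN : / N <= 2 * h).
 { apply (Rmult_le_reg_r N); auto. rewrite Rinv_l by lra. unfold v in Ev. lra. }
 assert (p3 : 0 < p ^ 3) by pos.
 assert (Hhp : h <= p).
 { apply Rnot_lt_le; intros L. nra. }
 set (P := fun j => 1 - INR j * h).
 assert (HPj : forall j, P j = P (S j) + h) by (intros; unfold P; rewrite S_INR; ring).
 assert (HPn : P n = p) by reflexivity.
 assert (Pmono : forall j, (j < n)%nat -> p <= P (S j) < 1).
 { intros j Hj. apply le_INR in Hj. fold N in Hj. unfold P, p, v. assert (0 < INR (S j)) by (apply lt_0_INR; lia). nra. }
 assert (Hw : forall j, INR n - INR (S j) = (P (S j) - p) / h) by (intros; unfold P, p, v, N; field; lra).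
 assert (S1 : Rabs (psum (fun j => (INR n - INR (S j)) * (dp_log j t - (ln (1 - P (S j)) + h ^ 2 / (8 * P (S j) ^ 2)))) n) <= C * (16 * h + 6 * (h ^ 2 / p ^ 3))).
 { apply Rle_trans with (1 := psum_Rabs _ _).
  (* The estimate [1/(x^4 (1 - x)) <= 16/h + 2/x^4] separates the singularity at [x = 1], limited by
     [1 - x >= h], from the one at [x = 0]. *)
  apply Rle_trans with (psum (fun j => 16 * C * h ^ 2 + 2 * C * h ^ 2 * (h / P (S j) ^ 4)) n).
  - apply psum_le. intros j Hj. assert (B := Pmono j Hj).
   destruct (HD t h Ht Eh ltac:(lra) j) as [D _]; [fold (P (S j)); lra| |].
   { fold (P (S j)). apply Rle_trans with (1 := Hz). assert (p ^ 3 <= P (S j) ^ 3) by (apply pow_incr; lra).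
    apply Rle_trans with (z1 * p ^ 3); nra. }
   cbv zeta in D. fold (P (S j)) in D. set (x := P (S j)) in *.
   assert (Hkap : h <= 1 - x).
   { unfold x, P. rewrite S_INR. generalize (pos_INR j). nra. }
   rewrite Rabs_mult, Hw. fold x. rewrite (Rabs_pos_eq ((x - p) / h)) by pos.
   apply Rle_trans with (x / h * (C * h ^ 4 / (x ^ 5 * (1 - x)))).
   { apply Rmult_le_compat; [pos|apply Rabs_pos| |exact D].
    apply Rmult_le_compat_r; [left; apply Rinv_0_lt_compat|]; lra. }
   replace (x / h * (C * h ^ 4 / (x ^ 5 * (1 - x)))) with (C * h ^ 3 * (/ x ^ 4 * / (1 - x))) by (field; lra).
   replace (16 * C * h ^ 2 + 2 * C * h ^ 2 * (h / x ^ 4)) with (C * h ^ 3 * (16 * / h + 2 * / x ^ 4)) by (field; lra).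
   apply Rmult_le_compat_l; [pos|].
   assert (i1 : 0 < / x ^ 4) by pos.
   assert (i2 : 0 < / (1 - x) <= / h) by (split; [apply Rinv_0_lt_compat|apply Rinv_le_contravar]; lra).
   destruct (Rle_dec (/ 2) x) as [L|L].
   + assert (/ x ^ 4 <= 16).
    { replace 16 with (/ (/ 2) ^ 4) by field. apply Rinv_le_contravar; [apply pow_lt|apply pow_incr]; lra. }
    nra.
   + assert (/ (1 - x) <= 2) by (rewrite <- (Rinv_inv 2); apply Rinv_le_contravar; lra).
    nra.
  - rewrite psum_plus, psum_const, psum_scal. fold N.
   assert (T : Rabs (psum (fun j => h / P (S j) ^ 4) n) <= 3 * / P n ^ 3).
   { apply (psum_telescope_le _ (fun j => / P j ^ 3) 3); [|unfold P; simpl; rewrite Rmult_0_l, Rminus_0_r; lra].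
    intros j Hj. assert (B := Pmono j Hj). rewrite Rabs_pos_eq by pos.
    rewrite (HPj j). apply inv_cube_step. lra. }
   rewrite HPn in T. apply Rabs_le_between in T.
   assert (2 * C * h ^ 2 * psum (fun j => h / P (S j) ^ 4) n <= 2 * C * h ^ 2 * (3 * / p ^ 3)) by (mul_l; lra).
   replace (C * (16 * h + 6 * (h ^ 2 / p ^ 3))) with (C * 16 * h + 2 * C * h ^ 2 * (3 * / p ^ 3)) by (field; lra).
   assert (N * (16 * C * h ^ 2) = 16 * C * h * v) by (unfold v; ring).
   assert (16 * C * h * v <= 16 * C * h * 1) by (mul_l; nra). lra. }
 assert (S2 : Rabs (psum (fun j => (INR n - INR (S j)) * (h ^ 2 / (8 * P (S j) ^ 2))) n - / 8 * (p - ln p - 1)) <= h / p).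
 { rewrite (psum_ext _ (fun j => / 8 * (h * ((P (S j) - p) / P (S j) ^ 2)))).
  2:{ intros j Hj. assert (B := Pmono j Hj). rewrite Hw. field. lra. }
  rewrite psum_scal, <- Rmult_minus_distr_l, Rabs_mult, (Rabs_pos_eq (/ 8)) by lra.
  assert (T : Rabs (psum (fun j => h * ((P (S j) - p) / P (S j) ^ 2) - ((ln (P j) + p / P j) - (ln (P (S j)) + p / P (S j)))) n) <= (h * 2) * / P n).
  { apply (psum_telescope_le _ (fun j => / P j) (h * 2)); [|unfold P; simpl; rewrite Rmult_0_l, Rminus_0_r, Rinv_1; lra].
   intros j Hj. assert (B := Pmono j Hj). rewrite (HPj j). rewrite Rmult_assoc. apply riemann_step; lra. }
  rewrite HPn in T.
  replace (p - ln p - 1) with ((ln (P O) + p / P O) - (ln (P n) + p / P n)).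
  2:{ rewrite HPn. unfold P; simpl. rewrite Rmult_0_l, Rminus_0_r, ln_1. field. lra. }
  rewrite <- (psum_telescope (fun j => ln (P j) + p / P j)).
  assert (E := fun f g => psum_minus f g n).
  rewrite E. assert (0 < h / p) by pos. replace (h * 2 * / p) with (2 * (h / p)) in T by (field; lra). lra. }
 assert (Esum : psum (fun j => (INR n - INR (S j)) * dp_log j t) n =
  psum (fun j => (INR n - INR (S j)) * (dp_log j t - (ln (1 - P (S j)) + h ^ 2 / (8 * P (S j) ^ 2)))) n +
  psum (fun j => (INR n - INR (S j)) * (h ^ 2 / (8 * P (S j) ^ 2))) n +
  (N * psum (fun k => ln (INR (S k))) n - psum (fun k => INR (S k) * ln (INR (S k))) n + ln h * (N * (N - 1) / 2))).
 { assert (Ek : psum (fun j => INR n - INR (S j)) n = N * (N - 1) / 2).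
  { assert (Ea : forall k, psum (fun j => INR (S j)) k = INR k * (INR k + 1) / 2).
   { induction k; cbn [psum]; [simpl; field|]. rewrite IHk, S_INR. field. }
   rewrite (psum_ext _ (fun j => INR n + -1 * INR (S j))) by (intros; ring). rewrite psum_plus, psum_scal, psum_const, Ea. fold N. field. }
  rewrite <- Ek, <- !psum_scal.
  replace (psum (fun k => N * ln (INR (S k))) n - psum (fun k => INR (S k) * ln (INR (S k))) n) with
   (psum (fun k => N * ln (INR (S k))) n + psum (fun k => -1 * (INR (S k) * ln (INR (S k)))) n) by (rewrite (psum_scal (-1)); ring).
  rewrite <- !psum_plus. apply psum_ext. intros j Hj.
  replace (1 - P (S j)) with (INR (S j) * h) by (unfold P; ring). rewrite ln_mult by (auto; apply lt_0_INR; lia). fold N. ring. }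
 specialize (HK n Hn1). specialize (Hg0 n Hn1). specialize (Hl t Ht0t). fold N in HK, Hg0.
 unfold log_tail. rewrite Esum. fold N.
 fold N in S1, S2.
 set (X1 := psum (fun j => (N - INR (S j)) * (dp_log j t - (ln (1 - P (S j)) + h ^ 2 / (8 * P (S j) ^ 2)))) n) in *.
 set (X2 := psum (fun j => (N - INR (S j)) * (h ^ 2 / (8 * P (S j) ^ 2))) n) in *.
 set (L := psum (fun k => ln (INR (S k))) n) in *. set (K := psum (fun k => INR (S k) * ln (INR (S k))) n) in *.
 assert (ElnN : ln N = ln v - ln h) by (unfold v; rewrite ln_mult by lra; ring).
 assert (Elnt : ln t = - ln 2 - ln h) by (rewrite Et, ln_Rinv, ln_mult by lra; ring).
 assert (EN : N = v / h) by (unfold v; field; lra).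
 set (e1 := L - (N * ln N - N + ln N / 2 + / (12 * N)) - g0) in *.
 set (e2 := K - (N ^ 2 / 2 * ln N - N ^ 2 / 4 + N * ln N / 2 + (ln N + 1) / 12) - gK) in *.
 set (e3 := ln (besI0 t) - (2 * t - ln t / 2 + / (16 * t)) - C0) in *.
 assert (B1 : Rabs (N * e1) <= 24 * h).
 { rewrite Rabs_mult, (Rabs_pos_eq N) by lra. apply Rle_trans with (N * (12 / N ^ 2)); [mul_l; lra|].
  replace (N * (12 / N ^ 2)) with (12 * / N) by (field; lra). lra. }
 assert (B3 : Rabs (N * e3) <= 4 * A * h).
 { rewrite Rabs_mult, (Rabs_pos_eq N) by lra. apply Rle_trans with (N * (A / t ^ 2)); [mul_l; lra|].
  replace (N * (A / t ^ 2)) with (4 * A * h * v) by (rewrite Et; unfold v; field; lra).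
  rewrite <- (Rmult_1_r (4 * A * h)) at 2. mul_l; nra. }
 match goal with |- Rabs ?a <= _ => replace a with (N * e1 - e2 + N * e3 + X1 + (X2 - / 8 * (p - ln p - 1))) end.
 2:{ unfold e1, e2, e3. rewrite ElnN, Elnt, Et, EN. unfold p. field. split; [|lra]. unfold p in Hp. lra. }
 assert (0 < h ^ 2 / p ^ 3) by pos. assert (0 < h / p) by pos.
 assert (Q3 : 0 < C * (h ^ 2 / p ^ 3)) by nra.
 assert (Q4 : 0 < A * (h ^ 2 / p ^ 3)) by nra. assert (Q5 : 0 < A * (h / p)) by nra. assert (Q6 : 0 < C * (h / p)) by nra.
 abs_lra.
Qed.

Lemma inv_sqrt_step c h : 0 < h <= c -> h / sqrt c ^ 5 <= 2 * (/ sqrt c ^ 3 - / sqrt (c + h) ^ 3).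
Proof.
 intros H. assert (Ex : sqrt c * sqrt c = c) by (apply sqrt_sqrt; lra).
 assert (Ea : sqrt (c + h) * sqrt (c + h) = c + h) by (apply sqrt_sqrt; lra).
 assert (Px := sqrt_lt_R0 c ltac:(lra)). assert (Hle : sqrt c <= sqrt (c + h)) by (apply sqrt_le_1_alt; lra).
 set (x := sqrt c) in *. set (a := sqrt (c + h)) in *.
 replace (2 * (/ x ^ 3 - / a ^ 3)) with (/ (a ^ 3 * x ^ 5) * (2 * x ^ 2 * (a ^ 3 - x ^ 3))) by (field; lra).
 replace (h / x ^ 5) with (/ (a ^ 3 * x ^ 5) * (h * a ^ 3)) by (field; lra).
 apply Rmult_le_compat_l; [left; apply Rinv_0_lt_compat; pos|].
 apply Rle_trans with (2 * x ^ 2 * (a * h)); [|mul_l; nra].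
 replace (h * a ^ 3) with (a ^ 2 * (a * h)) by ring. mul_r; nra.
Qed.

(** [F] is a primitive of [ln (1 + sqrt y)]. Summing over odd indices is the midpoint rule with step
    [2h], whose gain of one order makes the error vanish after division by [2h]. *)
Lemma midpoint_step (w x h : R) : 0 < w -> 0 < h -> w ^ 2 <= x - h -> x + h <= 1 ->
 let F := fun y => (y - 1) * ln (1 + sqrt y) + sqrt y - y / 2 in
 Rabs (F (x + h) - F (x - h) - 2 * h * ln (1 + sqrt x)) <= h ^ 3 / w ^ 3.
Proof.
 intros Hw Hh H1 H2 F. set (g := fun y => ln (1 + sqrt y)).
 assert (Sq : forall y, w ^ 2 <= y -> sqrt y * sqrt y = y /\ w <= sqrt y).
 { intros y Hy. assert (0 < w ^ 2) by pos. split; [apply sqrt_sqrt; lra|].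
  rewrite <- (sqrt_pow2 w) by lra. now apply sqrt_le_1_alt. }
 assert (DF : forall y, w ^ 2 <= y -> is_derive F y (g y)).
 { intros y Hy. destruct (Sq y Hy) as [E L]. assert (0 < w ^ 2) by pos. unfold F, g.
  auto_derive; [repeat split; lra|]. set (s := sqrt y) in *. clearbody s. subst y. field. lra. }
 assert (Dg : forall y, w ^ 2 <= y -> is_derive g y (/ (2 * (sqrt y + y)))).
 { intros y Hy. destruct (Sq y Hy) as [E L]. assert (0 < w ^ 2) by pos. unfold g.
  auto_derive; [repeat split; lra|]. set (s := sqrt y) in *. clearbody s. subst y. field. repeat split; nra. }
 assert (Dg2 : forall y, w ^ 2 <= y -> is_derive (fun y => / (2 * (sqrt y + y))) y (- (/ (2 * sqrt y) + 1) / (2 * (sqrt y + y) ^ 2))).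
 { intros y Hy. destruct (Sq y Hy) as [E L]. assert (0 < w ^ 2) by pos.
  auto_derive; [repeat split; lra|]. field. repeat split; lra. }
 assert (Bg2 : forall y, w ^ 2 <= y <= 1 -> Rabs (- (/ (2 * sqrt y) + 1) / (2 * (sqrt y + y) ^ 2)) <= / w ^ 3).
 { intros y [Hy Hy1]. destruct (Sq y Hy) as [E L].
  set (s := sqrt y) in *. replace (- (/ (2 * s) + 1) / (2 * (s + y) ^ 2)) with (- ((1 + 2 * s) / 4 * / (1 + s) ^ 2 * / s ^ 3)) by (rewrite <- E; field; repeat split; nra).
  assert (0 < / (1 + s) ^ 2) by pos. assert (0 < / s ^ 3) by pos.
  rewrite Rabs_Ropp, Rabs_pos_eq by (apply Rmult_le_pos; nra).
  apply Rle_trans with (1 * / s ^ 3).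
  - mul_r. apply div_le; nra.
  - rewrite Rmult_1_l. apply Rinv_le_contravar; [pos|apply pow_incr; lra]. }
 set (e := fun d => F (x + d) - F (x - d) - 2 * d * g x).
 assert (De : forall d, 0 <= d <= h -> is_derive e d (g (x + d) + g (x - d) - 2 * g x)).
 { intros d Hd. assert (A1 := DF (x + d) ltac:(lra)). assert (A2 := DF (x - d) ltac:(lra)). unfold e.
  auto_derive; [split; [eexists; exact A1|split; [eexists; exact A2|auto]]|].
  rewrite (Derive_eta _ _ _ A1). replace (x + - d) with (x - d) by ring. rewrite (Derive_eta _ _ _ A2). ring. }
 assert (Be : forall d, 0 <= d <= h -> Rabs (g (x + d) + g (x - d) - 2 * g x) <= / w ^ 3 * h ^ 2).
 { intros d Hd. apply Rle_trans with (/ w ^ 3 * d ^ 2).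
  - apply (second_diff_bound g (fun y => / (2 * (sqrt y + y))) (fun y => - (/ (2 * sqrt y) + 1) / (2 * (sqrt y + y) ^ 2)) x d (/ w ^ 3) ltac:(lra)); intros y Hy; [apply Dg|apply Dg2|apply Bg2]; lra.
  - mul_l. apply pow_incr; lra. }
 assert (L := lipschitz_on e (fun d => g (x + d) + g (x - d) - 2 * g x) 0 h (/ w ^ 3 * h ^ 2) (fun d Hd => conj (De d Hd) (Be d Hd)) h 0 ltac:(lra) ltac:(lra)).
 unfold e in L. rewrite Rplus_0_r, !Rminus_0_r, (Rabs_pos_eq h) in L by lra.
 replace (h ^ 3 / w ^ 3) with (/ w ^ 3 * h ^ 2 * h) by (field; lra). unfold g in L.
 replace (F x - F x - 2 * 0 * ln (1 + sqrt x)) with 0 in L by ring. now rewrite Rminus_0_r in L.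
Qed.

Lemma psum_pairs (f : nat -> R) J : psum f (2 * J) = psum (fun j => f (2 * j)%nat + f (S (2 * j))) J.
Proof.
 induction J; [reflexivity|]. replace (2 * S J)%nat with (S (S (2 * J))) by lia. cbn [psum]. rewrite IHJ. ring.
Qed.

(** Stirling at [2J] minus Stirling at [J]. The unknown [g0] cancels and the explicit [ln 2 / 2]
    remains, the source of the constant in the integral of [q]. *)
Lemma odd_log_sum J g0 : (1 <= J)%nat -> (forall n, (1 <= n)%nat ->
 Rabs (psum (fun k => ln (INR (S k))) n - (INR n * ln (INR n) - INR n + ln (INR n) / 2 + / (12 * INR n)) - g0) <= 12 / INR n ^ 2) ->
 Rabs (psum (fun j => ln (INR (S (2 * j)))) J - (INR J * ln (INR (2 * J)) - INR J + ln 2 / 2)) <= 30 / INR J.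
Proof.
 intros HJ H. assert (A := H J HJ). assert (B := H (2 * J)%nat ltac:(lia)). rewrite psum_pairs in B.
 rewrite (psum_ext _ (fun j => ln (INR (S (2 * j))) + (ln 2 + ln (INR (S j))))) in B.
 2:{ intros j _. f_equal. rewrite <- ln_mult by (try apply lt_0_INR; lra || lia). f_equal. rewrite !S_INR, mult_INR. simpl. ring. }
 rewrite !psum_plus, psum_const in B. rewrite mult_INR in *. change (INR 2) with 2 in *.
 assert (P : 1 <= INR J) by (apply (le_INR 1); auto). rewrite ln_mult in * by lra.
 set (x := INR J) in *. assert (I : 0 < / x <= 1) by (split; [pos|apply Rinv_le_1; lra]).
 assert (E1 : 12 / x ^ 2 <= 12 * / x) by (replace (12 / x ^ 2) with (12 * (/ x * / x)) by (field; lra); nra).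
 assert (E2 : 12 / (2 * x) ^ 2 <= 3 * / x) by (replace (12 / (2 * x) ^ 2) with (3 * (/ x * / x)) by (field; lra); nra).
 assert (E3 : / (12 * (2 * x)) = / x / 24) by (field; lra). assert (E4 : / (12 * x) = / x / 12) by (field; lra).
 rewrite E3 in B. rewrite E4 in A. abs_lra.
Qed.

(** Uses [atanh (sqrt p) = ln (1 + sqrt p) - ln (1 - p) / 2]: the first part is regular enough for
    the midpoint rule, the second is [ln (k h) / 2] and is summed exactly by [odd_log_sum]. *)
Lemma atanh_sum_expansion : exists z1 h1 C, 0 < z1 /\ 0 < h1 /\ 0 < C /\ forall t h J, 0 < t -> h = / (2 * t) -> h <= h1 ->
 let p := 1 - INR (2 * J) * h in let w := sqrt p in 0 < p <= / 2 -> h ^ 2 <= z1 * p ^ 3 ->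
 Rabs (t - atanh_sum J t - ((w - (1 - w ^ 2) * atanh w) / (2 * h) + ln 2 / 4)) <= C * (h + h / w ^ 3).
Proof.
 destruct stirling as [g0 Hg0]. destruct dp_left as [z1 [h1 [C [Hz1 [Hh1 [HC HD]]]]]].
 exists (Rmin z1 1), h1, (4 * C + 60 + 1). split; [apply Rmin_glb_lt; lra|]. split; [auto|]. split; [lra|].
 intros t h J Ht Eh Hh p w Hp Hz. assert (M1 := Rmin_l z1 1). assert (M2 := Rmin_r z1 1).
 assert (h_pos : 0 < h) by (rewrite Eh; pos).
 assert (p3 : 0 < p ^ 3) by pos.
 assert (Hhp : h <= p).
 { apply Rnot_lt_le; intros L. nra. }
 assert (Ew : w * w = p) by (apply sqrt_sqrt; lra). assert (Hw : 0 < w) by (apply sqrt_lt_R0; lra).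
 assert (Hw1 : w < 1) by nra.
 set (P := fun j => 1 - INR j * h).
 assert (HPj : forall j, P j = P (S j) + h) by (intros; unfold P; rewrite S_INR; ring).
 assert (HPn : P (2 * J)%nat = p) by reflexivity.
 assert (HJ1 : (1 <= J)%nat) by (destruct J; [unfold p in Hp; simpl in Hp; lra|lia]).
 assert (Pmono : forall k, (k <= 2 * J)%nat -> p <= P k <= 1).
 { intros j Hj. apply le_INR in Hj. unfold P, p. assert (0 <= INR j) by apply pos_INR. nra. }
 set (x := INR J). assert (Hx : 1 <= x) by (apply (le_INR 1); auto).
 assert (Exh : 2 * x * h = 1 - p) by (unfold p, x; rewrite mult_INR; simpl; ring).
 assert (Hix : / x <= 4 * h).
 { apply (Rmult_le_reg_r x); [lra|]. rewrite Rinv_l by lra. lra. }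
 assert (E := fun f g => psum_minus f g J).
 set (A := fun j => ln (1 + sqrt (P (S (2 * j))))). set (B := fun j => ln (1 - P (S (2 * j))) / 2).
 assert (S1 : Rabs (atanh_sum J t - psum (fun j => A j - B j) J) <= 2 * C * h * / w ^ 3).
 { unfold atanh_sum. rewrite E.
  replace w with (sqrt (P (2 * J)%nat)) by reflexivity.
  apply (psum_telescope_le _ (fun j => / sqrt (P (2 * j)%nat) ^ 3)).
  2:{ unfold P; simpl. rewrite Rmult_0_l, Rminus_0_r, sqrt_1. nra. }
  intros j Hj. set (c := P (S (2 * j))). assert (Hc1 := Pmono (S (2 * j)) ltac:(lia)). fold c in Hc1.
  assert (Hc2 := Pmono (2 * S j)%nat ltac:(lia)). replace (2 * S j)%nat with (S (S (2 * j))) in * by lia.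
  assert (Ec : c = P (S (S (2 * j))) + h) by apply HPj. rewrite (HPj (2 * j)%nat). fold c.
  destruct (HD t h Ht Eh Hh (2 * j)%nat) as [_ D]; [fold (P (S (2 * j))); fold c; lra| |].
  { fold (P (S (2 * j))); fold c. apply Rle_trans with (1 := Hz). assert (p ^ 3 <= c ^ 3) by (apply pow_incr; lra).
   apply Rle_trans with (z1 * p ^ 3); nra. }
  fold (P (S (2 * j))) in D. fold c in D. apply Rle_trans with (1 := D).
  assert (G := inv_sqrt_step c h ltac:(lra)).
  assert (Mon : / sqrt c ^ 3 <= / sqrt (P (S (S (2 * j)))) ^ 3).
  { assert (0 < sqrt (P (S (S (2 * j))))) by (apply sqrt_lt_R0; lra).
   apply Rinv_le_contravar; [pos|]. apply pow_incr. split; [lra|]. apply sqrt_le_1_alt; lra. }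
  assert (0 < sqrt c) by (apply sqrt_lt_R0; lra).
  replace (C * h ^ 2 / sqrt c ^ 5) with (C * h * (h / sqrt c ^ 5)) by (field; lra).
  apply Rle_trans with (C * h * (2 * (/ sqrt c ^ 3 - / sqrt (c + h) ^ 3))); [mul_l; nra|].
  assert (0 < C * h) by nra. nra. }
 set (F := fun y => (y - 1) * ln (1 + sqrt y) + sqrt y - y / 2).
 assert (SA : Rabs (2 * h * psum A J - (F 1 - F p)) <= h ^ 2 / w ^ 3).
 { replace (F 1 - F p) with (F (P (2 * 0)%nat) - F (P (2 * J)%nat)) by (rewrite HPn; f_equal; f_equal; unfold P; simpl; ring).
  rewrite <- (psum_telescope (fun j => F (P (2 * j)%nat))), <- psum_scal, E.
  apply Rle_trans with (INR J * (h ^ 3 / w ^ 3)).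
  - apply psum_Rabs_le. intros j Hj. assert (Hc2 := Pmono (2 * S j)%nat ltac:(lia)). assert (Hc0 := Pmono (2 * j)%nat ltac:(lia)).
   replace (2 * S j)%nat with (S (S (2 * j))) in * by lia. assert (Q1 := HPj (2 * j)%nat). assert (Q2 := HPj (S (2 * j))).
   assert (G := midpoint_step w (P (S (2 * j))) h Hw h_pos ltac:(replace (w ^ 2) with p by (rewrite <- Ew; ring); lra) ltac:(lra)). cbv zeta in G. fold F in G.
   rewrite Rabs_minus_sym. rewrite Q1. replace (P (S (S (2 * j)))) with (P (S (2 * j)) - h) by lra. exact G.
  - fold x. replace (x * (h ^ 3 / w ^ 3)) with (x * h * (h ^ 2 / w ^ 3)) by (field; lra).
   assert (0 < h ^ 2 / w ^ 3) by pos. nra. }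
 assert (SB := odd_log_sum J g0 HJ1 Hg0). fold x in SB.
 assert (EB : psum B J = (psum (fun j => ln (INR (S (2 * j)))) J + x * ln h) / 2).
 { unfold x. rewrite <- psum_const, <- psum_plus. unfold Rdiv. rewrite Rmult_comm, <- psum_scal. apply psum_ext. intros j Hj.
  unfold B, P. replace (1 - (1 - INR (S (2 * j)) * h)) with (INR (S (2 * j)) * h) by ring.
  rewrite ln_mult by (auto; apply lt_0_INR; lia). field. }
 assert (Ex2 : ln (INR (2 * J)) = ln (1 - w) + ln (1 + w) - ln h).
 { rewrite <- ln_mult by lra. replace ((1 - w) * (1 + w)) with (INR (2 * J) * h) by (rewrite mult_INR; change (INR 2) with 2; fold x; rewrite Exh, <- Ew; ring).
  rewrite ln_mult; [ring|apply lt_0_INR; lia|auto]. }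
 rewrite Ex2 in SB. rewrite <- (E A B), EB in S1.
 assert (EF1 : F 1 = / 2) by (unfold F; rewrite sqrt_1; field).
 assert (EFp : F p = - (1 - p) * ln (1 + w) + w - p / 2) by (unfold F; fold w; ring).
 rewrite EF1, EFp in SA.
 assert (SA' : Rabs (psum A J - (/ 2 - (- (1 - p) * ln (1 + w) + w - p / 2)) / (2 * h)) <= h / w ^ 3).
 { replace (psum A J - (/ 2 - (- (1 - p) * ln (1 + w) + w - p / 2)) / (2 * h)) with
   (/ (2 * h) * (2 * h * psum A J - (/ 2 - (- (1 - p) * ln (1 + w) + w - p / 2)))) by (field; lra).
  assert (0 < / (2 * h)) by pos. rewrite Rabs_mult, (Rabs_pos_eq (/ (2 * h))) by lra.
  apply Rle_trans with (/ (2 * h) * (h ^ 2 / w ^ 3)); [mul_l; lra|].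
  replace (/ (2 * h) * (h ^ 2 / w ^ 3)) with (h / w ^ 3 / 2) by (field; lra).
  assert (0 < h / w ^ 3) by pos. lra. }
 set (Lo := psum (fun j => ln (INR (S (2 * j)))) J) in *. set (LA := psum A J) in *.
 assert (Key : t - atanh_sum J t - ((w - (1 - w ^ 2) * atanh w) / (2 * h) + ln 2 / 4) =
  - (atanh_sum J t - (LA - (Lo + x * ln h) / 2)) - (LA - (/ 2 - (- (1 - p) * ln (1 + w) + w - p / 2)) / (2 * h))
  + (Lo - (x * (ln (1 - w) + ln (1 + w) - ln h) - x + ln 2 / 2)) / 2).
 { replace t with (/ (2 * h)) at 1 by (rewrite Eh; field; lra). unfold atanh.
  replace x with ((1 - w * w) / (2 * h)) by (rewrite Ew, <- Exh; field; lra). rewrite <- Ew. field. lra. }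
 rewrite Key. assert (0 < C * h) by nra.
 replace (2 * C * h * / w ^ 3) with (2 * C * (h / w ^ 3)) in S1 by (field; lra).
 abs_lra.
Qed.

(** The bulk term vanishes to third order at [p = 0]. Of its expansion only [- p^3/6] survives
    division by [h^2], where it becomes [- s^3/12]. *)
Lemma left_bulk_bound p : 0 <= p <= / 2 ->
 Rabs ((1 - p) - / 4 + (1 - p) ^ 2 * ln (1 - p) / 2 - 3 / 4 * (1 - p) ^ 2 + p ^ 3 / 6) <= p ^ 4.
Proof.
 intros Hp.
 set (f1 := fun x => x ^ 2 / 2 - x - (1 - x) * ln (1 - x)).
 assert (B1 : forall x, 0 <= x <= p -> Rabs (f1 x) <= p ^ 3).
 { intros x Hx. assert (L := lipschitz_on f1 (fun x => x + ln (1 - x)) 0 p (p ^ 2)).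
  assert (E0 : f1 0 = 0) by (unfold f1; rewrite !Rminus_0_r, ln_1; field).
  assert (H : Rabs (f1 x - f1 0) <= p ^ 2 * Rabs (x - 0)).
  { apply L; [|lra|lra]. intros y Hy. split; [unfold f1; auto_derive; [lra|change (1 + - y) with (1 - y); field; lra]|].
   assert (A := ln_1m_quadratic y ltac:(lra)). assert (y ^ 2 <= p ^ 2) by (apply pow_incr; lra). apply Rabs_le. lra. }
  rewrite E0, !Rminus_0_r, (Rabs_pos_eq x) in H by lra. apply Rle_trans with (1 := H).
  replace (p ^ 3) with (p ^ 2 * p) by ring. mul_l; lra. }
 set (f := fun x => (1 - x) - / 4 + (1 - x) ^ 2 * ln (1 - x) / 2 - 3 / 4 * (1 - x) ^ 2 + x ^ 3 / 6).
 assert (E0 : f 0 = 0) by (unfold f; rewrite !Rminus_0_r, ln_1; field).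
 assert (H : Rabs (f p - f 0) <= p ^ 3 * Rabs (p - 0)).
 { apply (lipschitz_on f f1 0 p); [|lra|lra]. intros x Hx. split; [|auto]. unfold f, f1. auto_derive; [lra|change (1 + - x) with (1 - x); field; lra]. }
 rewrite E0, !Rminus_0_r, (Rabs_pos_eq p) in H by lra. replace (p ^ 4) with (p ^ 3 * p) by ring. exact H.
Qed.

(** The derivative is [2 w (atanh w - w) - 2 w^2 + 2 w^2], of third order, so after division by [2h]
    only the cubic term remains in the scaling limit. *)
Lemma left_bulk_bound_atanh w : 0 <= w <= / 2 -> Rabs (w - (1 - w ^ 2) * atanh w - 2 / 3 * w ^ 3) <= 4 * w ^ 4.
Proof.
 intros Hw. set (f := fun x => x - (1 - x ^ 2) * atanh x - 2 / 3 * x ^ 3).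
 assert (E0 : f 0 = 0) by (unfold f, atanh; rewrite !Rminus_0_r, !Rplus_0_r, ln_1; field).
 assert (H : Rabs (f w - f 0) <= (4 * w ^ 3) * Rabs (w - 0)).
 { apply (lipschitz_on f (fun x => 2 * x * (atanh x - x)) 0 w); [|lra|lra]. intros x Hx.
  assert (D := atanh_derive x ltac:(lra)). assert (0 <= x ^ 2 <= / 4) by (split; [pos|nra]). split.
  - unfold f. auto_derive; [eexists; exact D|]. rewrite (Derive_eta _ _ _ D). field. lra.
  - assert (A := atanh_bounds x ltac:(lra)). assert (x ^ 3 <= w ^ 3) by (apply pow_incr; lra).
   rewrite Rabs_pos_eq by pos. apply Rle_trans with (2 * x * (2 * x ^ 2)); [mul_l; lra|].
   replace (2 * x * (2 * x ^ 2)) with (4 * x ^ 3) by ring. lra. }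
 rewrite E0, !Rminus_0_r, (Rabs_pos_eq w) in H by lra. replace (4 * w ^ 4) with (4 * w ^ 3 * w) by ring. exact H.
Qed.

(* With [t = m^3] and [h = 1/(2t)], the left variable [s] and [p = 1 - n h] are related by [p = s/(2m^2)]. *)
Lemma left_scaling (z1 h1 : R) : 0 < z1 -> 0 < h1 -> exists a0, 1 <= a0 /\ forall a, a0 <= a ->
 exists M0, 1 <= M0 /\ forall m n, M0 <= m -> a <= - scaled m n <= a + 1 ->
 let s := - scaled m n in let h := / (2 * m ^ 3) in let p := 1 - INR n * h in
 p = s / (2 * m ^ 2) /\ h <= h1 /\ 0 < h <= / m /\ 0 < p <= / 4 /\ p <= (a + 1) / m /\ h ^ 2 <= z1 * p ^ 3.
Proof.
 intros Hz Hh. assert (P1 : 0 < 2 / z1) by pos. assert (P2 : 0 < / h1) by pos.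
 exists (1 + 2 / z1). split; [lra|]. intros a Ha. exists (2 * (a + 1) + / h1). split; [lra|].
 intros m n Hm Hs s h p.
 assert (Ep : p = s / (2 * m ^ 2)) by (unfold p, h, s, scaled; field; lra).
 assert (Hs' : a <= s <= a + 1) by exact Hs. clearbody s.
 assert (Hmm : m <= 2 * m ^ 3) by (assert (1 <= m ^ 2) by (simpl; nra); simpl in *; nra).
 assert (Hh1 : 0 < h <= / m) by (unfold h; split; [pos|apply Rinv_le_contravar; lra]).
 assert (Ep' : p = s * / m * (/ m / 2)) by (rewrite Ep; field; lra).
 assert (Hsm : 0 < s * / m <= / 2).
 { split; [pos|]. apply div_le; lra. }
 assert (Him : / m <= 1) by (apply Rinv_le_1; lra).
 split; [auto|]. split.
 { apply Rle_trans with (1 := proj2 Hh1). rewrite <- (Rinv_inv h1). apply Rinv_le_contravar; lra. }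
 split; [auto|]. split; [rewrite Ep'; split; [pos|nra]|]. split.
 - rewrite Ep'. unfold Rdiv. apply Rle_trans with (s * / m * 1); [mul_l; lra|]. rewrite Rmult_1_r. mul_r; lra.
 - rewrite Ep. replace (z1 * (s / (2 * m ^ 2)) ^ 3) with (h ^ 2 * (z1 * s ^ 3 / 2)) by (unfold h; field; lra).
  rewrite <- (Rmult_1_r (h ^ 2)) at 1. mul_l.
  assert (s <= s ^ 3) by (assert (1 <= s ^ 2) by (simpl; nra); simpl in *; nra).
  assert (E : z1 * (2 / z1) = 2) by (field; lra). assert (z1 * (2 / z1) <= z1 * s ^ 3) by (mul_l; lra). lra.
Qed.

Lemma log_tail_left (gK : R) : log_hyperfactorial_const gK ->
 exists G C a0, 0 < C /\ 1 <= a0 /\ forall a eps, a0 <= a -> 0 < eps -> exists M0, forall M n, M0 <= INR M ->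
 let s := - scaled (INR M) n in a <= s <= a + 1 ->
 Rabs (log_tail n (INR M ^ 3) - (INR n * G - s ^ 3 / 12 - ln s / 8 + ln 2 / 24 - gK)) <= C / s ^ 3 + eps.
Proof.
 intros HK. destruct (log_tail_expansion gK HK) as [G [z1 [h1 [C [Hz1 [Hh1 [HC H]]]]]]].
 destruct (left_scaling z1 h1 Hz1 Hh1) as [a0 [Ha0 HS]].
 exists G, (2 * C), a0. split; [lra|]. split; [auto|]. intros a eps Ha He.
 destruct (HS a Ha) as [M0 [HM1 HM]]. set (B := 2 * C + (a + 1) ^ 4 + (a + 1)).
 assert (HB : 0 < B) by (unfold B; assert (0 <= (a + 1) ^ 4) by pos; lra).
 exists (M0 + B / eps). intros M n HMn s Hs. set (m := INR M) in *.
 assert (PB : 0 < B / eps) by pos.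
 destruct (HM m n ltac:(lra) Hs) as [Ep [X1 [X2 [X3 [X4 X5]]]]]. fold s in Ep. set (h := / (2 * m ^ 3)) in *.
 assert (Pm : 0 < m ^ 3) by pos.
 specialize (H (m ^ 3) h n Pm eq_refl X1 ltac:(lra) X5). set (v := INR n * h) in *. set (p := 1 - v) in *.
 replace v with (1 - p) in H by (unfold p; ring).
 assert (Lb := left_bulk_bound p ltac:(lra)). assert (Lv := ln_1m_bound p ltac:(lra)).
 set (b := 1 - p - / 4 + (1 - p) ^ 2 * ln (1 - p) / 2 - 3 / 4 * (1 - p) ^ 2) in *.
 (* Together with [Lnh] this makes all [ln m] cancel in [ln h / 12 - ln p / 8], and leaves
    [ln 2 (1/8 - 1/12) = ln 2 / 24]. *)
 assert (Lnp : ln p = ln s - ln 2 - 2 * ln m).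
 { rewrite Ep, ln_div by (try apply Rmult_lt_0_compat; try pos). simpl pow.
  rewrite Rmult_1_r, !ln_mult by nra. ring. }
 assert (Lnh : ln h = - ln 2 - 3 * ln m).
 { unfold h. rewrite ln_Rinv by lra. simpl pow. rewrite Rmult_1_r, !ln_mult by (try apply Rmult_lt_0_compat; nra). ring. }
 assert (Eb : b / h ^ 2 = - (s ^ 3 / 12) + (b + p ^ 3 / 6) / h ^ 2).
 { replace (b / h ^ 2) with (- (p ^ 3 / h ^ 2 / 6) + (b + p ^ 3 / 6) / h ^ 2) by (field; lra). do 2 f_equal. rewrite Ep. unfold h. field. lra. }
 assert (Bb : Rabs ((b + p ^ 3 / 6) / h ^ 2) <= (a + 1) ^ 4 / m).
 { unfold Rdiv. rewrite Rabs_mult, (Rabs_pos_eq (/ h ^ 2)) by pos.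
  apply Rle_trans with (p ^ 4 * / h ^ 2); [mul_r; exact Lb|].
  replace (p ^ 4 * / h ^ 2) with (s ^ 4 * (/ m * (/ m / 4))) by (rewrite Ep; unfold h; field; lra).
  apply Rmult_le_compat; [pos|pos|apply pow_incr; lra|].
  assert (/ m <= 1) by (apply Rinv_le_1; lra). nra. }
 assert (Eh3 : h ^ 2 / p ^ 3 = 2 / s ^ 3) by (rewrite Ep; unfold h; field; lra).
 assert (Ehp : h / p <= / m).
 { replace (h / p) with (/ s * / m) by (rewrite Ep; unfold h; field; lra).
  assert (/ s <= 1) by (apply Rinv_le_1; lra). nra. }
 assert (HCm : C * (h + h ^ 2 / p ^ 3 + h / p) <= 2 * C / s ^ 3 + 2 * C * / m).
 { rewrite Eh3. replace (2 * C / s ^ 3) with (C * (2 / s ^ 3)) by (field; lra). nra. }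
 assert (HBm : B * / m <= eps).
 { apply (Rmult_le_reg_r m); [lra|]. rewrite Rmult_assoc, Rinv_l by lra. replace (B * 1) with (B / eps * eps) by (field; lra).
  rewrite (Rmult_comm eps). mul_r; lra. }
 rewrite Eb, Lnp, Lnh in H. unfold Rdiv in Bb, X4. unfold B in HBm.
 abs_lra.
Qed.

Lemma atanh_sum_left : exists C a0, 0 < C /\ 1 <= a0 /\ forall a eps, a0 <= a -> 0 < eps -> exists M0, forall M J, M0 <= INR M ->
 let s := - scaled (INR M) (2 * J) in a <= s <= a + 1 ->
 Rabs (INR M ^ 3 - atanh_sum J (INR M ^ 3) - (2 / 3 * sqrt (s / 2) ^ 3 + ln 2 / 4)) <= C / sqrt s ^ 3 + eps.
Proof.
 destruct atanh_sum_expansion as [z1 [h1 [C [Hz1 [Hh1 [HC H]]]]]].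
 destruct (left_scaling z1 h1 Hz1 Hh1) as [a0 [Ha0 HS]].
 exists (2 * C), a0. split; [lra|]. split; [auto|]. intros a eps Ha He.
 destruct (HS a Ha) as [M0 [HM1 HM]]. set (B := C + (a + 1) ^ 2).
 assert (HB : 0 < B) by (unfold B; assert (0 <= (a + 1) ^ 2) by pos; lra).
 exists (M0 + B / eps). intros M J HMn s Hs. set (m := INR M) in *.
 assert (PB : 0 < B / eps) by pos.
 destruct (HM m (2 * J)%nat ltac:(lra) Hs) as [Ep [X1 [X2 [X3 [X4 X5]]]]]. fold s in Ep. set (h := / (2 * m ^ 3)) in *.
 assert (Pm : 0 < m ^ 3) by pos.
 specialize (H (m ^ 3) h J Pm eq_refl X1 ltac:(lra) X5). set (p := 1 - INR (2 * J) * h) in *.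
 set (r := sqrt (s / 2)). assert (Hr : 0 < r) by (apply sqrt_lt_R0; lra). assert (Er : r * r = s / 2) by (apply sqrt_sqrt; lra).
 assert (Ew : sqrt p = r * / m).
 { rewrite Ep. replace (s / (2 * m ^ 2)) with ((r * / m) ^ 2) by (replace s with (2 * (r * r)) by lra; field; lra).
  apply sqrt_pow2. left. pos. }
 set (w := sqrt p) in *. assert (Ewp : w ^ 2 = p) by (simpl; rewrite Rmult_1_r; apply sqrt_sqrt; lra).
 assert (Pw : 0 < w) by (rewrite Ew; pos).
 assert (Lb := left_bulk_bound_atanh w ltac:(split; [lra|nra])).
 assert (Eb : (w - (1 - w ^ 2) * atanh w) / (2 * h) = 2 / 3 * r ^ 3 + (w - (1 - w ^ 2) * atanh w - 2 / 3 * w ^ 3) / (2 * h)).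
 { replace (2 / 3 * r ^ 3) with (2 / 3 * w ^ 3 / (2 * h)) by (rewrite Ew; unfold h; field; lra). field. lra. }
 assert (Bb : Rabs ((w - (1 - w ^ 2) * atanh w - 2 / 3 * w ^ 3) / (2 * h)) <= (a + 1) ^ 2 * / m).
 { unfold Rdiv. rewrite Rabs_mult, (Rabs_pos_eq (/ (2 * h))) by pos.
  apply Rle_trans with (4 * w ^ 4 * / (2 * h)); [mul_r; exact Lb|].
  replace (4 * w ^ 4) with (4 * p ^ 2) by (rewrite <- Ewp; ring).
  replace (4 * p ^ 2 * / (2 * h)) with (s ^ 2 * / m) by (rewrite Ep; unfold h; field; lra).
  mul_r. apply pow_incr; lra. }
 assert (Hsr : sqrt s <= 2 * r) by (rewrite <- (sqrt_pow2 (2 * r)) by lra; apply sqrt_le_1_alt; nra).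
 assert (Ps : 0 < sqrt s) by (apply sqrt_lt_R0; lra).
 assert (Eh3 : h / w ^ 3 <= / sqrt s ^ 3 * 2).
 { replace (h / w ^ 3) with (/ (2 * r) ^ 3 * 4) by (rewrite Ew; unfold h; field; lra).
  assert (G : sqrt s * sqrt s = s) by (apply sqrt_sqrt; lra).
  replace (/ (2 * r) ^ 3 * 4) with (/ (r ^ 3 * 2)) by (field; lra). replace (/ sqrt s ^ 3 * 2) with (/ (sqrt s ^ 3 / 2)) by (field; lra).
  assert (0 < sqrt s ^ 3) by pos.
  apply Rinv_le_contravar; [lra|].
  assert (E1 : sqrt s ^ 3 <= 2 * r * (2 * (r * r))) by (replace (sqrt s ^ 3) with (sqrt s * (sqrt s * sqrt s)) by ring; rewrite G; apply Rmult_le_compat; lra).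
  replace (r ^ 3 * 2) with (2 * r * (2 * (r * r)) / 2) by field. lra. }
 assert (HBm : B * / m <= eps).
 { apply (Rmult_le_reg_r m); [lra|]. rewrite Rmult_assoc, Rinv_l by lra. replace (B * 1) with (B / eps * eps) by (field; lra).
  rewrite (Rmult_comm eps). mul_r; lra. }
 assert (HCm : C * (h + h / w ^ 3) <= 2 * C / sqrt s ^ 3 + C * / m).
 { replace (2 * C / sqrt s ^ 3) with (C * (/ sqrt s ^ 3 * 2)) by (field; lra). nra. }
 rewrite Eb in H. unfold B in HBm.
 abs_lra.
Qed.

Lemma even_index (a m : R) : 2 <= m -> 0 <= a <= m ->
 exists J, a <= - scaled m (2 * J) <= a + 2 / m.
Proof.
 intros Hm Ha. destruct (nfloor_ex (m ^ 3 - a * m / 2)) as [J [H1 H2]].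
 { simpl. nra. }
 exists J. assert (E : scaled m (2 * J) * m = 2 * INR J - 2 * m ^ 3) by (unfold scaled; rewrite mult_INR; simpl; field; lra).
 split; apply (Rmult_le_reg_r m); try lra. replace ((a + 2 / m) * m) with (a * m + 2) by (field; lra). lra.
Qed.

(** Only even indices are sampled, because the [atanh] identity lives on them; the logarithmic sum
    uses the same grid. *)
Lemma grid_limit_left (f : R -> R) (a B : R) : 0 <= a -> continuity_pt f a ->
 (forall eps, 0 < eps -> exists M0, forall M J, M0 <= INR M -> a <= - scaled (INR M) (2 * J) <= a + 1 ->
   f (- scaled (INR M) (2 * J)) <= B + eps) -> f a <= B.
Proof.
 intros Ha Cf H. apply Rnot_lt_le; intros L. set (eps := (f a - B) / 3).
 destruct (H eps) as [M0 HM]; [unfold eps; lra|].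
 destruct (Cf eps) as [d [Hd Hc]]; [unfold eps; lra|].
 destruct (INR_unbounded (Rabs M0 + 2 + a + 4 / d)) as [M HMM].
 assert (P1 := Rle_abs M0). assert (P2 := Rabs_pos M0). assert (P3 : 0 < 4 / d) by pos.
 destruct (even_index a (INR M) ltac:(lra) ltac:(lra)) as [J HJ].
 assert (Hd2 : 2 / INR M <= d / 2 /\ 2 / INR M <= 1).
 { split; apply (Rmult_le_reg_r (INR M)); try lra; replace (2 / INR M * INR M) with 2 by (field; lra); [|lra].
  assert (E : d / 2 * (4 / d) = 2) by (field; lra). assert (d / 2 * (4 / d) <= d / 2 * INR M) by (mul_l; lra). lra. }
 specialize (HM M J ltac:(lra) ltac:(lra)). set (s := - scaled (INR M) (2 * J)) in *.
 destruct (Req_dec s a) as [E|E]; [rewrite E in HM; unfold eps in HM; lra|].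
 assert (A := Hc s). simpl in A. unfold Rdist in A.
 assert (A' : Rabs (f s - f a) < eps).
 { apply A. split; [split; [exact I|auto]|]. apply Rabs_def1; lra. }
 apply Rabs_def2 in A'. unfold eps in *. lra.
Qed.

(** * Asymptotics of the primitives at minus infinity *)

Section LeftAsymptotics.

Variables q dq : R -> R.
Hypothesis Hq1 : forall x, is_derive q x (dq x).
Hypothesis Hq2 : forall x, is_derive dq x (2 * q x ^ 3 + x * q x).
Hypothesis HqA : airy_like q.
Variables X0 C0 : R.
Hypothesis HC0 : 0 <= C0.

(** [t - atanh_sum] is [P/2] seen from the right and [2/3 (s/2)^(3/2) + ln 2 / 4] seen from the
    left. The limit in [m] is taken at fixed [a]; only the error in [a] survives. *)
Lemma first_integral_left (P : R -> R) : (forall x, is_derive P x (- q x)) ->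
 (forall x, X0 <= x -> Rabs (P x) <= C0 * exp (- x)) ->
 exists C a0, 0 < C /\ 1 <= a0 /\ forall a, a0 <= a ->
 Rabs (P (- a) - (4 / 3 * sqrt (a / 2) ^ 3 + ln 2 / 2)) <= C / sqrt a ^ 3.
Proof.
 intros HP HPb. destruct atanh_sum_left as [C [a0 [HC [Ha0 H]]]].
 exists (2 * C), a0. split; [lra|]. split; [auto|]. intros a Ha.
 apply (grid_limit_left (fun a => Rabs (P (- a) - (4 / 3 * sqrt (a / 2) ^ 3 + ln 2 / 2)))); [lra| |].
 - apply (continuity_pt_comp (fun a => P (- a) - (4 / 3 * sqrt (a / 2) ^ 3 + ln 2 / 2)) Rabs); [|apply Rcontinuity_abs].
  assert (D := HP (- a)). eapply is_derive_continuity_pt. auto_derive; [|reflexivity].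
  split; [eexists; exact D|]. split; [lra|auto].
 - intros eps He. destruct (H a (eps / 4) Ha ltac:(lra)) as [M1 H1].
  destruct (atanh_sum_right q dq Hq1 Hq2 HqA X0 C0 HC0 P (- (a + 1)) (eps / 4) HP HPb ltac:(lra)) as [M2 H2].
  exists (Rabs M1 + Rabs M2). intros M J HM Hs. assert (B1 := Rle_abs M1). assert (B2 := Rle_abs M2).
  assert (B3 := Rabs_pos M1). assert (B4 := Rabs_pos M2).
  specialize (H1 M J ltac:(lra)). specialize (H2 M J ltac:(lra) ltac:(lra)). cbv zeta in H1. specialize (H1 Hs).
  rewrite Ropp_involutive. set (s := - scaled (INR M) (2 * J)) in *.
  replace (scaled (INR M) (2 * J)) with (- s) in * by (unfold s; ring).
  assert (HCs : C / sqrt s ^ 3 <= C / sqrt a ^ 3).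
  { mul_l. assert (0 < sqrt a) by (apply sqrt_lt_R0; lra).
   apply Rinv_le_contravar; [pos|]. apply pow_incr. split; [lra|apply sqrt_le_1_alt; lra]. }
  replace (2 * C / sqrt a ^ 3) with (2 * (C / sqrt a ^ 3)) by (unfold Rdiv; ring).
  abs_lra.
Qed.

(** [log_tail] is [- Q2] from the right and an explicit expression plus [n G] from the left;
    comparing them on the grid determines [Q2] near [- a]. *)
Lemma second_integral_left (Q1 Q2 : R -> R) (gK : R) : (forall x, is_derive Q1 x (- q x ^ 2)) -> (forall x, is_derive Q2 x (- Q1 x)) ->
 (forall x, X0 <= x -> Rabs (Q1 x) <= C0 * exp (- x)) -> (forall x, X0 <= x -> Rabs (Q2 x) <= C0 * exp (- x)) ->
 log_hyperfactorial_const gK ->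
 exists C a0, 0 < C /\ 1 <= a0 /\ forall a, a0 <= a ->
 Rabs (Q2 (- a) - (a ^ 3 / 12 + ln a / 8 - ln 2 / 24 + gK)) <= C / a ^ 3.
Proof.
 intros HQ1 HQ2 HQ1b HQ2b HK. destruct (log_tail_left gK HK) as [G [C [a0 [HC [Ha0 H]]]]].
 assert (Main : forall a eps, a0 <= a -> 0 < eps -> exists M0, 0 <= M0 /\ forall M n, M0 <= INR M -> let s := - scaled (INR M) n in a <= s <= a + 1 ->
  Rabs (Q2 (- s) + INR n * G - (s ^ 3 / 12 + ln s / 8 - ln 2 / 24 + gK)) <= C / a ^ 3 + eps).
 { intros a eps Ha He. destruct (H a (eps / 2) Ha ltac:(lra)) as [M1 H1].
  destruct (log_tail_right q dq Hq1 Hq2 HqA Q1 Q2 HQ1 HQ2 X0 C0 HC0 HQ1b HQ2b (- (a + 1)) (eps / 2) ltac:(lra)) as [M2 H2].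
  assert (B1 := Rle_abs M1). assert (B2 := Rle_abs M2). assert (B3 := Rabs_pos M1). assert (B4 := Rabs_pos M2).
  exists (Rabs M1 + Rabs M2). split; [lra|]. intros M n HM s Hs.
  specialize (H1 M n ltac:(lra) Hs). specialize (H2 M n ltac:(lra) ltac:(unfold s in Hs; lra)).
  replace (scaled (INR M) n) with (- s) in * by (unfold s; ring). rewrite Ropp_involutive in H1.
  assert (HCs : C / s ^ 3 <= C / a ^ 3).
  { mul_l. apply Rinv_le_contravar; [pos|]. apply pow_incr; lra. }
  abs_lra. }
 (* [Q2] is bounded on a compact interval while [n] tends to infinity, so the linear term must vanish. *)
 assert (EG : G = 0).
 { destruct (Main a0 1 (Rle_refl _) Rlt_0_1) as [M0 [HM0 HM]].
  destruct (compact_bound Q2 (- (a0 + 1)) (- a0)) as [B [HB HB']]; [intros; eapply is_derive_continuity_pt, HQ2|].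
  set (K := B + (a0 + 1) ^ 3 / 12 + (a0 + 1) / 8 + ln 2 + Rabs gK + C + 1).
  destruct (Req_dec G 0) as [EG|NG]; [auto|exfalso]. assert (PG : 0 < Rabs G) by (now apply Rabs_pos_lt).
  assert (PgK := Rabs_pos gK). assert (Pl2 : 0 < ln 2) by (rewrite <- ln_1; apply ln_increasing; lra).
  assert (P3 : 0 <= (a0 + 1) ^ 3) by pos.
  assert (PK : 0 < K / Rabs G) by (apply Rdiv_lt_0_compat; [unfold K|]; lra).
  destruct (INR_unbounded (M0 + 2 + (a0 + 1) + K / Rabs G)) as [M HMM]. set (m := INR M) in *.
  destruct (even_index a0 m ltac:(lra) ltac:(lra)) as [J HJ].
  assert (H2m : 2 / m <= 1) by (apply (Rmult_le_reg_r m); [lra|]; replace (2 / m * m) with 2 by (field; lra); lra).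
  specialize (HM M (2 * J)%nat ltac:(fold m; lra) ltac:(fold m; lra)). cbv zeta in HM. fold m in HM.
  set (s := - scaled m (2 * J)) in *. specialize (HB' (- s) ltac:(lra)).
  assert (En : INR (2 * J) = 2 * m ^ 3 - s * m) by (unfold s, scaled; field; lra).
  assert (Hn : K / Rabs G < INR (2 * J)).
  { rewrite En. assert (m * (2 * m ^ 2 - s) >= m * 1); [|nra]. apply Rle_ge, Rmult_le_compat_l; [lra|]. nra. }
  assert (s3 : 0 <= s ^ 3 <= (a0 + 1) ^ 3) by (split; [apply pow_le|apply pow_incr]; lra).
  assert (ls : 0 <= ln s <= a0 + 1).
  { split; [rewrite <- ln_1; apply ln_le; lra|]. apply Rle_trans with (s - 1); [|lra].
   rewrite <- (ln_exp (s - 1)). apply ln_le; [lra|]. generalize (exp_ineq1_le (s - 1)); lra. }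
  assert (C3 : C / a0 ^ 3 <= C).
  { unfold Rdiv. rewrite <- (Rmult_1_r C) at 2. mul_l. rewrite <- Rinv_1. apply Rinv_le_contravar; [lra|].
   rewrite <- (pow1 3). apply pow_incr; lra. }
  assert (HnG : Rabs (INR (2 * J) * G) <= K).
  { assert (Z1 := Rle_abs gK). assert (Z2 := Rle_abs (- gK)). rewrite Rabs_Ropp in Z2. unfold K.
   abs_lra. }
  rewrite Rabs_mult, Rabs_pos_eq in HnG by apply pos_INR.
  apply (Rmult_lt_compat_r (Rabs G)) in Hn; [|auto]. replace (K / Rabs G * Rabs G) with K in Hn by (field; lra). lra. }
 exists C, a0. split; [lra|]. split; [auto|]. intros a Ha.
 apply (grid_limit_left (fun a => Rabs (Q2 (- a) - (a ^ 3 / 12 + ln a / 8 - ln 2 / 24 + gK)))); [lra| |].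
 - apply (continuity_pt_comp (fun a => Q2 (- a) - (a ^ 3 / 12 + ln a / 8 - ln 2 / 24 + gK)) Rabs); [|apply Rcontinuity_abs].
  assert (D := HQ2 (- a)). eapply is_derive_continuity_pt. auto_derive; [|reflexivity].
  split; [eexists; exact D|]. split; [lra|auto].
 - intros eps He. destruct (Main a eps Ha He) as [M0 [_ HM]]. exists M0. intros M J HMM Hs.
  specialize (HM M (2 * J)%nat HMM Hs). cbv zeta in HM. rewrite EG, Rmult_0_r, Rplus_0_r in HM. exact HM.
Qed.

End LeftAsymptotics.

(** * The derivative of zeta at -1 *)

(** Complex differentiability in epsilon-delta form, convenient for the estimates; [cdiff_iff]
    relates it to [is_derive], from which the rules of calculus are imported. *)
Definition cdiff (f : C -> C) (s l : C) : Prop := forall eps, 0 < eps -> exists d, 0 < d /\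
 forall z, Cmod (z - s) < d -> Cmod (f z - f s - l * (z - s)) <= eps * Cmod (z - s).

Lemma cdiff_of_derive (f : C -> C) s l : @is_derive C_AbsRing C_NormedModule f s l -> cdiff f s l.
Proof.
 intros [_ H] eps He. destruct (H s (fun P HP => HP) (mkposreal eps He)) as [d Hd].
 exists d. split; [apply cond_pos|]. intros z Hz. specialize (Hd z Hz).
 rewrite (Cmult_comm l). exact Hd.
Qed.

Lemma Re_le_Cmod z : Rabs (Re z) <= Cmod z /\ Rabs (Im z) <= Cmod z.
Proof. split; eapply Rle_trans; [apply Rmax_l|apply Rmax_Cmod|apply Rmax_r|apply Rmax_Cmod]. Qed.

Lemma Cmod_Ci : Cmod Ci = 1.
Proof. unfold Cmod, Ci; simpl. replace (0 * (0 * 1) + 1 * (1 * 1)) with 1 by ring. apply sqrt_1. Qed.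

Lemma Cmod_le_sum x y : Cmod (x, y) <= Rabs x + Rabs y.
Proof.
 replace (x, y) with (RtoC x + RtoC y * Ci)%C by (unfold Ci, RtoC, Cplus, Cmult; simpl; f_equal; ring).
 eapply Rle_trans; [apply Cmod_triangle|]. rewrite Cmod_mult, !Cmod_R.
 rewrite Cmod_Ci; lra.
Qed.

Lemma cdiff_continuous f s l : cdiff f s l -> forall eps, 0 < eps -> exists d, 0 < d /\
 forall z, Cmod (z - s) < d -> Cmod (f z - f s) < eps.
Proof.
 intros H eps He. destruct (H 1 Rlt_0_1) as [d [Hd Hz]]. assert (Pl := Cmod_ge_0 l).
 exists (Rmin d (eps / (2 + Cmod l))). split; [apply Rmin_glb_lt; [auto|pos]|].
 intros z Hzd. assert (M1 := Rmin_l d (eps / (2 + Cmod l))). assert (M2 := Rmin_r d (eps / (2 + Cmod l))).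
 replace (f z - f s)%C with ((f z - f s - l * (z - s)) + l * (z - s))%C by ring.
 eapply Rle_lt_trans; [apply Cmod_triangle|]. rewrite Cmod_mult. specialize (Hz z ltac:(lra)).
 assert (E : eps / (2 + Cmod l) * (2 + Cmod l) = eps) by (field; lra). nra.
Qed.

(** * Goursat's theorem for rectangles in the upper half-plane *)

Section Goursat.

Variable g : C -> C.
Hypothesis Dg : forall s, 0 < Im s -> exists l, cdiff g s l.

(** On a horizontal side [dz = dt] and on a vertical one [dz = i dt], so the imaginary part of the
    contour integral involves [Im g] here and [Re g] in [vint]. This part alone suffices, as the
    lower bound wanted later concerns [Re g] on a vertical side. *)
Definition hint (x A y : R) : R := RInt (fun t => Im (g (t, y))) x (x + A).
Definition vint (y B x : R) : R := RInt (fun t => Re (g (x, t))) y (y + B).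
(* The imaginary part of the integral of [g] along the boundary of the rectangle. *)
Definition circulation (x y A B : R) : R := hint x A y - hint x A (y + B) + vint y B (x + A) - vint y B x.

Lemma continuity_h y t : 0 < y -> continuity_pt (fun t => Im (g (t, y))) t.
Proof.
 intros Hy eps He. destruct (Dg (t, y) Hy) as [l Hl]. destruct (cdiff_continuous _ _ _ Hl eps He) as [d [Hd H]].
 exists d. split; [auto|]. intros z [_ Hz]. simpl in *. unfold Rdist in *.
 eapply Rle_lt_trans; [|apply (H (z, y))]; [apply (Re_le_Cmod (g (z, y) - g (t, y)))|].
 eapply Rle_lt_trans; [apply Cmod_le_sum|]. simpl. replace (y + - y) with 0 by ring. rewrite Rabs_R0. unfold Rminus in Hz. lra.
Qed.

Lemma continuity_v x t : 0 < t -> continuity_pt (fun t => Re (g (x, t))) t.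
Proof.
 intros Hy eps He. destruct (Dg (x, t) Hy) as [l Hl]. destruct (cdiff_continuous _ _ _ Hl eps He) as [d [Hd H]].
 exists d. split; [auto|]. intros z [_ Hz]. simpl in *. unfold Rdist in *.
 eapply Rle_lt_trans; [|apply (H (x, z))]; [apply (Re_le_Cmod (g (x, z) - g (x, t)))|].
 eapply Rle_lt_trans; [apply Cmod_le_sum|]. simpl. replace (x + - x) with 0 by ring. rewrite Rabs_R0. unfold Rminus in Hz. lra.
Qed.

Lemma ex_hint y a b : 0 < y -> ex_RInt (fun t => Im (g (t, y))) a b.
Proof. intros Hy. apply ex_RInt_cont. intros; now apply continuity_h. Qed.

Lemma ex_vint x a b : 0 < a -> 0 < b -> ex_RInt (fun t => Re (g (x, t))) a b.
Proof.
 intros Ha Hb. apply (ex_RInt_continuous (V := R_CompleteNormedModule)). intros t [Ht _].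
 apply continuity_pt_filterlim, continuity_v. eapply Rlt_le_trans; [|exact Ht]. now apply Rmin_glb_lt.
Qed.

Lemma circulation_split x y A B : 0 < y -> 0 < B -> circulation x y A B =
 circulation x y (A / 2) (B / 2) + circulation (x + A / 2) y (A / 2) (B / 2) +
 circulation x (y + B / 2) (A / 2) (B / 2) + circulation (x + A / 2) (y + B / 2) (A / 2) (B / 2).
Proof.
 intros Hy HB.
 assert (Eh : forall y', 0 < y' -> hint x A y' = hint x (A / 2) y' + hint (x + A / 2) (A / 2) y').
 { intros y' Hy'. unfold hint. replace (x + A) with (x + A / 2 + A / 2) by field. symmetry.
  apply (RInt_Chasles (V := R_CompleteNormedModule)); now apply ex_hint. }
 assert (Ev : forall x', vint y B x' = vint y (B / 2) x' + vint (y + B / 2) (B / 2) x').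
 { intros x'. unfold vint. replace (y + B) with (y + B / 2 + B / 2) by field. symmetry.
  apply (RInt_Chasles (V := R_CompleteNormedModule)); apply ex_vint; lra. }
 unfold circulation. replace (y + B) with (y + B / 2 + B / 2) by field. replace (x + A) with (x + A / 2 + A / 2) by field.
 rewrite !Eh, !Ev by lra. ring.
Qed.

Lemma RInt_diff_bound (u v : R -> R) a b c e : a <= b -> ex_RInt u a b -> ex_RInt v a b ->
 (forall t, a <= t <= b -> Rabs (u t - v t - c) <= e) -> Rabs (RInt u a b - RInt v a b - c * (b - a)) <= e * (b - a).
Proof.
 intros Hab Hu Hv H. rewrite (Rmult_comm e).
 replace (RInt u a b - RInt v a b - c * (b - a)) with (RInt (fun t => u t - v t - c) a b).
 - apply abs_RInt_le_const; auto. apply (ex_RInt_minus (V := R_NormedModule)); [now apply (ex_RInt_minus (V := R_NormedModule))|apply ex_RInt_const].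
 - apply is_RInt_unique. replace (c * (b - a)) with (scal (b - a) c) by (unfold scal; simpl; unfold mult; simpl; ring).
  apply (is_RInt_minus (V := R_NormedModule)); [apply (is_RInt_minus (V := R_NormedModule))|apply (is_RInt_const (V := R_NormedModule))];
   now apply (RInt_correct (V := R_CompleteNormedModule)).
Qed.

(** The affine part of [g] contributes [- Re l A B] through the horizontal sides and [+ Re l A B]
    through the vertical ones; only the remainder is left. *)
Lemma circulation_local x y A B xs ys l eps : 0 < A -> 0 < B -> 0 < y -> x <= xs <= x + A -> y <= ys <= y + B ->
 (forall z, Cmod (z - (xs, ys)) <= A + B -> Cmod (g z - g (xs, ys) - l * (z - (xs, ys))) <= eps) ->
 Rabs (circulation x y A B) <= 2 * eps * (A + B).
Proof.
 intros HA HB Hy Hx Hys H.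
 assert (Hz : forall a b, x <= a <= x + A -> y <= b <= y + B -> Cmod (g (a, b) - g (xs, ys) - l * ((a, b) - (xs, ys))) <= eps).
 { intros a b Ha Hb. apply H. eapply Rle_trans; [apply Cmod_le_sum|]. simpl. apply Rplus_le_compat; apply Rabs_le; lra. }
 assert (H1 : Rabs (hint x A y - hint x A (y + B) - (- (Re l * B)) * (x + A - x)) <= 2 * eps * (x + A - x)).
 { apply RInt_diff_bound; [lra|apply ex_hint; lra|apply ex_hint; lra|]. intros t Ht.
  assert (Z1 := Hz t y Ht ltac:(lra)). assert (Z2 := Hz t (y + B) Ht ltac:(lra)).
  apply (Rle_trans _ _ _ (proj2 (Re_le_Cmod _))) in Z1, Z2. destruct l as [l1 l2]. simpl in *.
  apply Rabs_le_between in Z1, Z2. apply Rabs_le_between. unfold Re, Im. lra. }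
 assert (H2 : Rabs (vint y B (x + A) - vint y B x - Re l * A * (y + B - y)) <= 2 * eps * (y + B - y)).
 { apply RInt_diff_bound; [lra|apply ex_vint; lra|apply ex_vint; lra|]. intros t Ht.
  assert (Z1 := Hz x t ltac:(lra) Ht). assert (Z2 := Hz (x + A) t ltac:(lra) Ht).
  apply (Rle_trans _ _ _ (proj1 (Re_le_Cmod _))) in Z1, Z2. destruct l as [l1 l2]. simpl in *.
  apply Rabs_le_between in Z1, Z2. apply Rabs_le_between. unfold Re, Im. lra. }
 unfold circulation. abs_lra.
Qed.

Lemma goursat x y A B : 0 < A -> 0 < B -> 0 < y -> circulation x y A B = 0.
Proof.
 intros HA HB Hy. destruct (Req_dec (circulation x y A B) 0) as [|NZ]; [auto|exfalso]. apply Rabs_pos_lt in NZ.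
 set (e := Rabs (circulation x y A B) / 2).
 (* Selects a quarter whose circulation still exceeds [e / 4^(n+1)]. If the first three fail, the
    triangle inequality forces the fourth. *)
 set (step := fun (n : nat) (p : R * R) => let (x, y) := p in let a := A / 2 ^ n / 2 in let b := B / 2 ^ n / 2 in
  if Rlt_dec (e / 4 ^ S n) (Rabs (circulation x y a b)) then (x, y) else
  if Rlt_dec (e / 4 ^ S n) (Rabs (circulation (x + a) y a b)) then (x + a, y) else
  if Rlt_dec (e / 4 ^ S n) (Rabs (circulation x (y + b) a b)) then (x, y + b) else (x + a, y + b)).
 set (p := fix p n := match n with O => (x, y) | S n => step n (p n) end).
 assert (Hp : forall n, y <= snd (p n) /\ e / 4 ^ n < Rabs (circulation (fst (p n)) (snd (p n)) (A / 2 ^ n) (B / 2 ^ n)) /\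
  0 <= fst (p (S n)) - fst (p n) <= A / 2 ^ n - A / 2 ^ S n /\ 0 <= snd (p (S n)) - snd (p n) <= B / 2 ^ n - B / 2 ^ S n).
 { assert (Hs : forall n, 0 <= fst (p (S n)) - fst (p n) <= A / 2 ^ n - A / 2 ^ S n /\ 0 <= snd (p (S n)) - snd (p n) <= B / 2 ^ n - B / 2 ^ S n).
  { intros n. replace (A / 2 ^ n - A / 2 ^ S n) with (A / 2 ^ n / 2) by (simpl; field; apply pow_nonzero; lra).
   replace (B / 2 ^ n - B / 2 ^ S n) with (B / 2 ^ n / 2) by (simpl; field; apply pow_nonzero; lra).
   assert (A / 2 ^ n > 0 /\ B / 2 ^ n > 0) by (split; apply Rdiv_lt_0_compat; auto; pos).
   change (p (S n)) with (step n (p n)). destruct (p n) as [u v]. unfold step. cbv zeta.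
   repeat (destruct (Rlt_dec _ _)); simpl; lra. }
  intros n. split; [|split; [|apply Hs]].
  - induction n; [simpl; lra|]. destruct (Hs n). lra.
  - induction n; [simpl; rewrite !Rdiv_1_r; unfold e; lra|].
   assert (Hyn : y <= snd (p n)) by (clear IHn; induction n; [simpl; lra|]; destruct (Hs n); lra).
   replace (A / 2 ^ S n) with (A / 2 ^ n / 2) by (simpl; field; apply pow_nonzero; lra).
   replace (B / 2 ^ S n) with (B / 2 ^ n / 2) by (simpl; field; apply pow_nonzero; lra).
   assert (Bn : 0 < B / 2 ^ n) by (pos).
   change (p (S n)) with (step n (p n)). destruct (p n) as [u v]. simpl fst in *. simpl snd in *. unfold step. cbv zeta.
   rewrite circulation_split in IHn by lra.
   replace (e / 4 ^ n) with (4 * (e / 4 ^ S n)) in IHn by (simpl; field; apply pow_nonzero; lra).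
   set (a := A / 2 ^ n / 2) in *. set (b := B / 2 ^ n / 2) in *.
   repeat (destruct (Rlt_dec _ _)); cbn [fst snd]; auto.
   repeat match goal with H : ~ _ < _ |- _ => apply Rnot_lt_le in H end.
   change (4 * 4 ^ n) with (4 ^ S n) in *.
   assert (T1 := Rabs_triang (circulation u v a b + circulation (u + a) v a b + circulation u (v + b) a b) (circulation (u + a) (v + b) a b)).
   assert (T2 := Rabs_triang (circulation u v a b + circulation (u + a) v a b) (circulation u (v + b) a b)).
   assert (T3 := Rabs_triang (circulation u v a b) (circulation (u + a) v a b)). lra. }
 assert (Lim : forall (f : nat -> R) D, 0 < D -> (forall n, 0 <= f (S n) - f n <= D / 2 ^ n - D / 2 ^ S n) ->
  exists l, forall n, f n <= l <= f n + D / 2 ^ n).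
 { intros f D HD Hf. assert (PD : forall n, 0 < D / 2 ^ n) by (intros; pos).
  destruct (convergent_sequence (fun n => f n + D / 2 ^ n / 2) (fun n => D / 2 ^ n / 2)) as [l Hl].
  - intros n. specialize (PD n). lra.
  - intros n. specialize (Hf n). apply Rabs_le. lra.
  - exists l. intros n. specialize (Hl n). apply Rabs_le_between in Hl. lra. }
 destruct (Lim (fun n => fst (p n)) A HA (fun n => proj1 (proj2 (proj2 (Hp n))))) as [xs Hxs].
 destruct (Lim (fun n => snd (p n)) B HB (fun n => proj2 (proj2 (proj2 (Hp n))))) as [ys Hys].
 assert (Pys : 0 < ys) by (specialize (Hys O); simpl in Hys; lra).
 destruct (Dg (xs, ys) Pys) as [l Hl].
 (* On a rectangle of scale [k = 2^(-n)] this accuracy bounds the circulation by exactly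
    [e k^2 = e / 4^n], the value it is supposed to exceed. *)
 destruct (Hl (e / (2 * (A + B) ^ 2))) as [d [Hd Hz]]; [apply Rdiv_lt_0_compat; [unfold e; lra|pos]|].
 destruct (pow_lt_1_zero (/ 2) ltac:(rewrite Rabs_pos_eq; lra) (d / (A + B)) ltac:(pos)) as [n Hn].
 specialize (Hn n (le_n n)). rewrite Rabs_pos_eq in Hn by pos. rewrite pow_inv in Hn.
 set (k := / 2 ^ n) in *.
 assert (Hk : (A + B) * k < d).
 { apply (Rmult_lt_compat_l (A + B)) in Hn; [|lra]. replace ((A + B) * (d / (A + B))) with d in Hn by (field; lra). auto. }
 destruct (Hp n) as [Hy0 [Hbad _]].
 apply (Rlt_not_le _ _ Hbad). unfold Rdiv. fold k.
 eapply Rle_trans; [apply (circulation_local _ _ _ _ xs ys l (e / (2 * (A + B) ^ 2) * ((A + B) * k)))|].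
 - pos.
 - pos.
 - lra.
 - apply Hxs.
 - apply Hys.
 - intros z Hzs. eapply Rle_trans; [apply Hz; lra|]. apply Rmult_le_compat_l; [|lra].
  apply Rdiv_le_0_compat; [unfold e; lra|]. assert (0 < (A + B) ^ 2) by pos. lra.
 - right. replace (/ 4 ^ n) with (k * k); [field; lra|]. unfold k. rewrite <- Rinv_mult, <- Rpow_mult_distr. replace (2 * 2) with 4 by ring. reflexivity.
Qed.

End Goursat.

(** * Complex calculus and the peaked kernel *)

Notation is_cderive := (@is_derive C_AbsRing (AbsRing_NormedModule C_AbsRing)).

Lemma cdiff_iff f s l : cdiff f s l <-> is_cderive f s l.
Proof.
 split.
 - intros H. split; [apply (is_linear_scal_l (K := C_AbsRing) (V := AbsRing_NormedModule C_AbsRing))|]. intros x Hx.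
  apply (is_filter_lim_locally_unique (K := C_AbsRing) (V := AbsRing_NormedModule C_AbsRing)) in Hx. subst x. intros eps. destruct (H eps (cond_pos eps)) as [d [Hd Hz]].
  exists (mkposreal d Hd). intros z Hzd. specialize (Hz z Hzd). rewrite (Cmult_comm l) in Hz. exact Hz.
 - intros [_ H] eps He. destruct (H s (fun P HP => HP) (mkposreal eps He)) as [d Hd].
  exists d. split; [apply cond_pos|]. intros z Hz. specialize (Hd z Hz). rewrite (Cmult_comm l). exact Hd.
Qed.

Lemma cdiff_const c s : cdiff (fun _ => c) s 0.
Proof. apply cdiff_iff. apply (is_derive_const (K := C_AbsRing) (V := AbsRing_NormedModule C_AbsRing)). Qed.

Lemma cdiff_id s : cdiff (fun z => z) s 1.
Proof. apply cdiff_iff. apply (is_derive_id (K := C_AbsRing)). Qed.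

Lemma cdiff_plus f g s a b : cdiff f s a -> cdiff g s b -> cdiff (fun z => f z + g z)%C s (a + b)%C.
Proof. rewrite !cdiff_iff. apply (is_derive_plus (K := C_AbsRing) (V := AbsRing_NormedModule C_AbsRing)). Qed.

Lemma cdiff_mult f g s a b : cdiff f s a -> cdiff g s b -> cdiff (fun z => f z * g z)%C s (a * g s + f s * b)%C.
Proof. rewrite !cdiff_iff. intros Hf Hg. apply (is_derive_mult (K := C_AbsRing)); auto. apply Cmult_comm. Qed.

Lemma cdiff_comp f g s a b : cdiff f (g s) a -> cdiff g s b -> cdiff (fun z => f (g z)) s (b * a)%C.
Proof. rewrite !cdiff_iff. intros Hf Hg. now apply (is_derive_comp (K := C_AbsRing) (V := AbsRing_NormedModule C_AbsRing)). Qed.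

Definition cexp (z : C) : C := (exp (Re z) * cos (Im z), exp (Re z) * sin (Im z)).

Lemma cexp_plus z w : cexp (z + w) = (cexp z * cexp w)%C.
Proof.
 destruct z as [a b], w as [c d]. unfold cexp, Cmult, Cplus; simpl. rewrite exp_plus, cos_plus, sin_plus. f_equal; ring.
Qed.

Lemma Cmod_cexp z : Cmod (cexp z) = exp (Re z).
Proof.
 unfold cexp, Cmod; simpl. replace (exp (Re z) * cos (Im z) * (exp (Re z) * cos (Im z) * 1) + exp (Re z) * sin (Im z) * (exp (Re z) * sin (Im z) * 1))
  with (exp (Re z) ^ 2 * (Rsqr (sin (Im z)) + Rsqr (cos (Im z)))) by (unfold Rsqr; ring).
 rewrite sin2_cos2, Rmult_1_r. apply sqrt_pow2. pos.
Qed.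

Lemma exp_minus_1_bound x : Rabs x <= 1 -> Rabs (exp x - 1) <= 3 * Rabs x /\ Rabs (exp x - 1 - x) <= 3 * Rabs x ^ 2 /\ exp x <= 3.
Proof.
 intros Hx.
 assert (B : forall t, -1 <= t <= 1 -> exp t <= 3).
 { intros t Ht. apply Rle_trans with (exp 1); [destruct (Rle_lt_or_eq_dec t 1 (proj2 Ht)) as [L| ->]; [left; now apply exp_increasing|lra]|apply exp_le_3]. }
 assert (Hx' := Hx). apply Rabs_le_between in Hx'.
 assert (B1 : forall t, Rabs t <= Rabs x -> Rabs (exp t - 1) <= 3 * Rabs t).
 { intros t Ht. assert (L := lipschitz_on exp exp (-1) 1 3). assert (Ht1 : Rabs t <= 1) by lra. apply Rabs_le_between in Ht1.
  specialize (L ltac:(intros z Hz; split; [apply is_derive_Reals, derivable_pt_lim_exp|rewrite Rabs_pos_eq by pos; auto]) t 0 Ht1 ltac:(lra)).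
  rewrite exp_0, Rminus_0_r in L. exact L. }
 split; [apply B1; lra|]. split; [|apply B; lra].
 assert (L := lipschitz_on (fun t => exp t - 1 - t) (fun t => exp t - 1) (- Rabs x) (Rabs x) (3 * Rabs x)).
 specialize (L ltac:(intros t Ht; split; [auto_derive; auto; ring|]; apply Rabs_le in Ht; eapply Rle_trans; [now apply B1|lra]) x 0
  ltac:(apply Rabs_le_between; lra) ltac:(generalize (Rabs_pos x); lra)).
 cbv beta in L. rewrite exp_0, !Rminus_0_r in L. replace (exp x - 1 - x - (1 - 1)) with (exp x - 1 - x) in L by ring.
 replace (3 * Rabs x ^ 2) with (3 * Rabs x * Rabs x) by ring. exact L.
Qed.

Lemma trig_bounds y : Rabs (cos y - 1) <= Rabs y ^ 2 /\ Rabs (sin y - y) <= 2 * Rabs y ^ 2.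
Proof.
 assert (S : forall t, Rabs (sin t) <= Rabs t).
 { intros t. assert (L := lipschitz_on sin cos (- Rabs t) (Rabs t) 1). rewrite <- (Rminus_0_r t) at 2. rewrite <- (Rminus_0_r (sin t)), <- sin_0 at 1.
  rewrite <- (Rmult_1_l (Rabs (t - 0))). assert (P := Rabs_pos t). apply L; [|apply Rabs_le_between; lra|lra].
  intros z _. split; [apply is_derive_Reals, derivable_pt_lim_sin|]. apply Rabs_le. generalize (COS_bound z); lra. }
 assert (P := Rabs_pos y).
 assert (Cc : forall t, Rabs t <= Rabs y -> Rabs (cos t - 1) <= Rabs y * Rabs t).
 { intros t Ht. assert (L := lipschitz_on cos (fun t => - sin t) (- Rabs y) (Rabs y) (Rabs y)). rewrite <- cos_0.
  replace (Rabs t) with (Rabs (t - 0)) by (f_equal; ring). apply L; [|apply Rabs_le_between; lra|lra].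
  intros z Hz. split; [apply is_derive_Reals, derivable_pt_lim_cos|]. rewrite Rabs_Ropp. apply Rle_trans with (1 := S z). apply Rabs_le; lra. }
 split; [replace (Rabs y ^ 2) with (Rabs y * Rabs y) by ring; apply Cc; lra|].
 assert (Q : Rabs (sin y - y) <= 2 * Rabs y) by (unfold Rminus; eapply Rle_trans; [apply Rabs_triang|]; rewrite Rabs_Ropp; generalize (S y); lra).
 assert (L := lipschitz_on (fun t => sin t - t) (fun t => cos t - 1) (- Rabs y) (Rabs y) (Rabs y * Rabs y)).
 assert (L' : Rabs ((sin y - y) - (sin 0 - 0)) <= Rabs y * Rabs y * Rabs (y - 0)).
 { apply L; [|apply Rabs_le_between; lra|lra]. intros t Ht. split; [auto_derive; auto; ring|]. apply Rabs_le in Ht.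
  apply Rle_trans with (1 := Cc t Ht). mul_l; lra. }
 rewrite sin_0, !Rminus_0_r in L'. destruct (Rle_dec (Rabs y) 1); nra.
Qed.

Lemma cdiff_cexp s : cdiff cexp s (cexp s).
Proof.
 intros eps He. set (k := 20 * Cmod (cexp s)). assert (Pk : 0 < k) by (unfold k; rewrite Cmod_cexp; generalize (exp_pos (Re s)); lra).
 exists (Rmin 1 (eps / k)). split; [apply Rmin_glb_lt; [lra|now apply Rdiv_lt_0_compat]|].
 intros z Hz. set (w := (z - s)%C) in *. replace z with (s + w)%C by (unfold w; ring). rewrite cexp_plus.
 replace (cexp s * cexp w - cexp s - cexp s * w)%C with (cexp s * (cexp w - 1 - w))%C by ring. rewrite Cmod_mult.
 assert (M1 := Rmin_l 1 (eps / k)). assert (M2 := Rmin_r 1 (eps / k)).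
 destruct (Re_le_Cmod w) as [R1 R2].
 assert (H : Cmod (cexp w - 1 - w) <= 20 * Cmod w ^ 2).
 { destruct (exp_minus_1_bound (Re w)) as [E1 [E2 E3]]; [lra|]. destruct (trig_bounds (Im w)) as [T1 T2].
  replace (cexp w - 1 - w)%C with ((exp (Re w) - 1 - Re w) + exp (Re w) * (cos (Im w) - 1), exp (Re w) * (sin (Im w) - Im w) + Im w * (exp (Re w) - 1)).
  2:{ unfold cexp, Cminus, Cplus, Copp, RtoC; destruct w; simpl. f_equal; ring. }
  eapply Rle_trans; [apply Cmod_le_sum|].
  assert (P1 := exp_pos (Re w)). assert (X1 := Rabs_pos (Re w)). assert (X2 := Rabs_pos (Im w)).
  assert (Q1 : Rabs (Re w) ^ 2 <= Cmod w ^ 2) by (apply pow_incr; lra). assert (Q2 : Rabs (Im w) ^ 2 <= Cmod w ^ 2) by (apply pow_incr; lra).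
  assert (A : forall u v, Rabs (u + exp (Re w) * v) <= Rabs u + 3 * Rabs v).
  { intros u v. eapply Rle_trans; [apply Rabs_triang|]. rewrite Rabs_mult, (Rabs_pos_eq (exp (Re w))) by lra. generalize (Rabs_pos v); nra. }
  assert (A1 := A (exp (Re w) - 1 - Re w) (cos (Im w) - 1)). assert (A2 := A (Im w * (exp (Re w) - 1)) (sin (Im w) - Im w)).
  rewrite Rabs_mult in A2. rewrite (Rplus_comm (exp (Re w) * (sin (Im w) - Im w))).
  assert (Rabs (Im w) * Rabs (exp (Re w) - 1) <= Cmod w * (3 * Cmod w)) by (apply Rmult_le_compat; try apply Rabs_pos; lra). generalize (pow2_ge_0 (Cmod w)); lra. }
 apply Rle_trans with (k * Cmod w * Cmod w); [|mul_r].
 - unfold k. assert (P := Cmod_ge_0 (cexp s)). nra.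
 - assert (E : k * (eps / k) = eps) by (field; lra). nra.
Qed.

Lemma path_bound (F : C -> C) (gam : R -> C) a b : a <= b -> (forall t t', Cmod (gam t - gam t') <= Rabs (t - t')) ->
 (forall t, a <= t <= b -> exists l, cdiff F (gam t) l) -> exists B, forall t, a <= t <= b -> Cmod (F (gam t)) <= B.
Proof.
 intros Hab Hg HF. destruct (continuity_ab_maj (fun t => Cmod (F (gam t))) a b Hab) as [Mx [H _]]; [|eauto].
 intros t Ht eps He. destruct (HF t Ht) as [l Hl]. destruct (cdiff_continuous _ _ _ Hl eps He) as [d [Hd H]].
 exists d. split; [auto|]. intros z [_ Hz]. simpl in *. unfold Rdist in *.
 assert (K := H (gam z) (Rle_lt_trans _ _ _ (Hg z t) Hz)).
 assert (T1 := Cmod_triangle (F (gam z) - F (gam t)) (F (gam t))). assert (T2 := Cmod_triangle (F (gam t) - F (gam z)) (F (gam z))).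
 replace (F (gam z) - F (gam t) + F (gam t))%C with (F (gam z)) in T1 by ring.
 replace (F (gam t) - F (gam z) + F (gam z))%C with (F (gam t)) in T2 by ring.
 replace (F (gam t) - F (gam z))%C with (- (F (gam z) - F (gam t)))%C in T2 by ring. rewrite Cmod_opp in T2.
 apply Rabs_def1; lra.
Qed.

(** The entire function [exp (2 M cosh (al (z - s0)))]. On the vertical line through [s0] it is the
    positive number [exp (2 M cos (al (y - y0)))], largest at [s0]; at height distance [PI/al] its
    modulus is at most [exp (- 2 M)]. *)
Definition peak (M al : R) (s0 z : C) : C :=
 cexp (RtoC M * (cexp (RtoC al * (z - s0)) + cexp (- (RtoC al * (z - s0))))).

Lemma cdiff_peak M al s0 s : exists l, cdiff (peak M al s0) s l.
Proof.
 assert (D : cdiff (fun z => RtoC al * (z - s0))%C s (0 * (s - s0) + RtoC al * (1 + 0))%C).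
 { apply (cdiff_mult (fun _ => RtoC al) (fun z => z - s0)%C); [apply cdiff_const|].
  apply (cdiff_plus (fun z => z) (fun _ => - s0)%C); [apply cdiff_id|apply cdiff_const]. }
 assert (D2 := cdiff_mult (fun _ => RtoC (-1)) _ s _ _ (cdiff_const _ s) D).
 assert (E := cdiff_comp cexp _ s _ _ (cdiff_cexp _) D). assert (E2 := cdiff_comp cexp _ s _ _ (cdiff_cexp _) D2).
 assert (G := cdiff_mult (fun _ => RtoC M) _ s _ _ (cdiff_const _ s) (cdiff_plus _ _ s _ _ E E2)).
 assert (K := cdiff_comp cexp _ s _ _ (cdiff_cexp _) G). cbv beta in K. eexists. intros eps He.
 destruct (K eps He) as [d [Hd H]]. exists d. split; [exact Hd|]. intros z Hz. specialize (H z Hz).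
 assert (Er : forall z, peak M al s0 z = cexp (RtoC M * (cexp (RtoC al * (z - s0)) + cexp (RtoC (-1) * (RtoC al * (z - s0)))))).
 { intros u. unfold peak. do 4 f_equal. ring. }
 rewrite !Er. exact H.
Qed.

Lemma peak_exponent M al s0 z : Re (RtoC M * (cexp (RtoC al * (z - s0)) + cexp (- (RtoC al * (z - s0))))) =
 M * ((exp (al * (Re z - Re s0)) + exp (- (al * (Re z - Re s0)))) * cos (al * (Im z - Im s0))).
Proof.
 destruct z as [x y], s0 as [x0 y0]. unfold cexp, Cmult, Cplus, Cminus, Copp, RtoC, Re, Im; simpl.
 replace (al * (y + - y0) + 0 * (x + - x0)) with (al * (y - y0)) by ring.
 replace (al * (x + - x0) - 0 * (y + - y0)) with (al * (x - x0)) by ring. rewrite cos_neg, sin_neg. ring.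
Qed.

Lemma peak_vertical M al x0 y0 y : peak M al (x0, y0) (x0, y) = RtoC (exp (2 * M * cos (al * (y - y0)))).
Proof.
 unfold peak. replace (RtoC al * ((x0, y) - (x0, y0)))%C with ((0, al * (y - y0)) : C)
  by (unfold RtoC, Cmult, Cminus, Cplus, Copp; simpl; f_equal; ring).
 set (th := al * (y - y0)). replace (RtoC M * (cexp (0, th) + cexp (- (0, th))))%C with (RtoC (2 * M * cos th)).
 - unfold cexp, RtoC, Re, Im; simpl. rewrite cos_0, sin_0. f_equal; ring.
 - unfold cexp, RtoC, Cmult, Cplus, Copp, Re, Im; simpl. rewrite Ropp_0, exp_0, cos_neg, sin_neg. f_equal; ring.
Qed.

Lemma Cmod_peak M al s0 z : Cmod (peak M al s0 z) =
 exp (M * ((exp (al * (Re z - Re s0)) + exp (- (al * (Re z - Re s0)))) * cos (al * (Im z - Im s0)))).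
Proof. unfold peak. now rewrite Cmod_cexp, peak_exponent. Qed.

(* As [M] grows, [peak] concentrates the contour integral at the point [(-1, y)] of the left side,
  while the right side is killed by letting [L] tend to infinity first. *)
Lemma continuation (f : nat -> C -> C) (eta : nat -> R) :
 (forall N s, 0 < Im s -> exists l, cdiff (f N) s l) ->
 (forall N L s, (N <= L)%nat -> -1 <= Re s <= 2 -> 0 < Im s <= 2 -> Cmod (f L s - f N s) <= eta N) ->
 (forall N s, Re s = 2 -> 0 < Im s <= 2 -> Cmod (f N s) <= eta N) ->
 (forall eps, 0 < eps -> exists N0, forall N, (N0 <= N)%nat -> eta N <= eps) ->
 forall N y, 0 < y <= 1 -> Cmod (f N (-1, y)) <= eta N.
Proof.
 intros Df Hc Hr Heta N y Hy. apply Rnot_lt_le; intros Hbad.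
 set (s0 := (-1, y) : C) in *. set (Y := y / 2). set (al := PI / Y). assert (PP := PI_RGT_0).
 assert (HY : 0 < Y) by (unfold Y; lra). assert (Hal : al * Y = PI) by (unfold al; field; lra).
 assert (Pal : 0 < al) by (now apply Rdiv_lt_0_compat).
 set (A := f N s0) in *. set (del := (Cmod A - eta N) / 2).
 assert (Hcom : 0 <= eta N) by (eapply Rle_trans; [apply Cmod_ge_0|apply (Hc N N s0 (le_n N)); simpl; lra]).
 (* A rotation that makes [a f] have real part close to [Cmod A] near [s0], so that real parts can
    be integrated without cancellation. *)
 set (a := (Cconj A / RtoC (Cmod A))%C).
 assert (PA : 0 < Cmod A) by lra. assert (CA : RtoC (Cmod A) <> 0) by (intros E; apply RtoC_inj in E; lra).
 assert (Ha : Cmod a = 1).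
 { unfold a. rewrite Cmod_div, Cmod_R, Rabs_pos_eq by (auto; lra). rewrite Cmod_conj. field. lra. }
 assert (HaA : Re (a * A) = Cmod A).
 { replace (a * A)%C with (RtoC (Cmod A)); [reflexivity|]. unfold a. replace (Cconj A / Cmod A * A)%C with (A * Cconj A / Cmod A)%C by (field; auto).
  rewrite <- Cmod2_conj. replace (RtoC (Cmod A ^ 2)) with (RtoC (Cmod A) * RtoC (Cmod A))%C by (rewrite <- RtoC_mult; f_equal; ring). field. auto. }
 destruct (Df N s0 ltac:(simpl; lra)) as [l0 Hl0]. destruct (cdiff_continuous _ _ _ Hl0 del ltac:(unfold del; lra)) as [r0 [Hr0 Hcont]].
 set (r := Rmin r0 Y / 2). assert (M1 := Rmin_l r0 Y). assert (M2 := Rmin_r r0 Y).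
 assert (Hr1 : 0 < r /\ r < r0 /\ r < Y) by (assert (0 < Rmin r0 Y) by (now apply Rmin_glb_lt); unfold r; lra).
 assert (GH : forall y' t t', Cmod ((t, y') - (t', y')) <= Rabs (t - t')).
 { intros. eapply Rle_trans; [apply Cmod_le_sum|]. simpl. replace (y' + - y') with 0 by ring. rewrite Rabs_R0. unfold Rminus; lra. }
 destruct (path_bound (f N) (fun t => (t, y - Y)) (-1) 2 ltac:(lra) (GH _) ltac:(intros; apply Df; simpl; unfold Y; lra)) as [B1 HB1].
 destruct (path_bound (f N) (fun t => (t, y + Y)) (-1) 2 ltac:(lra) (GH _) ltac:(intros; apply Df; simpl; unfold Y; lra)) as [B2 HB2].
 destruct (path_bound (f N) (fun t => (-1, t)) (y - Y) (y + Y) ltac:(lra)) as [B3 HB3].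
 { intros. eapply Rle_trans; [apply Cmod_le_sum|]. simpl. replace (-1 + - -1) with 0 by ring. rewrite Rabs_R0. unfold Rminus; lra. }
 { intros; apply Df; simpl; unfold Y in *; lra. }
 set (B := Rabs B1 + Rabs B2 + Rabs B3 + eta N). assert (Q1 := Rle_abs B1). assert (Q2 := Rle_abs B2). assert (Q3 := Rle_abs B3).
 assert (Q1' := Rabs_pos B1). assert (Q2' := Rabs_pos B2). assert (Q3' := Rabs_pos B3).
 assert (Btot : forall L s, (N <= L)%nat -> -1 <= Re s <= 2 -> 0 < Im s <= 2 -> Cmod (f N s) <= Rabs B1 + Rabs B2 + Rabs B3 -> Cmod (f L s) <= B).
 { intros L s HL H1 H2 H3. replace (f L s) with ((f L s - f N s) + f N s)%C by ring. eapply Rle_trans; [apply Cmod_triangle|].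
  specialize (Hc N L s HL H1 H2). unfold B. lra. }
 set (c1 := cos (al * (r / 2))). set (c2 := cos (al * r)).
 assert (Hc12 : c2 < c1) by (apply cos_decreasing_1; nra).
 assert (Hc2 : -1 <= c2) by (generalize (COS_bound (al * r)); unfold c2; lra).
 (* The centre of the left side, of length [r], contributes at least [del exp (2 M c1)] per unit
    length. Its outer parts and the horizontal sides are bounded by [B exp (2 M c2)] with [c2 < c1],
    the right side by [eta L]. *)
 assert (Main : forall M L, 0 < M -> (N <= L)%nat -> del * exp (2 * M * c1) * r <=
   (2 * Y + 6) * B * exp (2 * M * c2) + 2 * Y * (eta L * exp (M * (exp (al * 3) + exp (al * 3))))).
 { intros M L HM HL. set (g := fun z => (a * f L z * peak M al s0 z)%C).
  assert (Dg : forall s, 0 < Im s -> exists l, cdiff g s l).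
  { intros s Hs. destruct (Df L s Hs) as [l1 Hl1]. destruct (cdiff_peak M al s0 s) as [l2 Hl2].
   eexists. apply (cdiff_mult (fun z => a * f L z)%C); [apply cdiff_mult; [apply cdiff_const|exact Hl1]|exact Hl2]. }
  assert (Mg : forall z, Cmod (g z) = Cmod (f L z) * Cmod (peak M al s0 z)) by (intros; unfold g; rewrite !Cmod_mult, Ha; ring).
  assert (G := goursat g Dg (-1) (y - Y) 3 (2 * Y) ltac:(lra) ltac:(lra) ltac:(unfold Y; lra)). unfold circulation in G.
  replace (-1 + 3) with 2 in G by ring.
  assert (Eb : exp (2 * M * -1) <= exp (2 * M * c2)) by (destruct Hc2 as [Hc2|<-]; [left; apply exp_increasing; nra|lra]).
  assert (Hh : forall y', Rabs (y' - y) = Y -> (forall t, -1 <= t <= 2 -> Cmod (f N (t, y')) <= Rabs B1 + Rabs B2 + Rabs B3) ->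
   Rabs (hint g (-1) 3 y') <= 3 * (B * exp (2 * M * c2))).
  { intros y' Hy' HF. assert (Hy2 : 0 < y' <= 2) by (unfold Rabs in Hy'; destruct (Rcase_abs _) in Hy'; unfold Y in *; lra).
   unfold hint. replace (3 * (B * exp (2 * M * c2))) with ((-1 + 3 - -1) * (B * exp (2 * M * c2))) by ring.
   apply abs_RInt_le_const; [lra|apply ex_hint; [auto|lra]|]. intros t Ht.
   eapply Rle_trans; [apply (Re_le_Cmod (g (t, y')))|]. rewrite Mg, Cmod_peak. simpl Re. simpl Im.
   apply Rmult_le_compat; [apply Cmod_ge_0|pos|apply Btot; [auto|simpl; lra|simpl; lra|apply HF; lra]|].
   replace (cos (al * (y' - y))) with (-1).
   - apply Rle_trans with (2 := Eb). set (u := al * (t - -1)).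
    assert (2 <= exp u + exp (- u)) by (assert (X1 := exp_ineq1_le u); assert (X2 := exp_ineq1_le (- u)); lra).
    apply exp_mono; nra.
   - unfold Rabs in Hy'. destruct (Rcase_abs (y' - y)).
    + replace (al * (y' - y)) with (- PI) by (rewrite <- Hal; nra). now rewrite cos_neg, cos_PI.
    + rewrite Hy', Hal. now rewrite cos_PI. }
  assert (Hb := Hh (y - Y) ltac:(replace (y - Y - y) with (- Y) by ring; rewrite Rabs_Ropp; apply Rabs_pos_eq; lra)
   ltac:(intros t Ht; generalize (HB1 t Ht); lra)).
  assert (Ht := Hh (y - Y + 2 * Y) ltac:(replace (y - Y + 2 * Y - y) with Y by ring; apply Rabs_pos_eq; lra)
   ltac:(intros t Ht; replace (y - Y + 2 * Y) with (y + Y) by ring; generalize (HB2 t Ht); lra)).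
  assert (Hright : Rabs (vint g (y - Y) (2 * Y) 2) <= 2 * Y * (eta L * exp (M * (exp (al * 3) + exp (al * 3))))).
  { unfold vint. replace (2 * Y * (eta L * exp (M * (exp (al * 3) + exp (al * 3))))) with ((y - Y + 2 * Y - (y - Y)) * (eta L * exp (M * (exp (al * 3) + exp (al * 3))))) by ring.
   apply abs_RInt_le_const; [lra|apply ex_vint; [auto|unfold Y; lra|unfold Y; lra]|]. intros t Htt.
   eapply Rle_trans; [apply (Re_le_Cmod (g (2, t)))|]. rewrite Mg, Cmod_peak. simpl Re. simpl Im.
   apply Rmult_le_compat; [apply Cmod_ge_0|pos|apply Hr; simpl; [auto|unfold Y in *; lra]|].
   replace (2 - -1) with 3 by ring. assert (X2 := exp_pos (- (al * 3))).
   assert (X3 : exp (- (al * 3)) <= exp (al * 3)) by (left; apply exp_increasing; nra).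
   assert (X4 := COS_bound (al * (t - y))).
   assert (X5 : M * ((exp (al * 3) + exp (- (al * 3))) * cos (al * (t - y))) <= M * (exp (al * 3) + exp (al * 3))) by (mul_l; nra).
   apply exp_mono; lra. }
  assert (Eg : forall t, Re (g (-1, t)) = Re (a * f L (-1, t)) * exp (2 * M * cos (al * (t - y)))).
  { intros t. unfold g. unfold s0. rewrite peak_vertical. destruct (a * f L (-1, t))%C as [u v]. unfold RtoC, Cmult, Re; simpl. ring. }
  assert (Hle : forall z, - Cmod z <= Re (a * z)).
  { intros z. assert (X := proj1 (Re_le_Cmod (a * z))). rewrite Cmod_mult, Ha in X. apply Rabs_le_between in X. lra. }
  assert (Hin : forall t, Rabs (t - y) <= r -> del <= Re (a * f L (-1, t))).
  { intros t Htr. assert (HX : Cmod (f N (-1, t) - A) < del).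
   { apply Hcont. eapply Rle_lt_trans; [apply Cmod_le_sum|]. simpl. replace (-1 + - -1) with 0 by ring. rewrite Rabs_R0. unfold Rminus in Htr; lra. }
   assert (Htr' := Htr). apply Rabs_le_between in Htr'.
   assert (HZ := Hc N L (-1, t) HL ltac:(simpl; lra) ltac:(simpl; unfold Y in *; lra)).
   assert (U1 := Hle (f L (-1, t) - f N (-1, t))%C). assert (U2 := Hle (f N (-1, t) - A)%C).
   replace (a * f L (-1, t))%C with (a * (f L (-1, t) - f N (-1, t)) + a * (f N (-1, t) - A) + a * A)%C by ring.
   assert (Rp : forall u v, Re (u + v) = Re u + Re v) by reflexivity. rewrite !Rp, HaA. unfold del in *. lra. }
  assert (Hcos : forall t, r <= Rabs (t - y) <= Y -> cos (al * (t - y)) <= c2).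
  { intros t Ht'. unfold c2. replace (cos (al * (t - y))) with (cos (al * Rabs (t - y))).
   - apply cos_decr_1; nra.
   - unfold Rabs. destruct (Rcase_abs (t - y)); [rewrite <- cos_neg; f_equal; ring|auto]. }
  assert (Hout : forall t, Rabs (t - y) <= Y -> - (B * exp (2 * M * c2)) <= Re (g (-1, t))).
  { intros t Ht'. rewrite Eg. assert (X := exp_pos (2 * M * cos (al * (t - y)))). assert (X' := exp_pos (2 * M * c2)).
   assert (0 <= B) by (unfold B; lra).
   destruct (Rle_dec (Rabs (t - y)) r) as [HX|HX].
   - assert (Z := Hin t HX). assert (0 < del) by (unfold del; lra). nra.
   - assert (E : exp (2 * M * cos (al * (t - y))) <= exp (2 * M * c2)).
    { assert (Z := Hcos t ltac:(lra)). apply exp_mono; nra. }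
    apply Rabs_le_between in Ht'. assert (HZ := Btot L (-1, t) HL ltac:(simpl; lra) ltac:(simpl; unfold Y in *; lra) ltac:(generalize (HB3 t ltac:(lra)); lra)).
    assert (Z := Hle (f L (-1, t))). assert (P := Cmod_ge_0 (f L (-1, t))). nra. }
  assert (Hmid : forall t, Rabs (t - y) <= r / 2 -> del * exp (2 * M * c1) <= Re (g (-1, t))).
  { intros t Ht'. rewrite Eg. apply Rmult_le_compat; [unfold del; lra|pos|apply Hin; lra|].
   assert (Z : c1 <= cos (al * (t - y))).
   { unfold c1. replace (cos (al * (t - y))) with (cos (al * Rabs (t - y))).
    - assert (P := Rabs_pos (t - y)). apply cos_decr_1; nra.
    - unfold Rabs. destruct (Rcase_abs (t - y)); [rewrite <- cos_neg; f_equal; ring|auto]. }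
   apply exp_mono; nra. }
  assert (Ex : forall u v, - Y <= u -> - Y <= v -> ex_RInt (fun t => Re (g (-1, t))) (y + u) (y + v)) by (intros; apply ex_vint; auto; unfold Y in *; lra).
  assert (Low : forall u v m, - Y <= u -> u <= v -> (forall t, y + u <= t <= y + v -> m <= Re (g (-1, t))) ->
   m * (v - u) <= RInt (fun t => Re (g (-1, t))) (y + u) (y + v)).
  { intros u v m Hu Huv Hm. replace (m * (v - u)) with (RInt (fun _ => m) (y + u) (y + v)).
   - apply RInt_le; [lra|apply ex_RInt_const|apply Ex; lra|]. intros t Ht'. apply Hm; lra.
   - rewrite RInt_const. unfold scal; simpl; unfold mult; simpl. ring. }
  assert (Hleft : del * exp (2 * M * c1) * r - 2 * Y * (B * exp (2 * M * c2)) <= vint g (y - Y) (2 * Y) (-1)).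
  { unfold vint. replace (y - Y + 2 * Y) with (y + Y) by ring. replace (y - Y) with (y + - Y) by ring.
   rewrite <- (RInt_Chasles (V := R_CompleteNormedModule) _ (y + - Y) (y + - (r / 2)) (y + Y)) by (apply Ex; lra).
   rewrite <- (RInt_Chasles (V := R_CompleteNormedModule) _ (y + - (r / 2)) (y + r / 2) (y + Y)) by (apply Ex; lra).
   assert (L1 := Low (- Y) (- (r / 2)) (- (B * exp (2 * M * c2))) ltac:(lra) ltac:(lra) ltac:(intros; apply Hout, Rabs_le; lra)).
   assert (L2 := Low (- (r / 2)) (r / 2) (del * exp (2 * M * c1)) ltac:(lra) ltac:(lra) ltac:(intros; apply Hmid, Rabs_le; lra)).
   assert (L3 := Low (r / 2) Y (- (B * exp (2 * M * c2))) ltac:(lra) ltac:(lra) ltac:(intros; apply Hout, Rabs_le; lra)).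
   assert (PBr : 0 <= B * exp (2 * M * c2) * r) by pos. change (@plus R_CompleteNormedModule) with Rplus. lra. }
  apply Rabs_le_between in Hb, Ht, Hright. lra. }
 assert (Pdel : 0 < del) by (unfold del; lra).
 assert (Main2 : forall M, 0 < M -> del * r * exp (2 * M * (c1 - c2)) <= (2 * Y + 6) * B + 1).
 { intros M HM. set (W := exp (M * (exp (al * 3) + exp (al * 3)))). assert (PW : 0 < W) by apply exp_pos.
  assert (PE := exp_pos (2 * M * c2)).
  destruct (Heta (exp (2 * M * c2) / (2 * Y * W))) as [N0 HN0]; [pos|].
  assert (X := Main M (N + N0)%nat HM ltac:(lia)). specialize (HN0 (N + N0)%nat ltac:(lia)). fold W in X.
  assert (Z : 2 * Y * (eta (N + N0)%nat * W) <= exp (2 * M * c2)).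
  { apply (Rmult_le_compat_r (2 * Y * W)) in HN0; [|nra]. replace (exp (2 * M * c2) / (2 * Y * W) * (2 * Y * W)) with (exp (2 * M * c2)) in HN0 by (field; lra). lra. }
  apply (Rmult_le_reg_r (exp (2 * M * c2))); auto.
  replace (del * r * exp (2 * M * (c1 - c2)) * exp (2 * M * c2)) with (del * exp (2 * M * c1) * r); [lra|].
  replace (2 * M * c1) with (2 * M * (c1 - c2) + 2 * M * c2) by ring. rewrite exp_plus. ring. }
 assert (PK : 0 <= (2 * Y + 6) * B + 1) by (assert (0 <= B) by (unfold B; lra); nra).
 set (K := (2 * Y + 6) * B + 1) in *. set (k := del * r * (2 * (c1 - c2))). assert (Pdr : 0 < del * r) by nra.
 assert (Pk : 0 < k) by (unfold k; nra).
 assert (X := Main2 (K / k + 1) ltac:(assert (0 <= K / k) by (now apply Rdiv_le_0_compat); lra)).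
 assert (E := exp_ineq1_le (2 * (K / k + 1) * (c1 - c2))).
 assert (Z : del * r * (2 * (K / k + 1) * (c1 - c2)) = K + k).
 { transitivity (k * (K / k + 1)); [|field; lra]. set (u := K / k). unfold k. ring. }
 nra.
Qed.

Definition cpow (x : R) (z : C) : C := cexp (z * RtoC (ln x)).

(** Stated for the real part with a constant [a], so that the real Euler-Maclaurin step applies;
    differentiation only multiplies [a] by the exponent and lowers the exponent. *)
Lemma cpow_derive (a z : C) x : 0 < x -> is_derive (fun x => Re (a * cpow x z)) x (Re (a * z * cpow x (z - 1))).
Proof.
 intros Hx. destruct a as [a b], z as [c d]. unfold cpow, cexp, Cmult, Cminus, Cplus, Copp, RtoC, Re, Im. simpl.
 auto_derive; [repeat split; lra|].
 replace ((c + Ropp 1) * ln x - (d + - 0) * 0) with (c * ln x + - (d * 0) + - ln x) by ring.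
 replace ((c + Ropp 1) * 0 + (d + - 0) * ln x) with (c * 0 + d * ln x) by ring.
 rewrite (exp_plus (c * ln x + - (d * 0))), exp_Ropp, exp_ln by auto. field. lra.
Qed.

Lemma Cmod_cpow x z : Cmod (cpow x z) = exp (Re z * ln x).
Proof. unfold cpow. rewrite Cmod_cexp. f_equal. destruct z; unfold RtoC, Cmult, Re; simpl. ring. Qed.

(** The real formula applied to real parts after multiplication by [1] and by [- i], hence the
    factor 2. The five moduli come from five differentiations, after which [Re z <= 2] gives order
    [n^(-3)]. *)
Lemma complex_euler_maclaurin (z : C) (n : R) : 1 <= n -> Re z <= 2 ->
 Cmod (z * (cpow n (z - 1) + cpow (n + 1) (z - 1)) * RtoC (/ 2) - (cpow (n + 1) z - cpow n z)
  - z * (z - 1) * (cpow (n + 1) (z - 1 - 1) - cpow n (z - 1 - 1)) * RtoC (/ 12)) <=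
 2 * (Cmod z * Cmod (z - 1) * Cmod (z - 1 - 1) * Cmod (z - 1 - 1 - 1) * Cmod (z - 1 - 1 - 1 - 1)) / n ^ 3.
Proof.
 intros Hn Hz. set (K := Cmod z * Cmod (z - 1) * Cmod (z - 1 - 1) * Cmod (z - 1 - 1 - 1) * Cmod (z - 1 - 1 - 1 - 1)).
 set (D := (z * (cpow n (z - 1) + cpow (n + 1) (z - 1)) * RtoC (/ 2) - (cpow (n + 1) z - cpow n z)
  - z * (z - 1) * (cpow (n + 1) (z - 1 - 1) - cpow n (z - 1 - 1)) * RtoC (/ 12))%C).
 assert (H : forall c, Cmod c = 1 -> Rabs (Re (c * D)) <= K / n ^ 3).
 { intros c Hc. set (a1 := (c * z)%C). set (a2 := (a1 * (z - 1))%C). set (a3 := (a2 * (z - 1 - 1))%C). set (a4 := (a3 * (z - 1 - 1 - 1))%C).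
  assert (E := euler_maclaurin_step (fun x => Re (c * cpow x z)) (fun x => Re (a1 * cpow x (z - 1))) (fun x => Re (a2 * cpow x (z - 1 - 1)))
   (fun x => Re (a3 * cpow x (z - 1 - 1 - 1))) (fun x => Re (a4 * cpow x (z - 1 - 1 - 1 - 1)))
   (fun x => Re (a4 * (z - 1 - 1 - 1 - 1) * cpow x (z - 1 - 1 - 1 - 1 - 1))) n (K / n ^ 3)). cbv beta in E.
  replace (Re (c * D)) with ((Re (a1 * cpow n (z - 1)) + Re (a1 * cpow (n + 1) (z - 1))) / 2 - (Re (c * cpow (n + 1) z) - Re (c * cpow n z)) -
   (Re (a2 * cpow (n + 1) (z - 1 - 1)) - Re (a2 * cpow n (z - 1 - 1))) / 12).
  - apply E. intros x Hx. repeat (apply conj; [apply cpow_derive; lra|]).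
   eapply Rle_trans; [apply Re_le_Cmod|]. unfold a4, a3, a2, a1. rewrite !Cmod_mult, Hc, Cmod_cpow, Rmult_1_l. fold K.
   unfold Rdiv. mul_l. rewrite <- (exp_ln (/ n ^ 3)) by pos.
   rewrite ln_Rinv, ln_pow by (try pos).
   assert (L1 : ln n <= ln x) by (apply ln_le; lra). assert (L0 : 0 <= ln n) by (rewrite <- ln_1; apply ln_le; lra).
   assert (ER : Re (z - 1 - 1 - 1 - 1 - 1) = Re z - 5) by (destruct z; unfold Re, Cminus, Cplus, Copp, RtoC; simpl; ring). rewrite ER. simpl INR.
   apply exp_mono; nra.
  - unfold a2, a1, D. generalize (cpow n (z - 1)) (cpow (n + 1) (z - 1)) (cpow n z) (cpow (n + 1) z) (cpow (n + 1) (z - 1 - 1)) (cpow n (z - 1 - 1)).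
   intros [p1 p2] [q1 q2] [r1 r2] [s1 s2] [t1 t2] [u1 u2]. destruct c as [c1 c2], z as [z1 z2]. unfold Re, Cminus, Cplus, Copp, Cmult, RtoC; simpl. field. }
 assert (H1 := H 1 Cmod_1). assert (H2 := H (- Ci)%C ltac:(rewrite Cmod_opp; apply Cmod_Ci)).
 rewrite Cmult_1_l in H1. replace (Re (- Ci * D)) with (Im D) in H2 by (destruct D; unfold Re, Im, Ci, Copp, Cmult; simpl; ring).
 replace (2 * K / n ^ 3) with (K / n ^ 3 + K / n ^ 3) by (field; lra).
 clearbody D. destruct D as [d1 d2]. eapply Rle_trans; [apply Cmod_le_sum|]. unfold Re, Im in H1, H2. cbn [fst snd] in H1, H2. lra.
Qed.

Fixpoint csum (a : nat -> C) (n : nat) : C := match n with O => RtoC 0 | S n => csum a n + a n end%C.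

Lemma csum_sum_n a n : csum a (S n) = sum_n a n.
Proof. induction n; [simpl; rewrite sum_O; ring|]. rewrite sum_Sn, <- IHn. reflexivity. Qed.

Lemma cdiff_csum (a : nat -> C -> C) (da : nat -> C) s n : (forall k, cdiff (a k) s (da k)) ->
 cdiff (fun z => csum (fun k => a k z) n) s (csum da n).
Proof. intros H. induction n; [exact (cdiff_const (RtoC 0) s)|exact (cdiff_plus _ _ s _ _ IHn (H n))]. Qed.

Lemma csum_RtoC a b n : (forall k, a k = RtoC (b k)) -> csum a n = RtoC (psum b n).
Proof. intros H. induction n; [reflexivity|]. simpl. rewrite IHn, H, RtoC_plus. reflexivity. Qed.

Lemma nat_Cpow_opp_cpow n s : nat_Cpow_opp n s = cpow (INR n) (RtoC (-1) * s).
Proof.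
 unfold nat_Cpow_opp, cpow, cexp, Rpower, RtoC, Cmult, Re, Im. destruct s as [x y]; simpl.
 replace ((-1 * x - 0 * y) * ln (INR n) - (-1 * y + 0 * x) * 0) with (- x * ln (INR n)) by ring.
 replace ((-1 * x - 0 * y) * 0 + (-1 * y + 0 * x) * ln (INR n)) with (- (y * ln (INR n))) by ring.
 rewrite cos_neg, sin_neg. f_equal. ring.
Qed.

(** * Euler-Maclaurin error of the zeta function *)

Section Zeta.

Variable zeta : C -> C.
Hypothesis Hz : is_Riemann_zeta zeta.

Definition opp_pow (n : nat) (z : C) : C := cpow (INR n) (RtoC (-1) * z).

Lemma cdiff_opp_pow n s : cdiff (opp_pow n) s (RtoC (- ln (INR n)) * opp_pow n s)%C.
Proof.
 unfold opp_pow, cpow.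
 assert (D := cdiff_mult (fun z => RtoC (-1) * z)%C (fun _ => RtoC (ln (INR n))) s _ _ (cdiff_mult _ _ s _ _ (cdiff_const (RtoC (-1)) s) (cdiff_id s)) (cdiff_const _ s)).
 assert (E := cdiff_comp cexp _ s _ _ (cdiff_cexp _) D). cbv beta in E.
 match type of E with cdiff _ _ ?l => match goal with |- cdiff _ _ ?l' => replace l' with l; [exact E|] end end.
 rewrite RtoC_opp. ring.
Qed.

(* [z - 1] times the error of the Euler-Maclaurin approximation of [zeta] with [N + 1] terms. *)
Definition em_error (N : nat) (z : C) : C :=
 ((z + RtoC (-1)) * ((zeta z + RtoC (-1) * csum (fun k => opp_pow (S k) z) (S N)) + opp_pow (S N) z * (RtoC (/ 2) + RtoC (- / (12 * INR (S N))) * z))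
  + RtoC (- INR (S N)) * opp_pow (S N) z)%C.

Lemma cdiff_em_error N s l : cdiff zeta s l -> cdiff (em_error N) s
 ((zeta s + RtoC (-1) * csum (fun k => opp_pow (S k) s) (S N)) + opp_pow (S N) s * (RtoC (/ 2) + RtoC (- / (12 * INR (S N))) * s)
 + (s + RtoC (-1)) * (l + RtoC (-1) * csum (fun k => RtoC (- ln (INR (S k))) * opp_pow (S k) s) (S N) +
   (RtoC (- ln (INR (S N))) * opp_pow (S N) s * (RtoC (/ 2) + RtoC (- / (12 * INR (S N))) * s) + opp_pow (S N) s * RtoC (- / (12 * INR (S N)))))
 + RtoC (- INR (S N)) * (RtoC (- ln (INR (S N))) * opp_pow (S N) s))%C.
Proof.
 intros Hl.
 assert (D1 := cdiff_plus _ _ s _ _ (cdiff_id s) (cdiff_const (RtoC (-1)) s)).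
 assert (D2 := cdiff_mult _ _ s _ _ (cdiff_const (RtoC (-1)) s) (cdiff_csum (fun k => opp_pow (S k)) _ s (S N) (fun k => cdiff_opp_pow (S k) s))).
 assert (D3 := cdiff_plus _ _ s _ _ (cdiff_const (RtoC (/ 2)) s) (cdiff_mult _ _ s _ _ (cdiff_const (RtoC (- / (12 * INR (S N)))) s) (cdiff_id s))).
 assert (D4 := cdiff_mult _ _ s _ _ (cdiff_opp_pow (S N) s) D3).
 assert (D5 := cdiff_mult _ _ s _ _ D1 (cdiff_plus _ _ s _ _ (cdiff_plus _ _ s _ _ Hl D2) D4)).
 assert (D6 := cdiff_plus _ _ s _ _ D5 (cdiff_mult _ _ s _ _ (cdiff_const (RtoC (- INR (S N))) s) (cdiff_opp_pow (S N) s))).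
 cbv beta in D6. match type of D6 with cdiff _ _ ?l => match goal with |- cdiff _ _ ?l' => replace l' with l; [exact D6|] end end. ring.
Qed.

(** The increment is the Euler-Maclaurin remainder for the exponent [1 - s]. One of its five factors
    is [- (s + 1)], kept because it vanishes at [s = -1]; the others are at most 4, 4, 6 and 7, and
    [2 * 4 * 4 * 6 * 7 = 1344] is doubled when telescoping against [1/n^2]. *)
Lemma em_error_step N s : -1 <= Re s <= 2 -> Rabs (Im s) <= 2 -> Cmod (em_error (S N) s - em_error N s) <= 2688 * Cmod (s + 1) * (/ INR (S N) ^ 2 - / INR (S (S N)) ^ 2).
Proof.
 intros Hr Hi. set (n := INR (S N)). assert (Hn : 1 <= n) by (unfold n; rewrite S_INR; generalize (pos_INR N); lra).
 assert (ER : Re (1 - s) = 1 - Re s) by (destruct s; reflexivity).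
 assert (H := complex_euler_maclaurin (1 - s) n Hn ltac:(lra)).
 assert (Ep : forall x a, 0 < x -> cpow x (a - 1) = (cpow x a * RtoC (/ x))%C).
 { intros x a Hx. unfold cpow. replace ((a - 1) * RtoC (ln x))%C with (a * RtoC (ln x) + RtoC (- ln x))%C by (rewrite RtoC_opp; ring).
  rewrite cexp_plus. f_equal. unfold cexp, RtoC, Re, Im; simpl. rewrite cos_0, sin_0, exp_Ropp, exp_ln by auto. f_equal; ring. }
 assert (En : INR (S (S N)) = n + 1) by (rewrite S_INR; reflexivity).
 assert (Ec : forall x, 0 < x -> cpow x (1 - s) = (RtoC x * cpow x (RtoC (-1) * s))%C).
 { intros x Hx. replace (RtoC (-1) * s)%C with (1 - s - 1)%C by ring. rewrite Ep by auto. rewrite (Cmult_comm (cpow x (1 - s))), Cmult_assoc, <- RtoC_mult, Rinv_r by lra. ring. }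
 match type of H with Cmod ?d <= _ => replace (em_error (S N) s - em_error N s)%C with d end.
 - eapply Rle_trans; [exact H|].
  assert (B : forall a b, Rabs (Re (1 - s - RtoC a)) <= b -> Cmod (1 - s - RtoC a) <= b + 2).
  { intros a b Hab. destruct s as [x y]. unfold Cminus, Cplus, Copp, RtoC, Re, Im in *; simpl in *.
   eapply Rle_trans; [apply Cmod_le_sum|]. apply Rplus_le_compat; [exact Hab|]. replace (0 + - y + - 0) with (- y) by ring. now rewrite Rabs_Ropp. }
  assert (RR : forall a, Re (1 - s - RtoC a) = 1 - a - Re s) by (intros; destruct s; unfold Cminus, Cplus, Copp, RtoC, Re; simpl; ring).
  assert (B0 : Cmod (1 - s) <= 4) by (replace (1 - s)%C with (1 - s - RtoC 0)%C by ring; apply Rle_trans with (2 + 2); [apply B; rewrite RR; apply Rabs_le; lra|lra]).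
  assert (B1 : Cmod (1 - s - 1) <= 4) by (apply Rle_trans with (2 + 2); [apply B; rewrite RR; apply Rabs_le; lra|lra]).
  assert (B2 : Cmod (1 - s - 1 - 1) = Cmod (s + 1)) by (replace (1 - s - 1 - 1)%C with (- (s + 1))%C by ring; apply Cmod_opp).
  assert (B3 : Cmod (1 - s - 1 - 1 - 1) <= 6) by (replace (1 - s - 1 - 1 - 1)%C with (1 - s - RtoC 3)%C by (replace 3 with (1 + 1 + 1) by ring; rewrite !RtoC_plus; ring);
    apply Rle_trans with (4 + 2); [apply B; rewrite RR; apply Rabs_le; lra|lra]).
  assert (B4 : Cmod (1 - s - 1 - 1 - 1 - 1) <= 7) by (replace (1 - s - 1 - 1 - 1 - 1)%C with (1 - s - RtoC 4)%C by (replace 4 with (1 + 1 + 1 + 1) by ring; rewrite !RtoC_plus; ring);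
    apply Rle_trans with (5 + 2); [apply B; rewrite RR; apply Rabs_le; lra|lra]).
  rewrite B2. assert (P0 := Cmod_ge_0 (1 - s)). assert (P1 := Cmod_ge_0 (1 - s - 1)). assert (P2 := Cmod_ge_0 (s + 1)).
  assert (P3 := Cmod_ge_0 (1 - s - 1 - 1 - 1)). assert (P4 := Cmod_ge_0 (1 - s - 1 - 1 - 1 - 1)).
  apply Rle_trans with (2 * (4 * 4 * Cmod (s + 1) * 6 * 7) / n ^ 3).
  + mul_r. mul_l.
   apply Rmult_le_compat; auto; [pos|].
   apply Rmult_le_compat; auto; [pos|].
   apply Rmult_le_compat; [pos|auto| |lra]. apply Rmult_le_compat; auto.
  + rewrite En. replace (2688 * Cmod (s + 1) * (/ n ^ 2 - / (n + 1) ^ 2)) with (1344 * Cmod (s + 1) / n ^ 3 * (2 * n * (2 * n + 1) / (n + 1) ^ 2)) by (field; lra).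
   replace (2 * (4 * 4 * Cmod (s + 1) * 6 * 7) / n ^ 3) with (1344 * Cmod (s + 1) / n ^ 3 * 1) by (field; lra).
   apply Rmult_le_compat_l; [pos|].
   apply (Rmult_le_reg_r ((n + 1) ^ 2)); [apply pow_lt; lra|]. unfold Rdiv. rewrite Rmult_assoc, Rinv_l by (apply pow_nonzero; lra). nra.
 - unfold em_error, opp_pow. rewrite En. fold n. rewrite !Ep, !Ec by lra.
  change (csum (fun k => cpow (INR (S k)) (RtoC (-1) * s)) (S (S N))) with
   (csum (fun k => cpow (INR (S k)) (RtoC (-1) * s)) (S N) + cpow (INR (S (S N))) (RtoC (-1) * s))%C. rewrite En.
  generalize (cpow n (RtoC (-1) * s)) (cpow (n + 1) (RtoC (-1) * s)) (csum (fun k => cpow (INR (S k)) (RtoC (-1) * s)) (S N)) (zeta s).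
  intros p q S0 zt.
  replace (/ (12 * n)) with (/ 12 * / n) by (field; lra). replace (/ (12 * (n + 1))) with (/ 12 * / (n + 1)) by (field; lra).
  destruct p as [p1 p2], q as [q1 q2], S0 as [a1 a2], zt as [b1 b2], s as [s1 s2]. unfold Cminus, Cplus, Copp, Cmult, RtoC; simpl. f_equal; field; lra.
Qed.

Lemma em_error_diff N L s : (N <= L)%nat -> -1 <= Re s <= 2 -> Rabs (Im s) <= 2 ->
 Cmod (em_error L s - em_error N s) <= 2688 * Cmod (s + 1) / INR (S N) ^ 2.
Proof.
 intros HL Hr Hi.
 assert (H : Cmod (em_error L s - em_error N s) <= 2688 * Cmod (s + 1) * (/ INR (S N) ^ 2 - / INR (S L) ^ 2)).
 { induction HL; [unfold Cminus; rewrite Cplus_opp_r, Cmod_0; lra|].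
  replace (em_error (S m) s - em_error N s)%C with ((em_error (S m) s - em_error m s) + (em_error m s - em_error N s))%C by ring.
  eapply Rle_trans; [apply Cmod_triangle|]. generalize (em_error_step m s Hr Hi). lra. }
 assert (0 < / INR (S L) ^ 2) by (apply Rinv_0_lt_compat, pow_lt, lt_0_INR; lia). assert (P := Cmod_ge_0 (s + 1)%C). unfold Rdiv. nra.
Qed.

Lemma em_error_right s : Re s = 2 -> Rabs (Im s) <= 2 -> forall eps N, 0 < eps -> exists L, (N <= L)%nat /\ Cmod (em_error L s) <= eps.
Proof.
 intros Hr Hi eps N He. destruct Hz as [_ Hser]. specialize (Hser s ltac:(lra)).
 destruct (Hser (fun z => Rabs (Re z - Re (zeta s)) < eps / 20 /\ Rabs (Im z - Im (zeta s)) < eps / 20)) as [N0 HN0].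
 { exists (mkposreal (eps / 20) ltac:(lra)). intros z [H1 H2]. split; [exact H1|exact H2]. }
 destruct (INR_unbounded (20 / eps)) as [N1 HN1]. set (L := (N + N0 + N1)%nat). exists L. split; [lia|].
 destruct (HN0 L ltac:(lia)) as [H1 H2]. rewrite <- csum_sum_n in H1, H2.
 assert (Hs : forall k, csum (fun n => nat_Cpow_opp (S n) s) k = csum (fun n => opp_pow (S n) s) k).
 { induction k; [reflexivity|]. simpl csum. rewrite IHk, nat_Cpow_opp_cpow. reflexivity. }
 rewrite Hs in H1, H2. set (S0 := csum (fun n => opp_pow (S n) s) (S L)) in *.
 set (n := INR (S L)). assert (Hn : 20 / eps < n /\ 1 <= n).
 { unfold n, L. rewrite S_INR, !plus_INR. generalize (pos_INR N) (pos_INR N0) (pos_INR N1). lra. }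
 assert (Hne : / n <= eps / 20).
 { replace (eps / 20) with (/ (20 / eps)) by (field; lra). apply Rinv_le_contravar; [pos|lra]. }
 assert (Hd : Cmod (zeta s + RtoC (-1) * S0) <= eps / 10).
 { destruct (zeta s) as [z1 z2], S0 as [a1 a2]. unfold Cplus, Cmult, RtoC, Re, Im in *; simpl in *. eapply Rle_trans; [apply Cmod_le_sum|].
  replace (z1 + (-1 * a1 - 0 * a2)) with (- (a1 - z1)) by ring. replace (z2 + (-1 * a2 + 0 * a1)) with (- (a2 - z2)) by ring. rewrite !Rabs_Ropp. lra. }
 assert (Hp : Cmod (opp_pow (S L) s) = / n * / n).
 { unfold opp_pow. rewrite Cmod_cpow. fold n. replace (Re (RtoC (-1) * s)) with (- Re s) by (destruct s; unfold Re, RtoC, Cmult; simpl; ring).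
  rewrite Hr. replace (-(2) * ln n) with (- ln n + - ln n) by ring. rewrite exp_plus, exp_Ropp, exp_ln by lra. reflexivity. }
 assert (Hs1 : Cmod (s + RtoC (-1)) <= 3 /\ Cmod s <= 4).
 { destruct s as [x y]. unfold Cplus, RtoC, Re, Im in *; simpl in *. split; (eapply Rle_trans; [apply Cmod_le_sum|]).
  - rewrite Hr, Rplus_0_r, Rabs_pos_eq; lra.
  - rewrite Hr, (Rabs_pos_eq 2); lra. }
 unfold em_error. fold S0 n. assert (Pn : 0 < / n <= 1) by (split; [pos|apply Rinv_le_1; lra]).
 eapply Rle_trans; [apply Cmod_triangle|]. rewrite !Cmod_mult, Hp, Cmod_R, Rabs_Ropp, (Rabs_pos_eq n) by lra.
 assert (T1 : Cmod (RtoC (/ 2) + RtoC (- / (12 * n)) * s) <= 1).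
 { eapply Rle_trans; [apply Cmod_triangle|]. rewrite Cmod_mult, !Cmod_R, Rabs_Ropp, Rinv_mult, (Rabs_pos_eq (/ 2)), (Rabs_pos_eq (/ 12 * / n)) by nra. nra. }
 assert (T2 : Cmod (zeta s + RtoC (-1) * S0 + opp_pow (S L) s * (RtoC (/ 2) + RtoC (- / (12 * n)) * s)) <= eps / 10 + / n).
 { eapply Rle_trans; [apply Cmod_triangle|]. rewrite (Cmod_mult (opp_pow (S L) s)), Hp. nra. }
 replace (n * (/ n * / n)) with (/ n) by (field; lra).
 match goal with |- _ * ?u + _ <= _ => assert (P2 : 0 <= u) by apply Cmod_ge_0 end. nra.
Qed.

(** [continuation] together with the factor [s + 1] gives [|em_error N (-1 + i y)| <= 2688 y / n^2].
    Although [-1] is approached only from above, differentiability there forces the value 0 and a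
    derivative of modulus at most [2688 / n^2]; the latter contains [sum k ln k]. *)
Lemma zeta_derivative (gK : R) : log_hyperfactorial_const gK ->
 C_derive zeta (RtoC (-1)) = RtoC (- gK).
Proof.
 intros HK. destruct Hz as [Hd _].
 assert (Df : forall N s, 0 < Im s -> exists l, cdiff (em_error N) s l).
 { intros N s Hs. destruct (Hd s) as [l Hl]; [intros E; rewrite E in Hs; simpl in Hs; lra|].
  eexists. apply cdiff_em_error. apply cdiff_of_derive, Hl. }
 assert (Hn0 : forall N, 1 <= INR (S N)) by (intros N; rewrite S_INR; generalize (pos_INR N); lra).
 assert (Hs5 : forall s, -1 <= Re s <= 2 -> Rabs (Im s) <= 2 -> Cmod (s + 1) <= 5).
 { intros [x y] H1 H2. unfold Cplus, RtoC, Re, Im in *; simpl in *. eapply Rle_trans; [apply Cmod_le_sum|]. rewrite Rplus_0_r, (Rabs_pos_eq (x + 1)); lra. }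
 assert (Hdiff : forall N L s, (N <= L)%nat -> -1 <= Re s <= 2 -> 0 < Im s <= 2 -> Cmod (em_error L s - em_error N s) <= 13440 / INR (S N) ^ 2).
 { intros N L s HL H1 H2. assert (H3 : Rabs (Im s) <= 2) by (rewrite Rabs_pos_eq; lra).
  eapply Rle_trans; [now apply em_error_diff|]. apply Rmult_le_compat_r; [left; apply Rinv_0_lt_compat, pow_lt; generalize (Hn0 N); lra|].
  generalize (Hs5 s H1 H3); lra. }
 assert (Heta : forall eps, 0 < eps -> exists N0, forall N, (N0 <= N)%nat -> 13440 / INR (S N) ^ 2 <= eps).
 { intros eps He. destruct (INR_unbounded (13440 / eps)) as [N0 HN0]. exists N0. intros N HN. apply le_INR in HN.
  assert (P := Hn0 N). rewrite S_INR in *. set (n := INR N + 1) in *. assert (Hn : 13440 / eps < n) by (unfold n; lra).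
  apply (Rmult_le_reg_r (n ^ 2)); [apply pow_lt; lra|]. unfold Rdiv. rewrite Rmult_assoc, Rinv_l by (apply pow_nonzero; lra).
  replace (13440 * 1) with (eps * (13440 / eps)) by (field; lra). apply Rmult_le_compat_l; [lra|]. nra. }
 assert (Small : forall N y, 0 < y <= 1 -> Cmod (em_error N (-1, y)) <= 2688 * y / INR (S N) ^ 2).
 { intros N y Hy. assert (HC := continuation em_error (fun N => 13440 / INR (S N) ^ 2) Df Hdiff).
  assert (HCr : forall N0 s, Re s = 2 -> 0 < Im s <= 2 -> Cmod (em_error N0 s) <= 13440 / INR (S N0) ^ 2).
  { intros N0 s H1 H2. apply Rnot_lt_le; intros L0.
   destruct (em_error_right s H1 ltac:(rewrite Rabs_pos_eq; lra) ((Cmod (em_error N0 s) - 13440 / INR (S N0) ^ 2) / 2) N0 ltac:(lra)) as [L [HL1 HL2]].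
   assert (X := Hdiff N0 L s HL1 ltac:(lra) H2).
   assert (T := Cmod_triangle (em_error L s) (- (em_error L s - em_error N0 s))). rewrite Cmod_opp in T.
   replace (em_error L s + - (em_error L s - em_error N0 s))%C with (em_error N0 s) in T by ring. lra. }
  specialize (HC HCr Heta). apply Rnot_lt_le; intros L0.
  (* [continuation] bounds the error at a later [L] without the factor [y]; since that bound tends
     to 0 with [L], the sharper difference bound from [N] to [L] prevails. *)
  destruct (Heta ((Cmod (em_error N (-1, y)) - 2688 * y / INR (S N) ^ 2) / 2) ltac:(lra)) as [N1 HN1].
  set (L := (N + N1)%nat). assert (X1 := HC L y Hy). assert (X2 := HN1 L ltac:(lia)).
  assert (X3 := em_error_diff N L (-1, y) ltac:(lia) ltac:(simpl; lra) ltac:(simpl; rewrite Rabs_pos_eq; lra)).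
  replace (Cmod ((-1, y) + 1)) with y in X3.
  2:{ replace ((-1, y) + 1)%C with (RtoC y * Ci)%C by (unfold RtoC, Ci, Cplus, Cmult; simpl; f_equal; ring). rewrite Cmod_mult, Cmod_R, Rabs_pos_eq by lra.
    rewrite Cmod_Ci. ring. }
  assert (T := Cmod_triangle (em_error L (-1, y)) (- (em_error L (-1, y) - em_error N (-1, y)))). rewrite Cmod_opp in T.
  replace (em_error L (-1, y) + - (em_error L (-1, y) - em_error N (-1, y)))%C with (em_error N (-1, y)) in T by ring. lra. }
 destruct (Hd (RtoC (-1))) as [zp Hzp]; [intros E; apply RtoC_inj in E; lra|].
 rewrite (is_C_derive_unique _ _ _ Hzp). apply cdiff_of_derive in Hzp.
 assert (Low : forall N d, cdiff (em_error N) (RtoC (-1)) d -> em_error N (RtoC (-1)) = 0 /\ Cmod d <= 2688 / INR (S N) ^ 2).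
 { intros N d Hdd. assert (PN : 0 < INR (S N) ^ 2) by (apply pow_lt; generalize (Hn0 N); lra). set (k := 2688 / INR (S N) ^ 2).
  assert (Pk : 0 < k) by (unfold k; apply Rdiv_lt_0_compat; lra).
  assert (Sm : forall y, 0 < y <= 1 -> Cmod (em_error N (-1, y)) <= k * y) by (intros y Hy; apply Rle_trans with (1 := Small N y Hy); right; unfold k, Rdiv; ring).
  assert (Ey : forall y, 0 < y -> Cmod ((-1, y) - RtoC (-1)) = y).
  { intros y Hy. replace ((-1, y) - RtoC (-1))%C with (RtoC y * Ci)%C by (unfold RtoC, Ci, Cminus, Copp, Cplus, Cmult; simpl; f_equal; ring). rewrite Cmod_mult, Cmod_R, Rabs_pos_eq by lra.
   rewrite Cmod_Ci. ring. }
  assert (E0 : em_error N (RtoC (-1)) = 0).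
  { apply Cmod_eq_0. apply Rle_antisym; [|apply Cmod_ge_0]. apply Rnot_lt_le; intros L0. set (e := Cmod (em_error N (RtoC (-1)))) in *.
   destruct (cdiff_continuous _ _ _ Hdd (e / 2) ltac:(lra)) as [r [Hr H]].
   set (y := Rmin (r / 2) (Rmin 1 (e / (4 * k)))). assert (M1 := Rmin_l (r / 2) (Rmin 1 (e / (4 * k)))). assert (M2 := Rmin_r (r / 2) (Rmin 1 (e / (4 * k)))).
   assert (M3 := Rmin_l 1 (e / (4 * k))). assert (M4 := Rmin_r 1 (e / (4 * k))). fold y in M1, M2.
   assert (Py : 0 < y) by (unfold y; repeat apply Rmin_glb_lt; try lra; pos).
   assert (X := H (-1, y) ltac:(rewrite Ey; lra)). assert (X2 := Sm y ltac:(lra)).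
   assert (X3 : k * y <= e / 4) by (replace (e / 4) with (k * (e / (4 * k))) by (field; lra); mul_l; lra).
   assert (T := Cmod_triangle (em_error N (-1, y)) (- (em_error N (-1, y) - em_error N (RtoC (-1))))). rewrite Cmod_opp in T.
   replace (em_error N (-1, y) + - (em_error N (-1, y) - em_error N (RtoC (-1))))%C with (em_error N (RtoC (-1))) in T by ring. fold e in T. lra. }
  split; [auto|]. apply Rnot_lt_le; intros L0. destruct (Hdd ((Cmod d - k) / 2) ltac:(lra)) as [r [Hr H]].
  set (y := Rmin (r / 2) 1). assert (M1 := Rmin_l (r / 2) 1). assert (M2 := Rmin_r (r / 2) 1). fold y in M1, M2.
  assert (Py : 0 < y) by (unfold y; apply Rmin_glb_lt; lra).
  assert (X := H (-1, y) ltac:(rewrite Ey; lra)). rewrite E0, Ey in X by lra. assert (X2 := Sm y ltac:(lra)).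
  assert (T := Cmod_triangle (em_error N (-1, y)) (- (em_error N (-1, y) - 0 - d * ((-1, y) - RtoC (-1))))). rewrite Cmod_opp in T.
  replace (em_error N (-1, y) + - (em_error N (-1, y) - 0 - d * ((-1, y) - RtoC (-1))))%C with (d * ((-1, y) - RtoC (-1)))%C in T by ring.
  rewrite Cmod_mult, Ey in T by lra. nra. }
 assert (Op : forall n, opp_pow (S n) (RtoC (-1)) = RtoC (INR (S n))).
 { intros n. unfold opp_pow, cpow. rewrite <- !RtoC_mult. replace (-1 * -1 * ln (INR (S n))) with (ln (INR (S n))) by ring.
  unfold cexp, RtoC, Re, Im; cbn [fst snd]. rewrite cos_0, sin_0, exp_ln by (generalize (Hn0 n); lra). f_equal; ring. }
 assert (Close : forall N, Cmod (zp - RtoC (- gK)) <= 1344 / INR (S N) ^ 2 + 4 / INR (S N)).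
 { intros N. destruct (Low N _ (cdiff_em_error N _ _ Hzp)) as [E0 Hdd]. specialize (HK (S N) ltac:(lia)).
  unfold em_error in E0. rewrite !Op in E0, Hdd.
  rewrite (csum_RtoC _ (fun k => INR (S k)) (S N) Op) in E0, Hdd.
  rewrite (csum_RtoC _ (fun k => -1 * (INR (S k) * ln (INR (S k)))) (S N)) in Hdd
   by (intros k; rewrite Op, <- RtoC_mult; f_equal; ring).
  rewrite psum_scal in Hdd.
  set (n := INR (S N)) in *. set (T1 := psum (fun k => INR (S k)) (S N)) in *. set (T2 := psum (fun k => INR (S k) * ln (INR (S k))) (S N)) in *.
  set (g := T2 - (n ^ 2 / 2 * ln n - n ^ 2 / 4 + n * ln n / 2 + (ln n + 1) / 12)) in *. assert (P := Hn0 N). fold n in P.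
  (* At [s = -1] the factor [s - 1] is [-2]. Eliminating [zeta (-1)] through [E0] and solving for
     the derivative gives [- D/2 - g], with [D] of order [n^(-2)]. *)
  match type of Hdd with Cmod ?d <= _ => set (D := d) in *; assert (ED : zp = (RtoC (- / 2) * D + RtoC (- g))%C) end.
  { unfold D, g. destruct (zeta (RtoC (-1))) as [z1 z2], zp as [w1 w2]. unfold RtoC, Cplus, Cmult in E0 |- *. simpl in E0 |- *. injection E0 as E1 E2.
   f_equal; [apply (Rmult_eq_reg_l (-2)); [|lra]|apply (Rmult_eq_reg_l (-2)); [|lra]].
   - assert (E3 : z1 = T1 - n * (/ 2 + / (12 * n)) - n ^ 2 / 2) by lra.
    rewrite E3. field. lra.
   - assert (E3 : z2 = 0) by lra. rewrite E3. field. lra. }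
  rewrite ED. replace (RtoC (- / 2) * D + RtoC (- g) - RtoC (- gK))%C with (RtoC (- / 2) * D + RtoC (gK - g))%C by (rewrite !RtoC_opp, RtoC_minus; ring).
  eapply Rle_trans; [apply Cmod_triangle|]. rewrite Cmod_mult, !Cmod_R, Rabs_Ropp, (Rabs_pos_eq (/ 2)), (Rabs_minus_sym gK) by lra.
  fold g in HK. replace (1344 / n ^ 2) with (/ 2 * (2688 / n ^ 2)) by (field; lra). apply Rplus_le_compat; [mul_l; lra|exact HK]. }
 assert (E : (zp - RtoC (- gK))%C = 0).
 { apply Cmod_eq_0. apply Rle_antisym; [|apply Cmod_ge_0]. apply Rnot_lt_le; intros L0. set (e := Cmod (zp - RtoC (- gK))) in *.
  destruct (INR_unbounded (1348 / e)) as [N HN]. specialize (Close N). assert (P := Hn0 N). rewrite S_INR in *. set (n := INR N + 1) in *.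
  assert (H : e <= 1348 / n).
  { apply Rle_trans with (1 := Close). replace (1348 / n) with (1344 / n + 4 / n) by (field; lra). apply Rplus_le_compat_r.
   mul_l. apply Rinv_le_contravar; nra. }
  apply (Rmult_le_compat_r n) in H; [|lra]. replace (1348 / n * n) with 1348 in H by (field; lra).
  assert (1348 < e * n); [|lra]. replace 1348 with (e * (1348 / e)) at 1 by (field; lra). apply Rmult_lt_compat_l; [auto|unfold n; lra]. }
 replace zp with ((zp - RtoC (- gK)) + RtoC (- gK))%C by ring. rewrite E. ring.
Qed.

End Zeta.

(** * The two integrals *)

Lemma RInt_antiderivative (f F : R -> R) a b : a <= b -> (forall x, a <= x <= b -> is_derive F x (f x)) ->
 (forall x, a <= x <= b -> continuity_pt f x) -> RInt f a b = F b - F a.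
Proof.
 intros Hab HF Hf. apply is_RInt_unique. apply (is_RInt_derive (V := R_CompleteNormedModule) F f); rewrite Rmin_left, Rmax_right by auto.
 - exact HF.
 - intros x Hx. apply continuity_pt_filterlim, Hf, Hx.
Qed.

(** Uses the rate [a^(-3/2)] available for the integral of [q]; the rate [a^(-3)] for the other
    integral is weakened to it. *)
Lemma left_integral (f F : R -> R) (c l : R) : c < 0 -> (forall x, x <= c -> is_derive F x (f x)) ->
 (forall x, x <= c -> continuity_pt f x) ->
 (exists C a0, 0 < C /\ 1 <= a0 /\ forall a, a0 <= a -> Rabs (F (- a) - l) <= C / sqrt a ^ 3) ->
 is_RInt_gen f (Rbar_locally m_infty) (at_point c) (F c - l).
Proof.
 intros Hc HF Hf [C [a0 [HC [Ha0 H]]]]. apply is_RInt_gen_minf_of_lim; [exact Hf|].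
 intros eps He. exists (- (a0 + (C / eps) ^ 2)). intros b Hb Hbc.
 rewrite (RInt_antiderivative f F b c Hbc); [|intros; apply HF; lra|intros; apply Hf; lra].
 replace (F c - F b - (F c - l)) with (- (F (- - b) - l)) by (rewrite Ropp_involutive; ring). rewrite Rabs_Ropp.
 set (a := - b). assert (P : 0 < C / eps) by pos. assert (P2 := pow2_ge_0 (C / eps)).
 assert (Ha : a0 <= a) by (unfold a; lra). apply Rle_trans with (1 := H a Ha).
 assert (S1 : 1 <= sqrt a) by (rewrite <- sqrt_1; apply sqrt_le_1_alt; lra).
 assert (S2 : C / eps <= sqrt a) by (rewrite <- (sqrt_pow2 (C / eps)) by lra; apply sqrt_le_1_alt; unfold a; lra).
 assert (S3 : sqrt a <= sqrt a ^ 3) by (assert (1 <= sqrt a ^ 2) by (simpl; nra); simpl in *; nra).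
 apply div_le; [pos|].
 replace C with (eps * (C / eps)) at 1 by (field; lra). mul_l; lra.
Qed.

Theorem corollary1p2 (q : R -> R) (hq : is_Hastings_McLeod q)
  (zeta : C -> C) (hzeta : is_Riemann_zeta zeta)
  (c : R) (hc : c < 0) :
 (exists I1 I2 : R,
   is_RInt_gen (HM_R q) (at_point c) (Rbar_locally p_infty) I1 /\
   is_RInt_gen (fun y => HM_R q y - / 4 * y ^ 2 + 1 / (8 * y))
         (Rbar_locally m_infty) (at_point c) I2 /\
   RtoC (I1 + I2) =
    (RtoC (- (1 / 24) * ln 2) - C_derive zeta (RtoC (-1))
    + RtoC (1 / 12 * Rabs c ^ 3 + 1 / 8 * ln (Rabs c)))%C) /\
 (exists J1 J2 : R,
   is_RInt_gen q (at_point c) (Rbar_locally p_infty) J1 /\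
   is_RInt_gen (fun y => q y - sqrt (Rabs y / 2))
         (Rbar_locally m_infty) (at_point c) J2 /\
   J1 + J2 = 1 / 2 * ln 2 + sqrt 2 / 3 * Rpower (Rabs c) (3 / 2)).
Proof.
 destruct hq as [HP Hequiv]. set (dq := Derive q).
 assert (Hq1 : forall x, is_derive q x (dq x)) by (intros x; apply Derive_correct, HP).
 assert (Hq2 : forall x, is_derive dq x (2 * q x ^ 3 + x * q x)) by (intros x; apply HP).
 assert (HqA : airy_like q).
 { intros eps He. destruct (Hequiv (mkposreal eps He)) as [X HX]. exists (X + 1). intros x Hx. apply (HX x). lra. }
 assert (Cq : forall x, continuity_pt q x) by (intros; eapply is_derive_continuity_pt, Hq1).
 assert (Cq2 : forall x, continuity_pt (fun x => q x ^ 2) x).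
 { intros x. assert (D := Hq1 x). eapply is_derive_continuity_pt. auto_derive; [eexists; exact D|reflexivity]. }
 destruct (q_decay q dq Hq1 Hq2 HqA) as [X [HX1 [HXq HXd]]].
 (* A common constant for [tail_integral]: the first summand serves [q], the second [q^2], both from
    [q s <= q X exp (X - s)]. *)
 set (C0 := q X * exp X + q X ^ 2 * exp X). destruct (HXq X ltac:(lra)) as [PqX [HqX _]].
 assert (PeX := exp_pos X). assert (HC0 : 0 <= C0) by (unfold C0; nra).
 assert (Dec : forall s, X <= s -> 0 < q s <= q X /\ q s <= q X * exp X * exp (- s)).
 { intros s Hs. destruct (HXq s Hs) as [P _]. assert (H := HXd X s ltac:(lra)).
  replace (- (s - X)) with (X + - s) in H by ring. rewrite exp_plus in H. rewrite <- Rmult_assoc in H. split; [|exact H]. split; [exact P|].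
  assert (E : exp (X + - s) <= 1).
  { rewrite <- exp_0. destruct (Rle_lt_or_eq_dec (X + - s) 0 ltac:(lra)) as [L|L]; [left; now apply exp_increasing|rewrite L; lra]. }
  rewrite exp_plus in E. nra. }
 assert (Pes : forall s, 0 < exp (- s)) by (intros; apply exp_pos).
 assert (Bq : forall s, X <= s -> Rabs (q s) <= C0 * exp (- s)).
 { intros s Hs. destruct (Dec s Hs) as [P1 P2]. rewrite Rabs_pos_eq by lra. unfold C0. specialize (Pes s). nra. }
 assert (Bq2 : forall s, X <= s -> Rabs (q s ^ 2) <= C0 * exp (- s)).
 { intros s Hs. destruct (Dec s Hs) as [P1 P2]. rewrite Rabs_pos_eq by pos.
  apply Rle_trans with (q X * (q X * exp X * exp (- s))); [simpl; rewrite Rmult_1_r; apply Rmult_le_compat; lra|].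
  unfold C0. specialize (Pes s). simpl. nra. }
 destruct (tail_integral q X C0 Cq HC0 Bq) as [P [HP1 [HP2 HP3]]].
 destruct (tail_integral (fun x => q x ^ 2) X C0 Cq2 HC0 Bq2) as [Q1 [HQ1a [HQ1 HQ1b]]].
 assert (CQ1 : forall x, continuity_pt Q1 x) by (intros; eapply is_derive_continuity_pt, HQ1).
 destruct (tail_integral Q1 X C0 CQ1 HC0 HQ1b) as [Q2 [HQ2a [HQ2 HQ2b]]].
 assert (ER : forall x, HM_R q x = Q1 x).
 { intros x. unfold HM_R. apply is_RInt_gen_unique. exact (HQ1a x). }
 destruct log_hyperfactorial as [gK HK].
 assert (Hzp := zeta_derivative zeta hzeta gK HK).
 assert (AbsC : Rabs c = - c) by (apply Rabs_left; auto).
 split.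
 - destruct (second_integral_left q dq Hq1 Hq2 HqA X C0 HC0 Q1 Q2 gK HQ1 HQ2 HQ1b HQ2b HK) as [C [a0 [HC [Ha0 H]]]].
  (* An antiderivative of the second integrand. Its limit at minus infinity is [ln 2 / 24 - gK], and
     [Q2 c] cancels against the first integral. *)
  set (G := fun y => - Q2 y - y ^ 3 / 12 + ln (- y) / 8).
  exists (Q2 c), (G c - (ln 2 / 24 - gK)).
  assert (DG : forall y, y <= c -> is_derive G y (HM_R q y - / 4 * y ^ 2 + 1 / (8 * y))).
  { intros y Hy. rewrite ER. assert (D := HQ2 y). unfold G. auto_derive; [split; [eexists; exact D|lra]|].
   rewrite (Derive_eta _ _ _ D). field. lra. }
  split; [|split].
  + apply (is_RInt_gen_ext Q1); [|apply HQ2a]. exists (fun _ => True) (fun _ => True); [easy|now exists 0|]. intros; symmetry; apply ER.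
  + apply left_integral; [auto|exact DG| |].
   * intros y Hy. assert (D := HQ1 y). apply (continuity_pt_ext (fun y => Q1 y - / 4 * y ^ 2 + 1 / (8 * y))); [intros; now rewrite ER|].
    eapply is_derive_continuity_pt. auto_derive; [split; [eexists; exact D|lra]|reflexivity].
   * exists C, a0. split; [auto|]. split; [auto|]. intros a Ha. specialize (H a Ha). unfold G. rewrite Ropp_involutive.
    replace (- Q2 (- a) - (- a) ^ 3 / 12 + ln a / 8 - (ln 2 / 24 - gK)) with (- (Q2 (- a) - (a ^ 3 / 12 + ln a / 8 - ln 2 / 24 + gK))) by field.
    rewrite Rabs_Ropp. apply Rle_trans with (1 := H). mul_l.
    assert (S1 : 1 <= sqrt a) by (rewrite <- sqrt_1; apply sqrt_le_1_alt; lra). assert (S2 : sqrt a * sqrt a = a) by (apply sqrt_sqrt; lra).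
    apply Rinv_le_contravar; [pos|apply pow_incr; nra].
  + rewrite Hzp, AbsC. unfold G. rewrite <- RtoC_minus, <- RtoC_plus. f_equal. field.
 - destruct (first_integral_left q dq Hq1 Hq2 HqA X C0 HC0 P HP2 HP3) as [C [a0 [HC [Ha0 H]]]].
  (* An antiderivative with limit [- ln 2 / 2] at minus infinity; [P c] cancels against the first
     integral. *)
  set (G := fun y => - P y + 4 / 3 * sqrt (- y / 2) ^ 3).
  exists (P c), (G c - - (ln 2 / 2)).
  split; [apply HP1|]. split.
  + apply left_integral; [auto| | |].
   * intros y Hy. rewrite Rabs_left by lra. assert (D := HP2 y). unfold G. auto_derive; [split; [eexists; exact D|split; [lra|auto]]|].
    rewrite (Derive_eta _ _ _ D). replace (- y * / 2) with (- y / 2) by reflexivity.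
    assert (0 < sqrt (- y / 2)) by (apply sqrt_lt_R0; lra). field. lra.
   * intros y Hy. apply continuity_pt_minus; [apply Cq|].
    apply (continuity_pt_comp (fun y => Rabs y / 2) sqrt); [|apply continuity_pt_sqrt; apply Rdiv_le_0_compat; [apply Rabs_pos|lra]].
    apply continuity_pt_div; [apply Rcontinuity_abs|apply continuity_pt_const; easy|lra].
   * exists C, a0. split; [auto|]. split; [auto|]. intros a Ha. specialize (H a Ha). unfold G. rewrite Ropp_involutive.
    replace (- P (- a) + 4 / 3 * sqrt (a / 2) ^ 3 - - (ln 2 / 2)) with (- (P (- a) - (4 / 3 * sqrt (a / 2) ^ 3 + ln 2 / 2))) by field.
    now rewrite Rabs_Ropp.
  + unfold G. rewrite AbsC.
   assert (Ep : Rpower (- c) (3 / 2) = sqrt (- c) ^ 3).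
   { replace (3 / 2) with (/ 2 * INR 3) by (simpl; field). rewrite <- Rpower_mult, Rpower_sqrt, Rpower_pow; auto; [|lra]. apply sqrt_lt_R0; lra. }
   rewrite Ep. unfold Rdiv at 2. rewrite sqrt_mult by lra. rewrite <- Rdiv_1_l, sqrt_div, sqrt_1 by lra.
   assert (S2 : sqrt 2 * sqrt 2 = 2) by (apply sqrt_sqrt; lra). assert (S0 : 0 < sqrt 2) by (apply sqrt_lt_R0; lra).
   (* The coefficient [4/3] times [2^(-3/2)] equals [sqrt 2 / 3]. *)
   replace (4 / 3 * (sqrt (- c) * (1 / sqrt 2)) ^ 3) with (sqrt 2 / 3 * sqrt (- c) ^ 3); [field|].
   replace ((sqrt (- c) * (1 / sqrt 2)) ^ 3) with (sqrt (- c) ^ 3 * sqrt 2 / (sqrt 2 * sqrt 2 * (sqrt 2 * sqrt 2))) by (field; lra).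
   rewrite S2. field.
Qed.
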